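(* Let $\Omega\subset\mathbb{R}^n$ be a bounded open set, let $0<c_0\le c_1$, and let $X=(X_1,\dots,X_m)$ be a family of vector fields with Lipschitz coefficients on $\Omega$ satisfying the linear independence condition (LIC) on $\Omega$. Let $\mathcal{A}$ be the class of open subsets of $\Omega$. Let $i\in\{1,2\}$, with $p=2$ if $i=1$ and $1<p<\infty$ arbitrary if $i=2$. Let $(f_h)_h\subset J_i(\Omega,c_0,c_1)$ and, for each $h$, let $F_h^*:L^p(\Omega)\times\mathcal{A}\to[0,\infty]$ be defined by $$F_h^*(u,A)=\begin{cases}\int_A f_h(x,Xu(x))\,dx & \text{if } u|_A\in W^{1,p}_X(A),\\ \infty&\text{otherwise.}\end{cases}$$ Then, up to a subsequence (of $(f_h)_h$), there exist a local functional $F:L^p(\Omega)\times\mathcal{A}\to[0,\infty]$ and $f\in J_i(\Omega,c_0,c_1)$ such that: (i) for each $A\in\mathcal{A}$, the sequence $(F_h^*(\cdot,A))_h$ $\Gamma$-converges to $F(\cdot,A)$ in the (strong) topology of $L^p(\Omega)$; (ii) $F$ has the representation $$F(u,A)=\begin{cases}\int_A f(x,Xu(x))\,dx & \text{if } A\in\mathcal{A},\ u|_A\in W^{1,p}_X(A),\\ \infty&\text{otherwise.}\end{cases}$$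
   Context: Vector fields: $X_j(x)=\sum_{i=1}^n c_{ji}(x)\partial_i$, $j=1,\dots,m$, with $c_{ji}$ Lipschitz on $\Omega$; $X_j(x)$ is identified with $(c_{j1}(x),\dots,c_{jn}(x))\in\mathbb{R}^n$. $Xu=(X_1u,\dots,X_mu)$ is taken in the distributional sense: $X_ju=g$ on an open set $A$ means $\int_A g\varphi\,dx=-\int_A u\sum_{i=1}^n\partial_i(c_{ji}\varphi)\,dx$ for all $\varphi\in C_c^\infty(A)$. $W^{1,p}_X(A)=\{u\in L^p(A): X_ju\in L^p(A),\ j=1,\dots,m\}$. (LIC): there is a (relatively) closed set $\mathcal{N}_X\subset\Omega$ of Lebesgue measure zero such that for each $x\in\Omega\setminus\mathcal{N}_X$ the vectors $X_1(x),\dots,X_m(x)$ are linearly independent in $\mathbb{R}^n$. $I_{m,p}(\Omega,c_0,c_1)$ is the class of Borel functions $f:\Omega\times\mathbb{R}^m\to[0,\infty]$ such that: for every $\eta\in\mathbb{R}^m$, $f(\cdot,\eta)$ is Borel measurable on $\Omega$; for a.e. $x\in\Omega$, $f(x,\cdot):\mathbb{R}^m\to[0,\infty)$ is convex; and $c_0|\eta|^p\le f(x,\eta)\le c_1(|\eta|^p+1)$ for a.e. $x\in\Omega$ and each $\eta\in\mathbb{R}^m$. $J_1(\Omega,c_0,c_1)$ is the subclass of those $f\in I_{m,2}(\Omega,c_0,c_1)$ which are quadratic forms in $\eta$: $f(x,\eta)=\langle a(x)\eta,\eta\rangle=\sum_{i,j=1}^m a_{ij}(x)\eta_i\eta_j$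 for a.e. $x\in\Omega$ and all $\eta\in\mathbb{R}^m$, with $a(x)=[a_{ij}(x)]$ a symmetric $m\times m$ matrix. $J_2(\Omega,c_0,c_1)$ is the subclass of those $f\in I_{m,p}(\Omega,c_0,c_1)$ that are independent of $x$, i.e. $f=f(\eta)$. A functional $F:L^p(\Omega)\times\mathcal{A}\to[0,\infty]$ is local if $F(u,A)=F(v,A)$ whenever $A\in\mathcal{A}$ and $u=v$ a.e. on $A$. $\Gamma$-convergence in $L^p(\Omega)$ of $G_h$ to $G$: for every $u\in L^p(\Omega)$, (1) $G(u)\le\liminf_h G_h(u_h)$ for every sequence $u_h\to u$ in $L^p(\Omega)$; (2) there is a sequence $u_h\to u$ in $L^p(\Omega)$ with $G(u)=\lim_h G_h(u_h)$. *)

(* Defs.v *)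
From HB Require Import structures.
From mathcomp Require Import all_boot all_order all_algebra.
From mathcomp Require Import all_classical all_reals all_analysis measurable_realfun.

Set Implicit Arguments.
Unset Strict Implicit.
Unset Printing Implicit Defensive.

Import Order.TTheory GRing.Theory Num.Theory.
Import numFieldNormedType.Exports.

Local Open Scope classical_set_scope.
Local Open Scope ring_scope.

HB.instance Definition _ (R : realType) (n : nat) :=
  isMeasurable.Build (sigma_display (@open 'rV[R]_n)) 'rV[R]_n
    (@sigma_algebra0 _ setT (@open 'rV[R]_n))
    (@sigma_algebraC _ (@open 'rV[R]_n))
    (@sigma_algebra_bigcup _ setT (@open 'rV[R]_n)).

Lemma open_measurable_rV (R : realType) n (U : set 'rV[R]_n) :
  open U -> measurable U.
Proof. exact: sub_sigma_algebra. Qed.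

Lemma measurable_coord_rV (R : realType) n (i : 'I_n) :
  measurable_fun setT (fun x : 'rV[R]_n => x ord0 i).
Proof.
apply: (@measurability _ _ _ _ _ _ _ (RGenOpens.measurableE R)) => _ [_ [a [b ->]] <-].
rewrite setTI; apply: open_measurable_rV.
apply: (open_comp (f := fun x : 'rV[R]_n => x ord0 i)); last exact: interval_open.
by move=> x _; exact: coord_continuous.
Qed.

Lemma measurable_fun_rV (R : realType) d (T : measurableType d) n
    (f : T -> 'rV[R]_n) :
  (forall i, measurable_fun setT (fun t => f t ord0 i)) -> measurable_fun setT f.
Proof.
move=> mf; apply: (@measurability _ _ _ _ _ _ (@open 'rV[R]_n)) => // _ [U oU <-].
rewrite setTI.
pose B (qk : 'rV[rat]_n * nat) : set 'rV[R]_n :=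
  [set x | forall i, `|x ord0 i - ratr (qk.1 ord0 i)| < qk.2.+1%:R^-1].
pose F qk := if `[< B qk `<=` U >] then f @^-1` (B qk) else set0.
have -> : f @^-1` U = \bigcup_qk F qk.
  apply/seteqP; split=> [t /= Uft|t [qk _]]; last first.
    by rewrite /F; case: asboolP => //= BU /BU.
  have /nbhs_ballP[e /= e0 eU] : nbhs (f t) U by exact: open_nbhs_nbhs.
  have [k ke] : exists k : nat, k.+1%:R^-1 < e / 2.
    have e20 : 0 < e / 2 by rewrite divr_gt0.
    exists (Num.truncn (e / 2)^-1).
    by rewrite invf_plt ?posrE// truncnS_gt.
  have k0 : 0 < k.+1%:R^-1 :> R by rewrite invr_gt0.
  have /choice[q qP] : forall i, exists q : rat, `|f t ord0 i - ratr q| < k.+1%:R^-1.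
    move=> i; have /rat_in_itvoo[q] : f t ord0 i - k.+1%:R^-1 < f t ord0 i + k.+1%:R^-1.
      by rewrite ltrBlDr -addrA ltrDl addr_gt0.
    rewrite in_itv/= => /andP[q1 q2]; exists q.
    by rewrite distrC ltr_distl q1 q2.
  exists (\row_i q i, k) => //; rewrite /F; case: asboolP => [_ i /=|]; first by rewrite mxE.
  case=> x /= xB; apply: eU; split=> // i j; rewrite (ord1 i) /ball/=.
  have -> : f t ord0 j - x ord0 j = (f t ord0 j - ratr (q j)) - (x ord0 j - ratr (q j)).
    by rewrite opprB addrA subrK.
  rewrite (le_lt_trans (ler_normB _ _))// (splitr e) ltrD//.
    exact: lt_trans (qP j) ke.
  by have := xB j; rewrite mxE => /lt_trans; apply.
apply: countable_bigcupT_measurable => [|qk].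
  exact: countableP.
rewrite /F; case: asboolP => // _.
rewrite (_ : _ @^-1` _ = \bigcap_(i in [set: 'I_n])
    ((fun t => f t ord0 i) @^-1` ball (ratr (qk.1 ord0 i) : R) qk.2.+1%:R^-1)).
  apply: fin_bigcap_measurable => // i _.
  rewrite -[X in measurable X]setTI; apply: mf => //; exact: measurable_ball.
apply/seteqP; split=> t /= tB i.
  by move=> _; rewrite /ball/= distrC; exact: tB.
by rewrite distrC; exact: (tB i).
Qed.

Definition cons_rV (R : realType) n (z : measurableTypeR R * 'rV[R]_n) : 'rV[R]_n.+1 :=
  \row_i oapp (z.2 ord0) z.1 (unlift ord0 i).

Lemma measurable_cons_rV (R : realType) n :
  measurable_fun setT (@cons_rV R n).
Proof.
apply: measurable_fun_rV => i.
case: (unliftP ord0 i) => [j ->|->].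
  rewrite (_ : (fun _ => _) = (fun x : 'rV[R]_n => x ord0 j) \o snd); last first.
    by apply/funext => z; rewrite /= mxE liftK.
  by apply: measurableT_comp => //; exact: measurable_coord_rV.
rewrite (_ : (fun _ => _) = fst); first exact: measurable_fst.
by apply/funext => z; rewrite /= mxE unlift_none.
Qed.

Definition uncons_rV (R : realType) n (x : 'rV[R]_n.+1) :
    measurableTypeR R * 'rV[R]_n :=
  (x ord0 ord0, \row_i x ord0 (lift ord0 i)).

Lemma cons_rVK (R : realType) n : cancel (@cons_rV R n) (@uncons_rV R n).
Proof.
move=> [t y]; rewrite /uncons_rV/= !mxE unlift_none; congr pair.
by apply/rowP => i; rewrite !mxE liftK.
Qed.

Lemma measurable_uncons_rV (R : realType) n :
  measurable_fun setT (@uncons_rV R n).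
Proof.
apply: measurable_fun_pair; first exact: measurable_coord_rV.
apply: measurable_fun_rV => i.
rewrite (_ : (fun _ => _) = fun x : 'rV[R]_n.+1 => x ord0 (lift ord0 i)).
  exact: measurable_coord_rV.
by apply/funext => x; rewrite mxE.
Qed.

Section lebesgue_rVS.
Local Open Scope ereal_scope.
Context (R : realType) (n : nat).
Variable mu : {sigma_finite_measure set 'rV[R]_n -> \bar R}.

Definition lebesgue_rVS : set 'rV[R]_n.+1 -> \bar R :=
  pushforward (@lebesgue_measure R \x mu) (@cons_rV R n).

HB.instance Definition _ := Measure.copy lebesgue_rVS
  (measure_function_pushforward__canonical__measure_function_Measure
    (@lebesgue_measure R \x mu : {measure set _ -> \bar R})
    (@measurable_cons_rV R n)).

Let lebesgue_rVS_sigma_finite : sigma_finite setT lebesgue_rVS.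
Proof.
have /sigma_finiteP[F [FT ndF Foo]] := sigma_finiteT (@lebesgue_measure R).
have /sigma_finiteP[G [GT ndG Goo]] := sigma_finiteT mu.
exists (fun k => @uncons_rV R n @^-1` (F k `*` G k)) => [|k].
  rewrite -preimage_bigcup (_ : \bigcup_k _ = setT) ?preimage_setT//.
  apply/seteqP; split=> // -[t x] _.
  have [k _ Fkt] : (\bigcup_k F k) t by rewrite -FT.
  have [l _ Glx] : (\bigcup_k G k) x by rewrite -GT.
  exists (maxn k l) => //; split=> /=.
    by move: t Fkt; apply/subsetPset/ndF/leq_maxl.
  by move: x Glx; apply/subsetPset/ndG/leq_maxr.
have [mF Fk] := Foo k; have [mG Gk] := Goo k; split.
  by rewrite -[X in measurable X]setTI; apply: measurable_uncons_rV => //;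
    exact: measurableX.
rewrite /lebesgue_rVS /pushforward (_ : _ @^-1` _ = F k `*` G k).
  by rewrite product_measure1E// lte_mul_pinfty// ge0_fin_numE.
by rewrite -comp_preimage (_ : _ \o _ = id) ?preimage_id//; apply/funext/cons_rVK.
Qed.

HB.instance Definition _ := Measure_isSigmaFinite.Build _ _ _ lebesgue_rVS
  lebesgue_rVS_sigma_finite.

End lebesgue_rVS.

Fixpoint lebesgue_rV (R : realType) (n : nat) :
    {sigma_finite_measure set 'rV[R]_n -> \bar R} :=
  if n is k.+1 then lebesgue_rVS (lebesgue_rV R k) else \d_(0 : 'rV[R]_0).

Lemma measurable_box_rV (R : realType) n (A : 'I_n -> set (measurableTypeR R)) :
  (forall i, measurable (A i)) ->
  measurable [set x : 'rV[R]_n | forall i, A i (x ord0 i)].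
Proof.
move=> mA; rewrite (_ : [set x | _] = \bigcap_(i in [set: 'I_n])
    ((fun x : 'rV[R]_n => x ord0 i) @^-1` A i)).
  apply: fin_bigcap_measurable => // i _.
  by rewrite -[X in measurable X]setTI; exact: (measurable_coord_rV i measurableT (mA i)).
by apply/seteqP; split=> x /= xA i => [_|]; exact: xA.
Qed.

Lemma lebesgue_rV_box (R : realType) n (A : 'I_n -> set (measurableTypeR R)) :
  (forall i, measurable (A i)) ->
  lebesgue_rV R n [set x | forall i, A i (x ord0 i)] =
  (\prod_(i < n) lebesgue_measure (A i))%E.
Proof.
elim: n A => [|n IH] A mA.
  by rewrite big_ord0 /= diracE mem_set// => -[].
rewrite big_ord_recl -IH//= /lebesgue_rVS /pushforward.
rewrite (_ : _ @^-1` _ =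
    A ord0 `*` [set x : 'rV[R]_n | forall i, A (lift ord0 i) (x ord0 i)]).
  by rewrite product_measure1E//; exact: (measurable_box_rV (fun i => mA (lift ord0 i))).
apply/seteqP; split=> -[t x] /=.
  move=> tA; split; first by have := tA ord0; rewrite mxE unlift_none.
  by move=> i; have := tA (lift ord0 i); rewrite mxE liftK.
by move=> [tA xA] i; rewrite mxE; case: (unliftP ord0 i) => [j ->|->] /=.
Qed.

Section definitions.
Context {R : realType} {n m : nat}.
Implicit Types (Omega A : set 'rV[R]_n) (u g phi : 'rV[R]_n -> R)
  (Y : 'rV[R]_n -> 'rV[R]_n) (X : 'I_m -> 'rV[R]_n -> 'rV[R]_n)
  (f : 'rV[R]_n -> 'rV[R]_m -> \bar R) (p : R).

Local Notation mu := (lebesgue_rV R n).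

(* Elements of L^p(A) are given by representatives defined on all of R^n, of
   which only the values on A matter ([u \_ A] is the extension by 0); since
   the sigma-algebra is the Borel one, the representatives are Borel. *)
Definition inLp p A u : Prop := u \_ A \in Lfun mu p%:E.

Definition cvgLp p A (u_ : nat -> 'rV[R]_n -> R) u : Prop :=
  ('N[mu]_p%:E[EFin \o ((u_ h \- u)%R \_ A)])%E @[h --> \oo] --> 0%E.

(* The library norm on 'rV[R]_k is the sup norm; the growth condition is stated
   with the Euclidean one. *)
Definition enorm k (v : 'rV[R]_k) : R := Num.sqrt (\sum_i v ord0 i ^+ 2).

Definition partial (i : 'I_n) phi : 'rV[R]_n -> R := 'D_(delta_mx ord0 i) phi.

Fixpoint Ck (k : nat) phi : Prop :=
  if k is l.+1 then
    continuous phi /\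
    forall i, (forall x, derivable phi x (delta_mx ord0 i)) /\
              Ck l (partial i phi)
  else continuous phi.

Definition test_function A phi : Prop :=
  [/\ forall k, Ck k phi,
      compact (closure [set x | phi x != 0]) &
      closure [set x | phi x != 0] `<=` A].

(* [Y y ord0 i] is the i-th coefficient of Y at y. The partial derivatives of
   [Y * phi] exist almost everywhere on an open A when the coefficients are
   Lipschitz on A; elsewhere 'D is a junk value, on a null set. *)
Definition is_distr_deriv Y A u g : Prop :=
  forall phi, test_function A phi ->
    (\int[mu]_(x in A) (g x * phi x)%:E =
     - \int[mu]_(x in A)
         (u x * \sum_(i < n) partial i (fun y => Y y ord0 i * phi y) x)%:E)%E.

Definition distr_derivs p Y A u : set ('rV[R]_n -> R) :=
  [set g | inLp p A g /\ is_distr_deriv Y A u g].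

Definition W1X p X A u : Prop :=
  inLp p A u /\ forall j, distr_derivs p (X j) A u !=set0.

(* Xu on A, for u in W1X p X A: each component is unique up to a null set, and
   [xget] picks a representative. *)
Definition Xgrad p X A u (x : 'rV[R]_n) : 'rV[R]_m :=
  \row_j xget (cst 0) (distr_derivs p (X j) A u) x.

Definition LIC X Omega : Prop :=
  exists C : set 'rV[R]_n,
    [/\ closed C, mu (Omega `&` C) = 0%E &
        forall x, (Omega `\` C) x -> row_free (\matrix_(j < m) X j x)].

Definition Iclass p Omega (c0 c1 : R) f : Prop :=
  [/\ measurable_fun (Omega `*` setT)
        (fun z : 'rV[R]_n * 'rV[R]_m => f z.1 z.2),
      forall x eta, Omega x -> (0 <= f x eta)%E,
      forall eta, measurable_fun Omega (f ^~ eta),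
      {ae mu, forall x, Omega x ->
        (forall eta, f x eta \is a fin_num) /\
        convex_function setT (fun eta => fine (f x eta))} &
      {ae mu, forall x, Omega x -> forall eta,
        ((c0 * enorm eta `^ p)%:E <= f x eta <=
         (c1 * (enorm eta `^ p + 1))%:E)%E}].

Definition J1class Omega (c0 c1 : R) f : Prop :=
  Iclass 2 Omega c0 c1 f /\
  exists a : 'rV[R]_n -> 'M[R]_m,
    (forall x, Omega x -> (a x)^T = a x) /\
    {ae mu, forall x, Omega x -> forall eta,
      f x eta = (\sum_i \sum_j a x i j * eta ord0 i * eta ord0 j)%:E}.

Definition J2class p Omega (c0 c1 : R) f : Prop :=
  Iclass p Omega c0 c1 f /\
  exists g : 'rV[R]_m -> \bar R, forall x eta, Omega x -> f x eta = g eta.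

Definition functional p X f u A : \bar R :=
  if `[< W1X p X A u >] then (\int[mu]_(x in A) f x (Xgrad p X A u x))%E
  else +oo%E.

Definition open_in Omega A : Prop := open A /\ A `<=` Omega.

Definition local_functional p Omega
    (F : ('rV[R]_n -> R) -> set 'rV[R]_n -> \bar R) : Prop :=
  forall u v A, inLp p Omega u -> inLp p Omega v -> open_in Omega A ->
    u = v %[ae mu in A] -> F u A = F v A.

Definition Gamma_cvg p Omega (G_ : nat -> ('rV[R]_n -> R) -> \bar R)
    (G : ('rV[R]_n -> R) -> \bar R) : Prop :=
  forall u, inLp p Omega u ->
    (forall u_ : nat -> 'rV[R]_n -> R,
       (forall h, inLp p Omega (u_ h)) -> cvgLp p Omega u_ u ->
       (G u <= limn_einf (fun h => G_ h (u_ h)))%E) /\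
    (exists u_ : nat -> 'rV[R]_n -> R,
       [/\ forall h, inLp p Omega (u_ h), cvgLp p Omega u_ u &
           G_ h (u_ h) @[h --> \oo] --> G u]).

End definitions.

Variant integrand_kind := Quadratic | Autonomous.

Definition admissible_exponent {R : realType} (k : integrand_kind) (p : R) :=
  match k with Quadratic => p = 2 | Autonomous => 1 < p end.

Definition Jclass {R : realType} {n m : nat} (k : integrand_kind) (p : R)
    (Omega : set 'rV[R]_n) (c0 c1 : R) (f : 'rV[R]_n -> 'rV[R]_m -> \bar R) :=
  match k with
  | Quadratic => J1class Omega c0 c1 f
  | Autonomous => J2class p Omega c0 c1 f
  end.

(* Main.v *)
(* In both cases the Gamma-limit is identified by hand, without an abstract
   compactness theorem, and the same integrand serves for all open subsets.

   Quadratic integrands, f_h = <b_h eta, eta>.  The coordinate functions x_i are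
   differentiable along X, with gradients L^i spanning R^m almost everywhere by
   (LIC).  Along a subsequence there are correctors w^i_h -> x_i in L^2 that
   almost minimize the energy among functions close to x_i; this makes the
   fluxes S^i_h = b_h X w^i_h asymptotically orthogonal to X z for z -> 0 of
   bounded energy, so, with z = phi (u_h - u), the products S^i_h . X u_h pass to
   the limit against test functions (a div-curl lemma).  If sigma^i is the weak
   limit of S^i_h, the relations a L^i = sigma^i define the limit matrix a.  The
   two Gamma-inequalities follow by comparing u_h with combinations
   sum_i phi_i w^i_h, as the fields sum_i phi_i L^i are dense in L^2(A)^m.

   Autonomous integrands.  Convex functions with a common growth bound are locally
   equi-Lipschitz, hence a subsequence converges pointwise to a convex g.  The
   sequence u_h = u recovers the energy.  For the lower bound, g is the supremum
   of countably many affine functions, each of which is, up to epsilon, eventually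
   below all f_h; one integrates a measurable selection of the largest of the
   first N of them at X u against the weak convergence of X u_h.

   The distributional calculus needs that y |-> c_ji(y) phi(y) has partial
   derivatives almost everywhere (Rademacher on lines) with vanishing integral. *)

Require Import Defs.
From HB Require Import structures.
From mathcomp Require Import all_boot all_order all_algebra.
From mathcomp Require Import all_classical all_reals all_analysis measurable_realfun.
From mathcomp Require Import ring lra.

Set Implicit Arguments.
Unset Strict Implicit.
Unset Printing Implicit Defensive.

Import Order.TTheory GRing.Theory Num.Theory.
Import numFieldNormedType.Exports.

Local Open Scope classical_set_scope.
Local Open Scope ring_scope.

(** No bracket condition is imposed on the fields, so a bound on [X z] yields no strong compactness.
    The only strong convergence at hand is [u_h -> u] in L^p, which Gamma-convergence itself
    supplies, and the arguments are built around it. The correctors nearly minimize the energy in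
    small L^2-balls around x_i without boundary condition, so every [z] that is small in L^2 is an
    admissible variation; comparing [w] with [w + t z] for both signs of [t] gives the
    orthogonality. Approximation of [u] by smooth functions is avoided as well: only the field [X u]
    is approximated, in L^2, by [psi = sum_i phi_i L^i], which need not be a gradient. In the lower
    bound the error [X u - psi] costs at most c1 times its squared norm. The recovery sequence is
    [u + sum_i phi_i (w^i_h - x_i)], whose gradient carries [X u - psi] along unchanged. For
    autonomous integrands weak convergence is tested only against bounded measurable functions,
    because finitely many affine functions have bounded slopes; this lets weak L^p limits be
    assembled from L^2 limits of truncations. *)

Section almost_everywhere.
Context d (T : measurableType d) (R : realType) (mu : {measure set T -> \bar R}).

Lemma ae_imp (P Q : T -> Prop) : (forall x, P x -> Q x) ->
  {ae mu, forall x, P x} -> {ae mu, forall x, Q x}.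
Proof. by move=> PQ; apply: filterS. Qed.

Lemma ae_imp2 (P1 P2 Q : T -> Prop) : (forall x, P1 x -> P2 x -> Q x) ->
  {ae mu, forall x, P1 x} -> {ae mu, forall x, P2 x} -> {ae mu, forall x, Q x}.
Proof. by move=> PQ; apply: filterS2. Qed.

Lemma ae_forall_countType (I : countType) (P : I -> T -> Prop) :
  (forall i, {ae mu, forall x, P i x}) -> {ae mu, forall x, forall i, P i x}.
Proof.
move=> aeP.
have : {ae mu, forall x, forall k : nat, forall i, unpickle k = Some i -> P i x}.
  apply: ae_foralln => k; case: (unpickle k) => [i|]; last exact: nearW.
  by apply: ae_imp (aeP i) => x Pix j [<-].
by apply: ae_imp => x Px i; apply: (Px (pickle i)); rewrite pickleK.
Qed.

End almost_everywhere.

(** * Almost everywhere differentiability of Lipschitz functions on the line *)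

Section lipschitz_derivable.
Context {R : realType}.
Local Notation leb := (@lebesgue_measure R).

Lemma lipschitz_continuous (F : R -> R) (L : R) :
  (forall x y, `|F x - F y| <= L * `|x - y|) -> continuous F.
Proof.
move=> FL x; apply/cvgrPdist_lt => e e0.
have L0 : 0 <= L.
  have := FL 1 0; rewrite subr0 normr1 mulr1; exact: le_trans.
have L1 : 0 < L + 1 by rewrite ltr_wpDl.
near=> y; rewrite (le_lt_trans (FL _ _))//.
rewrite (@le_lt_trans _ _ ((L + 1) * `|x - y|))//.
  by rewrite ler_wpM2r// lerDl.
rewrite -ltr_pdivlMl// mulrC; near: y.
by apply: cvgr_dist_lt; rewrite ?divr_gt0//; exact: cvg_id.
Unshelve. all: by end_near. Qed.

Lemma nondecreasing_cumulative (G : R -> R) :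
  nondecreasing G -> continuous G ->
  exists H : cumulative R R, H = G :> (R -> R).
Proof.
move=> nd cG; have rc : right_continuous G by exact: right_continuousW.
pose b := isCumulative.Build R _ R G nd rc.
by exists (HB.pack_for (cumulative R R) G b).
Qed.

Lemma lebesgue_stieltjes_itv (G : cumulative R R) (a b : R) : a <= b ->
  lebesgue_stieltjes_measure G `]a, b]%classic = (G b - G a)%:E.
Proof.
move=> ab; rewrite /lebesgue_stieltjes_measure /measure_extension measurable_mu_extE/=; last first.
  exact: is_ocitv.
rewrite wlength_itv/= lte_fin; case: ltgtP ab => [_ _|//|-> _].
  by rewrite EFinB.
by rewrite subrr.
Qed.

(** The measures [dG] and [dH] add up to [L] times Lebesgue measure on half-open intervals, hence on
    Borel sets by uniqueness, and [dH] is nonnegative. Uniqueness is applied to the sum divided by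
    [L], so [L = 0] is treated apart: then both functions are constant and both measures vanish. *)
Lemma lipschitz_stieltjes_le (G H : cumulative R R) (L : R) : 0 <= L ->
  (forall x, G x + H x = L * x) -> forall A, measurable A ->
  (lebesgue_stieltjes_measure G A <= L%:E * leb A)%E.
Proof.
move=> L0 GH A mA.
have -> : (L%:E * leb A = lebesgue_stieltjes_measure G A + lebesgue_stieltjes_measure H A)%E.
  case: (eqVneq L 0) => [L00|Lneq0].
    have c0 (F1 F2 : cumulative R R) : (forall x, F1 x + F2 x = 0) ->
        forall x y, x <= y -> F1 x = F1 y.
      move=> F12 x y xy; apply/eqP; rewrite eq_le cumulative_is_nondecreasing//=.
      have := cumulative_is_nondecreasing F2 _ _ xy.
      by have := F12 x; have := F12 y; lra.
    have z (F1 F2 : cumulative R R) : (forall x, F1 x + F2 x = 0) ->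
        lebesgue_stieltjes_measure F1 A = 0%E.
      move=> F12; rewrite (@lebesgue_stieltjes_measure_unique _ F1 mzero)// => _ [[a b] _ <-]/=.
      have [ab|ba] := leP a b; last by rewrite set_itv_ge ?measure0// bnd_simp -leNgt ltW.
      by rewrite lebesgue_stieltjes_itv// (c0 _ _ F12 _ _ ab) subrr.
    rewrite (z G H) ?(z H G) ?L00 ?mul0e ?adde0//.
    - by move=> x; rewrite addrC GH L00 mul0r.
    - by move=> x; rewrite GH L00 mul0r.
  have Lp : 0 < L by rewrite lt0r Lneq0.
  pose m := mscale (NngNum (ltW (divr_gt0 ltr01 Lp)))
    (measure_add (lebesgue_stieltjes_measure G) (lebesgue_stieltjes_measure H)).
  rewrite (@lebesgue_measure_unique _ m) => [||//].
    rewrite /m /mscale muleA -EFinM.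
    have -> : L * ((NngNum (ltW (divr_gt0 ltr01 Lp)))%:num) = 1 by rewrite /= mul1r mulfV.
    by rewrite mul1e /= /msum !big_ord_recr big_ord0/= add0e.
  move=> _ [[a b] _ <-]/=; rewrite /m /mscale.
  have [ab|ba] := leP a b; last first.
    by rewrite set_itv_ge ?measure0 ?mule0// bnd_simp -leNgt ltW.
  rewrite /= /msum !big_ord_recr big_ord0/= add0e /lebesgue_measure !lebesgue_stieltjes_itv//= -EFinD -EFinM.
  congr EFin; have -> : G b - G a + (H b - H a) = L * (b - a).
    by have := GH a; have := GH b; lra.
  by rewrite mulrA mul1r mulVf// mul1r.
by rewrite leeDl.
Qed.

(** Rademacher's theorem on the line. The functions [L x + F x] and [L x - F x] are nondecreasing
    and add up to [2 L x], so the Stieltjes measure of the first is absolutely continuous. It has a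
    Radon-Nikodym density, and Lebesgue's theorem differentiates the primitive of that density. *)
Lemma lipschitz_derivable_ae (F : R -> R) (L : R) :
  (forall x y, `|F x - F y| <= L * `|x - y|) ->
  {ae leb, forall x, derivable F x 1}.
Proof.
move=> FL.
have L0 : 0 <= L by have := FL 1 0; rewrite subr0 normr1 mulr1; exact: le_trans.
have cF := lipschitz_continuous FL.
have FL' x y : x <= y -> - (L * (y - x)) <= F y - F x <= L * (y - x).
  move=> xy; rewrite -ler_norml (le_trans (FL _ _))//.
  by rewrite ger0_norm// subr_ge0.
have [G GE] : exists G : cumulative R R, G = (fun x => L * x + F x) :> (R -> R).
  apply: nondecreasing_cumulative.
    by move=> x y xy; have /andP[+ _] := FL' _ _ xy; lra.
  by move=> x; apply: cvgD; [apply: cvgM; [exact: cvg_cst|exact: cvg_id]|exact: cF].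
have [H HE] : exists G : cumulative R R, G = (fun x => L * x - F x) :> (R -> R).
  apply: nondecreasing_cumulative.
    by move=> x y xy; have /andP[_] := FL' _ _ xy; lra.
  by move=> x; apply: cvgB; [apply: cvgM; [exact: cvg_cst|exact: cvg_id]|exact: cF].
have Gle A : measurable A -> (lebesgue_stieltjes_measure G A <= (2 * L)%:E * leb A)%E.
  apply: (@lipschitz_stieltjes_le _ H); first by rewrite mulr_ge0.
  by move=> x; rewrite GE HE; lra.
(* Restriction to the bounded intervals [I N] makes the Stieltjes measure finite, so that
   Radon-Nikodym applies; each point is interior to some [I N]. *)
pose I (N : nat) : set (measurableTypeR R) := `](- N%:R), N%:R : R]%classic.
have mI N : measurable (I N) by exact: measurable_itv.
have GI N : (lebesgue_stieltjes_measure G (I N) < +oo)%E.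
  by rewrite lebesgue_stieltjes_itv ?ltry// lerNl (@le_trans _ _ 0)// lerNl oppr0.
suff HN : forall N : nat, {ae leb, forall x, - N%:R < x < N%:R -> derivable F x 1}.
  have : {ae leb, forall x, forall N : nat, - N%:R < x < N%:R -> derivable F x 1}.
    exact: ae_foralln.
  apply: ae_imp => x Hx.
  apply: (Hx (Num.truncn `|x|).+1).
  by rewrite -ltr_norml truncnS_gt.
move=> N.
have nu_dom : mfrestr (mI N) (GI N) `<< leb.
  apply/null_content_dominatesP => A mA lA0; rewrite /mfrestr/= /mrestr.
  apply/eqP; rewrite eq_le measure_ge0 andbT.
  rewrite (le_trans (Gle _ _))//; first exact: measurableI.
  rewrite (@le_trans _ _ ((2 * L)%:E * leb A)%E)//; last by rewrite lA0 mule0.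
  by rewrite lee_wpmul2l ?lee_fin ?mulr_ge0// le_measure ?inE//; exact: measurableI.
have [f [f0 ffin intf fE]] := radon_nikodym_sigma_finite nu_dom.
pose g := fine \o f.
have fg : f = EFin \o g by apply/funext => x; rewrite /g/= fineK.
have intg : leb.-integrable setT (EFin \o g) by rewrite -fg.
have gloc : locally_integrable setT g by exact: (open_integrable_locally openT).
have := lebesgue_differentiation gloc; apply: ae_imp => x gx /andP[Nx xN].
have intI : leb.-integrable [set` Interval (BRight (- N%:R : R)) (BRight (N%:R : R))] (EFin \o g).
  by apply: (integrableS measurableT).
have := FTC1_lebesgue_pt xN intI Nx gx => -[+ _].
set K := (K in derivable K x 1) => dK.
have KE y : - N%:R < y < N%:R -> K y = G y - G (- N%:R).
  move=> /andP[Ny yN]; rewrite /K /Rintegral.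
  under eq_integral do rewrite -/(comp EFin g _) -fg.
  rewrite -fE//.
  rewrite -[LHS]/(fine (lebesgue_stieltjes_measure G (`]- N%:R, y]%classic `&` I N))).
  rewrite setIidl; last first.
    by apply: subset_itvl; rewrite bnd_simp ltW.
  by rewrite lebesgue_stieltjes_itv ?ltW.
(* Near [x] the primitive [K] of the density equals [G - G(-N)], so the last bracket vanishes on a
   neighbourhood and is differentiable as a locally constant function. *)
have -> : F = (K + cst (G (- N%:R))) - (fun y => L * y) + (F - (K + cst (G (- N%:R))) + (fun y => L * y)).
  by apply/funext => y; rewrite !fctE; lra.
apply: derivableD; first apply: derivableB; first apply: derivableD => //.
  by apply: (@derivableM _ _ (cst L) id).
apply: (@near_eq_derivable _ _ _ (cst 0)); last exact: derivable_cst.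
near=> y.
have yN : - N%:R < y < N%:R.
  by apply/andP; split; near: y; [exact: lt_nbhsr|exact: lt_nbhsl].
by rewrite !fctE KE// GE; lra.
Unshelve. all: by end_near. Qed.

End lipschitz_derivable.

(** * Lebesgue measure on row vectors *)

Section lebesgue_rV_theory.
Context {R : realType} {n : nat}.
Local Notation mu := (lebesgue_rV R n).
Local Notation leb := (@lebesgue_measure R).
Implicit Types (x v : 'rV[R]_n) (A E : set 'rV[R]_n).

Lemma lebesgue_measure_translation (t : R) (A : set (measurableTypeR R)) :
  measurable A -> leb [set y : R | A (y + t)] = leb A.
Proof.
move=> mA.
have mT : measurable_fun setT (fun x : measurableTypeR R => (x + t : measurableTypeR R)).
  exact: measurable_funD.
pose m : {measure set (measurableTypeR R) -> \bar R} :=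
  measure_function_pushforward__canonical__measure_function_Measure leb mT.
rewrite [RHS](@lebesgue_measure_unique _ m)// => _ [[a b] _ <-]/=.
rewrite /m/= /pushforward.
have -> : (fun y : R => y + t) @^-1` `]a, b]%classic = `]a - t, b - t]%classic.
  by apply/seteqP; split => y /=; rewrite !in_itv/= ltrBlDr lerBrDr.
rewrite !lebesgue_measure_itv/= !lte_fin ltrD2r; case: ifP => // _.
by rewrite -!EFinB; congr EFin; lra.
Qed.

Definition box_rV (A : 'I_n -> set (measurableTypeR R)) : set 'rV[R]_n :=
  [set x | forall i, A i (x ord0 i)].

Lemma lebesgue_box_rV (B : 'I_n -> set (measurableTypeR R)) :
  (forall i, measurable (B i)) -> mu (box_rV B) = (\prod_(i < n) leb (B i))%E.
Proof. exact: lebesgue_rV_box. Qed.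

Definition measurable_boxes : set (set 'rV[R]_n) :=
  [set box_rV A | A in [set A | forall i, measurable (A i)]].

(** The identity is measurable from the sigma-algebra of boxes because its coordinates are, so boxes
    generate the Borel sets. Being stable under intersection, they determine a measure in
    [lebesgue_rV_unique]. *)
Lemma measurable_rVE : @measurable _ 'rV[R]_n = <<s measurable_boxes >>.
Proof.
apply/seteqP; split => [A mA|]; last first.
  apply: smallest_sub; first exact: sigma_algebra_measurable.
  by move=> _ [A mA <-]; exact: measurable_box_rV.
pose T : measurableType _ := g_sigma_algebraType measurable_boxes.
have mid : measurable_fun setT (fun x : T => (x : 'rV[R]_n)).
  apply: measurable_fun_rV => i _ B mB; rewrite setTI.
  apply: sub_sigma_algebra; exists (fun j => if j == i then B else setT).
    by move=> j; case: ifP.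
  apply/seteqP; split => x /=; first by move/(_ i); rewrite eqxx.
  by move=> xB j; case: eqP => // ->.
by have := mid measurableT _ mA; rewrite setTI.
Qed.

Lemma measurable_boxesI : setI_closed measurable_boxes.
Proof.
move=> _ _ [A mA <-] [B mB <-]; exists (fun i => A i `&` B i).
  by move=> i; exact: measurableI.
apply/seteqP; split => [x /= xAB|x [xA xB] i]; last by split; [exact: xA|exact: xB].
by split => i; case: (xAB i).
Qed.

Lemma lebesgue_rV_unique (m : {measure set 'rV[R]_n -> \bar R}) :
  (forall B, (forall i, measurable (B i)) ->
    m (box_rV B) = (\prod_(i < n) leb (B i))%E) ->
  forall A, measurable A -> mu A = m A.
Proof.
move=> mE A mA.
pose g (k : nat) := box_rV (fun=> `[- k%:R, k%:R]%classic).
apply: (measure_unique measurable_boxes g) => //.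
- exact: measurable_rVE.
- exact: measurable_boxesI.
- by move=> k; exists (fun=> `[- k%:R, k%:R]%classic) => // i; exact: measurable_itv.
- apply/seteqP; split => // x _.
  have /choice[f fP] : forall i : 'I_n, exists k : nat, `|x ord0 i| <= k%:R.
    by move=> i; exists (Num.truncn `|x ord0 i|).+1; exact/ltW/truncnS_gt.
  exists (\max_i f i)%N => // i; rewrite /= in_itv/= -ler_norml.
  by rewrite (le_trans (fP i))// ler_nat; exact: (leq_bigmax i).
- by move=> _ [B mB <-]; rewrite mE// -lebesgue_rV_box.
- move=> k; suff : (mu (g k) < +oo)%E by [].
  have -> : mu (g k) = (\prod_(i < n) leb `[(- k%:R)%R, k%:R%R]%classic)%E.
    by rewrite -(lebesgue_rV_box (A := fun=> `[- k%:R, k%:R]%classic)).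
  rewrite ltey_eq prode_fin_num// => i _.
  by rewrite lebesgue_measure_itv/=; case: ifP => // _; rewrite -EFinB.
Qed.

Lemma measurable_rV_shift v : measurable_fun setT (fun x => x + v).
Proof.
apply: measurable_fun_rV => i; under [X in measurable_fun _ X]funext do rewrite mxE.
by apply: measurable_funD => //; exact: measurable_coord_rV.
Qed.

Lemma lebesgue_rV_translation v A : measurable A -> mu [set x | A (x + v)] = mu A.
Proof.
move=> mA.
pose m : {measure set 'rV[R]_n -> \bar R} :=
  measure_function_pushforward__canonical__measure_function_Measure mu (measurable_rV_shift v).
rewrite [RHS](@lebesgue_rV_unique m)// => B mB.
rewrite -[LHS]/(mu ((fun x => x + v) @^-1` box_rV B)).
have -> : (fun x => x + v) @^-1` box_rV B = box_rV (fun i => [set t | B i (t + v ord0 i)]).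
  by apply/seteqP; split => x /= xB i; have := xB i; rewrite mxE.
rewrite lebesgue_box_rV => [|i].
  by apply: eq_bigr => i _; exact: lebesgue_measure_translation.
have mT : measurable_fun setT (fun x : measurableTypeR R => (x + v ord0 i : measurableTypeR R)).
  exact: measurable_funD.
by have := mT measurableT _ (mB i); rewrite setTI.
Qed.

Lemma coord_le_norm x i : `|x ord0 i| <= `|x|.
Proof.
rewrite -[leRHS]/(mx_norm x) mx_normrE; exact: (le_bigmax 0 (fun ij => `|x ij.1 ij.2|) (ord0, i)).
Qed.

Lemma bounded_lebesgue_rV_lty A : measurable A -> bounded_set A -> (mu A < +oo)%E.
Proof.
move=> mA [M [_ bA]].
pose K := `|M| + 1.
have KM : M < K by rewrite ltr_pwDr// ler_norm.
have mI (i : 'I_n) : measurable (`[- K, K]%classic : set (measurableTypeR R)).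
  exact: measurable_itv.
apply: (@le_lt_trans _ _ (mu (box_rV (fun=> `[- K, K]%classic)))).
  apply: le_measure; rewrite ?inE//; first exact: measurable_box_rV.
  move=> x Ax i /=; rewrite in_itv/= -ler_norml.
  by rewrite (le_trans _ (bA _ KM _ Ax))// coord_le_norm.
rewrite lebesgue_box_rV// ltey_eq prode_fin_num// => i _.
by rewrite lebesgue_measure_itv/=; case: ifP => // _; rewrite -EFinB.
Qed.

Lemma open_box_rV_sub A x : open A -> A x -> exists2 e : R, 0 < e &
  forall y : 'rV[R]_n, (forall i, `|x ord0 i - y ord0 i| < e) -> A y.
Proof.
move=> oA Ax; have /nbhs_ballP[e /= e0 eA] : nbhs x A by exact: open_nbhs_nbhs.
by exists e => // y xy; apply: eA; split => // i j; rewrite (ord1 i) /ball/=.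
Qed.

(** A cube around a point of [A] already has positive measure. This later provides a point where the
    almost everywhere conditions on an integrand hold. *)
Lemma open_lebesgue_rV_gt0 A : open A -> A !=set0 -> (0 < mu A)%E.
Proof.
move=> oA [x Ax]; have [e e0 eA] := open_box_rV_sub oA Ax.
pose B i : set (measurableTypeR R) := `]x ord0 i - e, x ord0 i + e[%classic.
have mB i : measurable (B i) by exact: measurable_itv.
apply: (@lt_le_trans _ _ (mu (box_rV B))); last first.
  apply: le_measure; rewrite ?inE//; first exact: measurable_box_rV.
    exact: open_measurable_rV.
  move=> y yB; apply: eA => i; have := yB i; rewrite /B/= in_itv/= distrC.
  by rewrite ltr_distl.
rewrite lebesgue_box_rV//; elim/big_ind: _ => [|a b a0 b0|i _]; [exact: lte01|exact: mule_gt0|].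
rewrite lebesgue_measure_itv/= lte_fin ifT; last by lra.
by rewrite -EFinB lte_fin; lra.
Qed.

Lemma measurable_line i : measurable_fun setT
  (fun z : measurableTypeR R * 'rV[R]_n => z.2 + (z.1 : R) *: delta_mx ord0 i).
Proof.
apply: measurable_fun_rV => j.
rewrite (_ : (fun _ => _) = (fun z : measurableTypeR R * 'rV[R]_n =>
    z.2 ord0 j + z.1 * (delta_mx ord0 i : 'rV[R]_n) ord0 j)); last first.
  by apply/funext => z; rewrite !mxE.
apply: measurable_funD.
  apply: (measurableT_comp (f := fun x : 'rV[R]_n => x ord0 j)) => //.
  exact: measurable_coord_rV.
by apply: measurable_funM => //; exact: measurable_fst.
Qed.

(* By translation invariance mu E is the average over t in [0, 1] of the
   measures of the translates of E, so Tonelli is applied only on R x R^n and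
   the coordinate i plays no special role. *)
Lemma null_lines_null i E : measurable E ->
  (forall x, leb [set t | E (x + t *: delta_mx ord0 i)] = 0%E) -> mu E = 0%E.
Proof.
move=> mE E0.
pose D := [set z : measurableTypeR R * 'rV[R]_n | E (z.2 + (z.1 : R) *: delta_mx ord0 i)].
have mD : measurable D.
  by have := measurable_line i measurableT mE; rewrite setTI.
pose f z : \bar R := (\1_D z)%:E.
have mf : measurable_fun setT f by apply/measurable_EFinP; exact: measurable_indic.
have f0 z : (0 <= f z)%E by rewrite lee_fin.
have H1 y : (\int[leb]_t f (t, y) = 0)%E.
  pose S : set (measurableTypeR R) := [set t | E (y + t *: delta_mx ord0 i)].
  have mS : measurable S.
    by have := measurableT_comp (measurable_line i) (measurable_pair2 y) measurableT mE; rewrite setTI.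
  rewrite -[RHS](E0 y) -/S -[S in RHS]setIT -integral_indic//.
have H2 (t : measurableTypeR R) : (\int[mu]_x f (t, x) = mu E)%E.
  pose S := [set x : 'rV[R]_n | E (x + (t : R) *: delta_mx ord0 i)].
  have mS : measurable S.
    by have := measurable_rV_shift ((t : R) *: delta_mx ord0 i) measurableT mE; rewrite setTI.
  rewrite -[RHS](lebesgue_rV_translation ((t : R) *: delta_mx ord0 i))//.
  rewrite -/S -[S in RHS]setIT -integral_indic//.
have := @fubini_tonelli _ _ _ _ _ leb mu f mf f0.
under eq_integral do rewrite H2.
under [RHS]eq_integral do rewrite H1.
rewrite integral0.
rewrite integral_cst// => /eqP; rewrite mule_eq0 => /orP[/eqP//|].
have : (leb [set: R] > 0)%E.
  apply: (@lt_le_trans _ _ (leb `[0%R, 1%R]%classic)).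
    by rewrite lebesgue_measure_itv/= lte_fin ltr01 -EFinB subr0 lte_fin.
  by apply: le_measure; rewrite ?inE//; exact: measurable_itv.
by rewrite lt0e => /andP[/negPf ->].
Qed.

End lebesgue_rV_theory.

(** * Partial derivatives of Lipschitz functions *)

Section partial_theory.
Context {R : realType} {n : nat}.
Local Notation mu := (lebesgue_rV R n).
Local Notation leb := (@lebesgue_measure R).
Local Notation E i := (delta_mx ord0 i : 'rV[R]_n).
Local Notation intg f := (mu.-integrable setT (EFin \o f)).
Implicit Types (x v : 'rV[R]_n) (w f g : 'rV[R]_n -> R).

Lemma continuous_measurable_rV k (h : 'rV[R]_k -> R) :
  continuous h -> measurable_fun setT h.
Proof.
move=> ch; apply: (@measurability _ _ _ _ _ _ _ (RGenOpens.measurableE R)) => _ [_ [a [b ->]] <-].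
rewrite setTI; apply: open_measurable_rV.
by apply: open_comp; [move=> x _; exact: ch|exact: interval_open].
Qed.

Lemma intg_measurable f : intg f -> measurable_fun setT f.
Proof. by move/measurable_int/measurable_EFinP. Qed.

Lemma intg_le f g : measurable_fun setT f -> intg g ->
  (forall x, `|f x| <= `|g x|) -> intg f.
Proof.
move=> mf ig fg; apply: le_integrable ig => //; first exact/measurable_EFinP.
by move=> x _; rewrite /= lee_fin.
Qed.

Lemma intg_indic (A : set 'rV[R]_n) : measurable A -> (mu A < +oo)%E -> intg (\1_A : _ -> R).
Proof.
move=> mA Aoo; apply/integrableP; split; first exact/measurable_EFinP/measurable_indic.
rewrite (eq_integral (EFin \o \1_A)) => [|x _].
  by rewrite integral_indic// setIT.
by rewrite /= ger0_norm.
Qed.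

Lemma intgZ (c : R) f : intg f -> intg (fun x => c * f x).
Proof. by move=> fi; have := integrableZl measurableT c fi; apply: eq_integrable. Qed.

Lemma intgD f g : intg f -> intg g -> intg (fun x => f x + g x).
Proof. by move=> fi gi; have := integrableD measurableT fi gi; apply: eq_integrable. Qed.

Lemma intgB f g : intg f -> intg g -> intg (fun x => f x - g x).
Proof. by move=> fi gi; have := integrableB measurableT fi gi; apply: eq_integrable. Qed.

Lemma intg_bounded f (A : set 'rV[R]_n) (M : R) :
  measurable_fun setT f -> measurable A -> (mu A < +oo)%E ->
  (forall x, `|f x| <= M) -> (forall x, ~ A x -> f x = 0) -> intg f.
Proof.
move=> mf mA Aoo fM f0; apply: (intg_le mf (intgZ M (intg_indic mA Aoo))) => x.
rewrite indicE normrM; have [xA|/negP] := boolP (x \in A).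
  by rewrite normr1 mulr1 (le_trans (fM x))// ler_norm.
by rewrite inE => /f0 ->; rewrite normr0 mulr_ge0.
Qed.

Lemma continuous_shift_rV w v : continuous w -> continuous (fun x => w (x + v)).
Proof.
move=> cw x; apply: (@continuous_comp _ _ _ (fun x => x + v) w); last exact: cw.
exact: (cvgD cvg_id (cvg_cst _)).
Qed.

Definition dquot i w (h : R) x := h^-1 * (w (x + h *: E i) - w x).

Lemma dquot_continuous i w h : continuous w -> continuous (dquot i w h).
Proof.
move=> cw x.
exact: (cvgM (cvg_cst h^-1) (cvgB (@continuous_shift_rV _ (h *: E i) cw x) (cw x))).
Qed.

Lemma dquotE i w x :
  (fun h : R => h^-1 *: ((w \o shift x) (h *: E i) - w x)) = (fun h => dquot i w h x).
Proof. by apply/funext => h; rewrite /dquot /= [h *: _ + x]addrC. Qed.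

Lemma derivable_line i w x (s : R) :
  derivable w (x + s *: E i) (E i) <->
  derivable (fun t : R => w (x + t *: E i)) s 1.
Proof.
rewrite /derivable dquotE.
rewrite (_ : (fun h => dquot _ _ _ _) = (fun h : R => h^-1 *:
  (((fun t : R => w (x + t *: E i)) \o shift s) (h *: 1) - w (x + s *: E i))))//.
apply/funext => h; rewrite /dquot /= -addrA -scalerDl [s + h]addrC.
by rewrite -[h *: 1]/(h * 1) mulr1.
Qed.

Definition derivable_set i w := [set x | derivable w x (E i)].

(** Cauchy's criterion with thresholds 1/(k+1) and 1/(l+1), which writes the set of
    differentiability as a countable intersection of countable unions. For fixed [k] and [l] the
    condition over all [a], [b] is an intersection of closed sets when [w] is continuous, hence
    Borel. *)
Lemma derivable_dquotP i w x : derivable w x (E i) <->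
  forall k, exists l : nat, forall a b : R, 0 < `|a| < l.+1%:R^-1 -> 0 < `|b| < l.+1%:R^-1 ->
    `|dquot i w a x - dquot i w b x| <= k.+1%:R^-1.
Proof.
rewrite /derivable dquotE; split => [/cvg_ex[/= d dP] k|H].
  have k20 : 0 < k.+1%:R^-1 / 2 :> R by rewrite divr_gt0// invr_gt0.
  move/cvgrPdist_lt : dP => /(_ _ k20).
  rewrite near_withinE => -[e /= e0 eP].
  have [l le] : exists l : nat, l.+1%:R^-1 < e.
    by exists (Num.truncn e^-1); rewrite invf_plt ?posrE// truncnS_gt.
  exists l => a b /andP[a0 al] /andP[b0 bl].
  have aP : `|d - dquot i w a x| < k.+1%:R^-1 / 2.
    by apply: (eP a) => /=; [rewrite sub0r normrN (lt_trans al)|rewrite -normr_gt0].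
  have bP : `|d - dquot i w b x| < k.+1%:R^-1 / 2.
    by apply: (eP b) => /=; [rewrite sub0r normrN (lt_trans bl)|rewrite -normr_gt0].
  rewrite (_ : _ - _ = (d - dquot i w b x) - (d - dquot i w a x)); last by lra.
  by rewrite (le_trans (ler_normB _ _))// (splitr k.+1%:R^-1) ltW// ltrD.
apply/cauchy_cvgP/cauchy_exP => e e0.
have [k ke] : exists k : nat, k.+1%:R^-1 < e.
  by exists (Num.truncn e^-1); rewrite invf_plt ?posrE// truncnS_gt.
have [l lP] := H k.
pose a : R := l.+1%:R^-1 / 2.
have a0 : 0 < a by rewrite divr_gt0// invr_gt0.
exists (dquot i w a x).
change (\forall b \near (0 : R)^', `|dquot i w a x - dquot i w b x| < e).
near=> b; rewrite (le_lt_trans _ ke)//; apply: lP.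
  by rewrite gtr0_norm// a0/= /a ltr_pdivrMr// ltr_pMr ?invr_gt0// ltr1n.
apply/andP; split; first by rewrite normr_gt0; near: b; exact: nbhs_dnbhs_neq.
by near: b; apply: dnbhs0_lt; rewrite invr_gt0.
Unshelve. all: by end_near. Qed.

Lemma measurable_derivable_set i w : continuous w -> measurable (derivable_set i w).
Proof.
move=> cw.
rewrite (_ : derivable_set i w = \bigcap_k \bigcup_l
    [set x | forall a b : R, 0 < `|a| < l.+1%:R^-1 -> 0 < `|b| < l.+1%:R^-1 ->
    `|dquot i w a x - dquot i w b x| <= k.+1%:R^-1]); last first.
  apply/seteqP; split => x /=.
    by move/derivable_dquotP => H k _; have [l lP] := H k; exists l.
  by move=> H; apply/derivable_dquotP => k; have [l _ lP] := H k Logic.I; exists l.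
apply: bigcapT_measurable => k; apply: bigcupT_measurable => l.
set S := (X in measurable X).
have -> : S = \bigcap_(ab in [set ab : R * R |
    0 < `|ab.1| < l.+1%:R^-1 /\ 0 < `|ab.2| < l.+1%:R^-1])
    [set x | `|dquot i w ab.1 x - dquot i w ab.2 x| <= k.+1%:R^-1].
  apply/seteqP; split => x /=; first by move=> H [a b] [/=]; exact: H.
  by move=> H a b ha hb; apply: (H (a, b)).
have cl (ab : R * R) : closed [set x | `|dquot i w ab.1 x - dquot i w ab.2 x| <= k.+1%:R^-1].
  apply: (@preimage_closed _ _ (fun x => `|dquot i w ab.1 x - dquot i w ab.2 x|) [set t | t <= k.+1%:R^-1]).
    move=> x _; exact: (cvg_norm (cvgB (@dquot_continuous i w ab.1 cw x) (@dquot_continuous i w ab.2 cw x))).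
  exact: closed_le.
rewrite -[X in measurable X]setCK; apply: measurableC; apply: open_measurable_rV; apply: closed_openC.
by apply: closed_bigI => ab _; exact: cl.
Qed.

(** The exceptional set is Borel, and each line in direction [e_i] meets it in a null set by the
    one-dimensional theorem; [null_lines_null] concludes. *)
Lemma lipschitz_line_derivable_ae i w (L : R) : continuous w ->
  (forall x t, `|w (x + t *: E i) - w x| <= L * `|t|) ->
  {ae mu, forall x, derivable w x (E i)}.
Proof.
move=> cw wL; exists (~` derivable_set i w); split => //.
  by apply: measurableC; exact: measurable_derivable_set.
apply: (@null_lines_null _ _ i); first by apply: measurableC; exact: measurable_derivable_set.
move=> x.
have /negligibleP : leb.-negligible [set t | (~` derivable_set i w) (x + t *: E i)].
  have : {ae leb, forall t : R, derivable (fun t : R => w (x + t *: E i)) t 1}.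
    apply: (@lipschitz_derivable_ae _ _ L) => s t.
    have := wL (x + t *: E i) (s - t).
    by rewrite -addrA -scalerDl [t + _]addrC subrK.
  apply: negligibleS => t /= nd; apply: contra_not nd => d.
  exact: (derivable_line i w x t).2.
apply.
have mD := measurableC (@measurable_derivable_set i w cw).
by have := measurableT_comp (measurable_line i) (measurable_pair2 x) measurableT mD; rewrite setTI.
Qed.

Lemma cvg_dquot i w x : derivable w x (E i) ->
  (fun k : nat => dquot i w k.+1%:R^-1 x) @ \oo --> partial i w x.
Proof.
move=> dw; have : (fun h => dquot i w h x) @ 0^' --> partial i w x.
  by rewrite -dquotE.
move/cvgrPdist_lt => H; apply/cvgrPdist_lt => e e0.
have := H _ e0; rewrite near_withinE => -[d /= d0 dP].
near=> k; apply: (dP k.+1%:R^-1) => /=; last by rewrite gt_eqF// invr_gt0.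
rewrite sub0r normrN gtr0_norm ?invr_gt0//.
by near: k; exact: near_infty_natSinv_lt (PosNum d0).
Unshelve. all: by end_near. Qed.

Lemma measurable_partial i w : continuous w -> measurable_fun setT (partial i w).
Proof.
move=> cw; have mD := @measurable_derivable_set i w cw.
(* Where the derivative does not exist, ['D] is the default limit [point]. The difference quotients
   are replaced by that constant there, so [q] converges everywhere to [partial i w]. *)
pose q (k : nat) : 'rV[R]_n -> R := fun x =>
  dquot i w k.+1%:R^-1 x * \1_(derivable_set i w) x +
  (point : R) * \1_(~` derivable_set i w) x.
have mq k : measurable_fun setT (q k).
  apply: measurable_funD; apply: measurable_funM => //.
  - by apply: continuous_measurable_rV; exact: dquot_continuous.
  - by apply: measurable_indic; exact: measurableC.
suff qP x : [set: 'rV[R]_n] x -> q ^~ x @ \oo --> partial i w x.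
  exact: (measurable_fun_cvg mq qP).
move=> _; rewrite /q !indicE in_setC.
have [/[!inE] dx|/negP] := boolP (x \in derivable_set i w).
  rewrite (_ : (fun=> _) = (fun k : nat => dquot i w k.+1%:R^-1 x)); first exact: cvg_dquot.
  by apply/funext => k; rewrite mulr1 mulr0 addr0.
rewrite inE => /dvgP dx.
rewrite (_ : (fun=> _) = cst (point : R)); last by apply/funext => k; rewrite mulr0 add0r mulr1.
by rewrite /partial /derive dx; exact: cvg_cst.
Qed.

(** The summand [|point|] pays for the default value taken where the derivative does not exist. *)
Lemma partial_le i w (L : R) x : (forall x t, `|w (x + t *: E i) - w x| <= L * `|t|) ->
  `|partial i w x| <= L + `|point : R|.
Proof.
move=> wL; have [dw|/dvgP dw] := pselect (derivable w x (E i)); last first.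
  rewrite /partial/derive dw lerDr.
  by have := wL 0 1; rewrite normr1 mulr1; exact: le_trans.
rewrite (@le_trans _ _ L)// ?lerDl//.
have /(_ _)H := cvg_norm (cvg_dquot dw).
rewrite -(cvg_lim _ H)//; apply: limr_le; first by apply/cvg_ex; eexists; exact: H.
apply: nearW => k; rewrite /dquot normrM gtr0_norm ?invr_gt0//.
rewrite ler_pdivrMl// mulrC (le_trans (wL _ _))// gtr0_norm ?invr_gt0//.
Qed.

Lemma partial_near0 i w x : (\forall y \near x, w y = 0) -> partial i w x = 0.
Proof.
move=> w0; rewrite /partial.
by rewrite (near_eq_derive (g := cst 0))// derive_cst.
Qed.

Lemma Rintegral_translation v f : intg f -> \int[mu]_x f (x + v) = \int[mu]_x f x.
Proof.
move=> fi; rewrite /Rintegral; congr fine.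
have ms := measurable_rV_shift v.
transitivity (\int[mu]_(x in (fun x => (x + v)%R) @^-1` setT) ((EFin \o f) \o (fun x => (x + v)%R)) x)%E => //.
rewrite -(integral_pushforward ms)//.
  apply: eq_measure_integral => A mA _.
  exact: lebesgue_rV_translation.
  exact: measurable_int fi.
apply/integrableP; split; first by apply: measurableT_comp; [exact/measurable_int/fi|exact: ms].
have /integrableP[mf] := fi; apply: le_lt_trans.
have := @ge0_integral_pushforward _ _ _ _ R _ ms mu setT (fun x => `|(f x)%:E|)%E measurableT.
rewrite preimage_setT => <-//.
  rewrite le_eqVlt; apply/orP; left; apply/eqP.
  by apply: eq_measure_integral => A mA _; exact: lebesgue_rV_translation.
by apply: measurableT_comp => //; exact: measurable_int fi.
Qed.

(** Every difference quotient has integral zero by translation invariance. Those with steps 1/(k+1)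
    are bounded by [L] and vanish off the ball [B], so dominated convergence carries this over to
    the partial derivative. *)
Lemma integral_partial0 i w (L : R) : continuous w ->
  (forall x t, `|w (x + t *: E i) - w x| <= L * `|t|) ->
  bounded_set [set x | w x != 0] ->
  intg (partial i w) /\ \int[mu]_x partial i w x = 0.
Proof.
move=> cw wL [M [_ bw]].
(* [w] vanishes from norm [|M| + 1] on, and the increments 1/(k+1) have length at most 1; the ball
   of radius [|M| + 2] therefore contains the support of every quotient. *)
pose B := [set x : 'rV[R]_n | `|x| <= `|M| + 2].
have mB : measurable B.
  rewrite -[X in measurable X]setCK; apply: measurableC; apply: open_measurable_rV.
  apply: closed_openC.
  apply: (@preimage_closed _ _ (fun x : 'rV[R]_n => `|x|) [set t | t <= `|M| + 2]).
    by move=> x _; exact: norm_continuous.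
  exact: closed_le.
have Boo : (mu B < +oo)%E.
  apply: bounded_lebesgue_rV_lty => //; exists (`|M| + 2); split => // t Mt x /= xB.
  by rewrite (le_trans xB)// ltW.
have w0 x : `|M| + 1 <= `|x| -> w x = 0.
  move=> Mx; apply: contrapT => /eqP wx.
  have := bw (`|M| + 1 / 2); rewrite (le_lt_trans (ler_norm M))//=; last by rewrite ltrDl.
  by move=> /(_ isT) /(_ x wx)/=; lra.
have E1 : `|E i : 'rV[R]_n| <= 1.
  rewrite -[leLHS]/(mx_norm _) mx_normrE; apply: bigmax_le => // -[a b] _ /=.
  by rewrite mxE; case: (_ && _); rewrite ?normr1 ?normr0.
have q0 k x : ~ B x -> dquot i w k.+1%:R^-1 x = 0.
  rewrite /B/= => /negP; rewrite -ltNge => xM; rewrite /dquot !w0 ?subrr ?mulr0//.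
    by lra.
  have k1 : `|k.+1%:R^-1 *: (E i : 'rV[R]_n)| <= 1.
    rewrite normrZ gtr0_norm ?invr_gt0// mulr_ile1 ?invr_ge0//.
    by rewrite invf_le1// ler1n.
  have := ler_normB (x + k.+1%:R^-1 *: E i) (k.+1%:R^-1 *: E i : 'rV[R]_n).
  by rewrite addrK; lra.
have L0 : 0 <= L.
  by have := wL 0 1; rewrite normr1 mulr1; exact: le_trans.
have EE1 : `|E i : 'rV[R]_n| = 1.
  by apply/eqP; rewrite eq_le E1/= (le_trans _ (coord_le_norm _ i))// mxE !eqxx normr1.
(* Moving [x] by twice the radius of [B] along [e_i] leaves the support, so the Lipschitz bound
   between the two points bounds [w x] itself. *)
have wb x : B x -> `|w x| <= L * (2 * (`|M| + 2)).
  rewrite /B/= => xB; have := wL x (2 * (`|M| + 2)).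
  rewrite w0 ?sub0r ?normrN; first by rewrite (ger0_norm (x := 2 * _)) ?mulr_ge0 ?addr_ge0.
  have := ler_normB (x + (2 * (`|M| + 2)) *: E i) x.
  rewrite addrC addKr normrZ EE1 mulr1 ger0_norm ?mulr_ge0 ?addr_ge0//.
  by have := normr_ge0 M; lra.
have wint : intg w.
  apply: (intg_bounded (continuous_measurable_rV cw) mB Boo (M := L * (2 * (`|M| + 2)))) => x.
    have [xB|xB] := pselect (B x); first exact: wb.
    rewrite w0 ?normr0 ?mulr_ge0 ?addr_ge0//.
    by move: xB; rewrite /B/= => /negP; rewrite -ltNge; lra.
  by rewrite /B/= => /negP; rewrite -ltNge => xB; apply: w0; lra.
have wtint v : intg (fun x => w (x + v)).
  pose Bv := [set x | B (x + v)].
  have mBv : measurable Bv by have := measurable_rV_shift v measurableT mB; rewrite setTI.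
  apply: (@intg_bounded _ Bv (L * (2 * (`|M| + 2)))) => //.
  - by apply: continuous_measurable_rV; exact: continuous_shift_rV.
  - by rewrite lebesgue_rV_translation.
  - move=> x; have [xB|xB] := pselect (B (x + v)); first exact: wb.
    rewrite w0 ?normr0 ?mulr_ge0 ?addr_ge0//.
    by move: xB; rewrite /B/= => /negP; rewrite -ltNge; lra.
  - by rewrite /Bv /B/= => x /negP; rewrite -ltNge => xB; apply: w0; lra.
have qint k : intg (dquot i w k.+1%:R^-1) /\ \int[mu]_x dquot i w k.+1%:R^-1 x = 0.
  split; first by apply: intgZ; apply: intgB.
  rewrite /dquot RintegralZl//; last by apply: intgB.
  rewrite RintegralB// (Rintegral_translation _ wint) subrr mulr0//.
have ci := intgZ L (intg_indic mB Boo).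
have [] := @dominated_convergence _ _ R mu setT measurableT
  (fun k => EFin \o dquot i w k.+1%:R^-1) (EFin \o partial i w)
  (fun x => (L * \1_B x)%:E).
- by move=> k; apply: measurable_int (qint k).1.
- by apply/measurable_EFinP; exact: measurable_partial.
- have := lipschitz_line_derivable_ae cw wL; apply: ae_imp => x dx _.
  by apply: cvg_EFin; [exact: nearW|exact: cvg_dquot].
- exact: ci.
- apply: aeW => x k _ /=; rewrite lee_fin indicE.
  have [/[!inE] xB|/negP] := boolP (x \in B); last first.
    by rewrite inE => xB; rewrite q0// normr0 mulr0.
  rewrite mulr1 /dquot normrM gtr0_norm ?invr_gt0// ler_pdivrMl// mulrC.
  by rewrite (le_trans (wL _ _))// gtr0_norm ?invr_gt0.
- move=> pint _ cvgI; split => //.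
  rewrite /Rintegral; have -> : (\int[mu]_x (EFin \o partial i w) x = 0)%E; last by [].
  rewrite -(cvg_lim _ cvgI)//; apply: lim_near_cst => //; apply: nearW => k /=.
  have [qi q00] := qint k.
  by rewrite -[LHS]fineK ?integrable_fin_num// -/(Rintegral _ _ _) q00.
Qed.

End partial_theory.

(** * Smooth flat functions *)

Section flat_function.
Context {R : realType}.

(** The functions t^(-j) exp(-1/t), extended by 0 to t <= 0. The derivative of member j is a
    combination of members j + 1 and j + 2, so smoothness of [flat 0] reduces to one induction over
    the family. *)
Definition flat (j : nat) (t : R) : R := if 0 < t then t^-1 ^+ j * expR (- t^-1) else 0.

Lemma flat_ge0 j t : 0 <= flat j t.
Proof. by rewrite /flat; case: ifP => // t0; rewrite mulr_ge0 ?expR_ge0// exprn_ge0// invr_ge0 ltW. Qed.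

(** With y = 1/t this is exp y >= y^(j+1)/(j+1)!. The linear decay at 0, applied to [flat j.+1],
    makes the derivative of [flat j] at 0 vanish. *)
Lemma flat_le j t : flat j t <= j.+1`!%:R * `|t|.
Proof.
rewrite /flat; case: ifP => [t0|_]; last by rewrite mulr_ge0.
rewrite gtr0_norm// expRN; set y := t^-1.
have y0 : 0 < y by rewrite invr_gt0.
have -> : t = y^-1 by rewrite invrK.
rewrite ler_pdivlMr// mulrAC ler_pdivrMr ?expR_gt0// -exprSr.
rewrite -ler_pdivrMl ?ltr0n ?fact_gt0// mulrC.
by apply: le_trans (expR_ge1Dxn j (ltW y0)); rewrite lerDr.
Qed.

Lemma flat_gt0 j t : 0 < t -> 0 < flat j t.
Proof. by move=> t0; rewrite /flat t0 mulr_gt0 ?expR_gt0// exprn_gt0// invr_gt0. Qed.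

Lemma flat_eq0 j t : t <= 0 -> flat j t = 0.
Proof. by rewrite /flat ltNge => ->. Qed.

Lemma flat_le1 t : flat 0 t <= 1.
Proof.
rewrite /flat; case: ifP => // t0; rewrite expr0 mul1r -expR0 ler_expR.
by rewrite oppr_le0 invr_ge0 ltW.
Qed.

Lemma flat_div_le (j : nat) (h : R) : `|h^-1 * flat j h| <= j.+2`!%:R * `|h|.
Proof.
have [hp|hn|<-] := ltgtP 0 h; last 2 first.
- by rewrite (flat_eq0 _ (ltW hn)) mulr0 normr0 mulr_ge0.
- by rewrite flat_eq0// mulr0 !normr0 mulr0.
have -> : h^-1 * flat j h = flat j.+1 h by rewrite /flat hp exprS mulrA.
by rewrite ger0_norm ?flat_ge0// flat_le.
Qed.

Lemma is_derive_flat (j : nat) (t : R) : is_derive t (1 : R) (flat j) (flat j.+2 t - j%:R * flat j.+1 t).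
Proof.
have [t0|t0|<-] := ltgtP 0 t.
- have E : \forall s \near t, s^-1 ^+ j * expR (- s^-1) = flat j s.
    near=> s; rewrite /flat ifT//.
    by near: s; exact: lt_nbhsr.
  apply: (near_eq_is_derive E).
  have dV : is_derive t 1 (fun s : R => s^-1) (- t^-1 ^+ 2).
    apply: is_derive_eq; first by apply: is_deriveV; rewrite gt_eqF.
    by rewrite -exprVn scaler1.
  have dX : is_derive t 1 (fun s : R => s^-1 ^+ j) (j%:R * t^-1 ^+ j.-1 * - t^-1 ^+ 2).
    have -> : (fun s : R => s^-1 ^+ j) = (fun s : R => s^-1) ^+ j by rewrite exprfctE.
    have := is_deriveX j dV => /is_derive_eq; apply.
    by rewrite -[LHS]/(_ * _); ring.
  have dN : is_derive t 1 (fun s : R => - s^-1) (t^-1 ^+ 2).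
    by have := is_deriveN dV => /is_derive_eq; apply; rewrite opprK.
  have dE : is_derive t 1 (fun s : R => expR (- s^-1)) (expR (- t^-1) * t^-1 ^+ 2).
    have := is_derive1_comp (is_derive_expR _) dN => /is_derive_eq; apply.
    by rewrite -[LHS]/(_ * _); ring.
  have := is_deriveM dX dE => /is_derive_eq; apply.
  rewrite -[_ *: (expR _ * _)]/(_ * _) -[expR _ *: _]/(_ * _) /flat t0.
  by case: j {E dX} => [|j] /=; rewrite ?mul0r ?exprS; ring.
- have E : \forall s \near t, 0 = flat j s.
    near=> s; rewrite flat_eq0// ltW//.
    by near: s; exact: lt_nbhsl.
  apply: (near_eq_is_derive E).
  rewrite !flat_eq0 ?ltW// mulr0 subr0; exact: is_derive_cst.
- rewrite !flat_eq0// mulr0 subr0.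
  have c : (fun h => h^-1 *: ((flat j \o shift 0) (h *: 1) - flat j 0)) @ 0^' --> (0 : R).
    apply/cvgrPdist_lt => e e0; near=> h.
    have h0 : h != 0 by near: h; exact: nbhs_dnbhs_neq.
    rewrite /= addr0 [flat j 0]flat_eq0// subr0 sub0r normrN -[h *: 1]/(h * 1) mulr1.
    rewrite -[h^-1 *: _]/(_ * _).
    have hj := flat_div_le j h.
    rewrite (le_lt_trans hj)// mulrC -ltr_pdivlMr ?ltr0n ?fact_gt0//.
    by near: h; apply: dnbhs0_lt; rewrite divr_gt0// ltr0n fact_gt0.
  apply: DeriveDef; first by apply/cvg_ex; exists 0.
  by apply/cvg_lim => //; exact: c.
Unshelve. all: by end_near. Qed.

Lemma continuous_flat j : continuous (flat j).
Proof.
move=> t; apply: differentiable_continuous; apply/derivable1_diffP.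
by have [] := is_derive_flat j t.
Qed.

End flat_function.

Section Ck_theory.
Context {R : realType} {n : nat}.
Local Notation E i := (delta_mx ord0 i : 'rV[R]_n).
Implicit Types (f g : 'rV[R]_n -> R) (x : 'rV[R]_n).

Lemma continuousD_rV f g : continuous f -> continuous g -> continuous (fun x => f x + g x).
Proof. by move=> cf cg x; exact: (cvgD (cf x) (cg x)). Qed.

Lemma continuousM_rV f g : continuous f -> continuous g -> continuous (fun x => f x * g x).
Proof. by move=> cf cg x; exact: (cvgM (cf x) (cg x)). Qed.

Lemma CkW k f : Ck k f -> continuous f.
Proof. by case: k => [//|k] []. Qed.

Lemma Ck_le k f : Ck k.+1 f -> Ck k f.
Proof.
elim: k f => [|k IH] f /=; first by case.
by move=> [cf H]; split => // i; have [d /IH] := H i.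
Qed.

Lemma Ck_cst k (c : R) : Ck k (cst c : 'rV[R]_n -> R).
Proof.
elim: k c => [|k IH] c /=; first exact: cst_continuous.
split=> [x|i]; first exact: cst_continuous.
split=> [x|]; first exact: derivable_cst.
have -> : partial i (cst c : 'rV[R]_n -> R) = cst 0.
  by apply/funext => x; rewrite /partial derive_cst.
exact: IH.
Qed.

Lemma CkD k f g : Ck k f -> Ck k g -> Ck k (fun x => f x + g x).
Proof.
elim: k f g => [|k IH] f g /=; first exact: continuousD_rV.
move=> [cf df] [cg dg]; split; first exact: continuousD_rV.
move=> i; have [dfi Cfi] := df i; have [dgi Cgi] := dg i; split.
  by move=> x; apply: (derivableD (dfi x) (dgi x)).
rewrite (_ : partial _ _ = fun x => partial i f x + partial i g x); first exact: IH.
by apply/funext => x; exact: (deriveD (dfi x) (dgi x)).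
Qed.

Lemma CkM k f g : Ck k f -> Ck k g -> Ck k (fun x => f x * g x).
Proof.
elim: k f g => [|k IH] f g; first exact: continuousM_rV.
move=> Cf Cg; have := Ck_le Cf; have := Ck_le Cg.
move: Cf Cg => /= [cf df] [cg dg] Ckg Ckf; split; first exact: continuousM_rV.
move=> i; have [dfi Cfi] := df i; have [dgi Cgi] := dg i; split.
  by move=> x; apply: (derivableM (dfi x) (dgi x)).
rewrite (_ : partial _ _ = fun x => f x * partial i g x + g x * partial i f x).
  by apply: CkD; apply: IH.
by apply/funext => x; exact: (deriveM (dfi x) (dgi x)).
Qed.

Lemma Ck_prod k (I : Type) (r : seq I) (F : I -> 'rV[R]_n -> R) :
  (forall i, Ck k (F i)) -> Ck k (fun x => \prod_(i <- r) F i x).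
Proof.
move=> CF; elim: r => [|i r IH].
  by rewrite (_ : (fun _ => _) = cst 1); [exact: Ck_cst|apply/funext => x; rewrite big_nil].
rewrite (_ : (fun _ => _) = fun x => F i x * \prod_(i <- r) F i x); first exact: CkM.
by apply/funext => x; rewrite big_cons.
Qed.

Lemma partial_line i f x d : is_derive (0 : R) 1 (fun t : R => f (x + t *: E i)) d ->
  derivable f x (E i) /\ partial i f x = d.
Proof.
move=> [dd dE].
have e : (fun h : R => h^-1 *: (((fun t : R => f (x + t *: E i)) \o shift 0) (h *: 1)
    - f (x + 0 *: E i))) = (fun h => dquot i f h x).
  by apply/funext => h; rewrite /dquot/= addr0 scale0r addr0 -[h *: 1]/(h * 1) mulr1.
split; first by rewrite /derivable dquotE -e.
by rewrite /partial /derive dquotE -e.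
Qed.

Lemma partial_affine_coord (i j : 'I_n) (h : R -> R) (a b d : R) (x : 'rV[R]_n) :
  is_derive (a * x ord0 j + b) 1 h d ->
  let f := fun x : 'rV[R]_n => h (a * x ord0 j + b) in
  derivable f x (E i) /\ partial i f x = (i == j)%:R * (a * d).
Proof.
move=> dh f; apply: partial_line.
have -> : (fun t : R => f (x + t *: E i)) =
    h \o (fun t : R => a * x ord0 j + b + t * (a * (i == j)%:R)).
  apply/funext => t; rewrite /f /= !mxE eqxx/= [j == i]eq_sym; congr (h _).
  by case: (i == j); rewrite /=; ring.
have dl : is_derive (0 : R) 1 (fun t : R => a * x ord0 j + b + t * (a * (i == j)%:R)) (a * (i == j)%:R).
  have := is_deriveD (is_derive_cst (a * x ord0 j + b) (0 : R) (1 : R))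
    (is_deriveM (is_derive_id (0 : R) (1 : R)) (is_derive_cst (a * (i == j)%:R) (0 : R) (1 : R))).
  move=> /is_derive_eq; apply.
  by rewrite -[id 0 *: 0]/(0 * 0) -[_ *: 1]/(_ * 1) mul0r !add0r mulr1.
pose g (t : R) := a * x ord0 j + b + t * (a * (i == j)%:R).
have dg : is_derive (g 0) 1 h d by rewrite /g mul0r addr0.
have := @is_derive1_comp _ h g _ _ _ dg dl => /is_derive_eq; apply.
by ring.
Qed.

Lemma continuous_affine_coord i (a b : R) :
  continuous (fun x : 'rV[R]_n => a * x ord0 i + b).
Proof.
move=> x; have ci := @coord_continuous R 1 n ord0 i x.
exact: (cvgD (cvgM (cvg_cst a) ci) (cvg_cst b)).
Qed.

Lemma continuous_flat_coord j i (a b : R) :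
  continuous (fun x : 'rV[R]_n => flat j (a * x ord0 i + b)).
Proof.
move=> x; apply: (@continuous_comp _ _ _ (fun x : 'rV[R]_n => a * x ord0 i + b) (flat j)).
  exact: continuous_affine_coord.
exact: continuous_flat.
Qed.

Lemma Ck_flat k j i (a b : R) : Ck k (fun x : 'rV[R]_n => flat j (a * x ord0 i + b)).
Proof.
elim: k j => [|k IH] j /=; first exact: continuous_flat_coord.
split; first exact: continuous_flat_coord.
move=> l; have H x := @partial_affine_coord l i (flat j) a b _ x (is_derive_flat j _).
split=> [x|]; first by case: (H x).
rewrite (_ : partial _ _ = fun x : 'rV[R]_n => cst ((l == i)%:R * a) x *
    (flat j.+2 (a * x ord0 i + b) + cst (- j%:R) x * flat j.+1 (a * x ord0 i + b))).
  apply: CkM; first exact: Ck_cst.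
  by apply: CkD => //; apply: CkM => //; exact: Ck_cst.
by apply/funext => x; rewrite (H x).2/=; ring.
Qed.

End Ck_theory.

(** * Test functions *)

Section test_functions.
Context {R : realType} {n : nat}.
Local Notation mu := (lebesgue_rV R n).
Local Notation E i := (delta_mx ord0 i : 'rV[R]_n).
Implicit Types (f g phi psi : 'rV[R]_n -> R) (x y : 'rV[R]_n) (A B Omega : set 'rV[R]_n).

Lemma norm_delta_rV i : `|E i| = 1.
Proof.
apply/eqP; rewrite eq_le; apply/andP; split; last first.
  by rewrite (le_trans _ (coord_le_norm _ i))// mxE !eqxx normr1.
rewrite -[leLHS]/(mx_norm _) mx_normrE; apply: bigmax_le => // -[a b] _ /=.
by rewrite mxE; case: (_ && _); rewrite ?normr1 ?normr0.
Qed.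

Lemma test_continuous A phi : test_function A phi -> continuous phi.
Proof. by case=> C _ _; exact: (CkW (C 0%N)). Qed.

Lemma test_measurable A phi : test_function A phi -> measurable_fun setT phi.
Proof. by move/test_continuous; exact: continuous_measurable_rV. Qed.

Lemma test_out A phi x : test_function A phi -> ~ A x -> phi x = 0.
Proof.
move=> [_ _ sA] Ax; apply: contrapT => /eqP phix.
by apply: Ax; apply: sA; exact: subset_closure.
Qed.

Lemma test_near0 A phi x : test_function A phi -> ~ closure [set x | phi x != 0] x ->
  \forall y \near x, phi y = 0.
Proof.
move=> _ nx.
have : (~` closure [set x | phi x != 0]) x by [].
have oC : open (~` closure [set x | phi x != 0]).
  by apply: closed_openC; exact: closed_closure.
move=> Nx.
have : nbhs x (~` closure [set x | phi x != 0]) by apply: open_nbhs_nbhs; split.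
apply: filterS => y ny; apply: contrapT => /eqP phiy; apply: ny.
exact: subset_closure.
Qed.

Lemma bounded_setS A B : A `<=` B -> bounded_set B -> bounded_set A.
Proof. by move=> AB [M [Mr bM]]; exists M; split => // t Mt x /AB; exact: bM. Qed.

Lemma test_supp_bounded A phi : test_function A phi -> bounded_set [set x | phi x != 0].
Proof.
move=> [_ cphi _]; apply: bounded_setS (compact_bounded cphi).
exact: subset_closure.
Qed.

Lemma test_bounded A phi : test_function A phi -> exists M, forall x, `|phi x| <= M.
Proof.
move=> tphi; have [_ cphi _] := tphi; have cont := test_continuous tphi.
have cw : {within closure [set x | phi x != 0], continuous phi}.
  exact: continuous_subspaceT.
have [M [_ bM]] := compact_bounded (continuous_compact cw cphi).
exists (`|M| + 1) => x; have M1 : M < `|M| + 1 by rewrite ltr_pwDr// ler_norm.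
have [p0|p0] := eqVneq (phi x) 0; first by rewrite p0 normr0 addr_ge0.
by apply: (bM _ M1); exists x => //; exact: subset_closure.
Qed.

Lemma test_partial A phi i : test_function A phi -> test_function A (partial i phi).
Proof.
move=> tphi; have [C cphi sA] := tphi.
have sub : closure [set x | partial i phi x != 0] `<=` closure [set x | phi x != 0].
  rewrite [X in _ `<=` X](closure_id _).1; last exact: closed_closure.
  apply: closure_subset => x /= px; apply: contrapT => nx.
  by move/eqP: px; apply; apply: partial_near0; exact: (test_near0 tphi).
split=> [k||].
- by have [_ /(_ i)[]] := C k.+1.
- by apply: subclosed_compact sub => //; exact: closed_closure.
- exact: subset_trans sub sA.
Qed.

Lemma test_mul A phi psi : test_function A phi -> (forall k, Ck k psi) ->
  test_function A (fun x => phi x * psi x).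
Proof.
move=> [C cphi sA] Cpsi.
have sub : closure [set x | phi x * psi x != 0] `<=` closure [set x | phi x != 0].
  by apply: closure_subset => x /=; rewrite mulf_eq0 negb_or => /andP[].
split=> [k||]; first exact: CkM.
- by apply: subclosed_compact sub => //; exact: closed_closure.
- exact: subset_trans sub sA.
Qed.

Lemma test_sub A B phi : A `<=` B -> test_function A phi -> test_function B phi.
Proof. by move=> AB [C cphi sA]; split=> //; exact: subset_trans sA AB. Qed.

Lemma test_line A phi : test_function A phi -> exists L : R,
  forall i x t, `|phi (x + t *: E i) - phi x| <= L * `|t|.
Proof.
move=> tphi; have [C _ _] := tphi.
have /choice[L LP] : forall i, exists M, forall x, `|partial i phi x| <= M.
  by move=> i; exact: test_bounded (test_partial i tphi).
exists (\sum_i `|L i|) => i x t.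
have dphi y : derivable phi y (E i) by have [_ /(_ i)[]] := C 1%N.
have dline s : is_derive (s : R) (1 : R) (fun t : R => phi (x + t *: E i)) (partial i phi (x + s *: E i)).
  apply: DeriveDef; first exact: (derivable_line i phi x s).1.
  have e : (fun h : R => h^-1 *: (((fun t : R => phi (x + t *: E i)) \o shift s) (h *: 1)
      - phi (x + s *: E i))) = (fun h => dquot i phi h (x + s *: E i)).
    apply/funext => h; rewrite /dquot /= -addrA -scalerDl [s + h]addrC.
    by rewrite -[h *: 1]/(h * 1) mulr1.
  by rewrite /partial /derive dquotE -e.
have cl : continuous (fun t : R => phi (x + t *: E i)).
  by move=> s; apply: differentiable_continuous; apply/derivable1_diffP; have [] := dline s.
have key a b : a <= b -> `|phi (x + b *: E i) - phi (x + a *: E i)| <= (\sum_i `|L i|) * `|b - a|.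
  move=> ab; have [c _ ->] := @MVT_segment _ _ _ _ _ ab (fun s _ => dline s) (continuous_subspaceT cl).
  rewrite normrM ler_wpM2r// (le_trans (LP i _))// (le_trans (ler_norm _))//.
  by rewrite (bigD1 i)//= lerDl sumr_ge0.
have [t0|t0] := leP 0 t.
  by have := key _ _ t0; rewrite scale0r addr0 subr0.
by have := key _ _ (ltW t0); rewrite scale0r addr0 sub0r normrN distrC.
Qed.

(** Boundedness is kept next to the Lipschitz constant so that products stay in the class; on a
    bounded [Omega] it follows from the Lipschitz bound. *)
Definition lip_bounded Omega (c : 'rV[R]_n -> R) := exists L M : R,
  (forall x y, Omega x -> Omega y -> `|c x - c y| <= L * `|x - y|) /\
  (forall x, Omega x -> `|c x| <= M).

Lemma lipschitz_lip_bounded Omega (c : 'rV[R]_n -> R) : bounded_set Omega ->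
  [lipschitz c x | x in Omega] -> lip_bounded Omega c.
Proof.
move=> bO cL.
have [L [L0 LP]] : exists L : R, 0 <= L /\
    forall x y, Omega x -> Omega y -> `|c x - c y| <= L * `|x - y|.
  have [M [_ MP]] := cL.
  exists (`|M| + 1); split; first by rewrite addr_ge0.
  have M1 : M < `|M| + 1 by rewrite ltr_pwDr// ler_norm.
  by move=> x y Ox Oy; have := MP _ M1 (x, y); apply.
have [Oe|] := pselect (exists x0, Omega x0); last first.
  by move=> Oe; exists 0, 0; split => x; [move=> y Ox|move=> Ox]; case: Oe; exists x.
have [x0 Ox0] := Oe; have [M [_ bM]] := bO.
have M1 : M < `|M| + 1 by rewrite ltr_pwDr// ler_norm.
exists L, (`|c x0| + L * ((`|M| + 1) + (`|M| + 1))); split=> // x Ox.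
rewrite -[c x](subrK (c x0)) addrC (le_trans (ler_normD _ _))// lerD2l.
rewrite (le_trans (LP _ _ Ox Ox0))// ler_wpM2l// (le_trans (ler_normB _ _))//.
by rewrite lerD//; exact: (bM _ M1).
Qed.

Lemma continuous_lip_at Omega (c : 'rV[R]_n -> R) x : open Omega -> lip_bounded Omega c ->
  Omega x -> {for x, continuous c}.
Proof.
move=> oO [L [M [LP _]]] Ox.
apply/(@cvgrPdist_lt _ _ _ (nbhs x) (nbhs_filter x)) => e e0.
have nO : nbhs x Omega by apply: open_nbhs_nbhs; split.
have L1 : 0 < `|L| + 1 by rewrite ltr_wpDl.
have dL : 0 < e / (`|L| + 1) by rewrite divr_gt0.
have H : \forall y \near x, `|x - y| < e / (`|L| + 1).
  by have := @cvg_id _ (nbhs x); move/(@cvgrPdist_lt _ _ _ (nbhs x) (nbhs_filter x)) => /(_ _ dL).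
near=> y; rewrite (@le_lt_trans _ _ ((`|L| + 1) * `|x - y|))//.
  rewrite (le_trans (LP _ _ Ox _))//; first by near: y.
  by rewrite ler_wpM2r// (le_trans (ler_norm L))// lerDl.
by rewrite mulrC -ltr_pdivlMr//; near: y.
Unshelve. all: by end_near. Qed.

Section coefficient_times_test.
Variables (Omega A : set 'rV[R]_n) (c phi : 'rV[R]_n -> R).
Hypotheses (oO : open Omega) (cb : lip_bounded Omega c) (AO : A `<=` Omega)
  (tphi : test_function A phi).

Lemma coef_test_continuous : continuous (fun x => c x * phi x).
Proof.
move=> x; have [Ox|Ox] := pselect (Omega x).
  have cc : c @ x --> c x := continuous_lip_at oO cb Ox.
  have cp : phi @ x --> phi x by exact: (test_continuous tphi).
  exact: (cvgM cc cp).
have nx : ~ closure [set x | phi x != 0] x.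
  by have [_ _ sA] := tphi; move/sA/AO.
have phi0 := test_near0 tphi nx.
have e : c x * phi x = 0 by rewrite (nbhs_singleton phi0) mulr0.
change ((fun y => c y * phi y) @ x --> c x * phi x); rewrite e.
apply: cvg_trans (@cst_continuous _ _ (0 : R) x).
apply: (@near_eq_cvg _ _ (nbhs x) (nbhs_filter x)).
by apply: filterS phi0 => y ->; rewrite mulr0.
Qed.

(** Outside [Omega] nothing is known about [c], but [phi] vanishes there. The increment is estimated
    according to which endpoints lie in [Omega]; the segment between them may leave [Omega], which
    is harmless because the Lipschitz bound for [c] holds between any two points of [Omega]. *)
Lemma coef_test_line : exists L : R,
  forall i x t, `|c (x + t *: E i) * phi (x + t *: E i) - c x * phi x| <= L * `|t|.
Proof.
have [L [M [LP MP]]] := cb; have [K KP] := test_line tphi; have [N NP] := test_bounded tphi.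
have K0 (i : 'I_n) : 0 <= K by have := KP i 0 1; rewrite normr1 mulr1; exact: le_trans.
have phi0 x : ~ Omega x -> phi x = 0 by move=> Ox; apply: (test_out tphi) => /AO.
exists (`|M| * K + `|L| * N) => i x t.
have N0 : 0 <= N by apply: le_trans (NP 0).
have [K0' Kt] := (K0 i, KP i x t).
set y := x + t *: E i in Kt *.
have yx : `|y - x| = `|t| by rewrite /y addrC addKr normrZ norm_delta_rV mulr1.
have [Oy|Oy] := pselect (Omega y); last first.
  rewrite (phi0 y Oy) mulr0 sub0r normrN.
  have [Ox|Ox] := pselect (Omega x); last first.
    by rewrite (phi0 x Ox) mulr0 normr0 !mulr_ge0// addr_ge0// mulr_ge0.
  rewrite (phi0 y Oy) sub0r normrN in Kt.
  rewrite normrM mulrDl (@le_trans _ _ (`|M| * (K * `|t|)))//.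
    by rewrite ler_pM// (le_trans (MP _ Ox))// ler_norm.
  by rewrite mulrA lerDl !mulr_ge0.
have -> : c y * phi y - c x * phi x = c y * (phi y - phi x) + (c y - c x) * phi x by ring.
rewrite (le_trans (ler_normD _ _))// [leRHS]mulrDl lerD//.
  by rewrite normrM -mulrA ler_pM// (le_trans (MP _ Oy))// ler_norm.
have [Ox|Ox] := pselect (Omega x); last by rewrite (phi0 x Ox) mulr0 normr0 !mulr_ge0.
rewrite normrM mulrAC ler_pM// -yx (le_trans (LP _ _ Oy Ox))// ler_wpM2r//.
exact: ler_norm.
Qed.

Lemma coef_test_bounded_supp : bounded_set [set x | c x * phi x != 0].
Proof.
apply: bounded_setS (test_supp_bounded tphi).
by move=> x /=; rewrite mulf_eq0 negb_or => /andP[].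
Qed.

End coefficient_times_test.

(** A smooth minorant of the indicator of the box from [a] to [b]: at a point inside, each factor
    [flat 0] is exp(-1/(k s)) with s > 0, which tends to 1 as [k] grows, while outside the open box
    some factor is 0. *)
Definition box_test (a b : 'rV[R]_n) (k : nat) x : R :=
  \prod_i (flat 0 (k%:R * x ord0 i + - (k%:R * a ord0 i)) *
           flat 0 (- k%:R * x ord0 i + k%:R * b ord0 i)).

Definition obox (a b : 'rV[R]_n) := [set x : 'rV[R]_n | forall i, a ord0 i < x ord0 i < b ord0 i].
Definition cbox (a b : 'rV[R]_n) := [set x : 'rV[R]_n | forall i, a ord0 i <= x ord0 i <= b ord0 i].

Lemma closed_cbox a b : closed (cbox a b).
Proof.
have cl i : closed [set x : 'rV[R]_n | a ord0 i <= x ord0 i <= b ord0 i].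
  apply: (@preimage_closed _ _ (fun x : 'rV[R]_n => x ord0 i) [set t | a ord0 i <= t <= b ord0 i]).
    by move=> x _; exact: coord_continuous.
  have := @interval_closed R (BLeft (a ord0 i)) (BRight (b ord0 i)).
  rewrite (_ : [set` Interval _ _] = [set t | a ord0 i <= t <= b ord0 i]); first exact.
  by apply/seteqP; split => t /=; rewrite in_itv.
rewrite (_ : cbox a b = \bigcap_i [set x : 'rV[R]_n | a ord0 i <= x ord0 i <= b ord0 i]).
  by apply: closed_bigI => i _; exact: cl.
by apply/seteqP; split => x xab i; [move=> _; exact: xab|exact: (xab i Logic.I)].
Qed.

Lemma compact_cbox a b : compact (cbox a b).
Proof.
apply: bounded_closed_compact; last exact: closed_cbox.
exists (`|a| + `|b|); split => // M MM x xab /=.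
rewrite (le_trans _ (ltW MM))// -[leLHS]/(mx_norm _) mx_normrE.
apply: bigmax_le => [|[i j] _]; first by rewrite addr_ge0.
rewrite (ord1 i)/= ler_norml; have /andP[ax xb] := xab j.
have := coord_le_norm a j; have := coord_le_norm b j.
have := ler_norm (b ord0 j).
have := normr_ge0 a; have := normr_ge0 b.
have := ler_norm (- a ord0 j); rewrite normrN.
by move=> *; apply/andP; split; lra.
Qed.

Lemma obox_cbox a b : obox a b `<=` cbox a b.
Proof. by move=> x xab i; have /andP[/ltW -> /ltW ->] := xab i. Qed.

Lemma box_test_out a b k x : ~ obox a b x -> box_test a b k x = 0.
Proof.
move=> /existsNP[i /negP]; rewrite negb_and -!leNgt => H.
apply/eqP; rewrite prodf_seq_eq0; apply/hasP; exists i; rewrite ?mem_index_enum//=.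
rewrite mulf_eq0; case/orP: H => H; apply/orP; [left|right]; apply/eqP/flat_eq0.
  by rewrite subr_le0 ler_wpM2l.
by rewrite mulNr addrC subr_le0 ler_wpM2l.
Qed.

Lemma box_test_ge0 a b k x : 0 <= box_test a b k x.
Proof. by apply: prodr_ge0 => i _; rewrite mulr_ge0 ?flat_ge0. Qed.

Lemma box_test_le1 a b k x : box_test a b k x <= 1.
Proof.
have -> : 1 = \prod_(i < n) (1 : R) by rewrite big1_eq.
rewrite /box_test.
apply: ler_prod => i _; rewrite mulr_ge0 ?flat_ge0//= mulr_ile1 ?flat_ge0//; exact: flat_le1.
Qed.

Lemma box_testP a b k A : cbox a b `<=` A -> test_function A (box_test a b k).
Proof.
move=> abA.
have sub : closure [set x | box_test a b k x != 0] `<=` cbox a b.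
  rewrite [X in _ `<=` X](closure_id _).1; last exact: closed_cbox.
  apply: closure_subset => x /= xk; apply: contrapT => nx.
  by move/eqP: xk; apply; apply: box_test_out => /obox_cbox.
split=> [l||].
- apply: Ck_prod => i; apply: CkM; exact: Ck_flat.
- by apply: subclosed_compact sub; [exact: closed_closure|exact: compact_cbox].
- exact: subset_trans sub abA.
Qed.

Lemma flat0_cvg1 (s : R) : 0 < s -> (fun k : nat => flat 0 (k%:R * s)) @ \oo --> (1 : R).
Proof.
move=> s0; have h : (fun k : nat => expR (- (s^-1 * k%:R^-1))) @ \oo --> (1 : R).
  rewrite [X in _ --> X](_ : 1 = expR (- (s^-1 * 0))); last by rewrite mulr0 oppr0 expR0.
  apply: continuous_cvg; first exact: continuous_expR.
  apply: cvgN; apply: cvgM.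
    exact: cvg_cst.
  have k0 : \forall k \near \oo, 0 < (k%:R : R).
    by exists 1%N => // k /= k1; rewrite ltr0n.
  by have := (gtr0_cvgV0 k0).2 cvgr_idn; apply.
apply: cvg_trans h; apply: near_eq_cvg; exists 1%N => // k /= k0.
by rewrite /flat mulr_gt0 ?ltr0n// expr0 mul1r invfM mulrC.
Qed.

Lemma cvg_prodr (I : Type) (r : seq I) (F : I -> nat -> R) (l : I -> R) :
  (forall i, F i k @[k --> \oo] --> l i) ->
  (fun k => \prod_(i <- r) F i k) @ \oo --> \prod_(i <- r) l i.
Proof.
move=> Fl; elim: r => [|i r IH].
  rewrite big_nil; under eq_fun do rewrite big_nil; exact: cvg_cst.
by rewrite big_cons; under eq_fun do rewrite big_cons; apply: cvgM.
Qed.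

Lemma box_test_cvg a b x : (fun k => box_test a b k x) @ \oo --> (\1_(obox a b) x : R).
Proof.
rewrite indicE; have [/[!inE] xab|/negP] := boolP (x \in obox a b); last first.
  rewrite inE => nx; rewrite (_ : (fun _ => _) = cst 0); first exact: cvg_cst.
  by apply/funext => k; rewrite box_test_out.
have -> : true%:R = \prod_(i < n) (1 : R) by rewrite big1_eq.
rewrite /box_test.
apply: cvg_prodr => i.
rewrite -[X in _ --> X]mulr1; have /andP[ax xb] := xab i.
apply: cvgM.
  under eq_fun do rewrite -mulrBr.
  by apply: flat0_cvg1; rewrite subr_gt0.
under eq_fun do rewrite mulNr addrC -mulrBr.
by apply: flat0_cvg1; rewrite subr_gt0.
Qed.

End test_functions.

(** * The fundamental lemma of the calculus of variations *)

Section fundamental_lemma.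
Context {R : realType} {n : nat}.
Local Notation mu := (lebesgue_rV R n).
Local Notation intg f := (mu.-integrable setT (EFin \o f)).
Implicit Types (f g phi psi : 'rV[R]_n -> R) (x y : 'rV[R]_n) (A B S : set 'rV[R]_n).

Lemma Rintegral_dominated (f_ : nat -> 'rV[R]_n -> R) f g :
  (forall k, measurable_fun setT (f_ k)) -> measurable_fun setT f ->
  {ae mu, forall x, f_ ^~ x @ \oo --> f x} -> intg g ->
  (forall k x, `|f_ k x| <= g x) ->
  \int[mu]_x f_ k x @[k --> \oo] --> \int[mu]_x f x.
Proof.
move=> mf_ mf ff ig fg.
have [] := @dominated_convergence _ _ R mu setT measurableT
  (fun k => EFin \o f_ k) (EFin \o f) (EFin \o g).
- by move=> k; apply/measurable_EFinP.
- exact/measurable_EFinP.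
- by apply: ae_imp ff => x fx _; apply: cvg_EFin; [exact: nearW|exact: fx].
- exact: ig.
- by apply: aeW => x k _; rewrite lee_fin.
- move=> fi _ cI.
  have ff' : (\int[mu]_x (EFin \o f) x)%E \is a fin_num by exact: integrable_fin_num.
  by apply: fine_cvg; rewrite fineK.
Qed.

Lemma intgM_bounded f g (M : R) : intg f -> measurable_fun setT g ->
  (forall x, `|g x| <= M) -> intg (fun x => f x * g x).
Proof.
move=> fi mg gM; apply: (intg_le _ (intgZ M fi)).
  by apply: measurable_funM => //; exact: intg_measurable.
by move=> x; rewrite !normrM mulrC ler_wpM2r// (le_trans (gM x))// ler_norm.
Qed.

Lemma intgM_indic f S : intg f -> measurable S -> intg (fun x => f x * \1_S x).
Proof.
move=> fi mS; apply: (intgM_bounded (M := 1) fi); first exact: measurable_indic.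
by move=> x; rewrite indicE; case: (_ \in _); rewrite ?normr1 ?normr0.
Qed.

Definition rat_box (q : 'rV[rat]_n * 'rV[rat]_n) : 'rV[R]_n * 'rV[R]_n :=
  (map_mx ratr q.1, map_mx ratr q.2).

Lemma open_bigcup_obox A : open A ->
  A = \bigcup_(q in [set q | cbox (rat_box q).1 (rat_box q).2 `<=` A])
      obox (rat_box q).1 (rat_box q).2.
Proof.
move=> oA; apply/seteqP; split => [x Ax|x [q /= qA] /obox_cbox/qA//].
have [e e0 eA] := open_box_rV_sub oA Ax.
have /choice[p pP] : forall i, exists p : rat, x ord0 i - e < ratr p < x ord0 i.
  move=> i; have /rat_in_itvoo[p] : x ord0 i - e < x ord0 i by rewrite ltrBlDr ltrDl.
  by rewrite in_itv/=; exists p.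
have /choice[q qP] : forall i, exists q : rat, x ord0 i < ratr q < x ord0 i + e.
  move=> i; have /rat_in_itvoo[q] : x ord0 i < x ord0 i + e by rewrite ltrDl.
  by rewrite in_itv/=; exists q.
exists (\row_i p i, \row_i q i) => [y/= yB|i]; last first.
  rewrite /= !mxE; have /andP[_ ->] := pP i; by have /andP[-> _] := qP i.
apply: eA => i; have := yB i; rewrite /= !mxE.
have /andP[p1 p2] := pP i; have /andP[q1 q2] := qP i.
move=> /andP[y1 y2]; rewrite ltr_norml; apply/andP; split; lra.
Qed.

Definition oboxes : set (set 'rV[R]_n) := [set obox ab.1 ab.2 | ab in [set: 'rV[R]_n * 'rV[R]_n]].

Lemma measurable_obox (a b : 'rV[R]_n) : measurable (obox a b).
Proof.
rewrite (_ : obox a b = box_rV (fun i => `]a ord0 i, b ord0 i[%classic)).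
  by apply: measurable_box_rV => i; exact: measurable_itv.
by apply/seteqP; split => x xab i; have := xab i; rewrite /= in_itv.
Qed.

Lemma oboxI (a b c d : 'rV[R]_n) : obox a b `&` obox c d =
  obox (\row_i Num.max (a ord0 i) (c ord0 i)) (\row_i Num.min (b ord0 i) (d ord0 i)).
Proof.
apply/seteqP; split => [x [xab xcd] i|x H].
  have /andP[h1 h2] := xab i; have /andP[h3 h4] := xcd i.
  by rewrite !mxE gt_max lt_min h1 h2 h3 h4.
split => i; have := H i; rewrite !mxE gt_max lt_min.
  by move=> /andP[/andP[-> _] /andP[-> _]].
by move=> /andP[/andP[_ ->] /andP[_ ->]].
Qed.

Lemma measurable_oboxE : @measurable _ 'rV[R]_n `<=` <<s oboxes >>.
Proof.
apply: smallest_sub; first exact: smallest_sigma_algebra.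
move=> U oU; rewrite (open_bigcup_obox oU).
pose T : measurableType _ := g_sigma_algebraType oboxes.
rewrite -[<<s oboxes >>]/(@measurable _ T).
rewrite bigcup_mkcond; apply: countable_bigcupT_measurable => [|q].
  exact: countableP.
case: ifP => _; last exact: measurable0.
by apply: sub_sigma_algebra; exists (rat_box q).
Qed.

(** The sets over which [f] has integral zero form a Dynkin system: differences by linearity,
    increasing unions by dominated convergence. It contains the open boxes, which are stable under
    intersection and generate the Borel sets. *)
Lemma integral_oboxes_ae0 f : intg f ->
  (forall a b, \int[mu]_x (f x * \1_(obox a b) x) = 0) -> {ae mu, forall x, f x = 0}.
Proof.
move=> fi f0.
pose H S := measurable S /\ \int[mu]_x (f x * \1_S x) = 0.
have mS S : measurable S -> intg (fun x => f x * \1_S x) by exact: intgM_indic.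
have cvgS (F : nat -> set 'rV[R]_n) : nondecreasing_seq F -> (forall k, measurable (F k)) ->
    (fun k => \int[mu]_x (f x * \1_(F k) x)) @ \oo --> \int[mu]_x (f x * \1_(\bigcup_k F k) x).
  move=> ndF mF; apply: (@Rintegral_dominated _ _ (fun x => `|f x|)).
  - by move=> k; exact: intg_measurable (mS _ (mF k)).
  - by apply: intg_measurable; apply: mS; exact: bigcupT_measurable.
  - apply: aeW => x; apply: cvgM; first exact: cvg_cst.
    apply: cvg_near_cst; have [[k _ Fkx]|nx] := pselect ((\bigcup_k F k) x).
      exists k => // l /= kl; rewrite !indicE !mem_set//; first by exists k.
      by move: (ndF _ _ kl) => /subsetPset; apply.
    apply: nearW => k; rewrite !indicE !memNset//.
    by apply: contra_not nx => ?; exists k.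
  - exact: integrable_norm.
  - move=> k x; rewrite normrM ler_piMr// indicE.
    by case: (_ \in _); rewrite ?normr1 ?normr0.
have cv0 (F : nat -> set 'rV[R]_n) : nondecreasing_seq F -> (forall k, H (F k)) ->
    H (\bigcup_k F k).
  move=> ndF HF; split; first by apply: bigcupT_measurable => k; case: (HF k).
  have mF k : measurable (F k) by case: (HF k).
  have := cvgS F ndF mF.
  rewrite (_ : (fun k => _) = cst 0); last by apply/funext => k; case: (HF k).
  by move=> /(cvg_unique _ (cvg_cst 0)) <-.
have HG : oboxes `<=` H.
  by move=> _ [[a b] _ <-]; split; [exact: measurable_obox|exact: f0].
have lsH : lambda_system setT H.
  split => //.
  - have -> : [set: 'rV[R]_n] = \bigcup_k obox (const_mx (- k%:R)) (const_mx k%:R).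
      apply/seteqP; split => // x _.
      exists (Num.truncn `|x|).+1 => // i; rewrite !mxE -ltr_norml.
      by rewrite (le_lt_trans (coord_le_norm x i))// truncnS_gt.
    apply: cv0 => [k l kl|k].
      apply/subsetPset => x xk i; have := xk i; rewrite !mxE -!ltr_norml.
      by move=> /lt_le_trans; apply; rewrite ler_nat.
    by split; [exact: measurable_obox|exact: f0].
  - move=> S B BS [mSS S0] [mB B0]; split; first exact: measurableD.
    rewrite (_ : (fun x => _) = (fun x => f x * \1_S x - f x * \1_B x)).
      by rewrite RintegralB// ?S0 ?B0 ?subrr//; exact: mS.
    apply/funext => x; rewrite -mulrBr; congr (_ * _).
    rewrite !indicE in_setD; have [xB|xB] := boolP (x \in B).
      by rewrite andbF (_ : x \in S) ?subrr//; move: xB; rewrite !inE; exact: BS.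
    by rewrite andbT subr0.
have oboxesI : setI_closed oboxes.
  move=> _ _ [[a b] _ <-] [[c d] _ <-]; rewrite oboxI/=.
  by eexists (_, _).
have sub : @measurable _ 'rV[R]_n `<=` H.
  move=> S /measurable_oboxE; apply: (lambda_system_subset oboxesI lsH HG).
  by move=> X _.
have := @integral_ae_eq _ _ _ mu setT measurableT (cst 0%E) (EFin \o f) fi.
move=> /(_ (measurable_cst _)) K.
have K2 : ae_eq mu setT (EFin \o f) (cst 0%E).
  apply: K => S _ mSS; rewrite integral0.
  have [_] := sub S mSS; rewrite /Rintegral.
  rewrite (_ : (fun x => _) = (EFin \o f) \_ S); last first.
    apply/funext => x; rewrite patchE indicE; case: (x \in S); rewrite ?mulr1 ?mulr0//.
  rewrite -integral_mkcond => E0; rewrite -[LHS]fineK ?E0//.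
  by apply: integrable_fin_num => //; exact: (integrableS measurableT).
by apply: ae_imp K2 => x H0; have [] := H0 Logic.I.
Qed.

(** For a closed box inside [A], the functions [box_test] converge boundedly to the indicator of the
    open box, so [f] has integral zero over it. Hence [f] vanishes almost everywhere on each of the
    countably many rational boxes that cover [A]. *)
Lemma test_integral0_ae0 A f : open A -> intg f ->
  (forall phi, test_function A phi -> \int[mu]_x (f x * phi x) = 0) ->
  {ae mu, forall x, A x -> f x = 0}.
Proof.
move=> oA fi fphi.
have box0 a b : cbox a b `<=` A -> \int[mu]_x (f x * \1_(obox a b) x) = 0.
  move=> abA.
  have := @Rintegral_dominated (fun k x => f x * box_test a b k x)
    (fun x => f x * \1_(obox a b) x) (fun x => `|f x|).
  have tb k : test_function A (box_test a b k) by exact: box_testP.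
  have -> : (fun k => \int[mu]_x (f x * box_test a b k x)) = cst 0.
    by apply/funext => k; exact: fphi.
  move=> H; suff C : cst 0 @ \oo --> \int[mu]_x (f x * \1_(obox a b) x).
    exact: (cvg_unique _ C (cvg_cst 0)).
  apply: H.
  - by move=> k; apply: measurable_funM; [exact: intg_measurable|exact: test_measurable (tb k)].
  - by apply: intg_measurable; apply: intgM_indic => //; exact: measurable_obox.
  - by apply: aeW => x; apply: cvgM; [exact: cvg_cst|exact: box_test_cvg].
  - exact: integrable_norm.
  - move=> k x; rewrite normrM ler_piMr// ger0_norm ?box_test_ge0//.
    exact: box_test_le1.
have Q0 (q : 'rV[rat]_n * 'rV[rat]_n) : cbox (rat_box q).1 (rat_box q).2 `<=` A ->
    {ae mu, forall x, f x * \1_(obox (rat_box q).1 (rat_box q).2) x = 0}.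
  move=> qA; apply: integral_oboxes_ae0.
    by apply: intgM_indic => //; exact: measurable_obox.
  move=> a b; rewrite (_ : (fun x => _) =
      (fun x => f x * \1_(obox (rat_box q).1 (rat_box q).2 `&` obox a b) x)); last first.
    by apply/funext => x; rewrite -mulrA indicI.
  rewrite oboxI; apply: box0 => x H; apply: qA => i; have := H i.
  by rewrite !mxE ge_max le_min => /andP[/andP[-> _] /andP[-> _]].
have : {ae mu, forall x, forall q : 'rV[rat]_n * 'rV[rat]_n,
    cbox (rat_box q).1 (rat_box q).2 `<=` A ->
    f x * \1_(obox (rat_box q).1 (rat_box q).2) x = 0}.
  apply: ae_forall_countType => q.
  have [qA|qA] := pselect (cbox (rat_box q).1 (rat_box q).2 `<=` A); last by apply: aeW => x /qA.
  by apply: ae_imp (Q0 q qA) => x.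
apply: ae_imp => x H; rewrite {1}(open_bigcup_obox oA) => -[q /= qA xq].
by have := H q qA; rewrite indicE mem_set// mulr1.
Qed.

End fundamental_lemma.

(** * Distributional derivatives along a vector field *)

Section weak_derivative.
Context {R : realType} {n : nat}.
Local Notation mu := (lebesgue_rV R n).
Local Notation E i := (delta_mx ord0 i : 'rV[R]_n).
Local Notation intg f := (mu.-integrable setT (EFin \o f)).
Implicit Types (f g h u phi psi : 'rV[R]_n -> R) (M : R) (x y : 'rV[R]_n) (A B Omega : set 'rV[R]_n).
Implicit Types Y : 'rV[R]_n -> 'rV[R]_n.

Lemma Rintegral_ae f g : measurable_fun setT f -> measurable_fun setT g ->
  {ae mu, forall x, f x = g x} -> \int[mu]_x f x = \int[mu]_x g x.
Proof.
move=> mf mg fg; congr fine; apply: ae_eq_integral => //; try exact/measurable_EFinP.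
by apply: ae_imp fg => x -> _.
Qed.

Lemma intg_sum (I : Type) (r : seq I) (F : I -> 'rV[R]_n -> R) :
  (forall i, intg (F i)) -> intg (fun x => \sum_(i <- r) F i x).
Proof.
move=> Fi; elim: r => [|i r IH].
  by under eq_fun do rewrite big_nil; exact: integrable0.
by under eq_fun do rewrite big_cons; exact: intgD.
Qed.

Lemma Rintegral_sum (I : Type) (r : seq I) (F : I -> 'rV[R]_n -> R) :
  (forall i, intg (F i)) ->
  \int[mu]_x (\sum_(i <- r) F i x) = \sum_(i <- r) \int[mu]_x F i x.
Proof.
move=> Fi; elim: r => [|i r IH].
  rewrite big_nil; under eq_Rintegral do rewrite big_nil.
  by rewrite /Rintegral integral0.
rewrite big_cons; under eq_Rintegral do rewrite big_cons.
by rewrite RintegralD ?IH//; exact: intg_sum.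
Qed.

Lemma measurable_sum_rV (I : Type) (r : seq I) (F : I -> 'rV[R]_n -> R) :
  (forall i, measurable_fun setT (F i)) -> measurable_fun setT (fun x => \sum_(i <- r) F i x).
Proof.
move=> mF; elim: r => [|i r IH].
  by under eq_fun do rewrite big_nil; exact: measurable_cst.
by under eq_fun do rewrite big_cons; exact: measurable_funD.
Qed.

Lemma bounded_sum (I : Type) (r : seq I) (F : I -> 'rV[R]_n -> R) :
  (forall i, exists M, forall x, `|F i x| <= M) ->
  exists M, forall x, `|\sum_(i <- r) F i x| <= M.
Proof.
move=> bF; elim: r => [|i r [M MP]]; first by exists 0 => x; rewrite big_nil normr0.
have [N NP] := bF i; exists (N + M) => x; rewrite big_cons.
by rewrite (le_trans (ler_normD _ _))// lerD.
Qed.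

Lemma patchM0 A u h x : (~ A x -> h x = 0) -> (u \_ A) x * h x = u x * h x.
Proof.
move=> h0; rewrite patchE; have [//|/negP] := boolP (x \in A).
by rewrite inE => /h0 ->; rewrite !mulr0.
Qed.

Lemma intg_patchM A u h M : intg (u \_ A) -> measurable_fun setT h ->
  (forall x, `|h x| <= M) -> (forall x, ~ A x -> h x = 0) -> intg (fun x => u x * h x).
Proof.
move=> ui mh hM h0; have -> : (fun x => u x * h x) = (fun x => (u \_ A) x * h x).
  by apply/funext => x; rewrite patchM0//; exact: h0.
exact: intgM_bounded mh hM.
Qed.

Definition vfield Omega Y := forall i, lip_bounded Omega (fun x => Y x ord0 i).

(** The divergence of the field [phi Y], that is, minus the formal adjoint of the derivation along
    [Y], applied to [phi]. *)
Definition adj Y phi x := \sum_(i < n) partial i (fun y => Y y ord0 i * phi y) x.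

Definition vgrad Y phi x := \sum_(i < n) Y x ord0 i * partial i phi x.

(** Integrals are real and over the whole space: test functions and their [adj] vanish off [A], so
    restriction to [A] is implicit. [is_distr_derivP] relates this to the extended-real
    definition. *)
Definition wderiv Y A u g := forall phi, test_function A phi ->
  \int[mu]_x (g x * phi x) = - \int[mu]_x (u x * adj Y phi x).

Section fixed_domain.
Variables (Omega A : set 'rV[R]_n) (Y : 'rV[R]_n -> 'rV[R]_n).
Hypotheses (oO : open Omega) (vY : vfield Omega Y) (AO : A `<=` Omega).

Lemma coef_test_bounded c phi : lip_bounded Omega c -> test_function A phi ->
  exists M, forall x, `|c x * phi x| <= M.
Proof.
move=> [L [M [_ MP]]] tphi; have [N NP] := test_bounded tphi.
exists (`|M| * `|N|) => x; have [Ox|Ox] := pselect (Omega x); last first.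
  by rewrite (test_out tphi) ?mulr0 ?normr0 ?mulr_ge0// => /AO.
rewrite normrM ler_pM// ?(le_trans (MP _ Ox)) ?ler_norm//.
by rewrite (le_trans (NP _)) ?ler_norm.
Qed.

Lemma adj_measurable phi : test_function A phi -> measurable_fun setT (adj Y phi).
Proof.
move=> tphi; apply: measurable_sum_rV => i; apply: measurable_partial.
exact: (coef_test_continuous oO (vY i) AO tphi).
Qed.

Lemma adj_bounded phi : test_function A phi -> exists M, forall x, `|adj Y phi x| <= M.
Proof.
move=> tphi; apply: bounded_sum => i.
have [L LP] := coef_test_line (vY i) AO tphi.
by exists (L + `|point : R|) => x; apply: partial_le => y t; exact: LP.
Qed.

Lemma adj_out phi x : test_function A phi -> ~ A x -> adj Y phi x = 0.
Proof.
move=> tphi Ax; apply: big1 => i _; apply: partial_near0.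
have nx : ~ closure [set x | phi x != 0] x by have [_ _ sA] := tphi; move/sA.
by have := test_near0 tphi nx; apply: filterS => y ->; rewrite mulr0.
Qed.

Lemma vgrad_continuous phi : test_function A phi -> continuous (vgrad Y phi).
Proof.
move=> tphi; rewrite /vgrad; elim: (index_enum _) => [|i r IH].
  by under eq_fun do rewrite big_nil; exact: cst_continuous.
under eq_fun do rewrite big_cons; apply: continuousD_rV => //.
exact: (coef_test_continuous oO (vY i) AO (test_partial i tphi)).
Qed.

Lemma vgrad_measurable phi : test_function A phi -> measurable_fun setT (vgrad Y phi).
Proof. by move/vgrad_continuous; exact: continuous_measurable_rV. Qed.

Lemma vgrad_bounded phi : test_function A phi -> exists M, forall x, `|vgrad Y phi x| <= M.
Proof.
move=> tphi; apply: bounded_sum => i.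
exact: (coef_test_bounded (vY i) (test_partial i tphi)).
Qed.

Lemma vgrad_out phi x : test_function A phi -> ~ A x -> vgrad Y phi x = 0.
Proof.
move=> tphi Ax; apply: big1 => i _; rewrite (test_out (test_partial i tphi)) ?mulr0//.
Qed.

Lemma intg_test u phi : test_function A phi -> intg (u \_ A) -> intg (fun x => u x * phi x).
Proof.
move=> tphi ui; have [M MP] := test_bounded tphi.
apply: intg_patchM ui (test_measurable tphi) MP _ => x; exact: test_out.
Qed.

Lemma intg_adj u phi : test_function A phi -> intg (u \_ A) -> intg (fun x => u x * adj Y phi x).
Proof.
move=> tphi ui; have [M MP] := adj_bounded tphi.
apply: intg_patchM ui (adj_measurable tphi) MP _ => x; exact: adj_out.
Qed.

Lemma is_distr_derivP u g : intg (u \_ A) -> intg (g \_ A) ->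
  is_distr_deriv Y A u g <-> wderiv Y A u g.
Proof.
move=> ui gi.
have e1 phi h : (forall x, ~ A x -> h x = 0) -> (\int[mu]_(x in A) (phi x * h x)%:E =
    \int[mu]_x (phi x * h x)%:E)%E.
  move=> h0; rewrite integral_mkcond; apply: eq_integral => x _.
  rewrite patchE; have [//|/negP] := boolP (x \in A).
  by rewrite inE => /h0 ->; rewrite mulr0.
split => H phi tphi; have := H phi tphi.
  rewrite (e1 g)//; last by move=> x; exact: test_out.
  rewrite (e1 u (adj Y phi))//; last by move=> x; exact: adj_out.
  by move=> K; rewrite /Rintegral K fineN.
rewrite (e1 g)//; last by move=> x; exact: test_out.
rewrite (e1 u (adj Y phi))//; last by move=> x; exact: adj_out.
move=> K; rewrite -[LHS]fineK; last by apply: integrable_fin_num => //; exact: intg_test.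
rewrite -[X in (- X)%E]fineK; last by apply: integrable_fin_num => //; exact: intg_adj.
by rewrite -EFinN; congr EFin; exact: K.
Qed.

Lemma wderivD u g u' g' : intg (u \_ A) -> intg (g \_ A) -> intg (u' \_ A) -> intg (g' \_ A) ->
  wderiv Y A u g -> wderiv Y A u' g' ->
  wderiv Y A (fun x => u x + u' x) (fun x => g x + g' x).
Proof.
move=> ui gi ui' gi' H H' phi tphi.
under eq_Rintegral do rewrite mulrDl.
under [in RHS]eq_Rintegral do rewrite mulrDl.
rewrite !RintegralD//; try exact: intg_test; try exact: intg_adj.
by rewrite H// H'// opprD.
Qed.

Lemma wderivZ c u g : intg (u \_ A) -> intg (g \_ A) ->
  wderiv Y A u g -> wderiv Y A (fun x => c * u x) (fun x => c * g x).
Proof.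
move=> ui gi H phi tphi.
under eq_Rintegral do rewrite -mulrA.
under [in RHS]eq_Rintegral do rewrite -mulrA.
rewrite !RintegralZl//; try exact: intg_test; try exact: intg_adj.
by rewrite H// mulrN.
Qed.

(** This is the product rule at points where the components of [phi Y] are differentiable in their
    directions; these are almost all points, as the components are Lipschitz along lines. *)
Lemma adj_mul phi psi : test_function A phi -> (forall k, Ck k psi) ->
  {ae mu, forall x, adj Y (fun y => phi y * psi y) x = psi x * adj Y phi x + phi x * vgrad Y psi x}.
Proof.
move=> tphi Cpsi.
have : {ae mu, forall x, forall i, derivable (fun y => Y y ord0 i * phi y) x (E i)}.
  apply: ae_forall_countType => i; have [L LP] := coef_test_line (vY i) AO tphi.
  apply: (@lipschitz_line_derivable_ae _ _ i _ L) => [|x t]; last exact: LP.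
  exact: (coef_test_continuous oO (vY i) AO tphi).
apply: ae_imp => x dx; rewrite /adj /vgrad !mulr_sumr -big_split/=; apply: eq_bigr => i _.
have dpsi : derivable psi x (E i) by have [_ /(_ i)[]] := Cpsi 1%N.
have -> : (fun y => Y y ord0 i * (phi y * psi y)) = (fun y => Y y ord0 i * phi y) * psi.
  by apply/funext => y; rewrite mulrA.
rewrite /partial (deriveM (dx i) dpsi) addrC; congr (_ + _).
by rewrite -[LHS]/(_ * _); ring.
Qed.

Lemma wderiv_uniq u g g' : open A -> intg (g \_ A) -> intg (g' \_ A) ->
  wderiv Y A u g -> wderiv Y A u g' -> {ae mu, forall x, A x -> g x = g' x}.
Proof.
move=> oA gi gi' H H'.
have : {ae mu, forall x, A x -> (g \_ A) x - (g' \_ A) x = 0}.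
  apply: (@test_integral0_ae0 _ _ A (fun x => (g \_ A) x - (g' \_ A) x) oA); first exact: intgB.
  move=> phi tphi; have t0 x : ~ A x -> phi x = 0 by exact: test_out.
  have -> : (fun x => ((g \_ A) x - (g' \_ A) x) * phi x) =
      (fun x => g x * phi x - g' x * phi x).
    by apply/funext => x; rewrite mulrBl !patchM0//; exact: t0.
  rewrite RintegralB//; try exact: intg_test.
  by rewrite H// H'// subrr.
by apply: ae_imp => x H0 Ax; have := H0 Ax; rewrite !patchE !mem_set// => /eqP; rewrite subr_eq0 => /eqP.
Qed.

Lemma wderiv_ae u g u' g' : measurable A -> intg (u \_ A) -> intg (g \_ A) -> intg (u' \_ A) -> intg (g' \_ A) ->
  {ae mu, forall x, A x -> u x = u' x} -> {ae mu, forall x, A x -> g x = g' x} ->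
  wderiv Y A u g -> wderiv Y A u' g'.
Proof.
move=> mA ui gi ui' gi' uu gg H phi tphi.
have tA x : ~ A x -> phi x = 0 by exact: test_out.
have aA x : ~ A x -> adj Y phi x = 0 by exact: adj_out.
transitivity (\int[mu]_x (g x * phi x)).
  apply: Rintegral_ae; [exact: intg_measurable (intg_test tphi gi')|
    exact: intg_measurable (intg_test tphi gi)|].
  apply: ae_imp gg => x gx; have [Ax|/tA ->] := pselect (A x); last by rewrite !mulr0.
  by rewrite gx.
rewrite H//; congr (- _).
apply: Rintegral_ae; [exact: intg_measurable (intg_adj tphi ui)|
  exact: intg_measurable (intg_adj tphi ui')|].
apply: ae_imp uu => x ux; have [Ax|/aA ->] := pselect (A x); last by rewrite !mulr0.
by rewrite ux.
Qed.

End fixed_domain.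

Lemma wderiv_sub Y A B u g : B `<=` A -> wderiv Y A u g -> wderiv Y B u g.
Proof. by move=> BA H phi /(test_sub BA); exact: H. Qed.

(** Testing with [psi phi] splits [adj] by the product rule, and the part in which [psi] is
    differentiated joins the derivative. As [psi] has compact support in [A], [psi phi] is a test
    function on [A] even when [phi] lives on the larger [B]. *)
Lemma wderiv_leibniz Omega A B Y psi u g : open Omega -> vfield Omega Y ->
  A `<=` B -> B `<=` Omega -> test_function A psi ->
  intg (u \_ A) -> intg (g \_ A) -> wderiv Y A u g ->
  wderiv Y B (fun x => u x * psi x) (fun x => g x * psi x + u x * vgrad Y psi x).
Proof.
move=> oO vY AB BO tpsi ui gi H phi tphi.
have AO : A `<=` Omega := subset_trans AB BO.
have Cphi k : Ck k phi by case: tphi.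
have Cpsi k : Ck k psi by case: tpsi.
have tpp : test_function A (fun x => psi x * phi x) by exact: test_mul.
have [Mphi bphi] := test_bounded tphi; have [Mpsi bpsi] := test_bounded tpsi.
have [Mv bv] := vgrad_bounded vY AO tpsi.
have [Ma ba] := adj_bounded vY BO tphi.
have i1 : intg (fun x => g x * (psi x * phi x)) by exact: intg_test tpp gi.
have i2 : intg (fun x => u x * (vgrad Y psi x * phi x)).
  apply: (@intg_patchM A _ _ (`|Mv| * `|Mphi|)) => //.
  - by apply: measurable_funM; [exact: (vgrad_measurable oO vY AO)|exact: test_measurable tphi].
  - move=> x; rewrite normrM ler_pM//.
      by rewrite (le_trans (bv _)) ?ler_norm.
    by rewrite (le_trans (bphi _)) ?ler_norm.
  - by move=> x Ax; rewrite (vgrad_out Y tpsi)// mul0r.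
have i3 : intg (fun x => u x * adj Y (fun y => psi y * phi y) x) by exact: (intg_adj oO vY AO).
have i4 : intg (fun x => u x * (psi x * adj Y phi x)).
  apply: (@intg_patchM A _ _ (`|Mpsi| * `|Ma|)) => //.
  - by apply: measurable_funM; [exact: test_measurable tpsi|exact: (adj_measurable oO vY BO)].
  - move=> x; rewrite normrM ler_pM//.
      by rewrite (le_trans (bpsi _)) ?ler_norm.
    by rewrite (le_trans (ba _)) ?ler_norm.
  - by move=> x Ax; rewrite (test_out tpsi)// mul0r.
rewrite (_ : (fun x => _) = (fun x => g x * (psi x * phi x) + u x * (vgrad Y psi x * phi x))); last first.
  by apply/funext => x; ring.
rewrite RintegralD// H//.
rewrite [X in - X + _](_ : _ = \int[mu]_x (u x * (psi x * adj Y phi x)) + \int[mu]_x (u x * (vgrad Y psi x * phi x))).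
  rewrite opprD subrK; congr (- _); apply: eq_Rintegral => x _; ring.
rewrite -RintegralD//; apply: Rintegral_ae.
- exact: intg_measurable.
- by apply: intg_measurable; exact: intgD.
have := adj_mul oO vY BO tphi Cpsi.
apply: ae_imp => x; rewrite (_ : (fun y => phi y * psi y) = (fun y => psi y * phi y)); last first.
  by apply/funext => y; rewrite mulrC.
by move=> ->; ring.
Qed.

Lemma lip_bounded_coord Omega i : bounded_set Omega -> lip_bounded Omega (fun x => x ord0 i).
Proof.
move=> [M [_ bM]]; exists 1, (`|M| + 1); split => [x y _ _|x Ox].
  by rewrite mul1r; have := coord_le_norm (x - y) i; rewrite !mxE.
rewrite (le_trans (coord_le_norm _ _))//; apply: (bM _ _ _ Ox).
by rewrite ltr_pwDr// ler_norm.
Qed.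

Lemma lip_boundedM Omega c d : lip_bounded Omega c -> lip_bounded Omega d ->
  lip_bounded Omega (fun x => c x * d x).
Proof.
move=> [L [M [LP MP]]] [K [N [KP NP]]].
exists (`|M| * `|K| + `|L| * `|N|), (`|M| * `|N|); split => [x y Ox Oy|x Ox]; last first.
  rewrite normrM ler_pM//; first by rewrite (le_trans (MP _ Ox)) ?ler_norm.
  by rewrite (le_trans (NP _ Ox)) ?ler_norm.
have -> : c x * d x - c y * d y = c x * (d x - d y) + (c x - c y) * d y by ring.
rewrite (le_trans (ler_normD _ _))// [leRHS]mulrDl lerD//.
  rewrite normrM -mulrA ler_pM//; first by rewrite (le_trans (MP _ Ox)) ?ler_norm.
  by rewrite (le_trans (KP _ _ Ox Oy))// ler_wpM2r// ler_norm.
rewrite normrM mulrAC ler_pM//; last by rewrite (le_trans (NP _ Oy)) ?ler_norm.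
by rewrite (le_trans (LP _ _ Ox Oy))// ler_wpM2r// ler_norm.
Qed.

(** The divergence of the field [x_i phi Y] has integral zero by [integral_partial0], and its
    expansion is [x_i adj Y phi + Y_i phi] almost everywhere. *)
Lemma wderiv_coord Omega Y i : open Omega -> bounded_set Omega -> vfield Omega Y ->
  wderiv Y Omega (fun x => x ord0 i) (fun x => Y x ord0 i).
Proof.
move=> oO bO vY phi tphi.
have xY k : lip_bounded Omega (fun x => x ord0 i * Y x ord0 k).
  by apply: lip_boundedM => //; exact: lip_bounded_coord.
pose W k x := (x ord0 i * Y x ord0 k) * phi x.
have W0 k : intg (partial k (W k)) /\ \int[mu]_x partial k (W k) x = 0.
  have [L LP] := coef_test_line (xY k) (@subset_refl _ Omega) tphi.
  apply: (@integral_partial0 _ _ _ _ L) => [|x t|]; [|exact: LP|].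
    exact: (coef_test_continuous oO (xY k) (@subset_refl _ _) tphi).
  exact: (coef_test_bounded_supp _ tphi).
have S0 : \int[mu]_x (\sum_k partial k (W k) x) = 0.
  rewrite Rintegral_sum; last by move=> k; case: (W0 k).
  by apply: big1 => k _; case: (W0 k).
have mO : (mu Omega < +oo)%E by apply: bounded_lebesgue_rV_lty => //; exact: open_measurable_rV.
have mOm : measurable Omega by exact: open_measurable_rV.
have i1 : intg (fun x => Y x ord0 i * phi x).
  have [M MP] := coef_test_bounded (@subset_refl _ Omega) (vY i) tphi.
  apply: (intg_bounded _ mOm mO MP).
    by apply: continuous_measurable_rV; exact: (coef_test_continuous oO (vY i) (@subset_refl _ _) tphi).
  by move=> x Ox; rewrite (test_out tphi)// mulr0.
have ix : intg ((fun x => x ord0 i) \_ Omega).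
  have [L [M [_ MP]]] := lip_bounded_coord i bO.
  apply: (@intg_bounded _ _ _ Omega `|M|) => //.
  - apply: (measurable_restrictT _ mOm).1; apply: measurable_funTS.
    exact: measurable_coord_rV.
  - move=> x; rewrite patchE; have [/[!inE] Ox|_] := boolP (x \in Omega).
      by rewrite (le_trans (MP _ Ox)) ?ler_norm.
    by rewrite normr0.
  - by move=> x Ox; rewrite patchE memNset.
have i2 : intg (fun x => x ord0 i * adj Y phi x) by exact: (intg_adj oO vY (@subset_refl _ _)).
apply/eqP; rewrite -addr_eq0 -RintegralD// -[X in _ == X]S0; apply/eqP.
apply: Rintegral_ae.
- by apply: intg_measurable; exact: intgD.
- by apply: intg_measurable; apply: intg_sum => k; case: (W0 k).
have : {ae mu, forall x, forall k, derivable (fun y => Y y ord0 k * phi y) x (E k)}.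
  apply: ae_forall_countType => k; have [L LP] := coef_test_line (vY k) (@subset_refl _ Omega) tphi.
  apply: (@lipschitz_line_derivable_ae _ _ k _ L) => [|x t]; last exact: LP.
  exact: (coef_test_continuous oO (vY k) (@subset_refl _ _) tphi).
apply: ae_imp => x dx.
have dc k : derivable (fun y : 'rV[R]_n => y ord0 i) x (E k) /\
    partial k (fun y : 'rV[R]_n => y ord0 i) x = (k == i)%:R.
  have := @partial_affine_coord _ _ k i id 1 0 1 x (is_derive_id _ _).
  rewrite (_ : (fun x : 'rV[R]_n => id (1 * x ord0 i + 0)) = (fun y : 'rV[R]_n => y ord0 i)).
    by rewrite mul1r mulr1.
  by apply/funext => y; rewrite mul1r addr0.
transitivity (\sum_k (x ord0 i * partial k (fun y => Y y ord0 k * phi y) x +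
                      (k == i)%:R * (Y x ord0 k * phi x))).
  rewrite big_split/= -mulr_sumr addrC; congr (_ + _).
  rewrite (bigD1 i)//= eqxx mul1r big1 ?addr0// => k /negPf ->.
  by rewrite mul0r.
apply: eq_bigr => k _; have [d1 d2] := dc k.
have -> : W k = (fun y => y ord0 i) * (fun y => Y y ord0 k * phi y).
  by apply/funext => y; rewrite /W mulrA.
rewrite [RHS]/partial (deriveM d1 (dx k)) -[RHS]/(_ * _ + _ * _) -d2.
by rewrite /partial; ring.
Qed.

End weak_derivative.

(** * Extraction of subsequences *)

Definition increasing_nat (s : nat -> nat) := {homo s : h l / (h < l)%N}.

Section subsequences.
Context {R : realType}.
Implicit Types (s r : nat -> nat).

Lemma increasing_nat_ge s : increasing_nat s -> forall h, (h <= s h)%N.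
Proof. by move=> si; elim=> [//|h IH]; apply: leq_ltn_trans IH (si _ _ _). Qed.

Lemma increasing_nat_comp s r : increasing_nat s -> increasing_nat r -> increasing_nat (s \o r).
Proof. by move=> si ri h l hl; apply/si/ri. Qed.

Lemma increasing_natS s : (forall h, (s h < s h.+1)%N) -> increasing_nat s.
Proof. by move=> sS; exact: (homo_ltn ltn_trans sS). Qed.

Lemma increasing_nat_cvg s : increasing_nat s -> s @ \oo --> \oo.
Proof.
move=> si; apply/cvgnyPge => N; near=> h.
by rewrite (leq_trans _ (increasing_nat_ge si h))//; near: h; exact: nbhs_infty_ge.
Unshelve. all: by end_near. Qed.

(** The second hypothesis says that [P k] is inherited by a sequence that is a subsequence from some
    rank on; the diagonal has exactly this relation to each stage. *)
Lemma diagonal_subsequence (P : nat -> (nat -> nat) -> Prop) :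
  (forall k s, increasing_nat s -> exists2 r, increasing_nat r & P k (s \o r)) ->
  (forall k s s' r N, P k s -> increasing_nat r -> (forall h, s' (h + N)%N = s (r h)) -> P k s') ->
  exists2 s, increasing_nat s & forall k, P k s.
Proof.
move=> Pex Psub.
have /choice[F FP] : forall ks : nat * (nat -> nat), exists r, increasing_nat ks.2 ->
    increasing_nat r /\ P ks.1 (ks.2 \o r).
  move=> [k s]; have [si|nsi] := pselect (increasing_nat s); last by exists id.
  by have [r ri Pr] := Pex k s si; exists r.
(* [S k] is the composition of the first [k] extractions; the diagonal is [S h h]. *)
pose S := fix S k := if k is l.+1 then S l \o F (l, S l) else id.
have Si k : increasing_nat (S k).
  by elim: k => [//|k IH] /=; apply: increasing_nat_comp => //; have [] := FP (k, S k) IH.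
have Fi k : increasing_nat (F (k, S k)) by have [] := FP (k, S k) (Si k).
have PS k : P k (S k.+1) by have [] := FP (k, S k) (Si k).
(* [T k h] carries the indices of stage [h + k] back to stage [k]. With it the diagonal, shifted by
   [k + 1], is a subsequence of [S k.+1]. *)
pose T k := fix T h := if h is l.+1 then T l \o F ((l + k)%N, S (l + k)%N) else id.
have TE k h : S (h + k)%N = S k \o T k h.
  by elim: h => [//|h IH]; rewrite addSn /= {1}IH.
have Ti k h : increasing_nat (T k h).
  by elim: h => [//|h IH] /=; exact: increasing_nat_comp.
exists (fun h => S h h).
  apply: increasing_natS => h /=; apply: Si.
  exact: leq_ltn_trans (increasing_nat_ge (Fi h) h) (Fi h _ _ (ltnSn h)).
move=> k; apply: (Psub k (S k.+1) _ (fun h => T k.+1 h (h + k.+1)%N) k.+1 (PS k)).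
  apply: increasing_natS => h /=; apply: Ti; rewrite addSn.
  exact: leq_ltn_trans (increasing_nat_ge (Fi _) _) (Fi _ _ _ (ltnSn _)).
by move=> h; rewrite TE.
Qed.

Lemma bounded_subsequence (u : nat -> R) (M : R) : (forall h, `|u h| <= M) ->
  exists2 r, increasing_nat r & cvgn (u \o r).
Proof.
move=> uM.
have bu : bounded_fun u.
  exists M; split; first exact: num_real.
  by move=> N MN x _ /=; rewrite (le_trans (uM x))// ltW.
have [r ri cr] := bolzano_weierstrass bu; exists r => // h l hl.
by rewrite ltnNge; have := ri l h; rewrite !leEnat => ->; rewrite -ltnNge.
Qed.

Lemma cvg_subseq (u : nat -> R) (l : R) r N s' s :
  (u \o s) @ \oo --> l -> increasing_nat r -> (forall h, s' (h + N)%N = s (r h)) ->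
  (u \o s') @ \oo --> l.
Proof.
move=> ul ri s's; rewrite -(cvg_shiftn N).
rewrite (_ : (fun h => (u \o s') (h + N)%N) = (u \o s) \o r).
  by apply: cvg_comp ul; exact: increasing_nat_cvg.
by apply/funext => h; rewrite /= s's.
Qed.

Lemma bounded_diagonal (u : nat -> nat -> R) (M : nat -> R) :
  (forall k h, `|u k h| <= M k) ->
  exists2 s, increasing_nat s & forall k, cvgn (u k \o s).
Proof.
move=> uM; apply: diagonal_subsequence => [k s si|k s s' r N /cvg_ex[/= l ul] ri s's].
  have [r ri cr] := @bounded_subsequence (u k \o s) (M k) (fun h => uM k (s h)).
  by exists r.
by apply/cvg_ex; exists l; exact: cvg_subseq ul ri s's.
Qed.

End subsequences.

(** * Hilbert space arguments *)

Section hilbert.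
Context {R : realType} (V : lmodType R) (D : set V) (ip : V -> V -> R).
Hypothesis D_lin : forall a u v, D u -> D v -> D (a *: u + v).
Hypothesis ip_linl : forall a u v w, D u -> D v -> D w ->
  ip (a *: u + v) w = a * ip u w + ip v w.
Hypothesis ip_sym : forall u v, D u -> D v -> ip u v = ip v u.
Hypothesis ip_ge0 : forall u, D u -> 0 <= ip u u.
Hypothesis ip_complete : forall u_ : nat -> V, (forall k, D (u_ k)) ->
  (forall e, 0 < e -> exists N, forall k l, (N <= k)%N -> (N <= l)%N ->
    ip (u_ k - u_ l) (u_ k - u_ l) < e) ->
  exists2 u, D u & ip (u_ k - u) (u_ k - u) @[k --> \oo] --> (0 : R).

Lemma DB u v : D u -> D v -> D (u - v).
Proof. by move=> Du Dv; rewrite addrC -scaleN1r; exact: D_lin. Qed.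

Lemma ip_linr a u v w : D u -> D v -> D w -> ip w (a *: u + v) = a * ip w u + ip w v.
Proof. by move=> Du Dv Dw; rewrite ip_sym ?ip_linl ?(ip_sym Dw)//; exact: D_lin. Qed.

Lemma ipBl u v w : D u -> D v -> D w -> ip (u - v) w = ip u w - ip v w.
Proof. by move=> Du Dv Dw; rewrite addrC -scaleN1r ip_linl// mulN1r addrC. Qed.

Lemma ipBr u v w : D u -> D v -> D w -> ip w (u - v) = ip w u - ip w v.
Proof. by move=> Du Dv Dw; rewrite addrC -scaleN1r ip_linr// mulN1r addrC. Qed.

Lemma ip_cauchy_schwarz u v : D u -> D v -> ip u v ^+ 2 <= ip u u * ip v v.
Proof.
move=> Du Dv.
have H t : 0 <= t ^+ 2 * ip u u + 2 * t * ip u v + ip v v.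
  have := ip_ge0 (D_lin t Du Dv).
  rewrite ip_linl ?ip_linr//; last exact: D_lin.
  by rewrite (ip_sym Dv Du) => /le_trans; apply; rewrite le_eqVlt; apply/orP; left; apply/eqP; ring.
have [u0|u0] := eqVneq (ip u u) 0.
  have [->|uv0] := eqVneq (ip u v) 0; first by rewrite expr0n/= u0 mul0r.
  (* For a null vector [u] the polynomial in [t] is affine, and this [t] gives it the value -1, a
     contradiction unless [ip u v] vanishes. *)
  pose t := - (ip v v + 1) / (2 * ip u v).
  have e : 2 * t * ip u v = - (ip v v + 1) by rewrite /t; field.
  by have := H t; rewrite u0 mulr0 e => ?; exfalso; lra.
have up : 0 < ip u u by rewrite lt0r u0 ip_ge0.
have := H (- ip u v / ip u u); rewrite (_ : _ + _ = ip v v - ip u v ^+ 2 / ip u u).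
  by rewrite subr_ge0 ler_pdivrMr// mulrC.
by field.
Qed.

Definition subspace_of (S : set V) := [/\ S `<=` D, S !=set0 &
  forall a u v, S u -> S v -> S (a *: u + v)].

Lemma ip_cvgl (u_ : nat -> V) u v : (forall k, D (u_ k)) -> D u -> D v ->
  ip (u_ k - u) (u_ k - u) @[k --> \oo] --> (0 : R) ->
  ip (u_ k) v @[k --> \oo] --> ip u v.
Proof.
move=> Du_ Du Dv cu; apply/cvgrPdist_lt => e e0.
have d0 : 0 < e ^+ 2 / (ip v v + 1) by rewrite divr_gt0 ?exprn_gt0// ltr_wpDl// ip_ge0.
move/cvgrPdist_lt : cu => /(_ _ d0); apply: filterS => k.
rewrite sub0r normrN ger0_norm ?ip_ge0//; last exact: DB.
rewrite ltr_pdivlMr ?ltr_wpDl ?ip_ge0// => H.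
rewrite distrC -ipBl// -ltr_sqr ?nnegrE// ?ltW// real_normK ?num_real//.
rewrite (le_lt_trans (ip_cauchy_schwarz _ _))//; first exact: DB.
apply: le_lt_trans H; rewrite ler_wpM2l ?lerDl// ip_ge0//; exact: DB.
Qed.

(** [ip] is only positive semidefinite, as functions are not identified almost everywhere, and [S]
    may fail to be closed; so [sigma] is given as a limit of elements of [S]. It is the limit of a
    minimizing sequence of the functional [J]. *)
Lemma riesz (S : set V) (L : V -> R) (C : R) : subspace_of S ->
  (forall a u v, S u -> S v -> L (a *: u + v) = a * L u + L v) ->
  (forall u, S u -> L u ^+ 2 <= C * ip u u) ->
  exists sigma, [/\ D sigma, (forall v, S v -> ip sigma v = L v) &
    exists2 v_ : nat -> V, (forall k, S (v_ k)) &
      ip (v_ k - sigma) (v_ k - sigma) @[k --> \oo] --> (0 : R)].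
Proof.
move=> [SD [s0 Ss0] Slin] Llin Lb.
have C0 u : S u -> L u ^+ 2 <= `|C| * ip u u.
  by move=> Su; rewrite (le_trans (Lb _ Su))// ler_wpM2r ?ler_norm// ip_ge0//; exact: SD.
pose J u := ip u u - 2 * L u.
have Jge u : S u -> - `|C| <= J u.
  move=> Su; have := C0 _ Su; have := ip_ge0 (SD _ Su); have := normr_ge0 C.
  rewrite /J; move: (ip u u) (L u) `|C| => x l c c0 x0 lc.
  rewrite leNgt; apply/negP => H; have := sqr_ge0 (x - c).
  have : 0 < (2 * l - x - c) * (2 * l + x + c) by rewrite mulr_gt0; lra.
  by nra.
have S0 : S 0 by have := Slin (-1) _ _ Ss0 Ss0; rewrite scaleN1r addNr.
have SZ a u : S u -> S (a *: u) by move=> Su; rewrite -[_ *: _]addr0; exact: Slin.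
have LZ a u : S u -> L (a *: u) = a * L u.
  have L0 : L 0 = 0 by have := Llin 1 0 0 S0 S0; rewrite scale1r addr0 mul1r => /eqP; rewrite -subr_eq0 opprD addNKr oppr_eq0 => /eqP.
  by move=> Su; have := Llin a u 0 Su S0; rewrite addr0 L0 addr0.
have infJ : has_inf [set J u | u in S].
  by split; [exists (J 0), 0|exists (- `|C|) => _ [u Su <-]; exact: Jge].
pose m := inf [set J u | u in S].
have mJ u : S u -> m <= J u by move=> Su; apply: ge_inf; [exact: infJ.2|exists u].
have /choice[v_ vP] : forall k : nat, exists u, S u /\ J u < m + k.+1%:R^-1.
  move=> k; have k0 : 0 < k.+1%:R^-1 :> R by rewrite invr_gt0.
  by have [_ [u Su <-] uJ] := inf_adherent k0 infJ; exists u.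
have Sv k := (vP k).1; have Dv k := SD _ (Sv k).
(* Parallelogram identity: the linear parts of [J] cancel against the midpoint, so two near
   minimizers are close to each other. *)
have par u w : S u -> S w ->
    ip (u - w) (u - w) = 2 * J u + 2 * J w - 4 * J (2^-1 *: u + 2^-1 *: w).
  move=> Su Sw; have [Du Dw] := (SD _ Su, SD _ Sw).
  have Dw2 : D (2^-1 *: w) by apply: SD; exact: SZ.
  have Duw : D (2^-1 *: u + 2^-1 *: w) by exact: D_lin.
  have Z x y : D x -> D y -> ip (2^-1 *: x) y = 2^-1 * ip x y.
    move=> Dx Dy; have D0 := SD _ S0.
    have e : ip 0 y = 0 by have := ipBl D0 D0 Dy; rewrite subrr subrr.
    by have := ip_linl 2^-1 Dx D0 Dy; rewrite addr0 e addr0.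
  rewrite ipBl ?ipBr//; try exact: DB.
  rewrite /J ip_linl// Z// !ip_linr// ![ip _ (2^-1 *: w)]ip_sym// !Z//.
  rewrite (ip_sym Dw Du) Llin//; last exact: SZ.
  by rewrite LZ//; lra.
have [sigma Ds cs] : exists2 u, D u & ip (v_ k - u) (v_ k - u) @[k --> \oo] --> (0 : R).
  apply: ip_complete => // e e0.
  have [N NP] : exists N : nat, N.+1%:R^-1 < e / 4.
    have e4 : 0 < e / 4 by rewrite divr_gt0.
    by exists (Num.truncn (e / 4)^-1); rewrite invf_plt ?posrE// truncnS_gt.
  have dN k : (N <= k)%N -> J (v_ k) < m + e / 4.
    move=> Nk; rewrite (lt_trans (vP k).2)// ltrD2l (le_lt_trans _ NP)//.
    by rewrite lef_pV2 ?posrE// ler_nat.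
  exists N => k l /dN Jk /dN Jl; rewrite par//.
  have : m <= J (2^-1 *: v_ k + 2^-1 *: v_ l) by apply: mJ; apply: Slin => //; exact: SZ.
  by move: (J _) (J _) (J _) Jk Jl => *; lra.
exists sigma; split => //; last by exists v_.
move=> v Sw; have Dw := SD _ Sw.
have c1 := ip_cvgl Dv Ds Dw cs.
have bk k : (ip (v_ k) v - L v) ^+ 2 <= (ip v v + 1) * k.+1%:R^-1.
  (* The minimizer in [t] of t^2 (|v|^2 + 1) + 2 t (ip (v_ k) v - L v); adding 1 to |v|^2 avoids
     dividing by zero. Near minimality of [v_ k] then bounds the squared defect in the Euler
     equation by (|v|^2 + 1)/(k + 1). *)
  pose t := - (ip (v_ k) v - L v) / (ip v v + 1).
  have vv := ip_ge0 Dw.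
  have := mJ _ (Slin t _ _ Sw (Sv k)); have := (vP k).2.
  rewrite /J; rewrite ip_linl//; last exact: D_lin.
  rewrite !ip_linr// Llin// (ip_sym Dw (Dv k)).
  set d := k.+1%:R^-1; set b := ip (v_ k) v; set x := ip v v; set l := L v.
  move=> h1 h2.
  have h3 : 0 <= t ^+ 2 * (x + 1) + 2 * t * (b - l) + d.
    have := sqr_ge0 t; nra.
  have x1 : 0 < x + 1 by rewrite ltr_wpDl.
  have e : t ^+ 2 * (x + 1) + 2 * t * (b - l) + d = d - (b - l) ^+ 2 / (x + 1).
    by rewrite /t -/b -/l -/x; field; rewrite gt_eqF.
  by move: h3; rewrite e subr_ge0 ler_pdivrMr// mulrC.
have c2 : (fun k => (ip (v_ k) v - L v) ^+ 2) @ \oo --> (0 : R).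
  apply: (@squeeze_cvgr _ _ _ _ (cst 0) (fun k => (ip v v + 1) * k.+1%:R^-1)).
  - by apply: nearW => k; rewrite sqr_ge0 bk.
  - exact: cvg_cst.
  - rewrite -[X in _ --> X](mulr0 (ip v v + 1)); apply: cvgM; first exact: cvg_cst.
    exact: cvg_harmonic.
have c3 : (fun k => (ip (v_ k) v - L v) ^+ 2) @ \oo --> (ip sigma v - L v) ^+ 2.
  have c4 : (fun k => ip (v_ k) v - L v) @ \oo --> ip sigma v - L v.
    by apply: cvgB c1 _; exact: cvg_cst.
  by rewrite expr2; under eq_fun do rewrite expr2; exact: cvgM.
have e : (ip sigma v - L v) ^+ 2 = 0 by exact: (cvg_unique _ c3 c2).
by apply/eqP; rewrite -subr_eq0 -sqrf_eq0 e.
Qed.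

Lemma hilbert_projection (S : set V) g : subspace_of S -> D g ->
  exists pg, [/\ D pg, (forall v, S v -> ip pg v = ip g v) &
    exists2 v_ : nat -> V, (forall k, S (v_ k)) &
      ip (v_ k - pg) (v_ k - pg) @[k --> \oo] --> (0 : R)].
Proof.
move=> sS Dg; have [SD _ _] := sS; apply: (riesz (C := ip g g)) => //.
- by move=> a u v Su Sv; rewrite ip_linr//; exact: SD.
- by move=> u Su; apply: ip_cauchy_schwarz => //; exact: SD.
Qed.

(** The residual of the projection is orthogonal to [S], hence null by hypothesis, and the
    projection is a limit of elements of [S]. *)
Lemma hilbert_dense (S : set V) : subspace_of S ->
  (forall g, D g -> (forall v, S v -> ip g v = 0) -> ip g g = 0) ->
  forall g e, D g -> 0 < e -> exists2 v, S v & ip (g - v) (g - v) < e.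
Proof.
move=> sS S0 g e Dg e0; have [SD _ _] := sS.
have [pg [Dpg pgS [v_ Sv cv]]] := hilbert_projection sS Dg.
have Dgp : D (g - pg) by exact: DB.
have z : ip (g - pg) (g - pg) = 0.
  by apply: S0 => // v Sv'; rewrite ipBl ?pgS ?subrr//; exact: SD.
move/cvgrPdist_lt : cv => /(_ _ e0)[N _ /(_ N (leqnn N))].
have Dv : D (v_ N) by exact: SD.
rewrite sub0r normrN ger0_norm; last by apply: ip_ge0; exact: DB.
move=> H; exists (v_ N) => //; apply: le_lt_trans H.
have Dvp : D (v_ N - pg) by exact: DB.
have -> : g - v_ N = (g - pg) - (v_ N - pg) by rewrite opprB addrA subrK.
move: (g - pg) (v_ N - pg) Dgp Dvp z => a b Da Db z.
have w0 : ip a b = 0.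
  apply/eqP; rewrite -sqrf_eq0 eq_le sqr_ge0 andbT.
  by rewrite (le_trans (ip_cauchy_schwarz Da Db))// z mul0r.
by rewrite ipBl ?ipBr//; [rewrite z (ip_sym Db Da) w0; lra|exact: DB].
Qed.

(** A diagonal extraction makes [ip (s (r h)) (s k)] converge for every [k], hence for all vectors
    in the span [S] of the sequence. Riesz represents the limit on [S], and any other [g] may be
    replaced by its projection, because [g] minus that projection is orthogonal to every [s k]. *)
Lemma hilbert_weak_compact (s : nat -> V) (C : R) : (forall h, D (s h)) ->
  (forall h, ip (s h) (s h) <= C) ->
  exists r sigma, [/\ increasing_nat r, D sigma &
    forall g, D g -> ip (s (r h)) g @[h --> \oo] --> ip sigma g].
Proof.
move=> Ds sC.
have C0 : 0 <= C by exact: le_trans (ip_ge0 (Ds 0%N)) (sC 0%N).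
have ipb g h : D g -> `|ip (s h) g| <= Num.sqrt (C * ip g g).
  move=> Dg; rewrite -sqrtr_sqr ler_wsqrtr// (le_trans (ip_cauchy_schwarz _ _))//.
  by rewrite ler_wpM2r// ip_ge0.
have [r ri cr] := bounded_diagonal (fun k h => ipb (s k) h (Ds k)).
pose S : set V := [set v | exists N (c : nat -> R), v = \sum_(k < N) c k *: s k].
have SD : S `<=` D.
  move=> _ [N [c ->]]; elim: N => [|N IH].
    by rewrite big_ord0; have := DB (Ds 0%N) (Ds 0%N); rewrite subrr.
  by rewrite big_ord_recr /= addrC; exact: D_lin.
have Ss k : S (s k).
  exists k.+1, (fun l => (l == k)%:R); rewrite big_ord_recr/= eqxx scale1r.
  by rewrite big1 ?add0r// => i _; rewrite (ltn_eqF (ltn_ord i)) scale0r.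
have Slin a u v : S u -> S v -> S (a *: u + v).
  move=> [N [c ->]] [M [d ->]].
  exists (N + M)%N, (fun k => a * (if (k < N)%N then c k else 0) + (if (k < M)%N then d k else 0)).
  have ext K (f : nat -> R) (L : nat) : (K <= L)%N ->
      \sum_(k < K) f k *: s k = \sum_(k < L) (if (k < K)%N then f k else 0) *: s k.
    move=> KL; rewrite (big_ord_widen _ (fun k => f k *: s k) KL) big_mkcond/=.
    by apply: eq_bigr => i _; case: ifP => // _; rewrite scale0r.
  rewrite (ext N c (N + M)%N) ?leq_addr// (ext M d (N + M)%N) ?leq_addl//.
  rewrite scaler_sumr -big_split/=; apply: eq_bigr => i _.
  by rewrite scalerDl scalerA.
have sS : subspace_of S by split => //; exists (s 0%N).
have cS v : S v -> cvgn (fun h => ip (s (r h)) v).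
  move=> [N [c ->]]; elim: N => [|N IH].
    rewrite big_ord0 (_ : (fun h => _) = cst 0); first exact: is_cvg_cst.
    apply/funext => h; have := ipBr (Ds 0%N) (Ds 0%N) (Ds (r h)).
    by rewrite !subrr.
  rewrite big_ord_recr/= addrC.
  have DN : D (\sum_(i < N) c i *: s i) by apply: SD; exists N, c.
  rewrite (_ : (fun h => _) = (fun h => c N * ip (s (r h)) (s N) + ip (s (r h)) (\sum_(i < N) c i *: s i))).
    by apply: is_cvgD => //; apply: is_cvgM; [exact: is_cvg_cst|exact: cr].
  by apply/funext => h; rewrite ip_linr.
pose L v := limn (fun h => ip (s (r h)) v).
have LP v : S v -> ip (s (r h)) v @[h --> \oo] --> L v by move/cS.
have [sigma [Dsig sigS [t_ St ct]]] : exists sigma, [/\ D sigma, (forall v, S v -> ip sigma v = L v) &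
    exists2 v_ : nat -> V, (forall k, S (v_ k)) &
      ip (v_ k - sigma) (v_ k - sigma) @[k --> \oo] --> (0 : R)].
  apply: (riesz (C := C)) => //.
  - move=> a u v Su Sv; apply/cvg_lim => //.
    rewrite (_ : (fun h => _) = (fun h => a * ip (s (r h)) u + ip (s (r h)) v)).
      exact: (cvgD (cvgM (cvg_cst a) (LP _ Su)) (LP _ Sv)).
    by apply/funext => h; rewrite ip_linr//; exact: SD.
  - move=> u Su; have c2 : (fun h => ip (s (r h)) u ^+ 2) @ \oo --> L u ^+ 2.
      by rewrite expr2; under eq_fun do rewrite expr2; apply: cvgM; exact: LP.
    rewrite -(cvg_lim _ c2)//; apply: limr_le; first by apply/cvg_ex; exists (L u ^+ 2).
    apply: nearW => h; rewrite (le_trans (ip_cauchy_schwarz _ _))//; first exact: SD.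
    by rewrite ler_wpM2r// ip_ge0//; exact: SD.
exists r, sigma; split => // g Dg.
have [pg [Dpg pgS [v_ Sv cv]]] := hilbert_projection sS Dg.
have Dv k := SD _ (Sv k).
have e1 h : ip (s (r h)) g = ip (s (r h)) pg.
  by rewrite (ip_sym (Ds _) Dg) -pgS// ip_sym.
have e2 : ip sigma g = ip sigma pg.
  have a1 := ip_cvgl (fun k => SD _ (St k)) Dsig Dg ct.
  have a2 := ip_cvgl (fun k => SD _ (St k)) Dsig Dpg ct.
  have e k : ip (t_ k) g = ip (t_ k) pg.
    by rewrite (ip_sym (SD _ (St k)) Dg) -pgS// ip_sym//; exact: SD.
  rewrite (_ : (fun k => _) = (fun k => ip (t_ k) pg)) in a1; last exact/funext.
  exact: (cvg_unique _ a1 a2).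
rewrite e2; under eq_fun do rewrite e1.
apply/cvgrPdist_lt => e e0.
have e3 : 0 < e / 3 by rewrite divr_gt0.
(* By Cauchy-Schwarz this threshold bounds the pairing of [v_ N - pg] with both [s (r h)] and
   [sigma] by e/3, since the denominator dominates both squared norms. *)
have d0 : 0 < (e / 3) ^+ 2 / (C + ip sigma sigma + 1).
  by rewrite divr_gt0 ?exprn_gt0// ltr_wpDl// addr_ge0// ip_ge0.
move/cvgrPdist_lt : cv => /(_ _ d0)[N _ /(_ N (leqnn N))].
have DvN : D (v_ N - pg) by exact: DB.
rewrite sub0r normrN ger0_norm ?ip_ge0//.
rewrite ltr_pdivlMr ?ltr_wpDl ?addr_ge0 ?ip_ge0// => HN.
have small w : D w -> ip w w <= C + ip sigma sigma + 1 -> `|ip w (v_ N - pg)| < e / 3.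
  move=> Dw wC; rewrite -ltr_sqr ?nnegrE// ?ltW// real_normK ?num_real//.
  rewrite (le_lt_trans (ip_cauchy_schwarz _ _))// mulrC.
  by apply: le_lt_trans HN; rewrite ler_wpM2l// ip_ge0.
have ssm : `|ip sigma (v_ N - pg)| < e / 3.
  by apply: small => //; rewrite addrAC lerDr addr_ge0.
have := LP _ (Sv N) => /cvgrPdist_lt/(_ _ e3); apply: filterS => h.
rewrite -sigS// => hh.
have hs : `|ip (s (r h)) (v_ N - pg)| < e / 3.
  by apply: small => //; rewrite (le_trans (sC _))// -addrA lerDl addr_ge0// ip_ge0.
rewrite !ipBr// in ssm hs.
move: ssm hs hh; rewrite !ltr_norml => /andP[? ?] /andP[? ?] /andP[? ?].
by apply/andP; split; lra.
Qed.

End hilbert.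

(** * Square-integrable functions *)

Section L2_space.
Context {R : realType} {n : nat}.
Local Notation mu := (lebesgue_rV R n).
Local Notation intg f := (mu.-integrable setT (EFin \o f)).
Implicit Types (f g u : 'rV[R]_n -> R) (x : 'rV[R]_n).

Lemma limn_einf_le (F : nat -> \bar R) (e : \bar R) :
  (forall N, exists2 k, (N <= k)%N & (F k <= e)%E) -> (limn_einf F <= e)%E.
Proof.
move=> Fe; rewrite limn_einf_lim; apply: lime_le; first exact: is_cvg_einfs.
apply: nearW => k; have [j kj Fj] := Fe k.
by apply: le_trans Fj; apply: ereal_inf_lbound; exists j.
Qed.

Lemma Rintegral_EFin f : intg f -> (\int[mu]_x (f x)%:E)%E = (\int[mu]_x f x)%:E.
Proof. by move=> fi; rewrite /Rintegral fineK//; exact: integrable_fin_num. Qed.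

Lemma ge0_intgP f : measurable_fun setT f -> (forall x, 0 <= f x) ->
  intg f <-> (\int[mu]_x (f x)%:E < +oo)%E.
Proof.
move=> mf f0; split=> [fi|foo]; first by rewrite Rintegral_EFin// ltry.
apply/integrableP; split; first exact/measurable_EFinP.
rewrite (eq_integral (EFin \o f))// => x _.
by rewrite /= ger0_norm.
Qed.

(** A bound for infinitely many [k] is enough, since it already bounds the lower limit of the
    integrals in Fatou's lemma. *)
Lemma Rintegral_fatou (F : nat -> 'rV[R]_n -> R) f (e : R) :
  (forall k, measurable_fun setT (F k)) -> measurable_fun setT f ->
  (forall k x, 0 <= F k x) -> (forall x, 0 <= f x) ->
  {ae mu, forall x, F ^~ x @ \oo --> f x} ->
  (forall N, exists2 k, (N <= k)%N & intg (F k) /\ \int[mu]_x F k x <= e) ->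
  intg f /\ \int[mu]_x f x <= e.
Proof.
move=> mF mf F0 f0 Ff Fe.
have fe : (\int[mu]_x (f x)%:E <= e%:E)%E.
  have -> : (\int[mu]_x (f x)%:E = \int[mu]_x limn_einf (fun k => (F k x)%:E))%E.
    apply: ae_eq_integral => //.
    - exact/measurable_EFinP.
    - apply: measurableT_comp => //; apply: measurable_fun_limn_esup => k.
      by apply: measurableT_comp => //; exact/measurable_EFinP.
    - apply: ae_imp Ff => x Fx _; apply/esym/(cvg_limn_einf_sup _).1.
      by apply: cvg_EFin => //; exact: nearW.
  apply: (le_trans (@fatou _ _ _ mu setT measurableT (fun k x => (F k x)%:E) _ _)).
  - by move=> k; exact/measurable_EFinP.
  - by move=> k x _; rewrite lee_fin.
  - apply: limn_einf_le => N; have [k Nk [Fi Fk]] := Fe N; exists k => //.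
    by rewrite Rintegral_EFin// lee_fin.
have fi : intg f by apply/ge0_intgP => //; exact: le_lt_trans fe (ltry _).
by split => //; rewrite -lee_fin -Rintegral_EFin.
Qed.

Definition L2 f := measurable_fun setT f /\ intg (fun x => f x ^+ 2).

Definition ip f g := \int[mu]_x (f x * g x).

Lemma L2_mul f g : L2 f -> L2 g -> intg (fun x => f x * g x).
Proof.
move=> [mf f2] [mg g2]; apply: (intg_le _ (intgD f2 g2)); first exact: measurable_funM.
move=> x; rewrite normrM [leRHS]ger0_norm ?addr_ge0 ?sqr_ge0//.
rewrite -[f x ^+ 2]real_normK ?num_real// -[g x ^+ 2]real_normK ?num_real//.
have := sqr_ge0 (`|f x| - `|g x|); have := normr_ge0 (f x); have := normr_ge0 (g x); nra.
Qed.

Lemma L2_lin (a : R) f g : L2 f -> L2 g -> L2 (a *: f + g).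
Proof.
move=> Lf Lg; have [[mf f2] [mg g2]] := (Lf, Lg); split.
  by apply: measurable_funD => //; exact: measurable_funM.
have -> : (fun x => (a *: f + g) x ^+ 2) = fun x => a ^+ 2 * f x ^+ 2 + (2 * a * (f x * g x) + g x ^+ 2).
  by apply/funext => x; rewrite -[(a *: f + g) x]/(a * f x + g x); ring.
by apply: intgD; [exact: intgZ|apply: intgD => //; apply: intgZ; exact: L2_mul].
Qed.

Lemma ip_lin (a : R) f g h : L2 f -> L2 g -> L2 h -> ip (a *: f + g) h = a * ip f h + ip g h.
Proof.
move=> Lf Lg Lh; rewrite /ip.
rewrite -RintegralZl//; last exact: L2_mul.
rewrite -RintegralD//; [|apply: intgZ|]; [|exact: L2_mul..].
by apply: eq_Rintegral => x _; rewrite -[(a *: f + g) x]/(a * f x + g x); ring.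
Qed.

Lemma ipC f g : ip f g = ip g f.
Proof. by apply: eq_Rintegral => x _; rewrite mulrC. Qed.

Lemma ip_ge0 f : 0 <= ip f f.
Proof. by apply: Rintegral_ge0 => x _; rewrite -expr2 sqr_ge0. Qed.

Lemma ip_sqr f : ip f f = \int[mu]_x f x ^+ 2.
Proof. by apply: eq_Rintegral => x _; rewrite expr2. Qed.

Lemma fast_cauchy_cvg (v : nat -> R) (M : R) :
  (forall k, 4 ^+ k * (v k.+1 - v k) ^+ 2 <= M) -> cvgn v.
Proof.
move=> vM; have M0 : 0 <= M.
  by rewrite (le_trans _ (vM 0%N))//; apply: mulr_ge0; rewrite ?sqr_ge0 ?exprn_ge0.
have cs : cvgn (series (telescope v)).
  apply: normed_cvg.
  apply: (@series_le_cvg _ _ (geometric (Num.sqrt M) 2^-1)) => //.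
  - by move=> k /=; exact: normr_ge0.
  - by move=> k; rewrite /geometric/= mulr_ge0 ?sqrtr_ge0// exprn_ge0.
  - move=> k /=; rewrite /geometric/= /telescope/= exprVn ler_pdivlMr ?exprn_gt0//.
    rewrite -[leLHS]ger0_norm ?mulr_ge0 ?exprn_ge0// -sqrtr_sqr ler_wsqrtr//.
    rewrite exprMn real_normK ?num_real// mulrC -exprM mulnC exprM.
    by apply: le_trans (vM k); rewrite (_ : 2 ^+ 2 = 4 :> R)//; ring.
  - by apply: is_cvg_geometric_series; rewrite ger0_norm// invf_lt1// ltr1n.
have -> : v = (fun k => v 0%N + series (telescope v) k).
  by apply/funext => k; exact: eq_sum_telescope.
by apply: is_cvgD => //; exact: is_cvg_cst.
Qed.

Lemma fast_subsequence (u : nat -> 'rV[R]_n -> R) :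
  (forall e, 0 < e -> exists N, forall k l, (N <= k)%N -> (N <= l)%N ->
    ip (u k - u l) (u k - u l) < e) ->
  exists2 s, increasing_nat s &
    forall k, ip (u (s k.+1) - u (s k)) (u (s k.+1) - u (s k)) < 8^-1 ^+ k.
Proof.
move=> uC.
have /choice[N NP] : forall j : nat, exists N, forall k l, (N <= k)%N -> (N <= l)%N ->
    ip (u k - u l) (u k - u l) < 8^-1 ^+ j.
  by move=> j; apply: uC; rewrite exprn_gt0.
pose s := fix s k := if k is j.+1 then maxn (s j).+1 (N k) else N 0%N.
have si : increasing_nat s by apply: increasing_natS => k /=; exact: leq_maxl.
have Ns k : (N k <= s k)%N by case: k => //= k; exact: leq_maxr.
exists s => // k; apply: NP; last exact: Ns.
exact: leq_trans (Ns k) (ltnW (si _ _ (ltnSn k))).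
Qed.

(** Riesz-Fischer: a fast subsequence converges almost everywhere because a weighted sum of its
    squared increments is integrable, and Fatou's lemma turns the Cauchy condition into convergence
    in L^2. *)
Lemma L2_complete (u : nat -> 'rV[R]_n -> R) : (forall k, L2 (u k)) ->
  (forall e, 0 < e -> exists N, forall k l, (N <= k)%N -> (N <= l)%N ->
    ip (u k - u l) (u k - u l) < e) ->
  exists2 v, L2 v & ip (u k - v) (u k - v) @[k --> \oo] --> (0 : R).
Proof.
move=> Lu uC; have [s si sP] := fast_subsequence uC.
pose w k := u (s k).
have L2B f g : L2 f -> L2 g -> L2 (f - g).
  by move=> Lf Lg; rewrite addrC -scaleN1r; exact: L2_lin.
have Lw k : L2 (w k) := Lu (s k).
have mw k : measurable_fun setT (w k) by case: (Lw k).
(* The squared increments have integral below 8^(-k), so with weight 4^k the integrals are summable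
   like 2^(-k); finiteness of the sum at a point still bounds the increments there by a multiple of
   2^(-k). *)
pose a k x : \bar R := (4 ^+ k * (w k.+1 x - w k x) ^+ 2)%:E.
have ma k : measurable_fun setT (a k).
  apply/measurable_EFinP; apply: measurable_funM => //; apply: measurable_funX.
  exact: measurable_funB.
have a0 k x : (0 <= a k x)%E by rewrite lee_fin mulr_ge0 ?sqr_ge0 ?exprn_ge0.
pose S x := (\sum_(k <oo) a k x)%E.
have mS : measurable_fun setT S.
  by apply: ge0_emeasurable_sum => // k x _ _; exact: a0.
have S0 x : (0 <= S x)%E by apply: nneseries_ge0 => k _ _; exact: a0.
have Soo : (\int[mu]_x S x < +oo)%E.
  rewrite integral_nneseries//.
  apply: (@le_lt_trans _ _ (\sum_(k <oo) (2 / (2 ^ k.+1)%:R)%:E)%E); last first.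
    by apply: le_lt_trans (epsilon_trick0 _ _) _; rewrite ?ltry.
  apply: lee_nneseries => [k _ _|k _]; first by apply: integral_ge0 => x _; exact: a0.
  have L2w : L2 (w k.+1 - w k) := L2B _ _ (Lw _) (Lw _).
  have i2 : intg (fun x => (w k.+1 x - w k x) ^+ 2) by case: L2w.
  rewrite (_ : (\int[mu]_x a k x)%E = (4 ^+ k * ip (w k.+1 - w k) (w k.+1 - w k))%:E).
    rewrite lee_fin; have -> : 2 / (2 ^ k.+1)%:R = 2^-1 ^+ k :> R.
      by rewrite natrX exprS invfM mulrA divff// mul1r exprVn.
    rewrite (le_trans (ler_wpM2l _ (ltW (sP k))))// ?exprn_ge0// -exprMn.
    by rewrite (_ : 4 * 8^-1 = 2^-1)//; lra.
  rewrite /a (Rintegral_EFin (intgZ _ i2)) RintegralZl//.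
have mG : measurable [set x | (S x < +oo)%E].
  by rewrite -[X in measurable X]setTI; exact: emeasurable_fun_infty_o.
pose G := [set x | (S x < +oo)%E].
have aeG : {ae mu, forall x, G x}.
  have : mu.-integrable setT S.
    apply/integrableP; split => //; rewrite (eq_integral S)// => x _.
    by rewrite gee0_abs.
  move/(integrable_ae measurableT); apply: ae_imp => x /(_ Logic.I).
  by rewrite ge0_fin_numE.
(* Setting the subsequence to 0 where the sum is infinite makes it converge at every point, hence
   with a measurable limit. *)
pose z k x := w k x * \1_G x.
have mz k : measurable_fun setT (z k).
  by apply: measurable_funM => //; exact: measurable_indic.
have zc x : cvgn (z ^~ x).
  have [Gx|nGx] := pselect (G x); last first.
    rewrite (_ : z ^~ x = cst 0); first exact: is_cvg_cst.
    by apply/funext => k; rewrite /z indicE memNset// mulr0.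
  rewrite (_ : z ^~ x = w ^~ x); last first.
    by apply/funext => k; rewrite /z indicE mem_set// mulr1.
  apply: (@fast_cauchy_cvg _ (fine (S x))) => k.
  rewrite -lee_fin fineK ?ge0_fin_numE//.
  apply: le_trans (nneseries_lim_ge k.+1 _); last by move=> j _ _; exact: a0.
  by rewrite big_nat_recr//= leeDr// sume_ge0.
pose v x := limn (z ^~ x).
have zv x : z ^~ x @ \oo --> v x by exact: zc.
have mv : measurable_fun setT v.
  by apply: (@measurable_fun_cvg _ _ _ setT z) => // x _; exact: zv.
have key e : 0 < e -> exists N, forall k, (N <= k)%N ->
    intg (fun x => (u k x - v x) ^+ 2) /\ \int[mu]_x (u k x - v x) ^+ 2 <= e.
  move=> e0; have [N NP] := uC e e0; exists N => k Nk.
  apply: (@Rintegral_fatou (fun j x => (u k x - w j x) ^+ 2)).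
  - by move=> j; apply: measurable_funX; apply: measurable_funB => //; case: (Lu k).
  - by apply: measurable_funX; apply: measurable_funB => //; case: (Lu k).
  - by move=> j x; exact: sqr_ge0.
  - by move=> x; exact: sqr_ge0.
  - apply: ae_imp aeG => x Gx.
    have wv : w ^~ x @ \oo --> v x.
      have := zv x; rewrite (_ : z ^~ x = w ^~ x)//.
      by apply/funext => j; rewrite /z indicE mem_set// mulr1.
    have c1 : (fun j => u k x - w j x) @ \oo --> u k x - v x by exact: (cvgB (cvg_cst _) wv).
    by rewrite expr2; under eq_fun do rewrite expr2; exact: (cvgM c1 c1).
  - move=> M; exists (maxn M N); first exact: leq_maxl.
    have L2k : L2 (u k - w (maxn M N)) := L2B _ _ (Lu _) (Lw _).
    split; first by case: L2k.
    rewrite -(ip_sqr (u k - w (maxn M N))) ltW//; apply: NP => //.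
    by rewrite (leq_trans (leq_maxr M N))// increasing_nat_ge.
have L2uv : exists k, L2 (u k - v).
  have [N NP] := key 1 ltr01; exists N; split; last by case: (NP N (leqnn N)).
  by apply: measurable_funB => //; case: (Lu N).
exists v.
  have [k Lk] := L2uv; have -> : v = u k - (u k - v) by rewrite opprB addrC subrK.
  exact: L2B _ _ (Lu k) Lk.
apply/cvgrPdist_lt => e e0; have e20 : 0 < e / 2 by rewrite divr_gt0.
have [N NP] := key _ e20; exists N => // k /= Nk.
rewrite sub0r normrN ger0_norm ?ip_ge0// ip_sqr.
by apply: le_lt_trans (NP k Nk).2 _; rewrite ltr_pdivrMr// ltr_pMr// ltr1n.
Qed.

Definition L2_set : set ('rV[R]_n -> R) := [set f | L2 f].

Lemma L2_weak_compact (s : nat -> 'rV[R]_n -> R) (C : R) : (forall h, L2 (s h)) ->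
  (forall h, ip (s h) (s h) <= C) ->
  exists r sigma, [/\ increasing_nat r, L2 sigma &
    forall g, L2 g -> ip (s (r h)) g @[h --> \oo] --> ip sigma g].
Proof.
by apply: (@hilbert_weak_compact _ _ L2_set ip) => [||u v _ _|u _|]; [exact: L2_lin|
  exact: ip_lin|exact: ipC|exact: ip_ge0|exact: L2_complete].
Qed.

Lemma L2_cauchy_schwarz f g : L2 f -> L2 g -> ip f g ^+ 2 <= ip f f * ip g g.
Proof.
by apply: (@ip_cauchy_schwarz _ _ L2_set ip) => [||u v _ _|u _]; [exact: L2_lin|
  exact: ip_lin|exact: ipC|exact: ip_ge0].
Qed.

End L2_space.

(** * Almost minimizing correctors *)

Section correctors.
Context {R : realType} (T : lmodType R) (D : set T) (nrm : T -> R) (B : nat -> T -> T -> R).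
Hypothesis D_lin : forall a u v, D u -> D v -> D (a *: u + v).
Hypothesis nrm_tri : forall a u v, D u -> D v -> nrm (a *: u + v) <= `|a| * nrm u + nrm v.
Hypothesis nrm0 : nrm 0 = 0.
Hypothesis B_ge0 : forall h u, D u -> 0 <= B h u u.
Hypothesis B_expand : forall h a u v, D u -> D v ->
  B h (a *: v + u) (a *: v + u) = B h u u + 2 * a * B h u v + a ^+ 2 * B h v v.
Variables (I : finType) (l : I -> T) (M : R).
Hypothesis Dl : forall i, D (l i).
Hypothesis lM : forall h i, B h (l i) (l i) <= M.

Let near_set h i (k : nat) := [set B h v v | v in [set v | D v /\ nrm (v - l i) <= k.+1%:R^-1]].
Let low h i k := inf (near_set h i k).

Let M_ge0 : I -> 0 <= M.
Proof. by move=> i; exact: le_trans (B_ge0 0 (Dl i)) (lM 0 i). Qed.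

Let near_set_l h i k : near_set h i k (B h (l i) (l i)).
Proof. by exists (l i) => //; split => //; rewrite subrr nrm0 invr_ge0. Qed.

Let near_set_lb h i k : has_lbound (near_set h i k).
Proof. by exists 0 => _ [v [Dv _] <-]; exact: B_ge0. Qed.

Let near_set_inf h i k : has_inf (near_set h i k).
Proof. by split => //; exists (B h (l i) (l i)). Qed.

Let low_ge0 h i k : 0 <= low h i k.
Proof. by apply: lb_le_inf; [exists (B h (l i) (l i))|move=> _ [v [Dv _] <-]; exact: B_ge0]. Qed.

Let low_leM h i k : low h i k <= M.
Proof. by apply: le_trans (lM h i); exact: ge_inf. Qed.

Let low_le h i k v : D v -> nrm (v - l i) <= k.+1%:R^-1 -> low h i k <= B h v v.
Proof. by move=> Dv vl; apply: ge_inf => //; exists v. Qed.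

Let low_nd h i : {homo low h i : k j / (k <= j)%N >-> k <= j}.
Proof.
move=> k j kj; apply: lb_le_inf; first by exists (B h (l i) (l i)).
move=> _ [v [Dv vl] <-]; apply: low_le => //; apply: le_trans vl _.
by rewrite lef_pV2 ?posrE// ler_nat.
Qed.

(** Let [low h i k] be the infimum of the energy over the ball of radius 1/(k+1) around [l i]. After
    extraction it converges to [J i k], which increases with [k] to [Joo i]. Choosing [w i k] nearly
    minimal in the k-th ball makes its energy at most [Joo i + 2/(k+1)], while any small
    perturbation of it stays in a fixed larger ball, whose infimum is almost [Joo i]. Perturbing
    thus cannot lower the energy noticeably, and the first variation is small. *)
Lemma correctors : exists s (w : I -> nat -> T), [/\ increasing_nat s,
  forall i k, D (w i k),
  forall i k, nrm (w i k - l i) <= k.+1%:R^-1,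
  forall i k, B (s k) (w i k) (w i k) <= M + 1 &
  forall i C e, 0 < e -> exists2 d, 0 < d & exists K, forall k z, (K <= k)%N -> D z ->
    nrm z <= d -> B (s k) z z <= C -> `|B (s k) (w i k) z| <= e].
Proof.
(* Pairs [(i, k)] are coded by natural numbers to extract along all of them at once; numbers that
   code no pair get the value 0. *)
have lowb (jk : nat) h : `|oapp (fun ik : I * nat => low h ik.1 ik.2) 0 (unpickle jk)| <= `|M|.
  case: (unpickle jk) => [[i k]|] /=; last by rewrite normr0.
  by rewrite ger0_norm// (le_trans (low_leM _ _ _)) ?ler_norm.
have [s0 s0i s0c] := bounded_diagonal lowb.
have cl i k : cvgn (fun h => low (s0 h) i k).
  by have := s0c (pickle (i, k)); rewrite /comp pickleK.
pose J i k := limn (fun h => low (s0 h) i k).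
have JP i k : low (s0 h) i k @[h --> \oo] --> J i k by exact: cl.
have Jnd i : {homo J i : k j / (k <= j)%N >-> k <= j}.
  move=> k j kj; apply: ler_lim => //; apply: nearW => h; exact: low_nd.
have JM i k : J i k <= M.
  by apply: limr_le => //; apply: nearW => h; exact: low_leM.
have Jub i : has_ubound (range (J i)) by exists M => _ [k _ <-].
pose Joo i := sup (range (J i)).
have JJoo i k : J i k <= Joo i by apply: ub_le_sup => //; exists k.
have step k N : exists t, (N < t)%N /\ forall i, low (s0 t) i k <= J i k + k.+1%:R^-1.
  have : \forall t \near \oo, forall i, low (s0 t) i k <= J i k + k.+1%:R^-1.
    apply: filter_forall => i; have k0 : 0 < k.+1%:R^-1 :> R by rewrite invr_gt0.
    have := JP i k => /cvgrPdist_le/(_ _ k0); apply: filterS => t.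
    by rewrite distrC ler_distl => /andP[].
  by move=> [t0 _ tP]; exists (maxn t0 N.+1); split; [exact: leq_maxr|apply: tP; exact: leq_maxl].
have /choice[F FP] : forall kN : nat * nat, exists t, (kN.2 < t)%N /\
    forall i, low (s0 t) i kN.1 <= J i kN.1 + kN.1.+1%:R^-1.
  by move=> [k N]; exact: step.
pose t := fix t k := if k is j.+1 then F (k, t j) else F (0%N, 0%N).
have ti : increasing_nat t by apply: increasing_natS => k /=; have [] := FP (k.+1, t k).
have tP k i : low (s0 (t k)) i k <= J i k + k.+1%:R^-1.
  by case: k => [|k] /=; [have [_] := FP (0%N, 0%N)|have [_] := FP (k.+1, t k)]; apply.
pose s := s0 \o t.
have /choice[w wP] : forall ik : I * nat, exists v, [/\ D v, nrm (v - l ik.1) <= ik.2.+1%:R^-1 &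
    B (s ik.2) v v <= low (s ik.2) ik.1 ik.2 + ik.2.+1%:R^-1 /\ B (s ik.2) v v <= M + 1].
  move=> [i k] /=; have k0 : 0 < k.+1%:R^-1 :> R by rewrite invr_gt0.
  have [_ [v [Dv vl] <-] vlow] := inf_adherent k0 (near_set_inf (s k) i k).
  exists v; split => //; split; first exact: ltW.
  rewrite (le_trans (ltW vlow))// lerD//; first exact: low_leM.
  by rewrite invf_le1// ler1n.
exists s, (fun i k => w (i, k)); split.
- exact: increasing_nat_comp.
- by move=> i k; have [] := wP (i, k).
- by move=> i k; have [] := wP (i, k).
- by move=> i k; have [_ _ []] := wP (i, k).
move=> i C e e0.
(* The length of the perturbation: with it the quadratic term tau^2 C is at most tau e, so that
   dividing the final inequality by 2 tau leaves exactly [e]. *)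
pose tau := e / (`|C| + 1).
have C1 : 0 < `|C| + 1 by rewrite ltr_wpDl.
have tau0 : 0 < tau by rewrite divr_gt0.
have eta0 : 0 < e * tau / 4 by rewrite divr_gt0// mulr_gt0.
have hs : has_sup (range (J i)) by split => //; exists (J i 0), 0%N.
have [_ [K' _ <-] JK'] := sup_adherent eta0 hs.
(* Half the radius of the fixed ball is reserved for the distance from [w] to [l i], the other half
   for tau times the norm of [z]. *)
have d0 : 0 < (2 * K'.+1%:R)^-1 :> R by rewrite invr_gt0 mulr_gt0.
exists ((2 * K'.+1%:R)^-1 / tau); first by rewrite divr_gt0.
have n1 : \forall k \near \oo, J i K' - e * tau / 4 <= low (s k) i K'.
  have /cvgrPdist_le/(_ _ eta0) : low (s0 (t k)) i K' @[k --> \oo] --> J i K'.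
    exact: (cvg_comp _ _ (increasing_nat_cvg ti) (JP i K')).
  by apply: filterS => k; rewrite distrC ler_distl => /andP[].
have n2 : \forall k \near \oo, k.+1%:R^-1 <= e * tau / 4 :> R.
  near=> k; apply: ltW; near: k; exact: near_infty_natSinv_lt (PosNum eta0).
have n3 : \forall k \near \oo, k.+1%:R^-1 <= (2 * K'.+1%:R)^-1 :> R.
  near=> k; apply: ltW; near: k; exact: near_infty_natSinv_lt (PosNum d0).
have [K _ KP] := filterI n1 (filterI n2 n3).
exists K => k z /KP[k1 [k2 k3]] Dz zd Cz.
have [Dw wl [wlow _]] := wP (i, k); rewrite /= in Dw wl wlow.
have key a : `|a| = tau -> - (2 * a * B (s k) (w (i, k)) z) <= e * tau / 4 * 4 + tau ^+ 2 * C.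
  move=> a_tau.
  have Dwz : D (a *: z + w (i, k)) by exact: D_lin.
  have : nrm (a *: z + w (i, k) - l i) <= K'.+1%:R^-1.
    have Dwl : D (w (i, k) - l i) by rewrite addrC -scaleN1r; exact: D_lin.
    rewrite -addrA (le_trans (nrm_tri _ _ _))// a_tau.
    have -> : K'.+1%:R^-1 = (2 * K'.+1%:R)^-1 + (2 * K'.+1%:R)^-1 :> R by field.
    apply: lerD; last exact: le_trans wl k3.
    by rewrite mulrC -ler_pdivlMr.
  move/(low_le (s k) Dwz); rewrite B_expand// => h1.
  have h2 := tP k i; have h3 := JJoo i k.
  rewrite -/(Joo i) in JK'.
  have h4 : a ^+ 2 = tau ^+ 2 by rewrite -a_tau real_normK// num_real.
  have h5 : a ^+ 2 * B (s k) z z <= tau ^+ 2 * C by rewrite h4 ler_wpM2l// sqr_ge0.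
  move: h1 h2 h3 h5 k1 k2 wlow JK'; rewrite /s /=.
  move: (B _ _ _) (B _ _ _) (B _ _ _) => b1 b2 b3.
  move: (low _ _ _) (low _ _ _) (J i k) (J i K') (Joo i) k.+1%:R^-1 (e * tau / 4) (tau ^+ 2 * C) (a ^+ 2 * b1).
  move=> x1 x2 x3 x4 x5 x6 x7 x8 x9 h1' h2' h3' h4' h5' h6' h7' h8'.
  have -> : 2 * a * b2 = 2 * (a * b2) by rewrite mulrA.
  lra.
have tC : tau * C <= e.
  rewrite (le_trans (ler_wpM2l (ltW tau0) (ler_norm C)))//.
  by rewrite /tau -mulrAC ler_pdivrMr// ler_wpM2l// ?lerDl// ltW.
have kp := key tau (gtr0_norm tau0).
have kn : 2 * tau * B (s k) (w (i, k)) z <= e * tau / 4 * 4 + tau ^+ 2 * C.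
  have := key (- tau); rewrite normrN gtr0_norm// => /(_ erefl).
  by rewrite mulrN mulNr opprK.
have t2C : tau ^+ 2 * C <= tau * e by rewrite expr2 -mulrA ler_wpM2l// ltW.
move: kp kn t2C; move: (B _ _ _) => b kp kn t2C.
by rewrite ler_norml -(ler_pM2l tau0) -[b <= e](ler_pM2l tau0); apply/andP; split; lra.
Unshelve. all: by end_near. Qed.

End correctors.

(** * L^p membership and convergence through integrals of p-th powers *)

Section Lp_bridge.
Context {R : realType} {n : nat}.
Local Notation mu := (lebesgue_rV R n).
Local Notation intg f := (mu.-integrable setT (EFin \o f)).
Implicit Types (f g u v : 'rV[R]_n -> R) (x : 'rV[R]_n) (A Omega : set 'rV[R]_n) (p : R).

Lemma measurable_normpowR f p : measurable_fun setT f ->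
  measurable_fun setT (fun x => `|f x| `^ p).
Proof.
move=> mf; apply: (measurableT_comp (f := fun t : R => t `^ p)).
  exact: measurable_powR.
exact: measurableT_comp.
Qed.

Lemma Lnorm_powR_integral f p : p != 0 ->
  ('N[mu]_p%:E[EFin \o f] `^ p = \int[mu]_x (`|f x| `^ p)%:E)%E.
Proof.
by move=> p0; rewrite powR_Lnorm//; apply: eq_integral => x _; rewrite poweR_EFin.
Qed.

Lemma mem_LfunP f p : 1 <= p -> (f \in Lfun mu p%:E) <->
  measurable_fun setT f /\ intg (fun x => `|f x| `^ p).
Proof.
move=> p1; have p0 : 0 < p by exact: lt_le_trans p1.
have key : measurable_fun setT f -> finite_norm mu p%:E f <-> intg (fun x => `|f x| `^ p).
  move=> mf; rewrite ge0_intgP//; last exact: measurable_normpowR.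
  rewrite -Lnorm_powR_integral ?gt_eqF// /finite_norm; split => H.
    exact: poweR_lty.
  by apply: lty_poweRy H; rewrite gt_eqF.
split.
  rewrite inE => /andP[]; rewrite inE /= => mf; rewrite inE /= => fN.
  by split => //; apply/key.
by move=> [mf fi]; rewrite inE; apply/andP; split; rewrite inE//=; apply/key.
Qed.

Lemma inLpP p A u : 1 <= p -> inLp p A u <->
  measurable_fun setT (u \_ A) /\ intg (fun x => `|(u \_ A) x| `^ p).
Proof. exact: mem_LfunP. Qed.

Lemma inLp2P A u : inLp 2 A u <-> L2 (u \_ A).
Proof.
rewrite inLpP ?ler1n// /L2.
suff -> : (fun x => `|(u \_ A) x| `^ 2) = (fun x => (u \_ A) x ^+ 2) by [].
by apply/funext => x; rewrite powR_mulrn// real_normK// num_real.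
Qed.

Lemma powR_ge_linear p (t : R) : 1 <= p -> `|t| <= 1 + `|t| `^ p.
Proof.
move=> p1; have [t1|t1] := leP `|t| 1; first by rewrite (le_trans t1)// lerDl powR_ge0.
by rewrite (le_trans (le1r_powR (ltW t1) p1))// lerDr.
Qed.

Lemma intg_powR f p A : 1 <= p -> measurable A -> (mu A < +oo)%E -> measurable_fun setT f ->
  intg (fun x => `|f x| `^ p) -> (forall x, ~ A x -> f x = 0) -> intg f.
Proof.
move=> p1 mA Aoo mf fp f0; apply: (intg_le mf (intgD (intg_indic mA Aoo) fp)) => x.
rewrite [leRHS]ger0_norm ?addr_ge0 ?powR_ge0//.
rewrite indicE; have [_|/negP] := boolP (x \in A); first exact: powR_ge_linear.
by rewrite inE => /f0 ->; rewrite normr0 add0r powR_ge0.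
Qed.

Lemma patch_out A u x : ~ A x -> (u \_ A) x = 0.
Proof. by move=> Ax; rewrite patchE memNset. Qed.

Lemma inLp_intg p A u : 1 <= p -> measurable A -> (mu A < +oo)%E -> inLp p A u -> intg (u \_ A).
Proof.
move=> p1 mA Aoo /(inLpP _ _ p1)[mu_ up].
exact: (intg_powR p1 mA Aoo mu_ up (@patch_out A u)).
Qed.

Lemma patch_patch A Omega u : A `<=` Omega -> (u \_ Omega) \_ A = u \_ A.
Proof.
move=> AO; apply/funext => x; rewrite !patchE; case: ifPn => // xA.
by rewrite mem_set//; apply: AO; rewrite inE in xA.
Qed.

Lemma patch_indic A u : u \_ A = (fun x => u x * \1_A x).
Proof. by apply/funext => x; rewrite patchE indicE; case: ifP; rewrite ?mulr1 ?mulr0. Qed.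

Lemma inLp_sub p A Omega u : 1 <= p -> measurable A -> A `<=` Omega -> inLp p Omega u -> inLp p A u.
Proof.
move=> p1 mA AO /(inLpP _ _ p1)[mu_ up]; apply/inLpP => //.
have mv : measurable_fun setT (u \_ A).
  rewrite -(patch_patch u AO) (patch_indic A (u \_ Omega)).
  by apply: measurable_funM; [exact: mu_|exact: measurable_indic].
split => //; apply: (intg_le _ up); first exact: measurable_normpowR.
move=> x; rewrite (ger0_norm (powR_ge0 _ _)) (ger0_norm (powR_ge0 _ _)).
have [Ax|Ax] := pselect (A x); first by rewrite !patchE !mem_set//; exact: AO.
rewrite (patch_out _ Ax). by rewrite normr0 powR0 ?powR_ge0// gt_eqF// (lt_le_trans _ p1).
Qed.

Lemma Lnorm_lt f p (e : R) : 1 <= p -> 0 < e ->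
  ('N[mu]_p%:E[EFin \o f] < e%:E)%E <-> (\int[mu]_x (`|f x| `^ p)%:E < (e `^ p)%:E)%E.
Proof.
move=> p1 e0; have p0 : 0 < p by exact: lt_le_trans p1.
rewrite -Lnorm_powR_integral ?gt_eqF//.
have := Lnorm_ge0 mu p%:E (EFin \o f).
case: ('N[mu]_p%:E[EFin \o f])%E => [r| |]//=; last first.
  by rewrite (gt_eqF p0).
rewrite lee_fin !lte_fin => r0; split => H.
  by apply: gt0_ltr_powR => //; rewrite nnegrE// ltW.
rewrite ltNge; apply/negP => er; move: H; apply/negP; rewrite -leNgt.
by apply: ge0_ler_powR; rewrite ?nnegrE// ltW.
Qed.

Lemma cvgLpP p A (u_ : nat -> 'rV[R]_n -> R) u : 1 <= p -> cvgLp p A u_ u <->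
  (forall e, 0 < e -> \forall h \near \oo,
     (\int[mu]_x (`|((fun y => u_ h y - u y)%R \_ A) x| `^ p)%:E < e%:E)%E).
Proof.
move=> p1; have p0 : 0 < p by exact: lt_le_trans p1.
have pe (e : R) : 0 < e -> (e `^ p^-1) `^ p = e.
  by move=> e0; rewrite -powRrM mulVf ?gt_eqF// powRr1// ltW.
have H0 h := Lnorm_ge0 mu p%:E (EFin \o ((fun y => u_ h y - u y)%R \_ A)).
split => [H e e0|H].
  have e1 : 0 < e `^ p^-1 by rewrite powR_gt0.
  have [fin c0] := iffLR (fine_cvgP _ (0 : R)) H.
  have /(_ _)c := iffLR (cvgrPdist_lt _ _) c0 _ e1.
  apply: filterS2 fin c => h fh.
  rewrite /= sub0r normrN (ger0_norm (fine_ge0 (H0 h))) => ch.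
  rewrite -[e]pe//; apply/(Lnorm_lt _ p1 e1).
  by rewrite -(fineK fh) lte_fin.
apply: (iffRL (fine_cvgP _ (0 : R))); have fin : \forall h \near \oo,
    'N[mu]_p%:E[EFin \o ((fun y => u_ h y - u y)%R \_ A)]%E \is a fin_num.
  have := H 1 ltr01; apply: filterS => h.
  rewrite -[1](@pe 1)// => /(Lnorm_lt _ p1); rewrite powR_gt0// => /(_ isT) h1.
  by rewrite ge0_fin_numE// (lt_trans h1) ?ltry.
split; first exact: fin.
apply/cvgrPdist_lt => e e0.
apply: filterS2 fin (H (e `^ p) (powR_gt0 p e0)) => h fh.
move=> /(Lnorm_lt _ p1 e0) => h1.
by rewrite /= sub0r normrN (ger0_norm (fine_ge0 (H0 h))) -lte_fin fineK.
Qed.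

End Lp_bridge.

(** * The gradient along X as a relation *)

Section gradient_relation.
Context {R : realType} {n m : nat}.
Local Notation mu := (lebesgue_rV R n).
Local Notation intg f := (mu.-integrable setT (EFin \o f)).
Variables (Omega : set 'rV[R]_n) (X : 'I_m -> 'rV[R]_n -> 'rV[R]_n) (p : R).
Hypotheses (oO : open Omega) (bO : bounded_set Omega) (p1 : 1 <= p)
  (vX : forall j, vfield Omega (X j)).
Implicit Types (u v : 'rV[R]_n -> R) (A B : set 'rV[R]_n) (G H : 'I_m -> 'rV[R]_n -> R).

(** A relation instead of the function [Xgrad], so that any representative of the gradient may be
    used; [functionalE] shows that the functional takes the same value on all of them. *)
Definition isgrad A v G := inLp p A v /\
  forall j, inLp p A (G j) /\ wderiv (X j) A v (G j).

Let mO : measurable Omega. Proof. exact: open_measurable_rV. Qed.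

Lemma open_in_measurable A : open_in Omega A -> measurable A.
Proof. by case=> oA _; exact: open_measurable_rV. Qed.

Lemma open_in_lty A : open_in Omega A -> (mu A < +oo)%E.
Proof.
move=> oA; apply: bounded_lebesgue_rV_lty; first exact: open_in_measurable.
exact: bounded_setS oA.2 bO.
Qed.

Lemma inLp_intg_in A v : open_in Omega A -> inLp p A v -> intg (v \_ A).
Proof.
by move=> oA; apply: inLp_intg => //; [exact: open_in_measurable|exact: open_in_lty].
Qed.

Lemma distr_derivsP A v j g : open_in Omega A -> inLp p A v ->
  distr_derivs p (X j) A v g <-> inLp p A g /\ wderiv (X j) A v g.
Proof.
move=> oA vA; split => -[gA H]; split => //.
  by apply/(is_distr_derivP oO (vX j) oA.2) => //; exact: inLp_intg_in.
by apply/(is_distr_derivP oO (vX j) oA.2) => //; exact: inLp_intg_in.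
Qed.

Lemma isgrad_W1X A v G : open_in Omega A -> isgrad A v G -> W1X p X A v.
Proof.
move=> oA [vA GA]; split => // j; exists (G j); apply/distr_derivsP => //.
Qed.

Lemma W1X_isgrad A v : open_in Omega A -> W1X p X A v ->
  isgrad A v (fun j x => Xgrad p X A v x ord0 j).
Proof.
move=> oA [vA H]; split => // j; apply/distr_derivsP => //.
rewrite (_ : (fun x => _) = xget (cst 0) (distr_derivs p (X j) A v)).
  by have [g Hg] := H j; apply: xgetPex; exists g.
by apply/funext => x; rewrite mxE.
Qed.

Lemma isgrad_uniq A v G H : open_in Omega A -> isgrad A v G -> isgrad A v H ->
  {ae mu, forall x, A x -> forall j, G j x = H j x}.
Proof.
move=> oA [vA GA] [_ HA].
have : {ae mu, forall x, forall j, A x -> G j x = H j x}.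
  apply: ae_forall_countType => j; have [Gj wG] := GA j; have [Hj wH] := HA j.
  exact: (wderiv_uniq oA.1 (inLp_intg_in oA Gj) (inLp_intg_in oA Hj) wG wH).
by apply: ae_imp => x h Ax j; exact: h.
Qed.

Lemma inLp_measurable A v : open_in Omega A -> inLp p A v -> measurable_fun A v.
Proof.
move=> oA /(inLpP _ _ p1)[mv _]; apply/(measurable_restrictT _ (open_in_measurable oA)).
exact: mv.
Qed.

Lemma measurable_grad A G : (forall j, measurable_fun A (G j)) -> measurable A ->
  measurable_fun A (fun x => (x, \row_j G j x)).
Proof.
move=> mG mA.
pose g x := \row_j (G j \_ A) x.
have mg : measurable_fun setT g.
  apply: measurable_fun_rV => j; under eq_fun do rewrite mxE.
  exact/(measurable_restrictT _ mA).
apply: (eq_measurable_fun (fun x => (x, g x))).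
  by move=> x xA; congr pair; apply/rowP => j; rewrite !mxE patchE xA.
apply: measurable_funTS; apply: measurable_fun_pair => //; exact: measurable_id.
Qed.

Lemma functionalE A v G (f : 'rV[R]_n -> 'rV[R]_m -> \bar R) : open_in Omega A ->
  measurable_fun (Omega `*` setT) (fun z : 'rV[R]_n * 'rV[R]_m => f z.1 z.2) ->
  isgrad A v G -> functional p X f v A = (\int[mu]_(x in A) f x (\row_j G j x))%E.
Proof.
move=> oA mf vG; have mA := open_in_measurable oA.
have vW := isgrad_W1X oA vG; rewrite /functional asboolT//.
have vX' := W1X_isgrad oA vW.
have mH H : isgrad A v H -> measurable_fun A (fun x => f x (\row_j H j x)).
  move=> [_ HA].
  apply: (@measurable_comp _ _ _ _ _ _ (Omega `*` [set: 'rV[R]_m])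
    (fun z : 'rV[R]_n * 'rV[R]_m => f z.1 z.2) A (fun x => (x, \row_j H j x))) => //.
  - exact: measurableX.
  - by move=> _ [x Ax <-]; split => //=; exact: oA.2.
  - apply: measurable_grad => // j; apply: inLp_measurable => //.
    by have [] := HA j.
have XE x : \row_j Xgrad p X A v x ord0 j = Xgrad p X A v x.
  by apply/rowP => j; rewrite mxE.
under eq_integral do rewrite -XE.
apply: ae_eq_integral => //; [exact: (mH _ vX')|exact: mH|].
apply: ae_imp (isgrad_uniq oA vX' vG) => x h Ax; congr (f x _).
by apply/rowP => j; rewrite [LHS]mxE [RHS]mxE; exact: h.
Qed.

(** Functions that agree almost everywhere on [A] have the same set of distributional derivatives
    there, so [xget] selects the same representative for both. *)
Lemma functional_local (f : 'rV[R]_n -> 'rV[R]_m -> \bar R) :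
  local_functional p Omega (functional p X f).
Proof.
move=> u v A uO vO oA uv; have mA := open_in_measurable oA.
have uA := inLp_sub p1 mA oA.2 uO; have vA := inLp_sub p1 mA oA.2 vO.
have uv' : {ae mu, forall x, A x -> u x = v x} by exact: uv.
have vu' : {ae mu, forall x, A x -> v x = u x} by apply: ae_imp uv' => x h /h.
have DE j : distr_derivs p (X j) A u = distr_derivs p (X j) A v.
  apply/seteqP; split => g.
    move=> /(distr_derivsP _ _ oA uA)[gA H]; apply/(distr_derivsP _ _ oA vA); split => //.
    apply: (wderiv_ae oO (vX j) oA.2 mA _ _ _ _ uv' _ H); try exact: inLp_intg_in.
    exact: aeW.
  move=> /(distr_derivsP _ _ oA vA)[gA H]; apply/(distr_derivsP _ _ oA uA); split => //.
  apply: (wderiv_ae oO (vX j) oA.2 mA _ _ _ _ vu' _ H); try exact: inLp_intg_in.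
  exact: aeW.
have WE : W1X p X A u <-> W1X p X A v.
  by split => -[_ H]; split => // j; have := H j; rewrite DE.
rewrite /functional; have -> : `[< W1X p X A u >] = `[< W1X p X A v >].
  by apply/asboolP/asboolP => /WE.
have -> : Xgrad p X A u = Xgrad p X A v; last by [].
by apply/funext => x; apply/rowP => j; rewrite [LHS]mxE [RHS]mxE DE.
Qed.

End gradient_relation.

(** * Elliptic coefficients and vector fields in L^2 *)

Section finite_dimensional_forms.
Context {R : realType} {m : nat}.
Implicit Types (v w : 'I_m -> R) (b : 'M[R]_m) (c : R).

Definition dot v w := \sum_j v j * w j.
Definition mulv b v : 'I_m -> R := fun j => \sum_i b j i * v i.

Lemma dot_lin c v v' w : dot (c *: v + v') w = c * dot v w + dot v' w.
Proof.
rewrite /dot mulr_sumr -big_split; apply: eq_bigr => j _ /=.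
by rewrite -[(c *: v + v') j]/(c * v j + v' j); ring.
Qed.

Lemma dotC v w : dot v w = dot w v.
Proof. by apply: eq_bigr => j _; rewrite mulrC. Qed.

Lemma dot_ge0 v : 0 <= dot v v.
Proof. by apply: sumr_ge0 => j _; rewrite -expr2 sqr_ge0. Qed.

Lemma dot_eq0 v : dot v v = 0 -> forall j, v j = 0.
Proof.
move=> /eqP; rewrite psumr_eq0 => [|j _]; last by rewrite -expr2 sqr_ge0.
by move=> /allP v0 j; have := v0 j (mem_index_enum j); rewrite mulf_eq0 orbb => /eqP.
Qed.

Lemma mulv_lin b c v w : mulv b (c *: v + w) = c *: mulv b v + mulv b w.
Proof.
apply/funext => j; rewrite -[RHS]/(c * _ + _) /mulv mulr_sumr -big_split.
by apply: eq_bigr => i _ /=; rewrite -[(c *: v + w) i]/(c * v i + w i); ring.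
Qed.

Lemma dot_mulv b v w : dot (mulv b v) w = \sum_i \sum_j b i j * v j * w i.
Proof. by apply: eq_bigr => i _; rewrite mulr_suml. Qed.

Lemma mulv_sym b v w : b^T = b -> dot (mulv b v) w = dot (mulv b w) v.
Proof.
move=> bT; rewrite !dot_mulv exchange_big; apply: eq_bigr => i _; apply: eq_bigr => j _.
by rewrite -{1}bT mxE; ring.
Qed.

Definition elliptic c0 c1 b := b^T = b /\
  forall v, c0 * dot v v <= dot (mulv b v) v <= c1 * dot v v.

Lemma elliptic_cauchy_schwarz c0 c1 b v w : 0 < c0 -> elliptic c0 c1 b ->
  dot (mulv b v) w ^+ 2 <= dot (mulv b v) v * dot (mulv b w) w.
Proof.
move=> c00 [bT bb].
apply: (@ip_cauchy_schwarz R ('I_m -> R) setT (fun v w => dot (mulv b v) w)) => //.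
- by move=> a u u' x _ _ _; rewrite mulv_lin dot_lin.
- by move=> u u' _ _; exact: mulv_sym.
- by move=> u _; have /andP[+ _] := bb u; apply: le_trans; rewrite mulr_ge0 ?dot_ge0// ltW.
Qed.

(** Cauchy-Schwarz for the form of [b], applied to [v] and [b v], gives |b v|^4 <= <b v, v> <b b v,
    b v> <= <b v, v> c1 |b v|^2. Stated through the flux, the upper bound survives weak convergence
    of fluxes with the same constant. *)
Lemma elliptic_sqr_le c0 c1 b v : 0 < c0 -> elliptic c0 c1 b ->
  dot (mulv b v) (mulv b v) <= c1 * dot (mulv b v) v.
Proof.
move=> c00 be; have := elliptic_cauchy_schwarz v (mulv b v) c00 be.
have /andP[_] := be.2 (mulv b v); have /andP[] := be.2 v.
have := dot_ge0 (mulv b v); have := dot_ge0 v.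
move: (dot v v) (dot (mulv b v) (mulv b v)) (dot (mulv b v) v) (dot (mulv b (mulv b v)) (mulv b v)) => d s t r.
move=> d0 s0 dt td rs st; have t0 : 0 <= t by apply: le_trans dt; rewrite mulr_ge0// ltW.
have [->|sn] := eqVneq s 0.
  have [t00|tn] := eqVneq t 0; first by rewrite t00 mulr0.
  have tp : 0 < t by rewrite lt_def tn.
  have cd : 0 < c1 * d by exact: lt_le_trans td.
  rewrite mulr_ge0// leNgt; apply/negP => c10.
  by move: cd; apply/negP; rewrite -leNgt mulr_le0_ge0// ltW.
have sp : 0 < s by rewrite lt_def sn.
rewrite -(ler_pM2r sp) -expr2 (le_trans st)// (_ : c1 * t * s = t * (c1 * s)); last by ring.
by apply: ler_wpM2l.
Qed.

Lemma dot_delta i v : dot v (fun j => (j == i)%:R) = v i.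
Proof.
rewrite /dot (bigD1 i)//= eqxx mulr1 big1 ?addr0// => j /negPf ->.
by rewrite mulr0.
Qed.

Lemma mulv_delta b i j : mulv b (fun k => (k == i)%:R) j = b j i.
Proof. exact: dot_delta. Qed.

Lemma elliptic_entry_le c0 c1 b i j : 0 < c0 -> elliptic c0 c1 b -> `|b i j| <= c1.
Proof.
move=> c00 be; have := elliptic_cauchy_schwarz (fun k => (k == j)%:R) (fun k => (k == i)%:R) c00 be.
have := be.2 (fun k => (k == j)%:R); have := be.2 (fun k => (k == i)%:R).
rewrite !dot_delta !mulv_delta !eqxx !mulr1 => /andP[i0 i1] /andP[j0 j1] h.
have ii0 : 0 <= b i i by rewrite (le_trans _ i0)// ltW.
have jj0 : 0 <= b j j by rewrite (le_trans _ j0)// ltW.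
have c10 : 0 <= c1 by exact: le_trans i1.
rewrite -(ler_pXn2r (ltn0Sn 1)) ?nnegrE// real_normK ?num_real// (le_trans h)//.
by rewrite expr2 ler_pM.
Qed.

End finite_dimensional_forms.

(** * Square-integrable fields and their fluxes *)

Section vector_L2.
Context {R : realType} {n m : nat}.
Local Notation mu := (lebesgue_rV R n).
Local Notation intg f := (mu.-integrable setT (EFin \o f)).
Implicit Types (V W U : 'I_m -> 'rV[R]_n -> R) (phi : 'rV[R]_n -> R) (A : set 'rV[R]_n)
  (b : 'rV[R]_n -> 'M[R]_m).

Definition vL2 V := forall j, L2 (V j).
Definition vip V W := \sum_j ip (V j) (W j).
Definition smul phi V : 'I_m -> 'rV[R]_n -> R := fun j x => phi x * V j x.
Definition flux b V : 'I_m -> 'rV[R]_n -> R := fun j x => \sum_i b x j i * V i x.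

Lemma vL2_lin a V W : vL2 V -> vL2 W -> vL2 (a *: V + W).
Proof. by move=> hV hW j; exact: L2_lin. Qed.

Lemma vL2B V W : vL2 V -> vL2 W -> vL2 (V - W).
Proof. by move=> hV hW; have := vL2_lin (-1) hW hV; rewrite scaleN1r addrC. Qed.

Lemma vL2D V W : vL2 V -> vL2 W -> vL2 (V + W).
Proof. by move=> hV hW; have := vL2_lin 1 hV hW; rewrite scale1r. Qed.

Lemma L2_0 : L2 (0 : 'rV[R]_n -> R).
Proof.
split; first exact: measurable_cst.
have -> : (fun x : 'rV[R]_n => (0 : 'rV[R]_n -> R) x ^+ 2) = cst 0.
  by apply/funext => x; rewrite -[_ ^+ 2]/(0 ^+ 2) expr0n.
exact: integrable0.
Qed.

Lemma vL2_sum (I : Type) (r : seq I) (V : I -> 'I_m -> 'rV[R]_n -> R) :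
  (forall i, vL2 (V i)) -> vL2 (\sum_(i <- r) V i).
Proof.
move=> hV; elim: r => [|i r IH]; first by rewrite big_nil => j; exact: L2_0.
by rewrite big_cons; exact: vL2D.
Qed.

Lemma vip_lin a V V' W : vL2 V -> vL2 V' -> vL2 W ->
  vip (a *: V + V') W = a * vip V W + vip V' W.
Proof.
move=> hV hV' hW; rewrite /vip mulr_sumr -big_split; apply: eq_bigr => j _.
exact: ip_lin.
Qed.

Lemma vipC V W : vip V W = vip W V.
Proof. by apply: eq_bigr => j _; exact: ipC. Qed.

Lemma vip_linr a V V' W : vL2 V -> vL2 V' -> vL2 W ->
  vip W (a *: V + V') = a * vip W V + vip W V'.
Proof. by move=> hV hV' hW; rewrite vipC vip_lin// !(vipC W). Qed.

Lemma vipDl V V' W : vL2 V -> vL2 V' -> vL2 W -> vip (V + V') W = vip V W + vip V' W.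
Proof. by move=> hV hV' hW; have := vip_lin 1 hV hV' hW; rewrite scale1r mul1r. Qed.

Lemma vipDr V V' W : vL2 V -> vL2 V' -> vL2 W -> vip W (V + V') = vip W V + vip W V'.
Proof. by move=> hV hV' hW; have := vip_linr 1 hV hV' hW; rewrite scale1r mul1r. Qed.

Lemma vipBl V V' W : vL2 V -> vL2 V' -> vL2 W -> vip (V - V') W = vip V W - vip V' W.
Proof.
move=> hV hV' hW; have := vip_lin (-1) hV' hV hW.
by rewrite scaleN1r mulN1r addrC => ->; rewrite addrC.
Qed.

Lemma vipBr V V' W : vL2 V -> vL2 V' -> vL2 W -> vip W (V - V') = vip W V - vip W V'.
Proof. by move=> hV hV' hW; rewrite vipC vipBl// !(vipC W). Qed.

Lemma vip_suml (I : Type) (r : seq I) (V : I -> 'I_m -> 'rV[R]_n -> R) W :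
  (forall i, vL2 (V i)) -> vL2 W -> vip (\sum_(i <- r) V i) W = \sum_(i <- r) vip (V i) W.
Proof.
move=> hV hW; elim: r => [|i r IH]; last by rewrite !big_cons vipDl ?IH//; exact: vL2_sum.
rewrite !big_nil /vip big1// => j _.
by rewrite /ip; under eq_Rintegral do rewrite mul0r; rewrite Rintegral_cst ?mul0r.
Qed.

Lemma vip_ge0 V : 0 <= vip V V.
Proof. by apply: sumr_ge0 => j _; exact: ip_ge0. Qed.

Lemma vip_cauchy_schwarz V W : vL2 V -> vL2 W -> vip V W ^+ 2 <= vip V V * vip W W.
Proof.
apply: (@ip_cauchy_schwarz R ('I_m -> 'rV[R]_n -> R) [set V | vL2 V] vip) => //=.
- by move=> a u v; exact: vL2_lin.
- by move=> a u v w; exact: vip_lin.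
- by move=> u v _ _; exact: vipC.
- by move=> u _; exact: vip_ge0.
Qed.

Lemma cvg_sumr (I : Type) (r : seq I) (F : I -> nat -> R) (l : I -> R) :
  (forall i, F i k @[k --> \oo] --> l i) ->
  (fun k => \sum_(i <- r) F i k) @ \oo --> \sum_(i <- r) l i.
Proof.
move=> Fl; elim: r => [|i r IH].
  rewrite big_nil; under eq_fun do rewrite big_nil; exact: cvg_cst.
by rewrite big_cons; under eq_fun do rewrite big_cons; apply: cvgD.
Qed.

Lemma L2_bounded_mul phi f (M : R) : measurable_fun setT phi -> (forall x, `|phi x| <= M) ->
  L2 f -> L2 (fun x => phi x * f x).
Proof.
move=> mp pM [mf f2]; split; first exact: measurable_funM.
have -> : (fun x => (phi x * f x) ^+ 2) = (fun x => f x ^+ 2 * phi x ^+ 2).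
  by apply/funext => x; rewrite exprMn mulrC.
apply: (intgM_bounded f2 (M := M ^+ 2)); first exact: measurable_funX.
by move=> x; rewrite normrX lerXn2r// nnegrE// (le_trans _ (pM x)).
Qed.

Lemma vL2_smul phi V (M : R) : measurable_fun setT phi -> (forall x, `|phi x| <= M) ->
  vL2 V -> vL2 (smul phi V).
Proof. by move=> mp pM hV j; exact: (L2_bounded_mul mp pM). Qed.

Lemma vip_smul phi V W : vip (smul phi V) W = vip V (smul phi W).
Proof.
apply: eq_bigr => j _; apply: eq_Rintegral => x _.
by rewrite /smul mulrCA mulrA.
Qed.

Lemma vip_dot V W : vL2 V -> vL2 W -> vip V W = \int[mu]_x dot (V ^~ x) (W ^~ x).
Proof. by move=> hV hW; rewrite Rintegral_sum// => j; exact: L2_mul. Qed.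

Lemma intg_dot V W : vL2 V -> vL2 W -> intg (fun x => dot (V ^~ x) (W ^~ x)).
Proof. by move=> hV hW; apply: intg_sum => j; exact: L2_mul. Qed.

Lemma fluxE b V x : (flux b V) ^~ x = mulv (b x) (V ^~ x).
Proof. by []. Qed.

Lemma flux_lin b a V W : flux b (a *: V + W) = a *: flux b V + flux b W.
Proof. by apply/funext => j; apply/funext => x; exact: (congr1 (@^~ j) (mulv_lin _ _ _ _)). Qed.

Lemma flux_smul b phi V : flux b (smul phi V) = smul phi (flux b V).
Proof.
apply/funext => j; apply/funext => x; rewrite /flux /smul mulr_sumr.
by apply: eq_bigr => i _; ring.
Qed.

Lemma fluxD b V W : flux b (V + W) = flux b V + flux b W.
Proof. by have := flux_lin b 1 V W; rewrite !scale1r. Qed.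

Lemma fluxB b V W : flux b (V - W) = flux b V - flux b W.
Proof. by have := flux_lin b (-1) W V; rewrite !scaleN1r addrC => ->; rewrite addrC. Qed.

Lemma flux_sum b (I : Type) (r : seq I) (V : I -> 'I_m -> 'rV[R]_n -> R) :
  flux b (\sum_(i <- r) V i) = \sum_(i <- r) flux b (V i).
Proof.
elim: r => [|i r IH]; last by rewrite !big_cons fluxD IH.
rewrite !big_nil; apply/funext => j; apply/funext => x.
by rewrite /flux big1// => i _; rewrite -[X in _ * X]/0 mulr0.
Qed.

Definition coefficients (c0 c1 : R) b :=
  (forall i j, measurable_fun setT (fun x => b x i j)) /\ forall x, elliptic c0 c1 (b x).

Section elliptic_coefficients.
Variables (c0 c1 : R) (b : 'rV[R]_n -> 'M[R]_m).
Hypotheses (c00 : 0 < c0) (cb : coefficients c0 c1 b).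

Lemma vL2_flux V : vL2 V -> vL2 (flux b V).
Proof.
move=> hV j; have -> : flux b V j = \sum_i ((fun x => b x j i * V i x) : 'rV[R]_n -> R).
  by apply/funext => x; rewrite fct_sumE.
elim/big_ind : _ => [|f g|i _]; first exact: L2_0.
  by move=> hf hg; have := L2_lin 1 hf hg; rewrite scale1r.
apply: (L2_bounded_mul (M := c1)) => //; first exact: cb.1.
by move=> x; apply: (elliptic_entry_le j i c00 (cb.2 x)).
Qed.

Lemma vip_flux_sym V W : vL2 V -> vL2 W -> vip (flux b V) W = vip (flux b W) V.
Proof.
move=> hV hW; rewrite !vip_dot//; try exact: vL2_flux.
by apply: eq_Rintegral => x _; rewrite !fluxE mulv_sym//; have [] := cb.2 x.
Qed.

Lemma le_RintegralT (f g : 'rV[R]_n -> R) : intg f -> intg g -> (forall x, f x <= g x) ->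
  \int[mu]_x f x <= \int[mu]_x g x.
Proof. by move=> hf hg fg; apply: le_Rintegral => // x _; exact: fg. Qed.

Lemma vip_flux_ge V : vL2 V -> c0 * vip V V <= vip (flux b V) V.
Proof.
move=> hV; have hF := vL2_flux hV; rewrite !vip_dot// -RintegralZl//; last exact: intg_dot.
apply: le_RintegralT; [exact/intgZ/intg_dot|exact: intg_dot|].
by move=> x; have [_ /(_ (V ^~ x))/andP[]] := cb.2 x.
Qed.

Lemma vip_flux_le V : vL2 V -> vip (flux b V) V <= c1 * vip V V.
Proof.
move=> hV; have hF := vL2_flux hV; rewrite !vip_dot// -RintegralZl//; last exact: intg_dot.
apply: le_RintegralT; [exact: intg_dot|exact/intgZ/intg_dot|].
by move=> x; have [_ /(_ (V ^~ x))/andP[]] := cb.2 x.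
Qed.

Lemma vip_flux_ge0 V : vL2 V -> 0 <= vip (flux b V) V.
Proof. by move=> hV; apply: le_trans (vip_flux_ge hV); rewrite mulr_ge0 ?vip_ge0// ltW. Qed.

Lemma vip_flux_flux V : vL2 V -> vip (flux b V) (flux b V) <= c1 * vip (flux b V) V.
Proof.
move=> hV; have hF := vL2_flux hV; rewrite !vip_dot// -RintegralZl//; last exact: intg_dot.
apply: le_RintegralT; [exact: intg_dot|exact/intgZ/intg_dot|].
by move=> x; rewrite fluxE; exact: elliptic_sqr_le c00 (cb.2 x).
Qed.

End elliptic_coefficients.

Definition vL2_on A : set ('I_m -> 'rV[R]_n -> R) :=
  [set V | vL2 V /\ forall j x, ~ A x -> V j x = 0].

Lemma vL2_dense A (S : set ('I_m -> 'rV[R]_n -> R)) : measurable A ->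
  subspace_of (vL2_on A) S ->
  (forall g, vL2_on A g -> (forall v, S v -> vip g v = 0) -> vip g g = 0) ->
  forall g e, vL2_on A g -> 0 < e -> exists2 v, S v & vip (g - v) (g - v) < e.
Proof.
move=> mA SS S0; apply: (@hilbert_dense R _ (vL2_on A) vip) => //.
- move=> a u v [u2 u0] [v2 v0]; split; first exact: vL2_lin.
  move=> j x Ax; rewrite -[LHS]/(a * u j x + v j x).
  by rewrite u0// v0// mulr0 addr0.
- by move=> a u v w [u2 _] [v2 _] [w2 _]; exact: vip_lin.
- by move=> u v _ _; exact: vipC.
- by move=> u _; exact: vip_ge0.
move=> u_ Du cauchy.
have /choice[v vP] : forall j, exists v : 'rV[R]_n -> R, L2 v /\
    ip (u_ k j - v) (u_ k j - v) @[k --> \oo] --> (0 : R).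
  move=> j; have [||v v2 vc] := @L2_complete R n (fun k => u_ k j); last by exists v.
    by move=> k; have [] := Du k.
  move=> e e0; have [N hN] := cauchy e e0; exists N => k l Nk Nl.
  apply: le_lt_trans (hN k l Nk Nl).
  by rewrite /vip (bigD1 j)//= lerDl sumr_ge0// => i _; exact: ip_ge0.
have v2 j : L2 (v j \_ A).
  have -> : v j \_ A = (fun x => \1_A x * v j x) by rewrite patch_indic; apply/funext => x; rewrite mulrC.
  apply: (L2_bounded_mul (M := 1)); [exact: measurable_indic| |by have [] := vP j].
  by move=> x; rewrite indicE normr_nat; case: (_ \in _).
exists (fun j => v j \_ A).
  by split => // j x; exact: patch_out.
have -> : (0 : R) = \sum_(j < m) 0 by rewrite big1.
apply: (@cvg_sumr _ _ (fun j k => ip (u_ k j - v j \_ A) (u_ k j - v j \_ A))) => j.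
have [vj2 vjc] := vP j.
apply: (squeeze_cvgr _ (cvg_cst 0) vjc); apply: nearW => k; rewrite ip_ge0/=.
have [uk2 uk0] := Du k.
have L2s (w : 'rV[R]_n -> R) : L2 w -> L2 (u_ k j - w).
  by move=> w2; have := L2_lin (-1) w2 (uk2 j); rewrite scaleN1r addrC.
rewrite !ip_sqr; apply: le_RintegralT; [by have [] := L2s _ (v2 j)|by have [] := L2s _ vj2|].
move=> x; rewrite -[(u_ k j - v j \_ A) x]/(u_ k j x - (v j \_ A) x) -[(u_ k j - v j) x]/(u_ k j x - v j x).
have [Ax|Ax] := pselect (A x); first by rewrite patchE mem_set.
by rewrite uk0// (patch_out _ Ax) subrr expr0n sqr_ge0.
Qed.

End vector_L2.

Lemma convex_functionP (R : realType) (E : lmodType R) (f : E -> R) :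
  convex_function setT f <-> forall (t : R) x y, 0 <= t <= 1 ->
    f (t *: x + (1 - t) *: y) <= t * f x + (1 - t) * f y.
Proof.
split => [H t x y /andP[t0 t1]|H t x y _ _].
  have := H (Itv01 t0 t1) x y (mem_setT _) (mem_setT _).
  by rewrite convRE /conv/= /unstable.onem.
rewrite convRE /conv/= /unstable.onem; apply: H.
by rewrite ge0 le1.
Qed.

(** * Quadratic integrands as measurable elliptic matrices *)

Section quadratic_integrands.
Context {R : realType} {n m : nat}.
Local Notation mu := (lebesgue_rV R n).
Local Notation intg f := (mu.-integrable setT (EFin \o f)).
Variables (Omega : set 'rV[R]_n) (c0 c1 : R).
Hypotheses (oO : open Omega) (c00 : 0 < c0) (c01 : c0 <= c1).
Implicit Types (f : 'rV[R]_n -> 'rV[R]_m -> \bar R) (b : 'rV[R]_n -> 'M[R]_m).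

Definition qform b (x : 'rV[R]_n) (eta : 'rV[R]_m) : R :=
  dot (mulv (b x) (eta ord0)) (eta ord0).

Lemma enorm_sqr k (v : 'rV[R]_k) : enorm v `^ 2 = dot (v ord0) (v ord0).
Proof.
rewrite powR_mulrn ?sqrtr_ge0// sqr_sqrtr; last by apply: sumr_ge0 => i _; exact: sqr_ge0.
by apply: eq_bigr => i _; rewrite expr2.
Qed.

Lemma elliptic_scalar c : c0 <= c <= c1 -> elliptic c0 c1 (c%:M : 'M[R]_m).
Proof.
move=> /andP[c0c cc1]; split; first exact: tr_scalar_mx.
move=> v; have -> : mulv c%:M v = c *: v + 0.
  apply/funext => j; rewrite addr0 /mulv (bigD1 j)//= big1 ?addr0.
    by rewrite mxE eqxx mulr1n.
  by move=> i ij; rewrite mxE eq_sym (negPf ij) mulr0n mul0r.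
rewrite dot_lin (_ : dot 0 v = 0) ?addr0; last by rewrite /dot big1// => j _; rewrite mul0r.
by rewrite !ler_wpM2r// dot_ge0.
Qed.

(** The growth condition bounds a quadratic form with an additive constant; replacing a vector by
    [r] times itself and letting [r] grow removes the constant. *)
Lemma linear_bound (s t c : R) : (forall r, r ^+ 2 * s <= c * (r ^+ 2 * t + 1)) -> s <= c * t.
Proof.
move=> H; rewrite leNgt; apply/negP => cts.
pose e := s - c * t; have e0 : 0 < e by rewrite subr_gt0.
have [r rP] : exists r : R, c < r ^+ 2 * e.
  exists ((`|c| + 1) / e + 1); apply: (@lt_le_trans _ _ (((`|c| + 1) / e + 1) * e)).
    by rewrite mulrDl divfK ?gt_eqF// mul1r; have := ler_norm c; lra.
  have h : 0 <= (`|c| + 1) / e by rewrite divr_ge0 ?ltW// ltr_wpDl.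
  by move: ((`|c| + 1) / e) h => q q0; apply: ler_wpM2r; [exact: ltW|nra].
by have := H r; rewrite /e in rP; nra.
Qed.

Lemma dotZ (t : R) (v w : 'I_m -> R) : dot (t *: v) w = t * dot v w.
Proof. by rewrite /dot mulr_sumr; apply: eq_bigr => i _; rewrite -[(t *: v) i]/(t * v i) mulrA. Qed.

Lemma mulvZ (b : 'M[R]_m) (t : R) v : mulv b (t *: v) = t *: mulv b v.
Proof.
have := mulv_lin b t v 0; rewrite !addr0 => ->.
suff -> : mulv b 0 = 0 by rewrite addr0.
by apply/funext => j; rewrite /mulv big1// => i _; rewrite mulr0.
Qed.

Lemma dot_mulv_expand (b : 'M[R]_m) (s t : R) v w : b^T = b ->
  dot (mulv b (s *: v + t *: w)) (s *: v + t *: w) =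
  s ^+ 2 * dot (mulv b v) v + 2 * s * t * dot (mulv b v) w + t ^+ 2 * dot (mulv b w) w.
Proof.
move=> bT; rewrite mulv_lin mulvZ dot_lin dotZ !(dotC (mulv b _) (s *: v + _)) !dot_lin !dotZ.
rewrite !(dotC _ (mulv b _)) (mulv_sym w v bT); ring.
Qed.

(** The matrix [a] of the class comes without measurability, so its entries are recovered from
    values of [f] at sums of basis vectors by polarization. Off the good set the matrix is [c0]
    times the identity, which makes ellipticity hold at every point. *)
Lemma J1class_coefficients f : J1class Omega c0 c1 f -> exists2 b, coefficients c0 c1 b &
  {ae mu, forall x, Omega x -> forall eta, f x eta = (qform b x eta)%:E}.
Proof.
move=> [[_ f0 mf _ fb] [a [aT fa]]]; have mO := open_measurable_rV oO.
have [N [mN N0 NP]] : mu.-negligible (~` [set x | Omega x ->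
    (forall eta, f x eta = (\sum_i \sum_j a x i j * eta ord0 i * eta ord0 j)%:E) /\
    forall eta, ((c0 * enorm eta `^ 2)%:E <= f x eta <= (c1 * (enorm eta `^ 2 + 1))%:E)%E]).
  have : {ae mu, forall x, Omega x ->
    (forall eta, f x eta = (\sum_i \sum_j a x i j * eta ord0 i * eta ord0 j)%:E) /\
    forall eta, ((c0 * enorm eta `^ 2)%:E <= f x eta <= (c1 * (enorm eta `^ 2 + 1))%:E)%E}.
    by apply: ae_imp2 fa fb => x h1 h2 Ox; split; [exact: h1|exact: h2].
  by [].
pose E (i : 'I_m) : 'rV[R]_m := delta_mx ord0 i.
pose D := Omega `&` ~` N.
have mD : measurable D by apply: measurableI => //; exact: measurableC.
pose pol x i j := (fine (f x (E i + E j)) - fine (f x (E i)) - fine (f x (E j))) / 2.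
pose b x : 'M[R]_m := if `[< D x >] then \matrix_(i, j) pol x i j else c0%:M.
have aE x (v w : 'I_m -> R) : \sum_i \sum_j a x i j * v i * w j = dot (mulv (a x) w) v.
  by rewrite dot_mulv; apply: eq_bigr => i _; apply: eq_bigr => j _; rewrite mulrAC.
have good x : D x -> [/\ Omega x, b x = a x,
    forall eta, f x eta = (dot (mulv (a x) (eta ord0)) (eta ord0))%:E &
    forall eta, ((c0 * enorm eta `^ 2)%:E <= f x eta <= (c1 * (enorm eta `^ 2 + 1))%:E)%E].
  move=> Dx; have [Ox Nx] := Dx.
  have [h1 h2] : (forall eta, f x eta = (\sum_i \sum_j a x i j * eta ord0 i * eta ord0 j)%:E) /\
    forall eta, ((c0 * enorm eta `^ 2)%:E <= f x eta <= (c1 * (enorm eta `^ 2 + 1))%:E)%E.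
    by apply: contrapT => h; apply: Nx; apply: NP => /= h'; apply: h; exact: h'.
  have h1' eta : f x eta = (dot (mulv (a x) (eta ord0)) (eta ord0))%:E by rewrite h1 aE.
  split => //; rewrite /b asboolT//; apply/matrixP => i j; rewrite mxE /pol !h1' /=.
  have EE k : E k ord0 = (fun l => (l == k)%:R).
    by apply/funext => l; rewrite mxE eqxx.
  have EDE : (E i + E j) ord0 = 1 *: (fun l => (l == i)%:R) + (fun l => (l == j)%:R).
    by rewrite scale1r -!EE; apply/funext => l; rewrite mxE.
  rewrite EDE !EE mulv_lin dot_lin ![dot _ (1 *: _ + _)]dotC !dot_lin !(dotC (fun l => (l == _)%:R)).
  rewrite !dot_delta !mulv_delta.
  have -> : a x j i = a x i j by rewrite -{1}(aT x Ox) mxE.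
  by field.
exists b.
  split => [i j|x].
    have -> : (fun x => b x i j) = (fun x => ((pol x i j - (c0%:M : 'M[R]_m) i j) * \1_D x + (c0%:M : 'M[R]_m) i j)).
      apply/funext => x; rewrite /b indicE; case: asboolP => Dx.
        by rewrite mxE mem_set// mulr1 subrK.
      by rewrite memNset// mulr0 add0r.
    apply: measurable_funD => //.
    have mfe eta : measurable_fun setT ((fun x => fine (f x eta)) \_ Omega).
      apply/(measurable_restrictT _ mO).
      by apply: (measurableT_comp (f := @fine R)); [exact: fine_measurable|exact: mf].
    have -> : (fun x => (pol x i j - (c0%:M : 'M[R]_m) i j) * \1_D x) =
      (fun x => (((fun x => fine (f x (E i + E j))) \_ Omega x - (fun x => fine (f x (E i))) \_ Omega x
        - (fun x => fine (f x (E j))) \_ Omega x) * 2^-1 - (c0%:M : 'M[R]_m) i j) * \1_D x).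
      apply/funext => x; rewrite indicE; have [xD|xD] := boolP (x \in D); last by rewrite !mulr0.
      have [Ox _] : D x by rewrite inE in xD.
      by rewrite !patchE !mem_set.
    apply: measurable_funM; last exact: measurable_indic.
    apply: measurable_funB => //; apply: measurable_funM => //.
    by apply: measurable_funB => //; exact: measurable_funB.
  have [Dx|Dx] := pselect (D x); last first.
    by rewrite /b asboolF//; apply: elliptic_scalar; rewrite lexx.
  have [Ox -> fE fB] := good x Dx; split; first exact: aT.
  have fB' (v : 'I_m -> R) : c0 * dot v v <= dot (mulv (a x) v) v <= c1 * (dot v v + 1).
    have := fB (\row_j v j); rewrite fE enorm_sqr !lee_fin.
    by have -> : (\row_j v j) ord0 = v by apply/funext => j; rewrite mxE.
  move=> v; have /andP[-> _] := fB' v; apply: linear_bound => r.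
  have /andP[_] := fB' (r *: v).
  by rewrite mulvZ !dotZ [dot (mulv _ _) _]dotC [dot v (r *: _)]dotC !dotZ !mulrA -!expr2 (dotC v).
have : {ae mu, forall x, ~ N x} by exists N; split => // x /= /contrapT.
apply: ae_imp => x Nx Ox eta; have [_ bE fE _] : _ := good x (conj Ox Nx).
by rewrite fE /qform bE.
Qed.

Lemma measurable_form b : coefficients c0 c1 b ->
  measurable_fun setT (fun z : 'rV[R]_n * 'rV[R]_m => qform b z.1 z.2).
Proof.
move=> [mb _]; have mc (j : 'I_m) : measurable_fun setT (fun z : 'rV[R]_n * 'rV[R]_m => z.2 ord0 j).
  by apply: (measurableT_comp (f := fun y : 'rV[R]_m => y ord0 j));
    [exact: measurable_coord_rV|exact: measurable_snd].
rewrite /qform /dot /mulv.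
apply: measurable_sum => i; apply: measurable_funM => //.
apply: measurable_sum => j; apply: measurable_funM => //.
by apply: (measurableT_comp (f := fun x => b x i j)); [exact: mb|exact: measurable_fst].
Qed.

Lemma measurable_form_Omega b : coefficients c0 c1 b ->
  measurable_fun (Omega `*` setT) (fun z : 'rV[R]_n * 'rV[R]_m => (qform b z.1 z.2)%:E).
Proof. by move=> cb; apply/measurable_EFinP/measurable_funTS; exact: measurable_form. Qed.

Lemma form_ge0 b x eta : coefficients c0 c1 b -> 0 <= qform b x eta.
Proof.
move=> [_ /(_ x)[_ /(_ (eta ord0))/andP[+ _]]]; apply: le_trans.
by rewrite mulr_ge0 ?dot_ge0// ltW.
Qed.

Lemma form_J1class b : coefficients c0 c1 b -> J1class Omega c0 c1 (fun x eta => (qform b x eta)%:E).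
Proof.
move=> cb; split.
  split.
  - exact: measurable_form_Omega.
  - by move=> x eta _; rewrite lee_fin form_ge0.
  - move=> eta; apply/measurable_EFinP; apply: measurable_funTS.
    by apply: (measurableT_comp (measurable_form cb)) (measurable_fun_pair _ _); first exact: measurable_id.
  - apply: aeW => x _; split => //; apply/convex_functionP => t v w /andP[t0 t1] /=.
    have bT : (b x)^T = b x by have [] := cb.2 x.
    (* Convexity: [t q(v) + (1 - t) q(w) - q(t v + (1 - t) w)] equals [t (1 - t) q(v - w)], which is
       nonnegative. *)
    have := form_ge0 x (v - w) cb; rewrite /qform.
    have -> : (v - w) ord0 = 1 *: v ord0 + (-1) *: w ord0 :> ('I_m -> R).
      by apply/funext => j; rewrite !mxE -[RHS]/(1 * v ord0 j + -1 * w ord0 j) mulN1r mul1r.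
    have -> : (t *: v + (1 - t) *: w) ord0 = t *: v ord0 + (1 - t) *: w ord0 :> ('I_m -> R).
      by apply/funext => j; rewrite !mxE.
    rewrite !dot_mulv_expand//.
    move: (dot (mulv _ (v ord0)) (v ord0)) (dot (mulv _ (w ord0)) (w ord0))
      (dot (mulv _ (v ord0)) (w ord0)) => A B C h.
    have t1' : 0 <= 1 - t by rewrite subr_ge0.
    by have := mulr_ge0 (mulr_ge0 t0 t1') h; nra.
  - apply: aeW => x _ eta; rewrite enorm_sqr !lee_fin.
    have [_ /(_ (eta ord0))/andP[-> h]] := cb.2 x; rewrite (le_trans h)// ler_wpM2l ?lerDl//.
    by rewrite (le_trans _ c01)// ltW.
exists b; split => [x _|]; first by have [] := cb.2 x.
apply: aeW => x _ eta; congr EFin; rewrite /qform dot_mulv.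
by apply: eq_bigr => i _; apply: eq_bigr => j _; rewrite mulrAC.
Qed.

End quadratic_integrands.

(** * Functions with square-integrable gradient *)

Section L2_gradients.
Context {R : realType} {n m : nat}.
Local Notation mu := (lebesgue_rV R n).
Local Notation intg f := (mu.-integrable setT (EFin \o f)).
Variables (Omega : set 'rV[R]_n) (X : 'I_m -> 'rV[R]_n -> 'rV[R]_n).
Hypotheses (oO : open Omega) (bO : bounded_set Omega) (vX : forall j, vfield Omega (X j)).
Implicit Types (u v phi : 'rV[R]_n -> R) (A B : set 'rV[R]_n) (U V W : 'I_m -> 'rV[R]_n -> R).

(** Function and gradient vanish off [A], so all pairings are integrals over the whole space. The
    derivative relation is tested inside [A] only; nothing is claimed across the boundary of [A]. *)
Definition grad2 A v V := [/\ L2 v, (forall x, ~ A x -> v x = 0), vL2_on A V &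
  forall j, wderiv (X j) A v (V j)].

Lemma patch_id A v : (forall x, ~ A x -> v x = 0) -> v \_ A = v.
Proof.
by move=> v0; apply/funext => x; rewrite patchE; case: ifPn => // /negP xA; rewrite v0// => Ax;
  apply: xA; rewrite inE.
Qed.

Lemma wderiv_patch A Y u g :
  wderiv Y A u g -> wderiv Y A (u \_ A) (g \_ A).
Proof.
move=> ug phi tphi.
under eq_Rintegral do rewrite (patchM0 _ (fun Ax => test_out tphi Ax)).
rewrite (ug _ tphi); congr -%R; apply: eq_Rintegral => x _.
by rewrite patchM0// => Ax; exact: (adj_out Y tphi Ax).
Qed.

Lemma isgrad_grad2 A v V : open_in Omega A -> isgrad X 2 A v V ->
  grad2 A (v \_ A) (fun j => V j \_ A).
Proof.
move=> oA [/inLp2P v2 HV]; split => //; first exact: patch_out.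
  split => [j|j x]; last exact: patch_out.
  by have [/inLp2P] := HV j.
by move=> j; have [_ h] := HV j; exact: wderiv_patch.
Qed.

Lemma grad2_isgrad A v V : grad2 A v V -> isgrad X 2 A v V.
Proof.
move=> [v2 v0 [V2 V0] HV]; split; first by apply/inLp2P; rewrite patch_id.
by move=> j; split; [apply/inLp2P; rewrite patch_id//; exact: V0|exact: HV].
Qed.

Lemma L2_on_intg A v : open_in Omega A -> L2 v -> (forall x, ~ A x -> v x = 0) -> intg (v \_ A).
Proof.
move=> oA v2 v0; apply: (inLp_intg_in bO (p := 2)) => //; first by rewrite ler1n.
by apply/inLp2P; rewrite patch_id.
Qed.

Lemma grad2_lin A a v V v' V' : open_in Omega A -> grad2 A v V -> grad2 A v' V' ->
  grad2 A (a *: v + v') (a *: V + V').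
Proof.
move=> oA [v2 v0 [V2 V0] HV] [v2' v0' [V2' V0'] HV']; have i0 := L2_on_intg oA.
split.
- exact: L2_lin.
- by move=> x Ax; rewrite -[LHS]/(a * v x + v' x) v0// v0'// mulr0 addr0.
- split; first exact: vL2_lin.
  by move=> j x Ax; rewrite -[LHS]/(a * V j x + V' j x) V0// V0'// mulr0 addr0.
move=> j; have h : wderiv (X j) A (fun x => a * v x) (fun x => a * V j x).
  by apply: (wderivZ oO (vX j) oA.2) => //; apply: i0 => //; exact: V0.
have aL f : L2 f -> L2 (fun x => a * f x).
  by move=> /(fun h => L2_lin a h L2_0); rewrite addr0.
apply: (wderivD oO (vX j) oA.2 _ _ _ _ h (HV' j)); apply: i0 => //.
- exact: aL.
- by move=> x /v0 ->; rewrite mulr0.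
- exact: aL.
- by move=> x /V0 ->; rewrite mulr0.
- exact: V0'.
Qed.

Definition cross phi v : 'I_m -> 'rV[R]_n -> R := fun j x => vgrad (X j) phi x * v x.

Lemma vgrad_bounds A phi : open_in Omega A -> test_function A phi ->
  exists2 M, 0 <= M & forall j x, `|vgrad (X j) phi x| <= M.
Proof.
move=> [oA AO] tphi.
have /choice[M MP] j : exists M, forall x, `|vgrad (X j) phi x| <= M.
  exact: (vgrad_bounded (vX j) AO tphi).
exists (\sum_j `|M j|) => [|j x]; first exact: sumr_ge0.
rewrite (le_trans (MP j x))// (le_trans (ler_norm _))// (bigD1 j)//= lerDl.
exact: sumr_ge0.
Qed.

Lemma vL2_cross A phi v : open_in Omega A -> test_function A phi -> L2 v -> vL2 (cross phi v).
Proof.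
move=> oA tphi v2 j; have [M _ MP] := vgrad_bounds oA tphi.
by apply: (L2_bounded_mul _ (MP j)) => //; exact: (vgrad_measurable oO (vX j) oA.2 tphi).
Qed.

Lemma ip_bounded_mul phi v (M : R) : measurable_fun setT phi -> (forall x, `|phi x| <= M) ->
  L2 v -> ip (fun x => phi x * v x) (fun x => phi x * v x) <= M ^+ 2 * ip v v.
Proof.
move=> mp pM v2; rewrite !ip_sqr -RintegralZl//; last by have [] := v2.
apply: le_RintegralT; [by have [] := L2_bounded_mul mp pM v2|by apply: intgZ; have [] := v2|].
move=> x; rewrite exprMn ler_wpM2r ?sqr_ge0// -[leLHS]real_normK ?num_real//.
by rewrite lerXn2r// nnegrE// (le_trans _ (pM x)).
Qed.

Lemma cross_le A phi : open_in Omega A -> test_function A phi ->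
  exists2 M, 0 <= M & forall v, L2 v -> vip (cross phi v) (cross phi v) <= M * ip v v.
Proof.
move=> oA tphi; have [M M0 MP] := vgrad_bounds oA tphi.
exists (m%:R * M ^+ 2) => [|v v2]; first by rewrite mulr_ge0 ?sqr_ge0.
rewrite (_ : _ * _ * _ = \sum_(j < m) M ^+ 2 * ip v v); last first.
  by rewrite sumr_const card_ord -mulrA mulr_natl.
apply: ler_sum => j _; apply: ip_bounded_mul => //.
exact: (vgrad_measurable oO (vX j) oA.2 tphi).
Qed.

Lemma smul_le phi (M : R) V : measurable_fun setT phi -> (forall x, `|phi x| <= M) ->
  vL2 V -> vip (smul phi V) (smul phi V) <= M ^+ 2 * vip V V.
Proof.
move=> mp pM V2; rewrite /vip mulr_sumr; apply: ler_sum => j _.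
exact: ip_bounded_mul.
Qed.

(** A cut-off with compact support in [A] removes the jump at the boundary: the product has a
    gradient on any larger [B], which is how a function known on [A] becomes a competitor on
    [Omega]. *)
Lemma grad2_test A B phi v V : open_in Omega A -> A `<=` B -> B `<=` Omega ->
  test_function A phi -> grad2 A v V ->
  grad2 B (fun x => phi x * v x) (smul phi V + cross phi v).
Proof.
move=> oA AB BO tphi [v2 v0 [V2 V0] HV].
have [M MP] := test_bounded tphi; have mp := test_measurable tphi.
split.
- exact: L2_bounded_mul MP v2.
- by move=> x Bx; rewrite v0 ?mulr0// => /AB.
- split; first by apply: vL2D; [exact: vL2_smul MP V2|exact: vL2_cross oA tphi v2].
  move=> j x Bx; rewrite -[LHS]/(phi x * V j x + vgrad (X j) phi x * v x).
  by rewrite v0 ?V0 ?mulr0 ?addr0// => /AB.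
move=> j; have -> : (fun x => phi x * v x) = (fun x => v x * phi x).
  by apply/funext => x; rewrite mulrC.
have -> : (smul phi V + cross phi v) j = (fun x => V j x * phi x + v x * vgrad (X j) phi x).
  apply/funext => x; rewrite -[LHS]/(phi x * V j x + vgrad (X j) phi x * v x).
  by rewrite mulrC (mulrC (v x)).
apply: (wderiv_leibniz oO (vX j) AB BO tphi _ _ (HV j)); apply: L2_on_intg => //.
exact: V0.
Qed.

Lemma grad2_sub A B v V : open_in Omega A -> A `<=` B -> grad2 B v V ->
  (forall x, ~ A x -> v x = 0) -> (forall j x, ~ A x -> V j x = 0) -> grad2 A v V.
Proof.
move=> oA AB [v2 _ [V2 _] HV] v0 V0; split => // j.
exact: wderiv_sub AB (HV j).
Qed.

Definition coordf (i : 'I_n) : 'rV[R]_n -> R := (fun x => x ord0 i) \_ Omega.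
(** The field L^i: its j-th component is the derivative of the coordinate x_i along [X j]. *)
Definition coordX (i : 'I_n) : 'I_m -> 'rV[R]_n -> R := fun j => (fun x => X j x ord0 i) \_ Omega.

Lemma lip_bounded_measurable c : lip_bounded Omega c -> measurable_fun setT (c \_ Omega).
Proof.
move=> cb; apply/(measurable_restrictT _ (open_measurable_rV oO)).
apply: (@measurability _ _ _ _ _ _ _ (RGenOpens.measurableE R)) => _ [_ [a [d ->]] <-].
apply: open_measurable_rV.
have oI : open (`]a, d[%classic : set R) by exact: interval_open.
have -> : Omega `&` c @^-1` `]a, d[%classic = (Omega `&` c @^-1` `]a, d[%classic)^°.
  rewrite interiorI; apply/seteqP; split => x.
    move=> [Ox cx]; split; first exact: open_nbhs_nbhs.
    apply: (continuous_lip_at oO cb Ox); exact: open_nbhs_nbhs.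
  by move=> [/nbhs_singleton ? /nbhs_singleton].
exact: open_interior.
Qed.

Lemma lip_bounded_L2 c : lip_bounded Omega c -> L2 (c \_ Omega).
Proof.
move=> cb; have mc := lip_bounded_measurable cb; split => //.
have mO := open_measurable_rV oO; have [L [M [_ cM]]] := cb.
apply: (@intg_bounded _ _ _ Omega (`|M| ^+ 2)) => //.
- exact: measurable_funX.
- exact: bounded_lebesgue_rV_lty.
- move=> x; rewrite normrX; apply: lerXn2r; rewrite ?nnegrE//.
  rewrite patchE; case: ifPn => [|_]; last by rewrite normr0.
  by rewrite inE => Ox; rewrite (le_trans (cM x Ox))// ler_norm.
- by move=> x Ox; rewrite patch_out// expr0n.
Qed.

Lemma grad2_coord i : grad2 Omega (coordf i) (coordX i).
Proof.
split.
- exact: lip_bounded_L2 (lip_bounded_coord _ bO).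
- exact: patch_out.
- split => [j|j x]; last exact: patch_out.
  exact: lip_bounded_L2 (vX j i).
move=> j; apply: wderiv_patch.
exact: wderiv_coord.
Qed.

End L2_gradients.

(** * Div-curl lemma and the limit coefficients *)

Section div_curl.
Context {R : realType} {n m : nat}.
Local Notation mu := (lebesgue_rV R n).
Local Notation intg f := (mu.-integrable setT (EFin \o f)).
Variables (Omega : set 'rV[R]_n) (X : 'I_m -> 'rV[R]_n -> 'rV[R]_n).
Hypotheses (oO : open Omega) (bO : bounded_set Omega) (vX : forall j, vfield Omega (X j)).
Variables (c0 c1 M : R) (b : nat -> 'rV[R]_n -> 'M[R]_m)
  (w : nat -> 'rV[R]_n -> R) (W : nat -> 'I_m -> 'rV[R]_n -> R) (sigma : 'I_m -> 'rV[R]_n -> R).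
Hypotheses (c00 : 0 < c0) (c01 : c0 <= c1) (cb : forall k, coefficients c0 c1 (b k)).
Local Notation S k := (flux (b k) (W k)).
Hypotheses (hW : forall k, vL2 (W k)) (hM : forall k, vip (S k) (W k) <= M).
Hypothesis hP : forall C e : R, 0 < e -> exists2 d, 0 < d & exists K, forall k z Z, (K <= k)%N ->
  grad2 X Omega z Z -> ip z z <= d -> vip (flux (b k) Z) Z <= C -> `|vip (S k) Z| <= e.
Hypotheses (sigma2 : vL2 sigma)
  (hS : forall g, vL2 g -> vip (S k) g @[k --> \oo] --> vip sigma g).

Lemma cvg0_sqr (a t : nat -> R) (C : R) : (forall h, a h ^+ 2 <= C * t h) ->
  t h @[h --> \oo] --> (0 : R) -> a h @[h --> \oo] --> (0 : R).
Proof.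
move=> at_ t0; apply/cvgr0Pnorm_lt => e e0.
have Ct : C * t h @[h --> \oo] --> (0 : R).
  by rewrite -[0](mulr0 C); apply: cvgM => //; exact: cvg_cst.
have /cvgr0Pnorm_lt/(_ (e ^+ 2)) := Ct.
rewrite exprn_gt0// => /(_ isT); apply: filterS => h ht.
rewrite -(ltr_pXn2r (ltn0Sn 1)) ?nnegrE// ?ltW// real_normK ?num_real//.
by rewrite (le_lt_trans (at_ h))// (le_lt_trans (ler_norm _)).
Qed.

Lemma vipD_le (V V' : 'I_m -> 'rV[R]_n -> R) : vL2 V -> vL2 V' ->
  vip (V + V') (V + V') <= 2 * vip V V + 2 * vip V' V'.
Proof.
move=> h h'; have := vip_ge0 (V - V').
rewrite vipBl ?vipBr ?vipDl ?vipDr//; try exact: vL2D; try exact: vL2B.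
by rewrite (vipC V' V); lra.
Qed.

(** The functions [u_h] live on [A] only, whereas the orthogonality [hP] concerns functions on
    [Omega]; multiplying [u_h - u] by [phi] gives functions on [Omega] that tend to 0 in L^2 with
    bounded energy. *)
Lemma div_curl A phi r (u_ : nat -> 'rV[R]_n -> R) U_ u U (C : R) :
  open_in Omega A -> test_function A phi -> increasing_nat r ->
  (forall h, grad2 X A (u_ h) (U_ h)) -> grad2 X A u U ->
  ip (u_ h - u) (u_ h - u) @[h --> \oo] --> (0 : R) -> (forall h, vip (U_ h) (U_ h) <= C) ->
  vip (S (r h)) (smul phi (U_ h)) @[h --> \oo] --> vip sigma (smul phi U).
Proof.
move=> oA tphi incr HU_ HU uc UC.
have [Mp MpP] := test_bounded tphi; have mp := test_measurable tphi.
have U2 : vL2 U by have [_ _ []] := HU.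
have U2_ h : vL2 (U_ h) by have [_ _ []] := HU_ h.
have u2 : L2 u by have [] := HU.
have u2_ h : L2 (u_ h) by have [] := HU_ h.
pose dU h := U_ h - U; pose du h := u_ h - u.
have dU2 h : vL2 (dU h) by exact: vL2B.
have HD h : grad2 X A (du h) (dU h).
  have := grad2_lin oO bO vX (-1) oA HU (HU_ h).
  by rewrite !scaleN1r ![- _ + _]addrC.
have du2 h : L2 (du h) by have [] := HD h.
have hS2 k : vL2 (S k) by exact: vL2_flux c00 (cb k) _ (hW k).
have sm2 (V : 'I_m -> 'rV[R]_n -> R) : vL2 V -> vL2 (smul phi V) by exact: vL2_smul MpP.
have cr2 h : vL2 (cross X phi (du h)) by exact: (vL2_cross oO vX oA tphi).
have rc : r h @[h --> \oo] --> \oo by exact: increasing_nat_cvg.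
pose Z h := smul phi (dU h) + cross X phi (du h).
have Z2 h : vL2 (Z h) by apply: vL2D; [exact: sm2|exact: cr2].
(* Three parts: the flux against the gradient of [phi (u_h - u)], which vanishes by [hP]; against
   the commutator term, which vanishes because [u_h] converges strongly; and against the fixed field
   [phi U], where weak convergence applies. *)
have E h : vip (S (r h)) (smul phi (U_ h)) =
    vip (S (r h)) (Z h) - vip (S (r h)) (cross X phi (du h)) + vip (S (r h)) (smul phi U).
  have -> : smul phi (U_ h) = smul phi (dU h) + smul phi U.
    apply/funext => j; apply/funext => x.
    by rewrite -[RHS]/(phi x * (U_ h j x - U j x) + phi x * U j x) -mulrDr subrK.
  by rewrite (vipDr (sm2 _ (dU2 h)) (sm2 _ U2) (hS2 _)) /Z (vipDr (sm2 _ (dU2 h)) (cr2 h) (hS2 _)) addrK.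
have [K K0 HK] := cross_le oO vX oA tphi.
have c10 : 0 < c1 by exact: lt_le_trans c01.
have lim2 : vip (S (r h)) (cross X phi (du h)) @[h --> \oo] --> (0 : R).
  apply: (@cvg0_sqr _ _ (c1 * M * K) _ uc) => h.
  rewrite (le_trans (vip_cauchy_schwarz (hS2 _) (cr2 h)))//.
  rewrite -[leRHS]mulrA; apply: ler_pM; rewrite ?vip_ge0//; last exact: HK.
  rewrite (le_trans (vip_flux_flux c00 (cb _) (hW _)))//.
  by rewrite ler_wpM2l ?(ltW c10).
have lim1 : vip (S (r h)) (Z h) @[h --> \oo] --> (0 : R).
  have [du_b duB] : exists D, forall h, ip (du h) (du h) <= D.
    have /cvg_seq_bounded[D [_ HD']] := cvgP _ uc.
    by exists (D + 1) => h; apply: le_trans (ler_norm _) _; apply: HD' => //; rewrite ltrDl.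
  (* An energy bound for the gradient of [phi (u_h - u)]: [C], [vip U U] and [du_b] bound [U_h], [U]
     and [u_h - u], and each 2 comes from the square of a sum. *)
  pose C' := c1 * (2 * (Mp ^+ 2 * (2 * C + 2 * vip U U)) + 2 * (K * du_b)).
  have ZC h : vip (flux (b (r h)) (Z h)) (Z h) <= C'.
    rewrite (le_trans (vip_flux_le c00 (cb _) (Z2 h)))// /C' ler_wpM2l ?(ltW c10)//.
    rewrite (le_trans (vipD_le (sm2 _ (dU2 h)) (cr2 h)))//.
    apply: lerD; rewrite ler_wpM2l//.
      rewrite (le_trans (smul_le mp MpP (dU2 h)))// ler_wpM2l ?sqr_ge0//.
      have NU : vL2 (- U) by have := vL2B (vL2B U2 U2) U2; rewrite subrr sub0r.
      rewrite (le_trans (vipD_le (U2_ h) NU))// lerD//.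
        by rewrite ler_wpM2l.
      suff -> : vip (- U) (- U) = vip U U by [].
      by apply: eq_bigr => j _; apply: eq_Rintegral => x _; exact: mulrNN.
    by rewrite (le_trans (HK _ (du2 h)))// ler_wpM2l.
  apply/cvgr0Pnorm_le => e e0; have [d d0 [N HN]] := hP C' e0.
  have zc : Mp ^+ 2 * ip (du h) (du h) @[h --> \oo] --> (0 : R).
    by rewrite -[0](mulr0 (Mp ^+ 2)); apply: cvgM => //; exact: cvg_cst.
  have /cvgr0Pnorm_lt/(_ _ d0) zd := zc.
  have rN : \forall h \near \oo, (N <= r h)%N by exists N => // h /= Nh; exact: leq_trans Nh (increasing_nat_ge incr h).
  apply: filterS2 zd rN => h zh rh.
  apply: (HN _ _ _ rh (grad2_test oO bO vX oA oA.2 (@subset_refl _ _) tphi (HD h))) => //.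
  rewrite (le_trans (ip_bounded_mul mp MpP (du2 h)))// ltW//.
  by rewrite (le_lt_trans (ler_norm _)).
have lim3 : vip (S (r h)) (smul phi U) @[h --> \oo] --> vip sigma (smul phi U).
  exact: (cvg_comp _ _ rc (hS (sm2 _ U2))).
under eq_fun do rewrite E.
rewrite -[vip sigma _]add0r; apply: cvgD => //.
by rewrite -[0 in X in _ --> X](subr0 0); apply: cvgB.
Qed.

End div_curl.

(** * Density of spanning fields with test functions as coefficients *)

Section density_of_test_functions.
Context {R : realType} {n : nat}.
Local Notation mu := (lebesgue_rV R n).
Local Notation E i := (delta_mx ord0 i : 'rV[R]_n).
Local Notation intg f := (mu.-integrable setT (EFin \o f)).
Implicit Types (phi psi f : 'rV[R]_n -> R) (A : set 'rV[R]_n).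

Lemma flat2_le (t : R) : flat 2 t <= 2.
Proof.
rewrite /flat; case: ifP => // t0; set y := t^-1; have y0 : 0 < y by rewrite invr_gt0.
rewrite expRN ler_pdivrMr ?expR_gt0//.
have := expR_ge1Dxn 1 (ltW y0); rewrite (_ : 2`!%:R = 2 :> R)//.
move: (y ^+ 2) (expR y) => a b h; lra.
Qed.

Lemma flat0_lipschitz (s t : R) : `|flat 0 s - flat 0 t| <= 2 * `|s - t|.
Proof.
wlog st : s t / s <= t.
  by move=> H; have [/H//|/ltW/H] := leP s t; rewrite distrC (distrC t).
have [| |c _ E0] := @MVT_segment R (flat 0) (fun r => flat 2 r - 0%:R * flat 1 r) s t st.
- by move=> r _; exact: is_derive_flat.
- by apply: continuous_subspaceT; exact: continuous_flat.
by rewrite distrC E0 normrM mul0r subr0 (distrC s) ler_wpM2r// ger0_norm ?flat_ge0 ?flat2_le.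
Qed.

Lemma Ck_flat_comp k j phi : (forall l, Ck l phi) -> Ck k (fun x => flat j (phi x)).
Proof.
move=> Cphi; have cphi : continuous phi by exact: (CkW (Cphi 0%N)).
have cf i : continuous (fun x => flat i (phi x)).
  by move=> x; apply: (@continuous_comp _ _ _ phi (flat i)); [exact: cphi|exact: continuous_flat].
elim: k j => [|k IH] j /=; first exact: cf.
split=> // i; have [_ /(_ i)[dphi _]] := Cphi 1%N.
have H x : derivable (fun x => flat j (phi x)) x (E i) /\ partial i (fun x => flat j (phi x)) x =
    (flat j.+2 (phi x) + cst (- j%:R) x * flat j.+1 (phi x)) * partial i phi x.
  apply: partial_line.
  have d0 : derivable phi (x + 0 *: E i) (E i) by rewrite scale0r addr0; exact: dphi.
  have /derivableP dg := iffLR (derivable_line i phi x 0) d0.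
  have [_ pE] := partial_line dg.
  have := @is_derive1_comp _ (flat j) (fun t => phi (x + t *: E i)) _ _ _ (is_derive_flat j _) dg.
  by move=> /is_derive_eq; apply; rewrite scale0r addr0 pE /cst/= mulNr.
split=> [x|]; first by case: (H x).
rewrite (_ : partial _ _ = fun x =>
    (flat j.+2 (phi x) + cst (- j%:R) x * flat j.+1 (phi x)) * partial i phi x).
  apply: CkM; last by have [_ /(_ i)[_]] := Cphi k.+1.
  by apply: CkD => //; apply: CkM => //; exact: Ck_cst.
by apply/funext => x; rewrite (H x).2.
Qed.

(** Composition with [flat 0] makes a test function nonnegative and does not enlarge its support,
    since [flat 0] vanishes at 0. *)
Lemma test_flat A phi : test_function A phi -> test_function A (fun x => flat 0 (phi x)).
Proof.
move=> [C cphi sA].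
have sub : closure [set x | flat 0 (phi x) != 0] `<=` closure [set x | phi x != 0].
  by apply: closure_subset => x /=; apply: contra => /eqP ->; rewrite flat_eq0.
split=> [k||]; first exact: Ck_flat_comp.
- by apply: subclosed_compact sub => //; exact: closed_closure.
- exact: subset_trans sub sA.
Qed.

Lemma test_lin A (a : R) phi psi : test_function A phi -> test_function A psi ->
  test_function A (fun x => a * phi x + psi x).
Proof.
move=> [C cphi sA] [C' cpsi sA'].
have sub : closure [set x | a * phi x + psi x != 0] `<=`
    closure [set x | phi x != 0] `|` closure [set x | psi x != 0].
  rewrite -closureU; apply: closure_subset => x /= h.
  have [p0|] := eqVneq (phi x) 0; last by left.
  by right; move: h; rewrite p0 mulr0 add0r.
split=> [k||].
- by apply: CkD => //; apply: CkM => //; exact: Ck_cst.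
- apply: subclosed_compact sub; first exact: closed_closure.
  exact: compactU.
- by apply: subset_trans sub _; rewrite subUset.
Qed.

Context {m : nat}.
Implicit Types (g V : 'I_m -> 'rV[R]_n -> R).

Lemma smul_lin (a : R) phi psi V : smul (fun x => a * phi x + psi x) V =
  a *: smul phi V + smul psi V.
Proof.
apply/funext => j; apply/funext => x.
by rewrite -[RHS]/(a * (phi x * V j x) + psi x * V j x) /smul mulrDl mulrA.
Qed.

(** A field orthogonal to all [phi L^i] is pointwise orthogonal to each [L^i] almost everywhere by
    the fundamental lemma, hence zero by the spanning hypothesis; [hilbert_dense] turns this into
    density. *)
Lemma fields_dense k A (L : 'I_k -> 'I_m -> 'rV[R]_n -> R) (M : R) : open A -> (mu A < +oo)%E ->
  (forall i j, measurable_fun setT (L i j)) -> (forall i j x, `|L i j x| <= M) ->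
  {ae mu, forall x, A x -> forall v : 'I_m -> R,
    (forall i, dot v (L i ^~ x) = 0) -> forall j, v j = 0} ->
  forall g e, vL2_on A g -> 0 < e -> exists2 phi : 'I_k -> 'rV[R]_n -> R,
    (forall i, test_function A (phi i)) &
    vip (g - \sum_i smul (phi i) (L i)) (g - \sum_i smul (phi i) (L i)) < e.
Proof.
move=> oA Aoo mL LM Lae; have mA := open_measurable_rV oA.
pose S := [set V | exists2 phi : 'I_k -> 'rV[R]_n -> R,
    (forall i, test_function A (phi i)) & V = \sum_i smul (phi i) (L i)].
have tL phi i : test_function A phi -> vL2_on A (smul phi (L i)).
  move=> tphi; have [K KP] := test_bounded tphi; have mp := test_measurable tphi.
  split => [j|j x Ax]; last by rewrite /smul (test_out tphi Ax) mul0r.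
  have mS : measurable_fun setT (smul phi (L i) j) by exact: measurable_funM.
  split => //; have bs := test_supp_bounded tphi.
  have ms : measurable [set x | phi x != 0].
    rewrite (_ : [set x | _] = ~` (phi @^-1` [set 0])); last first.
      by apply/seteqP; split => x /=; [move/eqP|move=> h; apply/eqP].
    by apply: measurableC; rewrite -[X in measurable X]setTI; exact: mp.
  apply: (@intg_bounded _ _ _ [set x | phi x != 0] ((K * M) ^+ 2)) => //.
  - exact: measurable_funX.
  - exact: bounded_lebesgue_rV_lty.
  - move=> x; rewrite normrX; apply: lerXn2r; rewrite ?nnegrE//.
      by rewrite mulr_ge0// ?(le_trans _ (KP x))// (le_trans _ (LM i j x)).
    by rewrite normrM ler_pM.
  - by move=> x /negP; rewrite negbK /smul => /eqP ->; rewrite mul0r expr0n.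
have vS : subspace_of (vL2_on A) S.
  split.
  - move=> _ [phi tphi ->]; split.
      by apply: vL2_sum => i; have [] := tL _ i (tphi i).
    move=> j x Ax; rewrite fct_sumE fct_sumE big1// => i _.
    by have [_] := tL _ i (tphi i); apply.
  - have t0 : test_function A (cst 0).
      split; first by move=> l; exact: Ck_cst.
        rewrite (_ : [set x | _] = set0) ?closure0; first exact: compact0.
        by apply/seteqP; split => x //=; rewrite eqxx.
      rewrite (_ : [set x | _] = set0) ?closure0//.
      by apply/seteqP; split => x //=; rewrite eqxx.
    by eexists; exists (fun=> cst 0).
  - move=> a _ _ [phi tphi ->] [psi tpsi ->].
    exists (fun i x => a * phi i x + psi i x); first by move=> i; exact: test_lin.
    by rewrite scaler_sumr -big_split; apply: eq_bigr => i _; rewrite /= smul_lin.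
have dense := @vL2_dense R n m A S (open_measurable_rV oA) vS _.
move=> g e gA e0; have [|V [phi tphi ->] h] := dense _ g e gA e0; last by exists phi.
move=> h [h2 h0] hS.
have L2L i j : forall phi, test_function A phi -> intg (fun x => h j x * (smul phi (L i)) j x).
  by move=> phi tphi; apply: L2_mul => //; have [] := tL _ i tphi.
have hL i phi : test_function A phi -> vip h (smul phi (L i)) = 0.
  (* The other coefficients are the zero function, written as [(-1) phi + phi] so that [test_lin]
     makes it a test function. *)
  move=> tphi; apply: hS; exists (fun i' => if i' == i then phi else (fun x => (-1) * phi x + phi x)).
    by move=> i'; case: ifP => // _; exact: test_lin.
  rewrite (bigD1 i)//= eqxx big1 ?addr0// => i' /negPf ->.
  by rewrite smul_lin scaleN1r addNr.
have Lh i j : intg (fun x => h j x * L i j x).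
  have -> : (fun x => h j x * L i j x) = (fun x => h j x * (\1_A x * L i j x)).
    apply/funext => x; rewrite indicE; have [xA|xA] := boolP (x \in A); first by rewrite mul1r.
    by rewrite h0 ?mul0r// => Ax; move/negP : xA; apply; rewrite inE.
  apply: L2_mul => //; split; first by apply: measurable_funM => //; exact: measurable_indic.
  apply: (@intg_bounded _ _ _ A (M ^+ 2)) => //.
  - by apply: measurable_funX; apply: measurable_funM => //; exact: measurable_indic.
  - have M0 (x : 'rV[R]_n) : 0 <= M by exact: (le_trans (normr_ge0 _) (LM i j x)).
    move=> x; rewrite normrX; apply: lerXn2r; rewrite ?nnegrE ?(M0 x)//.
    rewrite normrM indicE normr_nat; case: (_ \in _); first by rewrite mul1r.
    by rewrite mul0r (M0 x).
  - by move=> x Ax; rewrite indicE memNset// mul0r expr0n.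
have ae_i : {ae mu, forall x, forall i, A x -> dot (h ^~ x) (L i ^~ x) = 0}.
  apply: ae_forall_countType => i; apply: test_integral0_ae0 => //.
    by apply: intg_sum => j; exact: Lh.
  move=> phi tphi; rewrite -(hL i phi tphi) /vip -Rintegral_sum => [|j]; last exact: L2L.
  apply: eq_Rintegral => x _; rewrite /dot mulr_suml; apply: eq_bigr => j _.
  by rewrite /smul; ring.
have hz : {ae mu, forall x, forall j, h j x = 0}.
  apply: ae_imp2 ae_i Lae => x H1 H2 j.
  have [Ax|Ax] := pselect (A x); last exact: h0.
  by apply: (H2 Ax (h ^~ x)) => i; exact: H1.
rewrite /vip big1// => j _; rewrite ip_sqr (@Rintegral_ae _ _ _ (cst 0)).
- by rewrite Rintegral_cst// mul0r.
- by apply: measurable_funX; have [] := h2 j.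
- exact: measurable_cst.
- by apply: ae_imp hz => x ->; rewrite expr0n.
Qed.

End density_of_test_functions.

Section positivity.
Context {R : realType} {n : nat}.
Local Notation mu := (lebesgue_rV R n).
Local Notation intg f := (mu.-integrable setT (EFin \o f)).
Implicit Types (phi f : 'rV[R]_n -> R) (A : set 'rV[R]_n).

Lemma tests_dense A f (e : R) : open A -> (mu A < +oo)%E ->
  L2 f -> (forall x, ~ A x -> f x = 0) -> 0 < e ->
  exists2 phi, test_function A phi & ip (f - phi) (f - phi) < e.
Proof.
move=> oA Aoo f2 f0 e0.
have [|||| phi tphi] := @fields_dense R n 1 1 A (fun _ _ _ => 1) 1 oA Aoo _ _ _ (fun=> f) e _ e0.
- by move=> _ _; exact: measurable_cst.
- by move=> _ _ x; rewrite normr1.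
- apply: aeW => x _ v /(_ ord0); rewrite /dot big_ord1 mulr1 => v0 j.
  by rewrite (ord1 j).
- by split => [j|j x /f0].
rewrite /vip !big_ord1 => h; exists (phi ord0) => //.
suff -> : phi ord0 = smul (m := 1) (phi ord0) (fun _ _ => 1) ord0 by [].
by apply/funext => x; rewrite /smul mulr1.
Qed.

(** The indicator of the set where [f < 0] is approximated in L^2 by a test function, which may take
    negative values. Composition with [flat 0] repairs this: it is 2-Lipschitz and maps the
    indicator to its multiple by [c = flat 0 1], so the composed functions approximate [c] times the
    indicator. *)
Lemma test_ge0_ae A f : open A -> (mu A < +oo)%E -> L2 f ->
  (forall phi, test_function A phi -> (forall x, 0 <= phi x) -> 0 <= \int[mu]_x (f x * phi x)) ->
  {ae mu, forall x, A x -> 0 <= f x}.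
Proof.
move=> oA Aoo f2 fphi; have mA := open_measurable_rV oA; have [mf fi] := f2.
pose B := A `&` [set x | f x < 0].
have mB : measurable B.
  apply: measurableI => //; rewrite (_ : [set x | _] = f @^-1` `]-oo, 0[%classic).
    by rewrite -[X in measurable X]setTI; exact: mf.
  by apply/seteqP; split => x /=; rewrite in_itv.
pose h : 'rV[R]_n -> R := \1_B.
have BA x : B x -> A x by case.
have h2 : L2 h.
  split; first exact: measurable_indic.
  apply: (@intg_bounded _ _ _ A 1) => //.
  - by apply: measurable_funX; exact: measurable_indic.
  - by move=> x; rewrite /h indicE; case: (_ \in _); rewrite ?expr1n ?expr0n ?normr1 ?normr0.
  - by move=> x Ax; rewrite /h indicE memNset ?expr0n// => /BA.
have h0 x : ~ A x -> h x = 0 by move=> Ax; rewrite /h indicE memNset// => /BA.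
have fh_le0 x : f x * h x <= 0.
  rewrite /h indicE; have [|_] := boolP (x \in B); last by rewrite mulr0.
  by rewrite inE mulr1 => -[_ /ltW].
pose c : R := flat 0 1; have c0 : 0 < c by exact: flat_gt0.
have chE x : c * h x = flat 0 (h x).
  by rewrite /h indicE; case: (_ \in _); [rewrite mulr1|rewrite mulr0 flat_eq0].
have ifh : intg (fun x => f x * h x) by exact: L2_mul.
have key : 0 <= \int[mu]_x (f x * h x).
  rewrite leNgt; apply/negP => I0.
  pose I := \int[mu]_x (f x * h x).
  (* With this accuracy Cauchy-Schwarz gives [(c I - ip f psi)^2 < (c I)^2], which is impossible
     when [c I < 0 <= ip f psi]; the factor 4 is the squared Lipschitz constant of [flat 0]. *)
  pose e := (c * I) ^+ 2 / (4 * (ip f f + 1)).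
  have ff := ip_ge0 f.
  have cI : 0 < (c * I) ^+ 2 by rewrite exprn_even_gt0//= mulf_neq0//; [rewrite gt_eqF|rewrite lt_eqF].
  have e0 : 0 < e by rewrite /e divr_gt0// mulr_gt0// ltr_wpDl.
  have [phi tphi hphi] := tests_dense oA Aoo h2 h0 e0.
  have tflat := test_flat tphi; set psi := fun x => flat 0 (phi x).
  have L2t g : test_function A g -> L2 g.
    move=> tg; have mg := test_measurable tg; have [K KP] := test_bounded tg.
    split => //; apply: (@intg_bounded _ _ _ A (K ^+ 2)) => //.
    - exact: measurable_funX.
    - move=> x; rewrite normrX; apply: lerXn2r; rewrite ?nnegrE//.
      by rewrite (le_trans _ (KP x)).
    - by move=> x Ax; rewrite (test_out tg Ax) expr0n.
  have psi2 : L2 psi by exact: L2t.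
  have ch2 : L2 (c *: h - psi).
    by have := L2_lin (-1) psi2 (L2_lin c h2 L2_0); rewrite addr0 scaleN1r addrC.
  have hp2 : L2 (h - phi).
    by have := L2_lin (-1) (L2t _ tphi) h2; rewrite scaleN1r addrC.
  have psi_ge0 : 0 <= ip f psi by apply: fphi => // x; exact: flat_ge0.
  have E1 : ip f (c *: h - psi) = c * I - ip f psi.
    have psiN2 : L2 (- psi) by have := L2_lin (-1) psi2 L2_0; rewrite addr0 scaleN1r.
    rewrite ipC (ip_lin c h2 psiN2 f2) (ipC h); congr (_ + _).
    have := ip_lin (-1) psi2 L2_0 f2; rewrite addr0 scaleN1r mulN1r (ipC psi) => ->.
    suff -> : ip 0 f = 0 by rewrite addr0.
    by rewrite /ip; under eq_Rintegral do rewrite mul0r; rewrite Rintegral_cst// mul0r.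
  have := L2_cauchy_schwarz f2 ch2; rewrite E1.
  have le4 : ip (c *: h - psi) (c *: h - psi) <= 4 * ip (h - phi) (h - phi).
    rewrite !ip_sqr -RintegralZl//; last by have [] := hp2.
    apply: le_RintegralT; [by have [] := ch2|by apply: intgZ; have [] := hp2|].
    move=> x; rewrite -[(c *: h - psi) x]/(c * h x - flat 0 (phi x)) -[(h - phi) x]/(h x - phi x).
    rewrite chE -[leLHS]real_normK ?num_real// -[X in _ <= _ * X]real_normK ?num_real//.
    rewrite (_ : 4 = 2 ^+ 2); last by rewrite -natrX.
    rewrite -exprMn; apply: lerXn2r; rewrite ?nnegrE ?mulr_ge0//.
    exact: flat0_lipschitz.
  move=> CS.
  have b1 : (c * I) ^+ 2 <= (c * I - ip f psi) ^+ 2.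
    have cI0 : c * I < 0 by rewrite pmulr_rlt0.
    by nra.
  have b2 : ip f f * ip (c *: h - psi) (c *: h - psi) <= ip f f * (4 * e).
    by rewrite ler_wpM2l// (le_trans le4)// ler_wpM2l// ltW.
  have b3 : ip f f * (4 * e) < (c * I) ^+ 2.
    have -> : ip f f * (4 * e) = (c * I) ^+ 2 * (ip f f / (ip f f + 1)).
      by rewrite /e; field; rewrite gt_eqF// ltr_wpDl.
    rewrite gtr_pMr// ltr_pdivrMr ?mul1r; last by rewrite ltr_wpDl.
    by rewrite ltrDl.
  by have := lt_le_trans (le_lt_trans b2 b3) b1; rewrite ltNge CS.
have fh0 : {ae mu, forall x, - (f x * h x) = 0}.
  have iN : intg (fun x => - (f x * h x)).
    by have := intgZ (-1) ifh; under eq_fun do rewrite mulN1r.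
  have g0 : \int[mu]_x - (f x * h x) = 0.
    have E2 : \int[mu]_x - (f x * h x) = - \int[mu]_x (f x * h x).
      by rewrite -mulN1r -RintegralZl//; apply: eq_Rintegral => x _; rewrite mulN1r.
    apply/eqP; rewrite eq_le; apply/andP; split; first by rewrite E2 oppr_le0.
    by apply: Rintegral_ge0 => x _; rewrite oppr_ge0.
  have mN : measurable_fun setT (fun x => - (f x * h x)) by exact: intg_measurable iN.
  have h1 : (\int[mu]_x `|(- (f x * h x))%:E| = 0)%E.
    under eq_integral do rewrite gee0_abs ?lee_fin ?oppr_ge0//.
    by rewrite Rintegral_EFin// g0.
  have := (ae_eq_integral_abs mu measurableT (iffRL (measurable_EFinP _ _) mN)).1 h1.
  by apply: ae_imp => x /(_ I) [].
apply: ae_imp fh0 => x E0 Ax; rewrite leNgt; apply/negP => fx0.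
by move: E0; rewrite /h indicE mem_set// mulr1 => /eqP; rewrite oppr_eq0 lt_eqF.
Qed.

End positivity.

(** * The limit matrix at a point *)

Section pointwise_coefficients.
Context {R : realType} {n m : nat}.
Variables (s l : 'I_n -> 'I_m -> R) (c0 c1 : R).
Implicit Types (xi : 'rV[R]_n) (eta v : 'I_m -> R).

Definition rmul (t : 'I_n -> 'I_m -> R) xi : 'I_m -> R := fun j => \sum_i xi ord0 i * t i j.
Definition cols (t : 'I_n -> 'I_m -> R) : 'M[R]_(m, n) := \matrix_(j, i) t i j.
(** With [S] and [L] the matrices of columns s^i and l^i, this is S L^T (L L^T)^(-1). The inverse is
    written by the adjugate, and 1/det as (det^2)^(-1) det with a real power, so that measurability
    in the entries is apparent. *)
Definition solve : 'M[R]_m :=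
  let G := cols l *m (cols l)^T in
  cols s *m (cols l)^T *m (((\det G ^+ 2) `^ (-1) * \det G) *: \adj G).

Hypotheses (c10 : 0 < c1) (lfree : row_free (cols l))
  (A1 : forall i k, dot (s i) (l k) = dot (s k) (l i))
  (A2 : forall xi, c0 * dot (rmul l xi) (rmul l xi) <= dot (rmul s xi) (rmul l xi))
  (A3 : forall xi eta, 0 <= c1 * dot (rmul s xi) (rmul l xi) - 2 * dot (rmul s xi) eta + dot eta eta).

Let G := cols l *m (cols l)^T.
Let P := (cols l)^T *m (((\det G ^+ 2) `^ (-1) * \det G) *: \adj G).

Let cols_rmul t xi j : (cols t *m xi^T) j ord0 = rmul t xi j.
Proof. by rewrite mxE; apply: eq_bigr => i _; rewrite !mxE mulrC. Qed.

Let detG : \det G != 0.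
Proof.
have Gfree : row_free G.
  apply: inj_row_free => v vG; have : v *m cols l = 0.
    have vv : (v *m cols l) *m (v *m cols l)^T = 0.
      by rewrite trmx_mul mulmxA -(mulmxA v) vG mul0mx.
    have v0 := dot_eq0 (v := (v *m cols l) ord0).
    apply/rowP => i; rewrite [RHS]mxE; apply: v0.
    have := congr1 (fun M : 'M[R]_1 => M ord0 ord0) vv; rewrite !mxE => <-.
    by apply: eq_bigr => k _; rewrite [(_ ^T) _ _]mxE.
  by move=> vl; apply: (row_free_inj lfree); rewrite vl mul0mx.
by move: Gfree; rewrite row_free_unit unitmxE unitfE.
Qed.

Let lP : cols l *m P = 1%:M.
Proof.
rewrite /P mulmxA -/G -scalemxAr mul_mx_adj scale_scalar_mx powR_inv1 ?sqr_ge0//.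
by rewrite -mulrA -expr2 mulVf// expf_neq0.
Qed.

(** A linear relation among the [l i] must hold among the [s i] if a matrix is to map one family to
    the other. It follows from [A3] with [eta] the combination of the [s i]: when that of the [l i]
    vanishes, the inequality reads 0 <= -|eta|^2. *)
Let ker k (Z : 'M[R]_(n, k)) : cols l *m Z = 0 -> cols s *m Z = 0.
Proof.
move=> lZ; apply/matrixP => j i; rewrite [RHS]mxE.
pose xi : 'rV[R]_n := (col i Z)^T.
have E t : rmul t xi = fun j => (cols t *m Z) j i.
  apply/funext => j'; rewrite -cols_rmul trmxK mxE [RHS]mxE.
  by apply: eq_bigr => k' _; rewrite [col _ _ _ _]mxE.
have := A3 xi (rmul s xi).
have -> : rmul l xi = 0 by rewrite E lZ; apply/funext => j'; rewrite mxE.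
rewrite (dotC _ 0) (_ : dot 0 _ = 0); last by rewrite /dot big1// => k' _; rewrite mul0r.
have := dot_ge0 (rmul s xi); rewrite mulr0 => d0 d1.
have /dot_eq0/(_ j) : dot (rmul s xi) (rmul s xi) = 0 by apply/eqP; rewrite eq_le d0 andbT; lra.
by rewrite E.
Qed.

Let solveE : solve = cols s *m P. Proof. by rewrite /solve /P mulmxA. Qed.

Lemma solve_cols : solve *m cols l = cols s.
Proof.
apply/eqP; rewrite -subr_eq0 solveE -mulmxA -[X in _ - X]mulmx1 -mulmxBr.
by apply/eqP; apply: ker; rewrite mulmxBr mulmxA lP mul1mx mulmx1 subrr.
Qed.

Lemma solve_mulv i : mulv solve (l i) = s i.
Proof.
apply/funext => j; have := congr1 (fun M : 'M[R]_(m, n) => M j i) solve_cols; rewrite !mxE => <-.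
by apply: eq_bigr => k _; rewrite [cols _ _ _]mxE.
Qed.

Lemma solve_elliptic : elliptic c0 c1 solve.
Proof.
split.
  (* [A1] says that S^T L is symmetric; multiplied by P^T on the left and [P] on the right, S^T L
     becomes the transpose of [solve] and L^T S becomes [solve]. *)
  have sl : (cols s)^T *m cols l = (cols l)^T *m cols s.
    apply/matrixP => i k; rewrite !mxE; transitivity (dot (s i) (l k)).
      by apply: eq_bigr => j _; rewrite !mxE.
    by rewrite A1; apply: eq_bigr => j _; rewrite !mxE mulrC.
  have e1 : P^T *m ((cols s)^T *m cols l) *m P = solve^T.
    by rewrite [in RHS]solveE [in RHS]trmx_mul -!mulmxA lP mulmx1.
  have e2 : P^T *m ((cols l)^T *m cols s) *m P = solve.
    by rewrite solveE mulmxA -trmx_mul lP trmx1 mul1mx.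
  by rewrite -e1 sl e2.
move=> v; pose xi : 'rV[R]_n := (P *m (\col_j v j))^T.
have vE : rmul l xi = v.
  by apply/funext => j; rewrite -cols_rmul trmxK mulmxA lP mul1mx mxE.
have sE : rmul s xi = mulv solve v.
  apply/funext => j; rewrite -cols_rmul trmxK mulmxA -solveE mxE.
  by apply: eq_bigr => k _; rewrite [(\col__ _) _ _]mxE.
(* [A3] at [eta = c1 v] reads 0 <= -c1 t + c1^2 d with t = <a v, v> and d = |v|^2, which is the
   upper bound. *)
have := A2 xi; have := A3 xi (c1 *: v); rewrite vE sE.
rewrite (dotC _ (c1 *: v)) !dotZ (dotC v (c1 *: v)) dotZ (dotC v (mulv _ _)).
move: (dot v v) (dot (mulv solve v) v) => d t h1 h2; apply/andP; split => //.
by rewrite -(ler_pM2l c10); nra.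
Qed.

End pointwise_coefficients.

Section measurable_matrices.
Context {R : realType} {n : nat}.

Definition mmx p q (A : 'rV[R]_n -> 'M[R]_(p, q)) := forall i j, measurable_fun setT (fun x => A x i j).

Lemma mmx_mul p q r (A : 'rV[R]_n -> 'M[R]_(p, q)) (B : 'rV[R]_n -> 'M[R]_(q, r)) :
  mmx A -> mmx B -> mmx (fun x => A x *m B x).
Proof.
move=> mA mB i j; under eq_fun do rewrite mxE.
by apply: measurable_sum => k; exact: measurable_funM.
Qed.

Lemma mmx_tr p q (A : 'rV[R]_n -> 'M[R]_(p, q)) : mmx A -> mmx (fun x => (A x)^T).
Proof. by move=> mA i j; under eq_fun do rewrite mxE; exact: mA. Qed.

Lemma measurable_det p (A : 'rV[R]_n -> 'M[R]_p) : mmx A -> measurable_fun setT (fun x => \det (A x)).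
Proof.
move=> mA; apply: measurable_sum => s; apply: measurable_funM => //.
by apply: measurable_prod => i _; exact: mA.
Qed.

Lemma mmx_solve m (s l : 'rV[R]_n -> 'I_n -> 'I_m -> R) :
  (forall i j, measurable_fun setT (fun x => s x i j)) ->
  (forall i j, measurable_fun setT (fun x => l x i j)) -> mmx (fun x => solve (s x) (l x)).
Proof.
move=> ms ml; have mc (t : 'rV[R]_n -> 'I_n -> 'I_m -> R) :
    (forall i j, measurable_fun setT (fun x => t x i j)) -> mmx (fun x => cols (t x)).
  by move=> mt j i; under eq_fun do rewrite mxE; exact: mt.
have mG : mmx (fun x => cols (l x) *m (cols (l x))^T).
  by apply: mmx_mul; [exact: mc|apply: mmx_tr; exact: mc].
apply: mmx_mul; first by apply: mmx_mul; [exact: mc|apply: mmx_tr; exact: mc].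
move=> i j; under eq_fun do rewrite mxE.
have mdet := measurable_det mG.
apply: measurable_funM.
  apply: measurable_funM => //.
  apply: (measurableT_comp (f := fun t : R => t `^ (-1))); first exact: measurable_powR.
  exact: measurable_funX.
under eq_fun do rewrite mxE; apply: measurable_funM => //.
by apply: measurable_det => i' j'; rewrite (_ : (fun x => _) =
  (fun x => (cols (l x) *m (cols (l x))^T) (lift j i') (lift i j'))); [exact: mG|
  by apply/funext => x; rewrite !mxE].
Qed.

End measurable_matrices.

(** Inequalities obtained from weak limits hold almost everywhere for each fixed vector; taking them
    at rational vectors and using continuity gives one null set for all vectors. *)
Lemma rational_ge0 (R : realType) k (F : 'rV[R]_k -> R) : continuous F ->
  (forall q : 'rV[rat]_k, 0 <= F (map_mx ratr q)) -> forall x, 0 <= F x.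
Proof.
move=> cF Fq x; rewrite leNgt; apply/negP => Fx.
pose A := [set y | F y < 0].
have oA : open A.
  rewrite (_ : A = F @^-1` `]-oo, 0[%classic).
    by apply: (open_comp (f := F)); [move=> y _; exact: cF|exact: interval_open].
  by apply/seteqP; split => y /=; rewrite in_itv.
have [q qA xq] : (\bigcup_(q in [set q | cbox (rat_box q).1 (rat_box q).2 `<=` A])
    obox (rat_box q).1 (rat_box q).2) x by rewrite -open_bigcup_obox.
have : A (rat_box q).1.
  by apply: qA => i; rewrite lexx/=; have /andP[h1 h2] := xq i; exact: ltW (lt_trans h1 h2).
by rewrite /A/= ltNge Fq.
Qed.

Lemma continuous_rmul (R : realType) n m (t : 'I_n -> 'I_m -> R) j :
  continuous (fun xi : 'rV[R]_n => rmul t xi j).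
Proof.
rewrite /rmul; elim: (index_enum _) => [|i r IH].
  by under eq_fun do rewrite big_nil; exact: cst_continuous.
under eq_fun do rewrite big_cons; apply: continuousD_rV => //.
by apply: continuousM_rV; [exact: coord_continuous|exact: cst_continuous].
Qed.

Lemma continuous_dot_rV (R : realType) n m (V W : 'rV[R]_n -> 'I_m -> R) :
  (forall j, continuous (fun x => V x j)) -> (forall j, continuous (fun x => W x j)) ->
  continuous (fun x => dot (V x) (W x)).
Proof.
move=> cV cW; rewrite /dot; elim: (index_enum _) => [|i r IH].
  by under eq_fun do rewrite big_nil; exact: cst_continuous.
by under eq_fun do rewrite big_cons; apply: continuousD_rV => //; apply: continuousM_rV.
Qed.

(** * The limit coefficients from weak limits of fluxes *)

Section limit_coefficients.
Context {R : realType} {n m : nat}.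
Local Notation mu := (lebesgue_rV R n).
Local Notation intg f := (mu.-integrable setT (EFin \o f)).
Variables (Omega : set 'rV[R]_n) (X : 'I_m -> 'rV[R]_n -> 'rV[R]_n) (c0 c1 : R).
Hypotheses (oO : open Omega) (bO : bounded_set Omega) (vX : forall j, vfield Omega (X j))
  (LX : LIC X Omega) (c00 : 0 < c0) (c01 : c0 <= c1).
Implicit Types (phi : 'rV[R]_n -> R) (A : set 'rV[R]_n) (U V : 'I_m -> 'rV[R]_n -> R).

(** The data left after all extractions. [cf_P] is the asymptotic orthogonality; its threshold [d]
    depends on the energy bound [C] and on [e], but not on [z]. *)
Record corrector_family (b : nat -> 'rV[R]_n -> 'M[R]_m) (M : R)
    (w : 'I_n -> nat -> 'rV[R]_n -> R) (W : 'I_n -> nat -> 'I_m -> 'rV[R]_n -> R)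
    (sigma : 'I_n -> 'I_m -> 'rV[R]_n -> R) : Prop := {
  cf_coef : forall k, coefficients c0 c1 (b k);
  cf_grad : forall i k, grad2 X Omega (w i k) (W i k);
  cf_cvg : forall i, ip (w i k - coordf Omega i) (w i k - coordf Omega i) @[k --> \oo] --> (0 : R);
  cf_M : forall i k, vip (flux (b k) (W i k)) (W i k) <= M;
  cf_P : forall i (C e : R), 0 < e -> exists2 d, 0 < d & exists K, forall k z Z, (K <= k)%N ->
    grad2 X Omega z Z -> ip z z <= d -> vip (flux (b k) Z) Z <= C ->
    `|vip (flux (b k) (W i k)) Z| <= e;
  cf_sigma : forall i, vL2 (sigma i);
  cf_S : forall i g, vL2 g -> vip (flux (b k) (W i k)) g @[k --> \oo] --> vip (sigma i) g;
  cf_W : forall i g, vL2 g -> vip (W i k) g @[k --> \oo] --> vip (coordX Omega X i) g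
}.

Variables (b : nat -> 'rV[R]_n -> 'M[R]_m) (M : R)
  (w : 'I_n -> nat -> 'rV[R]_n -> R) (W : 'I_n -> nat -> 'I_m -> 'rV[R]_n -> R)
  (sigma : 'I_n -> 'I_m -> 'rV[R]_n -> R).
Hypothesis cf : corrector_family b M w W sigma.
Local Notation S i k := (flux (b k) (W i k)).
Local Notation L := (coordX Omega X).

Let cb k : coefficients c0 c1 (b k). Proof. exact: cf_coef cf k. Qed.

Lemma vL2_W i k : vL2 (W i k). Proof. by have [_ _ []] := cf_grad cf i k. Qed.

Lemma vL2_S i k : vL2 (S i k). Proof. exact: vL2_flux c00 (cb k) _ (vL2_W i k). Qed.

Lemma vL2_L i : vL2 (L i).
Proof. by have [_ _ []] := grad2_coord oO bO vX i. Qed.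

Lemma coordX_bounded : exists K : R, forall i j x, `|L i j x| <= K.
Proof.
have /choice[K KP] : forall ij : 'I_n * 'I_m, exists K : R, forall x, `|L ij.1 ij.2 x| <= K.
  move=> [i j]; have [_ [K [_ XK]]] := vX j i; exists `|K| => x.
  rewrite /coordX /= patchE; case: ifPn => [|_]; last by rewrite normr0.
  by rewrite inE => /XK /le_trans; apply; exact: ler_norm.
exists (\sum_ij `|K ij|) => i j x; rewrite (le_trans (KP (i, j) x))//.
rewrite (le_trans (ler_norm _))// (bigD1 (i, j))//= lerDl.
by apply: sumr_ge0.
Qed.

Lemma W_bounded i k : vip (W i k) (W i k) <= M / c0.
Proof.
rewrite ler_pdivlMr// mulrC (le_trans (vip_flux_ge c00 (cb k) (vL2_W i k)))//.
exact: cf_M cf i k.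
Qed.

Lemma corrector_div_curl i A phi r (u_ : nat -> 'rV[R]_n -> R)
    (U_ : nat -> 'I_m -> 'rV[R]_n -> R) u U (C : R) :
  open_in Omega A -> test_function A phi -> increasing_nat r ->
  (forall h, grad2 X A (u_ h) (U_ h)) -> grad2 X A u U ->
  ip (u_ h - u) (u_ h - u) @[h --> \oo] --> (0 : R) -> (forall h, vip (U_ h) (U_ h) <= C) ->
  vip (S i (r h)) (smul phi (U_ h)) @[h --> \oo] --> vip (sigma i) (smul phi U).
Proof.
move=> oA tphi incr HU_ HU uc UC.
apply: (div_curl oO bO vX c00 c01 cb _ (cf_M cf i) (cf_P cf i) _ oA tphi incr HU_ HU uc UC).
  by move=> k; exact: vL2_W.
by move=> g; exact: (cf_S cf).
Qed.

(** The div-curl lemma applied to the correctors themselves: products of fluxes and gradients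
    converge although both factors converge only weakly. *)
Lemma energy_cvg phi i l r : increasing_nat r -> test_function Omega phi ->
  vip (S i (r k)) (smul phi (W l (r k))) @[k --> \oo] --> vip (sigma i) (smul phi (L l)).
Proof.
move=> incr tphi.
apply: (@corrector_div_curl i Omega phi r (fun k => w l (r k)) (fun k => W l (r k)) (coordf Omega l) (L l) (M / c0)) => //.
- by split.
- by move=> h; exact: (cf_grad cf).
- exact: grad2_coord.
- exact: (cvg_comp _ _ (increasing_nat_cvg incr) (cf_cvg cf l)).
- by move=> h; exact: W_bounded.
Qed.

Definition comb (xi : 'rV[R]_n) (F : 'I_n -> 'I_m -> 'rV[R]_n -> R) : 'I_m -> 'rV[R]_n -> R :=
  \sum_i xi ord0 i *: F i.

Lemma combE xi F x : (comb xi F) ^~ x = rmul (fun i j => F i j x) xi.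
Proof. by apply/funext => j; rewrite /comb fct_sumE fct_sumE. Qed.

Lemma vL2Z (a : R) V : vL2 V -> vL2 (a *: V).
Proof. by move=> hV; have := vL2_lin a hV (vL2B hV hV); rewrite subrr addr0. Qed.

Lemma vL2_comb xi F : (forall i, vL2 (F i)) -> vL2 (comb xi F).
Proof. by move=> hF; apply: vL2_sum => i; exact: vL2Z. Qed.

Lemma vip_comb xi F g : (forall i, vL2 (F i)) -> vL2 g ->
  vip (comb xi F) g = \sum_i xi ord0 i * vip (F i) g.
Proof.
move=> hF hg; rewrite /comb vip_suml//; last by move=> i; exact: vL2Z.
apply: eq_bigr => i _; have := vip_lin (xi ord0 i) (hF i) (vL2B (hF i) (hF i)) hg.
by rewrite vipBl// !subrr addr0 addr0.
Qed.

Lemma flux_comb B xi F : flux B (comb xi F) = comb xi (fun i => flux B (F i)).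
Proof.
rewrite flux_sum; apply: eq_bigr => i _.
exact: (flux_smul B (cst (xi ord0 i)) (F i)).
Qed.

Lemma vip_comb2 xi phi (K : R) F G : measurable_fun setT phi -> (forall x, `|phi x| <= K) ->
  (forall i, vL2 (F i)) -> (forall i, vL2 (G i)) ->
  vip (comb xi F) (smul phi (comb xi G)) =
  \sum_i \sum_l xi ord0 i * (xi ord0 l * vip (F i) (smul phi (G l))).
Proof.
move=> mp pK hF hG; have sm V : vL2 V -> vL2 (smul phi V) by exact: vL2_smul pK.
rewrite vip_comb//; last exact/sm/vL2_comb.
apply: eq_bigr => i _; rewrite -vip_smul vipC vip_comb//; last exact: sm.
by rewrite mulr_sumr; apply: eq_bigr => l _; rewrite vipC vip_smul.
Qed.

Lemma comb_energy_cvg phi xi : test_function Omega phi ->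
  vip (comb xi (fun i => S i k)) (smul phi (comb xi (fun i => W i k))) @[k --> \oo] -->
  vip (comb xi sigma) (smul phi (comb xi L)).
Proof.
move=> tphi; have [K pK] := test_bounded tphi; have mp := test_measurable tphi.
rewrite (vip_comb2 xi mp pK (cf_sigma cf) vL2_L).
under eq_fun => k do rewrite (vip_comb2 xi mp pK (fun i => vL2_S i k) (fun i => vL2_W i k)).
apply: cvg_sumr => i; apply: cvg_sumr => l.
apply: cvgM; first exact: cvg_cst.
apply: cvgM; first exact: cvg_cst.
exact: (@energy_cvg phi i l id).
Qed.

Lemma comb_weak_cvg xi (F : 'I_n -> nat -> 'I_m -> 'rV[R]_n -> R) G g :
  (forall i k, vL2 (F i k)) -> (forall i, vL2 (G i)) ->
  (forall i, vip (F i k) g @[k --> \oo] --> vip (G i) g) -> vL2 g ->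
  vip (comb xi (fun i => F i k)) g @[k --> \oo] --> vip (comb xi G) g.
Proof.
move=> hF hG H hg; rewrite vip_comb//; under eq_fun => k do rewrite vip_comb//.
by apply: cvg_sumr => i; apply: cvgM => //; exact: cvg_cst.
Qed.

Lemma L2_dot_bounded V V' (K : R) : vL2 V -> (forall j, measurable_fun setT (V' j)) ->
  (forall j x, `|V' j x| <= K) -> L2 (fun x => dot (V ^~ x) (V' ^~ x)).
Proof.
move=> hV mV VK; have -> : (fun x => dot (V ^~ x) (V' ^~ x)) =
    \sum_j ((fun x => V' j x * V j x) : 'rV[R]_n -> R).
  by apply/funext => x; rewrite fct_sumE; apply: eq_bigr => j _; rewrite mulrC.
elim/big_ind : _ => [|f g|j _]; first exact: L2_0.
  by move=> hf hg; have := L2_lin 1 hf hg; rewrite scale1r.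
exact: (L2_bounded_mul _ (VK j)).
Qed.

(** The square |Y_k|^2 is at least 2 Y_k . V - |V|^2, which is affine in [Y_k] and so passes to the
    weak limit, while the energy on the right passes by div-curl. Testing with nonnegative functions
    localizes the result. Gradients in place of [Y_k] give the lower ellipticity bound, fluxes the
    upper one. *)
Lemma weak_lower_ae xi (Y_ : nat -> 'I_m -> 'rV[R]_n -> R) Y V (c K : R) : 0 <= c ->
  (forall k, vL2 (Y_ k)) -> vL2 Y ->
  (forall g, vL2 g -> vip (Y_ k) g @[k --> \oo] --> vip Y g) ->
  vL2 V -> (forall j, measurable_fun setT (V j)) -> (forall j x, `|V j x| <= K) ->
  (forall k x, c * dot (Y_ k ^~ x) (Y_ k ^~ x) <=
     dot (comb xi (fun i => S i k) ^~ x) (comb xi (fun i => W i k) ^~ x)) ->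
  {ae mu, forall x, Omega x -> 0 <= dot (comb xi sigma ^~ x) (comb xi L ^~ x)
    - c * (2 * dot (Y ^~ x) (V ^~ x) - dot (V ^~ x) (V ^~ x))}.
Proof.
move=> c0' hY_ hY Yc hV mV VK H.
have [KL KLP] := coordX_bounded.
have hs := vL2_comb xi (cf_sigma cf); have hl := vL2_comb xi vL2_L.
have L2Z' (a : R) f : L2 f -> L2 (fun x => a * f x) by move=> /(fun h => L2_lin a h L2_0); rewrite addr0.
have L2B' f g : L2 f -> L2 g -> L2 (fun x => f x - g x).
  by move=> hf hg; have := L2_lin (-1) hg hf; rewrite scaleN1r addrC.
apply: test_ge0_ae => //.
- exact: bounded_lebesgue_rV_lty (open_measurable_rV oO) bO.
- apply: (L2B'); first apply: (@L2_dot_bounded _ _ (\sum_i `|xi ord0 i| * KL)) => //.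
  + by move=> j; have [] := hl j.
  + move=> j x; rewrite (congr1 (@^~ j) (combE xi L x)) (le_trans (ler_norm_sum _ _ _))//.
    by apply: ler_sum => i _; rewrite normrM ler_wpM2l.
  apply: (L2Z'); apply: (L2B'); last exact: L2_dot_bounded VK.
  by apply: (L2Z'); exact: L2_dot_bounded VK.
move=> phi tphi phi0; have [Kp pK] := test_bounded tphi; have mp := test_measurable tphi.
have sm V' : vL2 V' -> vL2 (smul phi V') by exact: vL2_smul pK.
have iE (s l y : 'I_m -> 'rV[R]_n -> R) : vL2 s -> vL2 l -> vL2 y ->
    intg (fun x => (dot (s ^~ x) (l ^~ x) - c * (2 * dot (y ^~ x) (V ^~ x) - dot (V ^~ x) (V ^~ x))) * phi x) /\
    \int[mu]_x ((dot (s ^~ x) (l ^~ x) - c * (2 * dot (y ^~ x) (V ^~ x) - dot (V ^~ x) (V ^~ x))) * phi x)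
    = vip s (smul phi l) - c * (2 * vip y (smul phi V) - vip V (smul phi V)).
  move=> h1 h2 h3.
  have i1 := intg_dot h1 (sm _ h2); have i2 := intg_dot h3 (sm _ hV); have i3 := intg_dot hV (sm _ hV).
  have dE (p q : 'I_m -> 'rV[R]_n -> R) x : dot (p ^~ x) ((smul phi q) ^~ x) = dot (p ^~ x) (q ^~ x) * phi x.
    by rewrite /dot mulr_suml; apply: eq_bigr => j _; rewrite /smul; ring.
  have E : (fun x => (dot (s ^~ x) (l ^~ x) - c * (2 * dot (y ^~ x) (V ^~ x) - dot (V ^~ x) (V ^~ x))) * phi x) =
     (fun x => dot (s ^~ x) ((smul phi l) ^~ x) - c * (2 * dot (y ^~ x) ((smul phi V) ^~ x) - dot (V ^~ x) ((smul phi V) ^~ x))).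
    by apply/funext => x; rewrite !dE; ring.
  have ic := intgZ c (intgB (intgZ 2 i2) i3).
  rewrite E; split; first exact: intgB.
  rewrite RintegralB// RintegralZl//; last exact: (intgB (intgZ 2 i2) i3).
  by rewrite RintegralB//; [rewrite RintegralZl// !vip_dot//; exact: sm|exact: intgZ].
rewrite (iE _ _ _ hs hl hY).2.
have lim : vip (comb xi (fun i => S i k)) (smul phi (comb xi (fun i => W i k)))
    - c * (2 * vip (Y_ k) (smul phi V) - vip V (smul phi V)) @[k --> \oo] -->
    vip (comb xi sigma) (smul phi (comb xi L)) - c * (2 * vip Y (smul phi V) - vip V (smul phi V)).
  apply: cvgB; first exact: comb_energy_cvg.
  apply: cvgM; first exact: cvg_cst.
  apply: cvgB; last exact: cvg_cst.
  by apply: cvgM; [exact: cvg_cst|exact/Yc/sm].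
apply: (@cvgr_to_ge _ _ _ _ _ _ _ lim); apply: nearW => k.
rewrite -(iE _ _ _ (vL2_comb xi (fun i => vL2_S i k)) (vL2_comb xi (fun i => vL2_W i k)) (hY_ k)).2.
apply: Rintegral_ge0 => x _; rewrite mulr_ge0// subr_ge0 (le_trans _ (H k x))// ler_wpM2l//.
rewrite /dot mulr_sumr -sumrB; apply: ler_sum => j _.
by have := sqr_ge0 (Y_ k j x - V j x); nra.
Qed.

(** By symmetry of [b h], both sides integrated against a test function are limits of the same
    numbers. *)
Lemma sym_ae i k : {ae mu, forall x, Omega x ->
  dot (sigma i ^~ x) (L k ^~ x) = dot (sigma k ^~ x) (L i ^~ x)}.
Proof.
pose f x := dot (sigma i ^~ x) (L k ^~ x) - dot (sigma k ^~ x) (L i ^~ x).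
have hs := cf_sigma cf; have i1 := intg_dot (hs i) (vL2_L k); have i2 := intg_dot (hs k) (vL2_L i).
have : {ae mu, forall x, Omega x -> f x = 0}.
  apply: test_integral0_ae0 => //; first exact: intgB.
  move=> phi tphi; have [Kp pK] := test_bounded tphi; have mp := test_measurable tphi.
  have sm V' : vL2 V' -> vL2 (smul phi V') by exact: vL2_smul pK.
  have E : \int[mu]_x (f x * phi x) = vip (sigma i) (smul phi (L k)) - vip (sigma k) (smul phi (L i)).
    rewrite !vip_dot//; try exact/sm/vL2_L.
    rewrite -RintegralB//; try exact/intg_dot/sm/vL2_L.
    apply: eq_Rintegral => x _; rewrite /f mulrBl /dot !mulr_suml.
    by congr (_ - _); apply: eq_bigr => j _; rewrite /smul; ring.
  have e1 : vip (S i h) (smul phi (W k h)) @[h --> \oo] --> vip (sigma i) (smul phi (L k)).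
    exact: (@energy_cvg phi i k id).
  have e2 : vip (S k h) (smul phi (W i h)) @[h --> \oo] --> vip (sigma k) (smul phi (L i)).
    exact: (@energy_cvg phi k i id).
  have E2 h : vip (S k h) (smul phi (W i h)) = vip (S i h) (smul phi (W k h)).
    rewrite -[LHS]vip_smul -flux_smul (vip_flux_sym c00 (cb h))//; try exact: vL2_W.
    exact/sm/vL2_W.
  rewrite E; apply/eqP; rewrite subr_eq0; apply/eqP.
  move: e2; under eq_fun do rewrite E2; move=> e2; exact: (cvg_unique _ e1 e2).
by apply: ae_imp => x h Ox; apply/eqP; rewrite -subr_eq0; apply/eqP; exact: h.
Qed.

Definition ind_field (eta : 'I_m -> R) : 'I_m -> 'rV[R]_n -> R := fun j => cst (eta j) \_ Omega.

Lemma ind_field_bounded eta : [/\ vL2 (ind_field eta), forall j, measurable_fun setT (ind_field eta j) &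
  forall j x, `|ind_field eta j x| <= \sum_j `|eta j|].
Proof.
have lc c : lip_bounded Omega (cst c : 'rV[R]_n -> R).
  by exists 0, `|c|; split => // x y _ _; rewrite subrr normr0 mul0r.
split => [j|j|j x].
- exact: lip_bounded_L2 (lc _).
- exact: lip_bounded_measurable (lc _).
- rewrite (@le_trans _ _ `|eta j|)//; last by rewrite (bigD1 j)//= lerDl sumr_ge0.
  by rewrite /ind_field patchE; case: ifP => //; rewrite normr0.
Qed.

Lemma limit_coefficients : exists2 a, coefficients c0 c1 a &
  {ae mu, forall x, Omega x -> forall i, mulv (a x) (L i ^~ x) = sigma i ^~ x}.
Proof.
have c10 : 0 < c1 by exact: lt_le_trans c01.
have [C [cC C0 CX]] := LX.
have [KL KLP] := coordX_bounded; have hs := cf_sigma cf.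
pose sx x := fun i j => sigma i j x; pose lx x := fun i j => L i j x.
pose qR k (q : 'rV[rat]_k) : 'rV[R]_k := map_mx ratr q.
(* Here [Y] and [V] are the same combination of the L^i, so nothing is lost by linearizing the
   square. *)
have ae2 : {ae mu, forall x, forall q : 'rV[rat]_n, Omega x ->
    c0 * dot (rmul (lx x) (qR _ q)) (rmul (lx x) (qR _ q)) <= dot (rmul (sx x) (qR _ q)) (rmul (lx x) (qR _ q))}.
  apply: ae_forall_countType => q.
  have hl := vL2_comb (qR _ q) vL2_L.
  have := @weak_lower_ae (qR _ q) (fun k => comb (qR _ q) (fun i => W i k)) (comb (qR _ q) L)
    (comb (qR _ q) L) c0 (\sum_i `|qR _ q ord0 i| * KL) (ltW c00)
    (fun k => vL2_comb (qR _ q) (fun i => vL2_W i k)) hl _ hl _ _ _.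
  move=> H; apply: ae_imp (H _ _ _ _) => [x h Ox| | | |].
  - by have := h Ox; rewrite !combE -/(lx x) -/(sx x); lra.
  - move=> g hg; apply: comb_weak_cvg => //; [exact: vL2_W|exact: vL2_L|move=> i; exact: (cf_W cf)].
  - by move=> j; have [] := hl j.
  - move=> j x; rewrite (congr1 (@^~ j) (combE (qR _ q) L x)) (le_trans (ler_norm_sum _ _ _))//.
    by apply: ler_sum => i _; rewrite normrM ler_wpM2l.
  - move=> k x; rewrite -flux_comb fluxE.
    by have [_ /(_ (comb (qR _ q) (fun i => W i k) ^~ x))/andP[]] := (cb k).2 x.
(* Here [Y] is the flux, controlled by |S|^2 <= c1 S . W from [elliptic_sqr_le], and a constant
   rational [V] plays the part of [eta] in [A3]. *)
have ae3 : {ae mu, forall x, forall q : 'rV[rat]_n * 'rV[rat]_m, Omega x ->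
    0 <= c1 * dot (rmul (sx x) (qR _ q.1)) (rmul (lx x) (qR _ q.1))
      - 2 * dot (rmul (sx x) (qR _ q.1)) (qR _ q.2 ord0) + dot (qR _ q.2 ord0) (qR _ q.2 ord0)}.
  apply: ae_forall_countType => -[q e] /=.
  have [e2 me eb] := ind_field_bounded (qR _ e ord0).
  have c1i : 0 <= c1^-1 by rewrite invr_ge0 ltW.
  have hS k := vL2_comb (qR _ q) (fun i => vL2_S i k).
  have H := @weak_lower_ae (qR _ q) (fun k => comb (qR _ q) (fun i => S i k)) (comb (qR _ q) sigma)
    _ c1^-1 _ c1i hS (vL2_comb (qR _ q) hs) _ e2 me eb _.
  apply: ae_imp (H _ _) => [x h Ox| |].
  - have := h Ox; rewrite !combE -/(lx x) -/(sx x).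
    have -> : (ind_field (qR _ e ord0)) ^~ x = qR _ e ord0.
      by apply/funext => j; rewrite /ind_field patchE mem_set.
    move=> h1; have := mulr_ge0 (ltW c10) h1.
    by rewrite mulrBr mulrA divff ?gt_eqF// mul1r; lra.
  - move=> g hg; apply: comb_weak_cvg => //; [exact: vL2_S|move=> i; exact: (cf_S cf)].
  - move=> k x; rewrite ler_pdivrMl// -flux_comb fluxE.
    exact: elliptic_sqr_le c00 ((cb k).2 x).
have ae1 : {ae mu, forall x, forall ik : 'I_n * 'I_n, Omega x ->
    dot (sx x ik.1) (lx x ik.2) = dot (sx x ik.2) (lx x ik.1)}.
  by apply: ae_forall_countType => -[i k]; exact: sym_ae.
have ae4 : {ae mu, forall x, Omega x -> row_free (cols (lx x))}.
  have mC : measurable (Omega `&` C).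
    by apply: measurableI; [exact: open_measurable_rV|rewrite -[C]setCK; apply: measurableC;
      apply: open_measurable_rV; exact: closed_openC].
  exists (Omega `&` C); split => // x /= /not_implyP[Ox nf]; split => //.
  apply: contrapT => nC; apply: nf; have := CX x (conj Ox nC); congr (row_free _ = _).
  apply/matrixP => j i; rewrite [RHS]mxE [LHS]mxE /lx /coordX patchE mem_set//.
have aeT := ae_imp2 (fun x h h' => conj h h') (ae_imp2 (fun x h1 h2 => conj h1 h2) ae1 ae2)
  (ae_imp2 (fun x h3 h4 => conj h3 h4) ae3 ae4).
have [N [mN N0 NP]] := aeT.
pose D := Omega `&` ~` N.
have mD : measurable D by apply: measurableI; [exact: open_measurable_rV|exact: measurableC].
have good x : D x -> elliptic c0 c1 (solve (sx x) (lx x)) /\ forall i, mulv (solve (sx x) (lx x)) (lx x i) = sx x i.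
  move=> [Ox Nx]; have /contrapT[[h1 h2] [h3 h4]] := (fun h => Nx (NP x h)).
  have A1 i k : dot (sx x i) (lx x k) = dot (sx x k) (lx x i) by exact: (h1 (i, k) Ox).
  have A2 xi : c0 * dot (rmul (lx x) xi) (rmul (lx x) xi) <= dot (rmul (sx x) xi) (rmul (lx x) xi).
    rewrite -subr_ge0; move: xi; apply: rational_ge0 => [|q]; last by rewrite subr_ge0; exact: h2.
    have cN (f g : 'rV[R]_n -> R) : continuous f -> continuous g -> continuous (fun y => f y - c0 * g y).
      by move=> cf' cg y; exact: (cvgB (cf' y) (cvgM (cvg_cst c0) (cg y))).
    by apply: cN; apply: continuous_dot_rV => j; exact: continuous_rmul.
  have A3 xi (eta : 'I_m -> R) : 0 <= c1 * dot (rmul (sx x) xi) (rmul (lx x) xi)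
      - 2 * dot (rmul (sx x) xi) eta + dot eta eta.
    have F3 k (f g h : 'rV[R]_k -> R) : continuous f -> continuous g -> continuous h ->
        continuous (fun y => c1 * f y - 2 * g y + h y).
      by move=> cf' cg ch y; exact: (cvgD (cvgB (cvgM (cvg_cst c1) (cf' y)) (cvgM (cvg_cst (2 : R)) (cg y))) (ch y)).
    have cc k (v : 'I_m -> R) j : continuous (fun y : 'rV[R]_k => v j) by move=> ?; exact: cst_continuous.
    suff H : forall eta' : 'rV[R]_m, 0 <= c1 * dot (rmul (sx x) xi) (rmul (lx x) xi)
        - 2 * dot (rmul (sx x) xi) (eta' ord0) + dot (eta' ord0) (eta' ord0).
      have := H (\row_j eta j); suff -> : (\row_j eta j) ord0 = eta by [].
      by apply/funext => j; rewrite mxE.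
    apply: rational_ge0 => [|e].
      apply: F3; first by move=> ?; exact: cst_continuous.
        by apply: continuous_dot_rV => j; [exact: cc|exact: coord_continuous].
      by apply: continuous_dot_rV => j; exact: coord_continuous.
    move: xi; apply: rational_ge0 => [|q]; last exact: (h3 (q, e) Ox).
    apply: F3; last by move=> ?; exact: cst_continuous.
      by apply: continuous_dot_rV => j; exact: continuous_rmul.
    by apply: continuous_dot_rV => j; [exact: continuous_rmul|exact: cc].
  have lf := h4 Ox; split; first exact: (solve_elliptic c10 lf A1 A2 A3).
  by move=> i; exact: (solve_mulv lf A3).
have msx i j : measurable_fun setT (fun x => sx x i j) by have [] := hs i j.
have mlx i j : measurable_fun setT (fun x => lx x i j) by have [] := vL2_L i j.
pose a x : 'M[R]_m := if `[< D x >] then solve (sx x) (lx x) else c0%:M.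
exists a.
  split => [i j|x]; last first.
    rewrite /a; case: asboolP => [/good[]//|_]; apply: elliptic_scalar.
    by rewrite lexx.
  have -> : (fun x => a x i j) = (fun x => ((solve (sx x) (lx x) i j - (c0%:M : 'M[R]_m) i j) * \1_D x + (c0%:M : 'M[R]_m) i j)).
    apply/funext => x; rewrite /a indicE; case: asboolP => Dx; first by rewrite mem_set// mulr1 subrK.
    by rewrite memNset// mulr0 add0r.
  apply: measurable_funD => //; apply: measurable_funM; last exact: measurable_indic.
  by apply: measurable_funB => //; exact: mmx_solve.
have : {ae mu, forall x, ~ N x} by exists N; split => // x /= /contrapT.
apply: ae_imp => x Nx Ox i; rewrite /a asboolT//; have [_] := good x (conj Ox Nx).
exact.
Qed.

End limit_coefficients.

(** * The two inequalities for quadratic integrands *)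

Section quadratic_limit.
Context {R : realType} {n m : nat}.
Local Notation mu := (lebesgue_rV R n).
Local Notation intg f := (mu.-integrable setT (EFin \o f)).
Variables (Omega : set 'rV[R]_n) (X : 'I_m -> 'rV[R]_n -> 'rV[R]_n) (c0 c1 : R).
Hypotheses (oO : open Omega) (bO : bounded_set Omega) (vX : forall j, vfield Omega (X j))
  (LX : LIC X Omega) (c00 : 0 < c0) (c01 : c0 <= c1).
Variables (b : nat -> 'rV[R]_n -> 'M[R]_m) (M : R)
  (w : 'I_n -> nat -> 'rV[R]_n -> R) (W : 'I_n -> nat -> 'I_m -> 'rV[R]_n -> R)
  (sigma : 'I_n -> 'I_m -> 'rV[R]_n -> R) (a : 'rV[R]_n -> 'M[R]_m).
Hypothesis cf : corrector_family Omega X c0 c1 b M w W sigma.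
Local Notation L := (coordX Omega X).
Hypotheses (ca : coefficients c0 c1 a)
  (aL : {ae mu, forall x, Omega x -> forall i, mulv (a x) (L i ^~ x) = sigma i ^~ x}).
Local Notation S i k := (flux (b k) (W i k)).

Let cb k : coefficients c0 c1 (b k). Proof. exact: cf_coef cf k. Qed.
Let W2 i k : vL2 (W i k). Proof. exact: vL2_W cf i k. Qed.
Let S2 i k : vL2 (S i k). Proof. exact: (vL2_S c00 cf i k). Qed.
Let L2' i : vL2 (L i). Proof. exact: vL2_L. Qed.
Let s2 i : vL2 (sigma i). Proof. exact: cf_sigma cf i. Qed.
Let c10 : 0 < c1. Proof. exact: lt_le_trans c01. Qed.

Section with_tests.
Variables (A : set 'rV[R]_n) (phi : 'I_n -> 'rV[R]_n -> R).
Hypotheses (oA : open_in Omega A) (tphi : forall i, test_function A (phi i)).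

Let msm i (V : 'I_m -> 'rV[R]_n -> R) : vL2 V -> vL2 (smul (phi i) V).
Proof.
have [K pK] := test_bounded (tphi i); have mp := test_measurable (tphi i).
exact: vL2_smul pK.
Qed.

Definition psum (V : 'I_n -> 'I_m -> 'rV[R]_n -> R) := \sum_i smul (phi i) (V i).

Lemma vL2_psum V : (forall i, vL2 (V i)) -> vL2 (psum V).
Proof. by move=> hV; apply: vL2_sum => i; exact: msm. Qed.

Lemma flux_psum B V : flux B (psum V) = psum (fun i => flux B (V i)).
Proof. by rewrite flux_sum; apply: eq_bigr => i _; rewrite flux_smul. Qed.

Lemma vip_psum V U : (forall i, vL2 (V i)) -> vL2 U ->
  vip (psum V) U = \sum_i vip (V i) (smul (phi i) U).
Proof.
move=> hV hU; rewrite vip_suml//; last by move=> i; exact: msm.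
by apply: eq_bigr => i _; exact: vip_smul.
Qed.

Lemma vip_psum2 V U : (forall i, vL2 (V i)) -> (forall i, vL2 (U i)) ->
  vip (psum V) (psum U) = \sum_i \sum_l vip (V i) (smul (fun x => phi i x * phi l x) (U l)).
Proof.
move=> hV hU; rewrite vip_psum//; last exact: vL2_psum.
apply: eq_bigr => i _; rewrite -vip_smul vipC vip_psum//; last exact: msm.
apply: eq_bigr => l _; rewrite vipC -vip_smul -[LHS]vipC -[RHS]vipC -[RHS]vip_smul.
rewrite -[RHS]vipC -[LHS]vipC vip_smul [LHS]vip_smul; congr vip.
by apply/funext => j; apply/funext => x; rewrite /smul; ring.
Qed.

Lemma vip_psum_sigma U : vL2 U -> vip (psum sigma) U = vip (flux a (psum L)) U.
Proof.
move=> hU; rewrite flux_psum !vip_psum//; last by move=> i; exact: vL2_flux c00 ca _ _.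
apply: eq_bigr => i _; apply: eq_bigr => j _; apply: Rintegral_ae.
- by apply: measurable_funM; [have [] := s2 i j|have [] := msm i hU j].
- by apply: measurable_funM; [have [] := vL2_flux c00 ca (L2' i) j|have [] := msm i hU j].
apply: ae_imp aL => x H.
have [Ox|Ox] := pselect (Omega x); last first.
  by rewrite /smul (test_out (tphi i)) ?mul0r ?mulr0// => /oA.2.
by rewrite -[sigma i j x]/((sigma i ^~ x) j) -(H Ox i).
Qed.

Lemma psum_energy_cvg r : increasing_nat r ->
  vip (psum (fun i => S i (r k))) (psum (fun i => W i (r k))) @[k --> \oo] -->
  vip (psum sigma) (psum L).
Proof.
move=> incr; rewrite vip_psum2//; under eq_fun => k do rewrite vip_psum2//.
apply: cvg_sumr => i; apply: cvg_sumr => l.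
apply: (energy_cvg oO bO vX c00 c01 cf) => //.
have [Cl _ _] := tphi l; exact: (test_sub oA.2 (test_mul (tphi i) Cl)).
Qed.

Lemma psum_div_curl r (u_ : nat -> 'rV[R]_n -> R) (U_ : nat -> 'I_m -> 'rV[R]_n -> R) u U (C : R) :
  increasing_nat r -> (forall h, grad2 X A (u_ h) (U_ h)) -> grad2 X A u U ->
  ip (u_ h - u) (u_ h - u) @[h --> \oo] --> (0 : R) -> (forall h, vip (U_ h) (U_ h) <= C) ->
  vip (psum (fun i => S i (r h))) (U_ h) @[h --> \oo] --> vip (psum sigma) U.
Proof.
move=> incr HU_ HU uc UC; have U2 : vL2 U by have [_ _ []] := HU.
have U2_ h : vL2 (U_ h) by have [_ _ []] := HU_ h.
rewrite vip_psum//; under eq_fun => k do rewrite vip_psum//.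
apply: cvg_sumr => i.
exact: (corrector_div_curl oO bO vX c00 c01 cf oA (tphi i) incr HU_ HU uc UC).
Qed.

Lemma psum_weak_cvg U : vL2 U ->
  vip (psum (fun i => S i k)) U @[k --> \oo] --> vip (psum sigma) U.
Proof.
move=> U2; rewrite vip_psum//; under eq_fun => k do rewrite vip_psum//.
by apply: cvg_sumr => i; apply: (cf_S cf); exact: msm.
Qed.

End with_tests.

Lemma form_expandB B (V P : 'I_m -> 'rV[R]_n -> R) : coefficients c0 c1 B -> vL2 V -> vL2 P ->
  vip (flux B (V - P)) (V - P) = vip (flux B V) V - 2 * vip (flux B P) V + vip (flux B P) P.
Proof.
move=> cB hV hP; have fV := vL2_flux c00 cB hV; have fP := vL2_flux c00 cB hP.
rewrite fluxB vipBl ?vipBr//; last exact: vL2B.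
by rewrite (vip_flux_sym c00 cB hV hP); ring.
Qed.

Lemma form_expandD B (V P : 'I_m -> 'rV[R]_n -> R) : coefficients c0 c1 B -> vL2 V -> vL2 P ->
  vip (flux B (V + P)) (V + P) = vip (flux B V) V + 2 * vip (flux B P) V + vip (flux B P) P.
Proof.
move=> cB hV hP; have fV := vL2_flux c00 cB hV; have fP := vL2_flux c00 cB hP.
rewrite fluxD vipDl ?vipDr//; last exact: vL2D.
by rewrite (vip_flux_sym c00 cB hV hP); ring.
Qed.

Lemma coord_fields_dense A U (e : R) : open_in Omega A -> vL2_on A U -> 0 < e ->
  exists2 phi : 'I_n -> 'rV[R]_n -> R, (forall i, test_function A (phi i)) &
    vip (U - psum phi L) (U - psum phi L) < e.
Proof.
move=> oA UA e0; have [K KP] := coordX_bounded vX.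
apply: (fields_dense oA.1 (open_in_lty bO oA) _ KP _ UA e0).
  by move=> i j; have [] := L2' i j.
have [C [cC C0 CX]] := LX.
exists (Omega `&` C); split => //.
  by apply: measurableI; [exact: open_measurable_rV|rewrite -[C]setCK; apply: measurableC;
    apply: open_measurable_rV; exact: closed_openC].
move=> x /= /not_implyP[Ax nf]; have Ox := oA.2 _ Ax; split => //.
apply: contrapT => nC; apply: nf => v vL.
have fX := CX x (conj Ox nC).
have vX0 : (\row_j v j) *m (\matrix_(j < m) X j x) = 0.
  apply/rowP => i; rewrite [RHS]mxE -(vL i) mxE; apply: eq_bigr => j _.
  by rewrite !mxE /coordX patchE mem_set.
have : \row_j v j = 0 :> 'rV[R]_m by apply: (row_free_inj fX); rewrite vX0 mul0mx.
by move=> H j; have := congr1 (fun r : 'rV[R]_m => r ord0 j) H; rewrite !mxE.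
Qed.

(** Nonnegativity of the form at [U_h - P_h], with P_h = sum_i phi_i W^i_h and flux S_h, bounds the
    energy below by 2 S_h . U_h - S_h . P_h, where both terms converge. The limit equals a(U, U) -
    a(U - psi, U - psi), and the subtracted term is at most c1 |U - psi|^2 < e. *)
Lemma quadratic_liminf A r (u_ : nat -> 'rV[R]_n -> R) (U_ : nat -> 'I_m -> 'rV[R]_n -> R) u U (c : R) :
  open_in Omega A -> increasing_nat r -> (forall h, grad2 X A (u_ h) (U_ h)) -> grad2 X A u U ->
  ip (u_ h - u) (u_ h - u) @[h --> \oo] --> (0 : R) ->
  (forall h, vip (flux (b (r h)) (U_ h)) (U_ h) <= c) -> vip (flux a U) U <= c.
Proof.
move=> oA incr HU_ HU uc Uc; have [_ _ UA _] := HU; have [U2 _] := UA.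
have U2_ h : vL2 (U_ h) by have [_ _ []] := HU_ h.
apply/ler_addgt0Pr => e e0.
have e1 : 0 < e / c1 by rewrite divr_gt0.
have [phi tphi he] := coord_fields_dense oA UA e1.
set psi := psum phi L in he; have psi2 : vL2 psi by apply: (vL2_psum tphi).
have UC h : vip (U_ h) (U_ h) <= c / c0.
  by rewrite ler_pdivlMr// mulrC (le_trans (vip_flux_ge c00 (cb (r h)) (U2_ h))).
have l1 := psum_div_curl oA tphi incr HU_ HU uc UC.
have l2 := psum_energy_cvg oA tphi incr.
have key : 2 * vip (psum phi sigma) U - vip (psum phi sigma) psi <= c.
  have lim : 2 * vip (psum phi (fun i => S i (r h))) (U_ h) - vip (psum phi (fun i => S i (r h))) (psum phi (fun i => W i (r h)))
      @[h --> \oo] --> 2 * vip (psum phi sigma) U - vip (psum phi sigma) psi.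
    by apply: cvgB => //; apply: cvgM => //; exact: cvg_cst.
  apply: (@cvgr_to_le _ _ _ _ _ _ _ lim); apply: nearW => h.
  have P2 : vL2 (psum phi (fun i => W i (r h))) by apply: (vL2_psum tphi) => i; exact: W2.
  have := vip_flux_ge0 c00 (cb (r h)) (vL2B (U2_ h) P2).
  by rewrite (form_expandB (cb _) (U2_ h) P2) flux_psum; have := Uc h; lra.
rewrite !(vip_psum_sigma oA tphi)// in key.
have := form_expandB ca U2 psi2; have := vip_flux_le c00 ca (vL2B U2 psi2).
have : c1 * vip (U - psi) (U - psi) < e by rewrite mulrC -ltr_pdivlMr.
by rewrite -/psi in key *; lra.
Qed.

Lemma grad2_sum (I : Type) (s : seq I) A (v : I -> 'rV[R]_n -> R) (V : I -> 'I_m -> 'rV[R]_n -> R) :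
  open_in Omega A -> (forall i, grad2 X A (v i) (V i)) ->
  forall u U, grad2 X A u U -> grad2 X A (\sum_(i <- s) v i + u) (\sum_(i <- s) V i + U).
Proof.
move=> oA H u U HU; elim: s => [|i s IH]; first by rewrite !big_nil !add0r.
rewrite !big_cons -!addrA; have := grad2_lin oO bO vX 1 oA (H i) IH.
by rewrite !scale1r.
Qed.

Lemma vip_sum_cvg0 (s : seq 'I_n) (Q : 'I_n -> nat -> 'I_m -> 'rV[R]_n -> R) :
  (forall i k, vL2 (Q i k)) -> (forall i, vip (Q i k) (Q i k) @[k --> \oo] --> (0 : R)) ->
  vip (\sum_(i <- s) Q i k) (\sum_(i <- s) Q i k) @[k --> \oo] --> (0 : R).
Proof.
move=> Q2 Q0; elim: s => [|i s IH].
  under eq_fun do rewrite big_nil.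
  rewrite (_ : vip 0 0 = 0); first exact: cvg_cst.
  rewrite /vip big1// => j _.
  by rewrite /ip; under eq_Rintegral do rewrite mul0r; rewrite Rintegral_cst// mul0r.
have B k : vip (\sum_(j <- i :: s) Q j k) (\sum_(j <- i :: s) Q j k) <=
    2 * vip (Q i k) (Q i k) + 2 * vip (\sum_(j <- s) Q j k) (\sum_(j <- s) Q j k).
  by rewrite big_cons; apply: vipD_le; [exact: Q2|apply: vL2_sum => j; exact: Q2].
have lim : 2 * vip (Q i k) (Q i k) + 2 * vip (\sum_(j <- s) Q j k) (\sum_(j <- s) Q j k)
    @[k --> \oo] --> (0 : R).
  have c20 : cst (2 : R) k @[k --> \oo] --> (2 : R) by exact: cvg_cst.
  have := cvgD (cvgM c20 (Q0 i)) (cvgM c20 IH); rewrite !mulr0 addr0; exact.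
apply: (squeeze_cvgr _ (cvg_cst 0) lim); apply: nearW => k.
by rewrite vip_ge0 B.
Qed.

Lemma ip_sum_cvg0 (s : seq 'I_n) (v : 'I_n -> nat -> 'rV[R]_n -> R) :
  (forall i k, L2 (v i k)) -> (forall i, ip (v i k) (v i k) @[k --> \oo] --> (0 : R)) ->
  ip (\sum_(i <- s) v i k) (\sum_(i <- s) v i k) @[k --> \oo] --> (0 : R).
Proof.
move=> v2 v0; elim: s => [|i s IH].
  under eq_fun do rewrite big_nil.
  rewrite (_ : ip 0 0 = 0); first exact: cvg_cst.
  by rewrite /ip; under eq_Rintegral do rewrite mul0r; rewrite Rintegral_cst// mul0r.
have L2s s' k : L2 (\sum_(j <- s') v j k).
  elim: s' => [|j s' IHs]; first by rewrite big_nil; exact: L2_0.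
  by rewrite big_cons; have := L2_lin 1 (v2 j k) IHs; rewrite scale1r.
have B k : ip (\sum_(j <- i :: s) v j k) (\sum_(j <- i :: s) v j k) <=
    2 * ip (v i k) (v i k) + 2 * ip (\sum_(j <- s) v j k) (\sum_(j <- s) v j k).
  have [_ i1] := v2 i k; have [_ i2] := L2s s k; have [_ i3] := L2s (i :: s) k.
  rewrite !ip_sqr -!RintegralZl// -RintegralD//; try exact: intgZ.
  apply: le_RintegralT => //; first by apply: intgD; exact: intgZ.
  move=> x; rewrite big_cons -[(v i k + _) x]/(v i k x + _ x).
  by have := sqr_ge0 (v i k x - (\sum_(j <- s) v j k) x); nra.
have lim : 2 * ip (v i k) (v i k) + 2 * ip (\sum_(j <- s) v j k) (\sum_(j <- s) v j k)
    @[k --> \oo] --> (0 : R).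
  have c20 : cst (2 : R) k @[k --> \oo] --> (2 : R) by exact: cvg_cst.
  have := cvgD (cvgM c20 (v0 i)) (cvgM c20 IH); rewrite !mulr0 addr0; exact.
apply: (squeeze_cvgr _ (cvg_cst 0) lim); apply: nearW => k.
by rewrite ip_ge0 B.
Qed.

(** The gradient of the competitor is [(U - psi) + P_k + Q_k], with [P_k] built from the gradients
    of the correctors and [Q_k] from the commutator terms, which vanish because the correctors tend
    to the coordinates in L^2. *)
Lemma quadratic_recovery A u U (e : R) : open_in Omega A -> grad2 X A u U -> 0 < e ->
  exists K, forall k, (K <= k)%N -> exists v V, [/\ grad2 X A v V, ip (v - u) (v - u) <= e &
    vip (flux (b k) V) V <= vip (flux a U) U + e].
Proof.
move=> oA HU e0; have [_ _ UA _] := HU; have [U2 _] := UA.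
(* The form of [b k] at [U - psi] is not known to converge; this accuracy keeps it below e/2. *)
have e1 : 0 < e / 2 / c1 by rewrite !divr_gt0.
have [phi tphi he] := coord_fields_dense oA UA e1.
set psi := psum phi L in he; have psi2 : vL2 psi by apply: (vL2_psum tphi).
set Rr := U - psi in he; have R2 : vL2 Rr by exact: vL2B.
pose dw i k := w i k - coordf Omega i; pose dW i k := W i k - L i.
have Hd i k : grad2 X Omega (dw i k) (dW i k).
  have := grad2_lin oO bO vX (-1) (conj oO (@subset_refl _ _)) (grad2_coord oO bO vX i) (cf_grad cf i k).
  by rewrite !scaleN1r ![- _ + _]addrC.
have dw2 i k : L2 (dw i k) by have [] := Hd i k.
have tO i : test_function Omega (phi i) by exact: test_sub oA.2 (tphi i).
pose v0 i k := (fun x => phi i x * dw i k x) : 'rV[R]_n -> R.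
pose Q i k := cross X (phi i) (dw i k).
have Q2 i k : vL2 (Q i k) by exact: (vL2_cross oO vX oA (tphi i)).
have H0 i k : grad2 X A (v0 i k) (smul (phi i) (dW i k) + Q i k).
  apply: (@grad2_sub _ _ _ Omega X A Omega) => //; [exact: oA.2| | |].
  - exact: (grad2_test oO bO vX (conj oO (@subset_refl _ _)) (@subset_refl _ _) (@subset_refl _ _) (tO i) (Hd i k)).
  - by move=> x Ax; rewrite /v0 (test_out (tphi i) Ax) mul0r.
  - move=> j x Ax; rewrite -[LHS]/(phi i x * dW i k j x + vgrad (X j) (phi i) x * dw i k x).
    by rewrite (test_out (tphi i) Ax) (vgrad_out (X j) (tphi i) Ax) !mul0r addr0.
pose v k := \sum_i v0 i k + u.
pose V k := \sum_i (smul (phi i) (dW i k) + Q i k) + U.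
have HV k : grad2 X A (v k) (V k) by apply: grad2_sum.
pose Pk k := psum phi (fun i => W i k).
have P2 k : vL2 (Pk k) by apply: (vL2_psum tphi) => i; exact: W2.
pose Qk k := \sum_i Q i k.
have Qk2 k : vL2 (Qk k) by exact: vL2_sum.
have VE k : V k = (Rr + Pk k) + Qk k.
  rewrite /V big_split /= -/(Qk k).
  have -> : \sum_i smul (phi i) (dW i k) = Pk k - psi.
    rewrite /Pk /psi /psum -sumrB; apply: eq_bigr => i _.
    apply/funext => j; apply/funext => x.
    by rewrite -[RHS]/(phi i x * W i k j x - phi i x * L i j x) -mulrBr.
  by rewrite /Rr; apply/funext => j; apply/funext => x;
    rewrite -[LHS]/(Pk k j x - psi j x + Qk k j x + U j x)
            -[RHS]/(U j x - psi j x + Pk k j x + Qk k j x); ring.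
pose al k := vip (flux (b k) (Pk k)) (Pk k); pose be k := vip (flux (b k) (Pk k)) Rr.
have alc : al k @[k --> \oo] --> vip (flux a psi) psi.
  rewrite -(vip_psum_sigma oA tphi)//.
  have E k : al k = vip (psum phi (fun i => S i k)) (psum phi (fun i => W i k)).
    by rewrite /al flux_psum.
  under eq_fun do rewrite E.
  exact: (psum_energy_cvg oA tphi (r := id)).
have bec : be k @[k --> \oo] --> vip (flux a psi) Rr.
  rewrite -(vip_psum_sigma oA tphi)//.
  have E k : be k = vip (psum phi (fun i => S i k)) Rr by rewrite /be flux_psum.
  under eq_fun do rewrite E.
  exact: psum_weak_cvg.
pose Z k := Rr + Pk k; have Z2 k : vL2 (Z k) by exact: vL2D.
have ZE k : vip (flux (b k) (Z k)) (Z k) <= al k + 2 * be k + e / 2.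
  rewrite (form_expandD (cb k) R2 (P2 k)) -/(al k) -/(be k).
  have : c1 * vip Rr Rr < e / 2 by rewrite mulrC -ltr_pdivlMr.
  by have := vip_flux_le c00 (cb k) R2; lra.
have qc : vip (Qk k) (Qk k) @[k --> \oo] --> (0 : R).
  apply: vip_sum_cvg0 => // i; have [K K0 HK] := cross_le oO vX oA (tphi i).
  have lim : K * ip (dw i k) (dw i k) @[k --> \oo] --> (0 : R).
    by rewrite -[0](mulr0 K); apply: cvgM; [exact: cvg_cst|exact: cf_cvg cf i].
  apply: (squeeze_cvgr _ (cvg_cst 0) lim); apply: nearW => k.
  by rewrite vip_ge0 HK.
have sumc : al k + 2 * be k + e / 2 @[k --> \oo] --> vip (flux a psi) psi + 2 * vip (flux a psi) Rr + e / 2.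
  by apply: cvgD; [apply: cvgD => //; apply: cvgM => //; exact: cvg_cst|exact: cvg_cst].
have [C CP] : exists C, forall k, al k + 2 * be k + e / 2 <= C.
  have /cvg_seq_bounded[D [_ HD']] := cvgP _ sumc.
  by exists (D + 1) => h; apply: le_trans (ler_norm _) _; apply: HD' => //; rewrite ltrDl.
have dc : vip (flux (b k) (Z k)) (Qk k) @[k --> \oo] --> (0 : R).
  apply: (@cvg0_sqr _ _ _ (c1 * C) _ qc) => k.
  rewrite (le_trans (vip_cauchy_schwarz (vL2_flux c00 (cb k) (Z2 k)) (Qk2 k)))//.
  rewrite ler_wpM2r ?vip_ge0// (le_trans (vip_flux_flux c00 (cb k) (Z2 k)))//.
  by apply: ler_wpM2l; [exact: ltW|exact: le_trans (ZE k) (CP k)].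
have vc : ip (v k - u) (v k - u) @[k --> \oo] --> (0 : R).
  rewrite (_ : (fun k => ip (v k - u) (v k - u)) = (fun k => ip (\sum_i v0 i k) (\sum_i v0 i k))).
    apply: ip_sum_cvg0 => [i k|i]; first by have [] := H0 i k.
    have [K pK] := test_bounded (tphi i); have mp := test_measurable (tphi i).
    have lim : K ^+ 2 * ip (dw i k) (dw i k) @[k --> \oo] --> (0 : R).
      by rewrite -[0](mulr0 (K ^+ 2)); apply: cvgM; [exact: cvg_cst|exact: cf_cvg cf i].
    apply: (squeeze_cvgr _ (cvg_cst 0) lim); apply: nearW => k.
    by rewrite ip_ge0/=; exact: ip_bounded_mul pK (dw2 i k).
  by apply/funext => k; rewrite /v addrK.
pose bound k := al k + 2 * be k + e / 2 + 2 * vip (flux (b k) (Z k)) (Qk k) + c1 * vip (Qk k) (Qk k).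
have boundc : bound k @[k --> \oo] --> vip (flux a psi) psi + 2 * vip (flux a psi) Rr + e / 2.
  have c20 : cst (2 : R) k @[k --> \oo] --> (2 : R) by exact: cvg_cst.
  have c1c : cst c1 k @[k --> \oo] --> c1 by exact: cvg_cst.
  by have := cvgD (cvgD sumc (cvgM c20 dc)) (cvgM c1c qc); rewrite !mulr0 !addr0; exact.
(* The first two terms equal a(U, U) - a(U - psi, U - psi), so half of [e] is left as slack for the
   terms that tend to zero. *)
have lt1 : vip (flux a psi) psi + 2 * vip (flux a psi) Rr + e / 2 < vip (flux a U) U + e.
  have UE : U = psi + Rr by rewrite /Rr addrC subrK.
  have := form_expandD ca psi2 R2; rewrite -UE => ->.
  rewrite (vip_flux_sym c00 ca R2 psi2).
  by have := vip_flux_ge0 c00 ca R2; lra.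
have n1 : \forall k \near \oo, bound k < vip (flux a U) U + e by exact: (cvgr_lt _ boundc).
have n2 : \forall k \near \oo, ip (v k - u) (v k - u) < e by exact: (cvgr_lt _ vc).
have [K _ HK] := filterI n1 n2.
exists K => k Kk; have [h1 h2] := HK k Kk; exists (v k), (V k); split => //; first exact: ltW.
apply: le_trans (ltW h1); rewrite VE -/(Z k) (form_expandD (cb k) (Z2 k) (Qk2 k)) /bound.
rewrite (vip_flux_sym c00 (cb k) (Qk2 k) (Z2 k)).
by have := ZE k; have := vip_flux_le c00 (cb k) (Qk2 k); lra.
Qed.

End quadratic_limit.

(** * A criterion for Gamma-convergence *)

Section Gamma_criterion.
Context {R : realType} {n : nat}.
Local Notation mu := (lebesgue_rV R n).
Variables (Omega : set 'rV[R]_n) (p : R) (G_ : nat -> ('rV[R]_n -> R) -> \bar R)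
  (G : ('rV[R]_n -> R) -> \bar R).
Hypotheses (p1 : 1 <= p) (G0 : forall u, (0 <= G u)%E).

Definition dist_lt (v u : 'rV[R]_n -> R) (e : R) :=
  (\int[mu]_x (`|((fun y => v y - u y)%R \_ Omega) x| `^ p)%:E < e%:E)%E.

Hypothesis lower : forall u (u_ : nat -> 'rV[R]_n -> R) r (c : R), inLp p Omega u ->
  (forall h, inLp p Omega (u_ h)) -> increasing_nat r -> cvgLp p Omega u_ u ->
  (forall h, (G_ (r h) (u_ h) <= c%:E)%E) -> (G u <= c%:E)%E.
Hypothesis upper : forall u (e : R), inLp p Omega u -> (G u < +oo)%E -> 0 < e ->
  exists K, forall k, (K <= k)%N -> exists v, [/\ inLp p Omega v, dist_lt v u e &
    (G_ k v <= G u + e%:E)%E].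

Lemma frequently_subsequence (P : nat -> Prop) : ~ (\forall k \near \oo, ~ P k) ->
  exists2 r, increasing_nat r & forall h, P (r h).
Proof.
move=> H; have H' N : exists2 k, (N <= k)%N & P k.
  apply: contrapT => nk; apply: H; exists N => // k /= Nk Pk; apply: nk.
  by exists k.
have /choice[f fP] : forall N, exists k, (N <= k)%N /\ P k by move=> N; have [k] := H' N; exists k.
pose r := fix r h := if h is h'.+1 then f (r h').+1 else f 0%N.
exists r; first by apply: increasing_natS => h; exact: (fP (r h).+1).1.
by case=> [|h]; [exact: (fP 0%N).2|exact: (fP (r h).+1).2].
Qed.

Lemma eventually_gt u u_ (c : R) : inLp p Omega u -> (forall h, inLp p Omega (u_ h)) ->
  cvgLp p Omega u_ u -> (c%:E < G u)%E -> \forall h \near \oo, (c%:E < G_ h (u_ h))%E.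
Proof.
move=> uO uO_ uc cG; apply: contrapT => nev.
have [|r incr H] := @frequently_subsequence (fun h => (G_ h (u_ h) <= c%:E)%E).
  by move=> H; apply: nev; apply: filterS H => h /negP; rewrite -ltNge.
have := @lower u (u_ \o r) r c uO (fun h => uO_ (r h)) incr _ H.
have uc' : cvgLp p Omega (u_ \o r) u by exact: (cvg_comp _ _ (increasing_nat_cvg incr) uc).
by move=> /(_ uc'); rewrite leNgt cG.
Qed.

Lemma dist_lt_le v u e e' : e <= e' -> dist_lt v u e -> dist_lt v u e'.
Proof. by move=> ee h; apply: (lt_le_trans h); rewrite lee_fin. Qed.

(** [lower] speaks of sublevels along subsequences only, and [upper] gives approximate competitors
    for large [k] only. The exact recovery sequence comes from a diagonal choice over the
    accuracies, and [lower] keeps its energies from falling below [G u] in the limit. *)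
Lemma Gamma_criterion : Gamma_cvg p Omega G_ G.
Proof.
move=> u uO; split.
  move=> u_ uO_ uc; rewrite leNgt; apply/negP => lt.
  have [c cl cG] : exists2 c : R, (limn_einf (fun h => G_ h (u_ h)) < c%:E)%E & (c%:E < G u)%E.
    move: lt; case: (limn_einf _) => [l| |] //; case: (G u) => [g| |]//.
    - rewrite lte_fin => lg; exists ((l + g) / 2); rewrite lte_fin; first by rewrite midf_lt.
      by rewrite midf_lt.
    - by move=> _; exists (l + 1); rewrite ?ltry// lte_fin ltrDl.
    - by move=> _; exists (g - 1); rewrite ?ltNyr// lte_fin ltrBlDr ltrDl.
    - by move=> _; exists 0; rewrite ?ltNyr ?ltry.
  have [N _ HN] := eventually_gt uO uO_ uc cG.
  have : (c%:E <= limn_einf (fun h => G_ h (u_ h)))%E.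
    rewrite limn_einf_lim; apply: lime_ge; first exact: is_cvg_einfs.
    exists N => // k /= Nk; apply: le_ereal_inf_tmp => _ [l /= kl <-].
    by apply/ltW/HN; exact: leq_trans kl.
  by rewrite leNgt cl.
have [Gu|Gu] := eqVneq (G u) +oo%E.
  (* When [G u] is infinite the constant sequence recovers it: [lower] forces its energies to
     infinity. *)
  exists (fun=> u); have uc : cvgLp p Omega (fun=> u) u.
    apply/(cvgLpP _ _ _ p1) => e e0; apply: nearW => h.
    rewrite (_ : (fun y => u y - u y) \_ Omega = cst 0).
      rewrite (eq_integral (cst 0%E)) ?integral0 ?lte_fin// => x _.
      by rewrite /= normr0 powR0// gt_eqF// (lt_le_trans _ p1).
    by apply/funext => x; rewrite patchE subrr; case: ifP.
  split => //; rewrite Gu; apply/cvgeyPgt => A.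
  by apply: (@eventually_gt u (fun=> u)) => //; rewrite Gu ltry.
have Gfin : G u \is a fin_num by rewrite ge0_fin_numE// lt_neqAle Gu leey.
pose e j : R := j.+1%:R^-1; have e0 j : 0 < e j by rewrite invr_gt0.
pose good k j v := dist_lt v u (e j) /\ (G_ k v <= G u + (e j)%:E)%E.
have ee i j : (i <= j)%N -> e j <= e i by move=> ij; rewrite /e lef_pV2 ?posrE// ler_nat.
have goodS k i j v : (i <= j)%N -> good k j v -> good k i v.
  move=> ij [h1 h2]; split; first exact: dist_lt_le (ee _ _ ij) h1.
  by apply: (le_trans h2); rewrite leeD2l// lee_fin ee.
pose T k j := exists2 v, inLp p Omega v & good k j v.
(* [v k] is good for every accuracy [j <= k] that can be reached at [k]: by [goodS] it suffices to
   take the finest one among these. *)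
have /choice[v vP] k : exists v, inLp p Omega v /\ forall j, (j <= k)%N -> T k j -> good k j v.
  have : forall N, exists v, inLp p Omega v /\ forall j, (j <= N)%N -> T k j -> good k j v.
    elim=> [|N [v [vO IH]]].
      have [[v vO gv]|nT] := pselect (T k 0%N); last by exists u; split => // j; rewrite leqn0 => /eqP ->.
      by exists v; split => // j; rewrite leqn0 => /eqP ->.
    have [[v' vO' gv]|nT] := pselect (T k N.+1).
      by exists v'; split => // j jN _; exact: goodS jN gv.
    exists v; split => // j; rewrite leq_eqVlt => /predU1P[->//|jN]; exact: IH.
  exact.
have TK j : exists K, forall k, (K <= k)%N -> good k j (v k).
  have Gy : (G u < +oo)%E by rewrite lt_neqAle Gu leey.
  have [K HK] := upper uO Gy (e0 j); exists (maxn K j) => k; rewrite geq_max => /andP[Kk jk].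
  by apply: (vP k).2 => //; have [v' [h1 h2 h3]] := HK k Kk; exists v'.
have small (d : R) : 0 < d -> exists j, e j < d.
  move=> d0; exists (Num.truncn d^-1); rewrite /e invf_plt ?posrE//.
  by rewrite truncnS_gt.
have vc : cvgLp p Omega v u.
  apply/(cvgLpP _ _ _ p1) => d d0; have [j jd] := small d d0; have [K HK] := TK j.
  by exists K => // k /= /HK[h _]; exact: dist_lt_le (ltW jd) h.
have vO k : inLp p Omega (v k) by have [] := vP k.
exists v; split => //.
pose g := fine (G u); have gE : G u = g%:E by rewrite /g fineK.
have both (d : R) : 0 < d -> \forall k \near \oo, ((g - d)%:E < G_ k (v k))%E /\ (G_ k (v k) < (g + d)%:E)%E.
  move=> d0; have lowd : ((g - d)%:E < G u)%E by rewrite gE lte_fin ltrBlDr ltrDl.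
  have [j jd] := small d d0; have [K HK] := TK j.
  have up : \forall k \near \oo, (G_ k (v k) < (g + d)%:E)%E.
    exists K => // k /= /HK[_ h]; apply: (le_lt_trans h).
    by rewrite gE -EFinD lte_fin ltrD2l.
  exact: filterI (eventually_gt uO vO vc lowd) up.
rewrite gE; apply: (iffRL (fine_cvgP _ _)); split.
  apply: filterS (both 1 ltr01) => k [h1 h2]; rewrite fin_numElt.
  by rewrite (lt_trans _ h1) ?ltNyr// (lt_trans h2) ?ltry.
apply: (iffRL (cvgrPdist_lt _ _)) => d d0.
apply: filterS (both d d0) => k /=; case: (G_ k (v k)) => [r| |]//= [].
  by rewrite !lte_fin => h1 h2; rewrite ltr_norml; apply/andP; split; lra.
  by move=> _; rewrite ltNge leey.
by rewrite ltNge leNye.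
Qed.

End Gamma_criterion.

(** * Weak compactness in L^p *)

Section weak_Lp_compactness.
Context {R : realType} {n : nat}.
Local Notation mu := (lebesgue_rV R n).
Local Notation intg f := (mu.-integrable setT (EFin \o f)).
Implicit Types (f g : 'rV[R]_n -> R) (A : set 'rV[R]_n) (p : R).

(** A common subsequence is required twice: for the gradients and fluxes of all correctors, and for
    the truncations of one sequence at all levels. Members are extracted one at a time, then
    diagonally over their codes. *)
Lemma weak_compact_family (I : countType) (s : I -> nat -> 'rV[R]_n -> R) (C : I -> R) :
  (forall i h, L2 (s i h)) -> (forall i h, ip (s i h) (s i h) <= C i) ->
  exists r (sigma : I -> 'rV[R]_n -> R), [/\ increasing_nat r, forall i, L2 (sigma i) &
    forall i g, L2 g -> ip (s i (r h)) g @[h --> \oo] --> ip (sigma i) g].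
Proof.
move=> s2 sC.
pose P k t := forall i, pickle i = k -> exists2 tau, L2 tau &
  forall g, L2 g -> ip (s i (t h)) g @[h --> \oo] --> ip tau g.
have [||r incr rP] := @diagonal_subsequence P; last first.
- have /choice[sigma sP] i : exists tau, L2 tau /\
      forall g, L2 g -> ip (s i (r h)) g @[h --> \oo] --> ip tau g.
    by have [tau t2 tg] := rP (pickle i) i erefl; exists tau.
  by exists r, sigma; split => // i; have [] := sP i.
- move=> k t t' r N Pt incr E i ik; have [tau t2 tg] := Pt i ik; exists tau => // g g2.
  exact: (@cvg_subseq R (fun h => ip (s i h) g) _ r N t' t (tg g g2) incr E).
- move=> k t incr; have [[i ik]|ni] := pselect (exists i : I, pickle i = k).
    have [r [tau [incr' t2 tg]]] := L2_weak_compact (fun h => s2 i (t h)) (fun h => sC i (t h)).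
    exists r => // i' i'k; have -> : i' = i by apply: (pcan_inj pickleK); rewrite ik.
    by exists tau.
  by exists id => // i ik; exfalso; apply: ni; exists i.
Qed.

Lemma ge0_Rintegral_eq0 f : intg f -> (forall x, 0 <= f x) -> \int[mu]_x f x <= 0 ->
  {ae mu, forall x, f x = 0}.
Proof.
move=> fi f0 If; have I0 : \int[mu]_x f x = 0.
  by apply/eqP; rewrite eq_le If; apply: Rintegral_ge0.
have h1 : (\int[mu]_x `|(f x)%:E| = 0)%E.
  under eq_integral do rewrite gee0_abs ?lee_fin//.
  by rewrite Rintegral_EFin// I0.
have mf := intg_measurable fi.
have := (ae_eq_integral_abs mu measurableT (iffRL (measurable_EFinP _ _) mf)).1 h1.
by apply: ae_imp => x /(_ Logic.I) [].
Qed.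

Lemma L2_indic A : measurable A -> (mu A < +oo)%E -> L2 (\1_A : 'rV[R]_n -> R).
Proof.
move=> mA Aoo; split; first exact: measurable_indic.
apply: (@intg_bounded _ _ _ A 1) => //.
- by apply: measurable_funX; exact: measurable_indic.
- by move=> x; rewrite indicE; case: (_ \in _); rewrite ?expr1n ?expr0n ?normr1 ?normr0.
- by move=> x Ax; rewrite indicE memNset ?expr0n.
Qed.

(** Testing with the indicator of the set where the conclusion fails shows that this set is null. *)
Lemma weak_le_ae A (f_ g_ : nat -> 'rV[R]_n -> R) f g : measurable A -> (mu A < +oo)%E ->
  (forall h, L2 (f_ h)) -> (forall h, L2 (g_ h)) -> L2 f -> L2 g ->
  (forall h x, f_ h x <= g_ h x) ->
  (forall u, L2 u -> ip (f_ h) u @[h --> \oo] --> ip f u) ->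
  (forall u, L2 u -> ip (g_ h) u @[h --> \oo] --> ip g u) ->
  {ae mu, forall x, A x -> f x <= g x}.
Proof.
move=> mA Aoo f2_ g2_ f2 g2 fg fc gc; have [mf _] := f2; have [mg _] := g2.
pose B := A `&` [set x | g x < f x].
have mB : measurable B.
  apply: measurableI => //; rewrite (_ : [set x | _] = (fun x => f x - g x) @^-1` `]0, +oo[%classic).
    by rewrite -[X in measurable X]setTI; apply: (measurable_funB mf mg).
  by apply/seteqP; split => x /=; rewrite in_itv/= andbT subr_gt0.
have Boo : (mu B < +oo)%E.
  by apply: le_lt_trans Aoo; apply: le_measure; rewrite ?inE//; exact: subIsetl.
have b2 := L2_indic mB Boo.
have le : ip f \1_B <= ip g \1_B.
  rewrite -subr_le0; apply: (@cvgr_to_le _ _ _ _ _ _ _ (cvgB (fc _ b2) (gc _ b2))).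
  apply: nearW => h; rewrite subr_le0; apply: le_RintegralT; try exact: L2_mul.
  by move=> x; rewrite ler_wpM2r.
have i1 := L2_mul f2 b2; have i2 := L2_mul g2 b2.
have h0 : {ae mu, forall x, f x * \1_B x - g x * \1_B x = 0}.
  apply: ge0_Rintegral_eq0; first exact: intgB.
    move=> x; rewrite -mulrBl indicE; have [|] := boolP (x \in B); last by rewrite mulr0.
    by rewrite inE mulr1 => -[_ /ltW]; rewrite subr_ge0.
  by rewrite RintegralB// subr_le0.
apply: ae_imp h0 => x E0 Ax; rewrite leNgt; apply/negP => gf.
by move: E0; rewrite indicE mem_set// !mulr1 => /eqP; rewrite subr_eq0 gt_eqF.
Qed.

Lemma powR_cvg (u : nat -> R) l p : 0 < p -> (forall k, 0 <= u k) ->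
  u @ \oo --> l -> (fun k => u k `^ p) @ \oo --> l `^ p.
Proof.
move=> p0 u0 ul; have l0 : 0 <= l by apply: (@cvgr_to_ge _ _ _ _ _ _ _ ul); exact: nearW.
move: l0; rewrite le_eqVlt => /predU1P[l0|l0].
  rewrite -l0 powR0 ?gt_eqF//; apply/cvgr0Pnorm_lt => e e0.
  have : \forall k \near \oo, u k < e `^ p^-1.
    by apply: (cvgr_lt _ ul); rewrite -l0 powR_gt0.
  apply: filterS => k uk; rewrite ger0_norm ?powR_ge0//.
  have -> : e = (e `^ p^-1) `^ p by rewrite -powRrM mulVf ?gt_eqF// powRr1// ltW.
  by apply: gt0_ltr_powR => //; rewrite nnegrE// powR_ge0.
have E : \forall k \near \oo, expR (p * ln (u k)) = u k `^ p.
  have : \forall k \near \oo, 0 < u k by exact: (cvgr_gt _ ul).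
  by apply: filterS => k uk; rewrite /powR gt_eqF.
rewrite (_ : l `^ p = expR (p * ln l)); last by rewrite /powR gt_eqF.
apply: cvg_trans (near_eq_cvg E) _.
apply: (cvg_comp (fun k => p * ln (u k)) expR); last exact: continuous_expR.
apply: cvgM; first exact: cvg_cst.
by apply: continuous_cvg => //; exact: continuous_ln.
Qed.

(** Monotone convergence of the p-th powers shows that the limit is finite almost everywhere;
    setting the sequence to 0 elsewhere gives a limit at every point. *)
Lemma Lp_monotone_limit p (Z : nat -> 'rV[R]_n -> R) (C : R) : 1 <= p ->
  (forall k, measurable_fun setT (Z k)) -> (forall k x, 0 <= Z k x) ->
  (forall x, {homo Z ^~ x : k h / (k <= h)%N >-> k <= h}) ->
  (forall k, intg (fun x => Z k x `^ p)) -> (forall k, \int[mu]_x Z k x `^ p <= C) ->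
  exists V : 'rV[R]_n -> R, [/\ measurable_fun setT V, forall x, 0 <= V x, intg (fun x => V x `^ p) &
    {ae mu, forall x, Z ^~ x @ \oo --> V x}].
Proof.
move=> p1 mZ Z0 Znd iZ ZC; have p0 : 0 < p by exact: lt_le_trans p1.
pose g k x : \bar R := (Z k x `^ p)%:E.
have mg k : measurable_fun setT (g k).
  apply/measurable_EFinP; apply: (measurableT_comp (f := fun t : R => t `^ p)); last exact: mZ.
  exact: measurable_powR.
have g0 k x : setT x -> (0 <= g k x)%E by rewrite lee_fin powR_ge0.
have gnd x : setT x -> {homo g ^~ x : k h / (k <= h)%N >-> (k <= h)%E}.
  by move=> _ k h kh; rewrite lee_fin ge0_ler_powR ?nnegrE ?(ltW p0)// Znd.
pose E x := limn (g ^~ x).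
have mE : measurable_fun setT E.
  apply: (emeasurable_fun_cvg g) => // x _; apply: ereal_nondecreasing_is_cvgn.
  exact: gnd.
have E0 x : (0 <= E x)%E.
  by apply: lime_ge; [apply: ereal_nondecreasing_is_cvgn; exact: gnd|apply: nearW => k; exact: g0].
have IE : (\int[mu]_x E x <= C%:E)%E.
  rewrite (monotone_convergence mu measurableT mg g0 gnd); apply: lime_le.
    apply: ereal_nondecreasing_is_cvgn => k h kh; apply: ge0_le_integral => // x Tx;
      solve [exact: g0 | exact: (gnd x Tx)].
  by apply: nearW => k; rewrite Rintegral_EFin// lee_fin.
have iE : mu.-integrable setT E.
  apply/integrableP; split => //; rewrite (eq_integral E); first exact: le_lt_trans IE (ltry _).
  by move=> x _; rewrite gee0_abs.
pose G := [set x | (E x < +oo)%E].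
have mG : measurable G by rewrite -[X in measurable X]setTI; exact: emeasurable_fun_infty_o.
have aeG : {ae mu, forall x, G x}.
  by move/(integrable_ae measurableT) : iE; apply: ae_imp => x /(_ Logic.I); rewrite ge0_fin_numE.
pose z k x := Z k x * \1_G x.
have mz k : measurable_fun setT (z k) by apply: measurable_funM => //; exact: measurable_indic.
have z0 k x : 0 <= z k x by rewrite mulr_ge0.
have znd x : {homo z ^~ x : k h / (k <= h)%N >-> k <= h}.
  by move=> k h kh; rewrite ler_wpM2r// Znd.
have gE k x : (g k x <= E x)%E.
  apply: lime_ge; first by apply: ereal_nondecreasing_is_cvgn; exact: gnd.
  by exists k => // h /= kh; exact: gnd.
have zc x : cvgn (z ^~ x).
  apply: nondecreasing_is_cvgn; first exact: znd.
  exists (1 + fine (E x)) => _ [k _ <-]; rewrite /z indicE.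
  have [|_] := boolP (x \in G); last by rewrite mulr0 addr_ge0// fine_ge0.
  rewrite inE mulr1 => Gx; have := powR_ge_linear (Z k x) p1; rewrite ger0_norm// => /le_trans; apply.
  by rewrite lerD2l -lee_fin fineK ?ge0_fin_numE//; exact: gE.
pose V x := limn (z ^~ x); exists V; split.
- by apply: (measurable_fun_cvg mz) => x _; exact: zc.
- by move=> x; apply: limr_ge; [exact: zc|apply: nearW].
- have [] := @Rintegral_fatou R n (fun k x => z k x `^ p) (fun x => V x `^ p) C => //.
  + by move=> k; apply: (measurableT_comp (f := fun t : R => t `^ p)) => //; exact: measurable_powR.
  + apply: (measurableT_comp (f := fun t : R => t `^ p)); first exact: measurable_powR.
    by apply: (measurable_fun_cvg mz) => x _; exact: zc.
  + by move=> k x; exact: powR_ge0.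
  + by move=> x; exact: powR_ge0.
  + by apply: aeW => x; apply: powR_cvg => //; exact: zc.
  + move=> N; exists N => //; have zE x : z N x `^ p = Z N x `^ p * \1_G x.
      rewrite /z indicE; case: (x \in G); first by rewrite !mulr1.
      by rewrite !mulr0 powR0// gt_eqF.
    have i1 : intg (fun x => z N x `^ p).
      by under eq_fun do rewrite zE; exact: intgM_indic.
    split => //; apply: le_trans (ZC N); apply: le_RintegralT => // x.
    by rewrite zE indicE; case: (x \in G); rewrite ?mulr1// mulr0 powR_ge0.
- apply: ae_imp aeG => x Gx; rewrite (_ : Z ^~ x = z ^~ x); first exact: zc.
  by apply/funext => k; rewrite /z indicE mem_set// mulr1.
Qed.

End weak_Lp_compactness.

Section Lp_weak_compact.
Context {R : realType} {n : nat}.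
Local Notation mu := (lebesgue_rV R n).
Local Notation intg f := (mu.-integrable setT (EFin \o f)).
Implicit Types (f g : 'rV[R]_n -> R) (A : set 'rV[R]_n) (p : R).

(** For t > k one has t = t^p t^(1-p) <= t^p k^(1-p), as p > 1. For a sequence bounded in L^p the
    truncation error is thus small in L^1, uniformly along the sequence. *)
Lemma powR_tail p (t k : R) : 1 < p -> 0 < k -> 0 <= t -> t - Num.min t k <= t `^ p * k `^ (1 - p).
Proof.
move=> p1 k0 t0; have p0 : 0 < p by exact: lt_trans p1.
have [tk|kt] := leP t k; first by rewrite subrr mulr_ge0 ?powR_ge0.
have tp : 0 < t by exact: lt_trans kt.
apply: (@le_trans _ _ t); first by rewrite gerBl ltW.
rewrite -(mulr_powRB1 t0 p0) -mulrA ler_peMr// (_ : 1 - p = - (p - 1)); last by rewrite opprB.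
rewrite powRN.
rewrite ler_pdivlMr ?mul1r ?powR_gt0//.
by apply: ge0_ler_powR; rewrite ?nnegrE ?subr_ge0// ltW.
Qed.

Lemma iterated_limit (a : nat -> R) (b : nat -> nat -> R) (bk : nat -> R) (l : R) :
  (forall k, b k h @[h --> \oo] --> bk k) ->
  (forall e, 0 < e -> exists k, (forall h, `|a h - b k h| <= e) /\ `|bk k - l| <= e) ->
  a @ \oo --> l.
Proof.
move=> bc H; apply/cvgrPdist_le => e e0.
have e3 : 0 < e / 3 by rewrite divr_gt0.
have [k [h1 h2]] := H _ e3.
have /cvgrPdist_le/(_ _ e3) := bc k; apply: filterS => h h3.
rewrite (_ : l - a h = - (bk k - l) + (bk k - b k h) - (a h - b k h)); last by ring.
rewrite (le_trans (ler_normB _ _))// (le_trans (lerD (ler_normD _ _) (lexx _)))// normrN.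
by have := h1 h; lra.
Qed.

Lemma intg_powR_bounded f A p (K : R) : 0 < p -> measurable A -> (mu A < +oo)%E -> measurable_fun setT f ->
  (forall x, 0 <= f x <= K) -> (forall x, ~ A x -> f x = 0) -> intg (fun x => f x `^ p).
Proof.
move=> p0 mA Aoo mf fK f0; apply: (@intg_bounded _ _ _ A (K `^ p)) => //.
- by apply: (measurableT_comp (f := fun t : R => t `^ p)) => //; exact: measurable_powR.
- move=> x; have /andP[fx0 fxK] := fK x; rewrite ger0_norm ?powR_ge0//.
  by apply: ge0_ler_powR; rewrite ?nnegrE ?(ltW p0)// (le_trans fx0).
- by move=> x /f0 ->; rewrite powR0// gt_eqF.
Qed.

Lemma L2_bounded f A (K : R) : measurable A -> (mu A < +oo)%E -> measurable_fun setT f ->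
  (forall x, `|f x| <= K) -> (forall x, ~ A x -> f x = 0) -> L2 f.
Proof.
move=> mA Aoo mf fK f0; split => //; apply: (@intg_bounded _ _ _ A (K ^+ 2)) => //.
- exact: measurable_funX.
- by move=> x; rewrite normrX; apply: lerXn2r; rewrite ?nnegrE// (le_trans _ (fK x)).
- by move=> x /f0 ->; rewrite expr0n.
Qed.

(** On a set of finite measure the truncations [min (V h) k] are bounded in L^2 for each [k], hence
    weakly compact. One subsequence serves all levels; the weak limits increase with [k], keep the
    bound [C] on p-th powers, and their monotone limit is [V0]. The uniform truncation error lets
    the limits in [h] and [k] be exchanged. *)
Lemma Lp_weak_compact_ge0 p A (V : nat -> 'rV[R]_n -> R) (C : R) : 1 < p ->
  measurable A -> (mu A < +oo)%E ->
  (forall h, measurable_fun setT (V h)) -> (forall h x, 0 <= V h x) ->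
  (forall h x, ~ A x -> V h x = 0) -> (forall h, intg (fun x => V h x `^ p)) ->
  (forall h, \int[mu]_x V h x `^ p <= C) ->
  exists r (V0 : 'rV[R]_n -> R), [/\ increasing_nat r, measurable_fun setT V0,
    (forall x, 0 <= V0 x) /\ (forall x, ~ A x -> V0 x = 0), intg (fun x => V0 x `^ p) &
    forall g K, measurable_fun setT g -> (forall x, `|g x| <= K) ->
      \int[mu]_x (V (r h) x * g x) @[h --> \oo] --> \int[mu]_x (V0 x * g x)].
Proof.
move=> p1 mA Aoo mV V0' VA iV VC; have p0 : 0 < p by exact: lt_trans p1.
have p1' : 0 < p - 1 by rewrite subr_gt0.
pose s (k h : nat) x := Num.min (V h x) k%:R.
have ms k h : measurable_fun setT (s k h) by exact: measurable_minr.
have s0 k h x : 0 <= s k h x by rewrite le_min V0' ler0n.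
have sk k h x : s k h x <= k%:R by rewrite ge_min lexx orbT.
have sV k h x : s k h x <= V h x by rewrite ge_min lexx.
have sA k h x : ~ A x -> s k h x = 0 by move=> Ax; rewrite /s VA// min_l.
have s2 k h : L2 (s k h).
  by apply: (L2_bounded (K := k%:R) mA Aoo) => // [x|x]; [rewrite ger0_norm|exact: sA].
pose iA := \int[mu]_x (\1_A x : R); have intA := intg_indic mA Aoo.
have sC k h : ip (s k h) (s k h) <= k%:R ^+ 2 * iA.
  rewrite ip_sqr /iA -RintegralZl//; apply: le_RintegralT; [by have [] := s2 k h|exact: intgZ|].
  move=> x; rewrite indicE; have [xA|xA] := boolP (x \in A).
    by rewrite mulr1; apply: lerXn2r; rewrite ?nnegrE.
  by rewrite sA ?expr0n ?mulr0// => Ax; move/negP : xA; apply; rewrite inE.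
have [r [Y [incr Y2 Yc]]] := weak_compact_family s2 sC.
have indM f : (fun x => f x * \1_A x) = f \_ A by rewrite patch_indic.
have A1 x : `|\1_A x : R| <= 1 by rewrite indicE normr_nat; case: (_ \in _).
have mA1 : measurable_fun setT (\1_A : 'rV[R]_n -> R) by exact: measurable_indic.
have L2A f : L2 f -> L2 (fun x => \1_A x * f x) by exact: L2_bounded_mul.
pose Y' k x := \1_A x * Y k x.
have Y'2 k : L2 (Y' k) by exact: L2A.
have Y'c k g : L2 g -> ip (s k (r h)) g @[h --> \oo] --> ip (Y' k) g.
  move=> g2; have := Yc k _ (L2A _ g2).
  have -> : ip (Y k) (fun x => \1_A x * g x) = ip (Y' k) g.
    by apply: eq_Rintegral => x _; rewrite /Y'; ring.
  suff E h : ip (s k (r h)) (fun x => \1_A x * g x) = ip (s k (r h)) g by under eq_fun do rewrite E.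
  apply: eq_Rintegral => x _; rewrite indicE; have [xA|xA] := boolP (x \in A); first by rewrite mul1r.
  by rewrite sA ?mul0r// => Ax; move/negP : xA; apply; rewrite inE.
have Y'A k x : ~ A x -> Y' k x = 0 by move=> Ax; rewrite /Y' indicE memNset// mul0r.
have k12 (k : nat) : L2 (fun x => k%:R * \1_A x : R).
  have := L2_indic mA Aoo => h2; apply: (L2_bounded (K := k%:R) mA Aoo).
  - by apply: measurable_funM.
  - by move=> x; rewrite normrM normr_nat ler_piMr.
  - by move=> x Ax; rewrite indicE memNset// mulr0.
have ae_good : {ae mu, forall x, forall k, 0 <= Y' k x /\ (Y' k x <= k%:R /\ Y' k x <= Y' k.+1 x)}.
  apply: ae_forall_countType => k.
  have h1 : {ae mu, forall x, A x -> (0 : 'rV[R]_n -> R) x <= Y' k x}.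
    apply: (weak_le_ae mA Aoo (fun=> L2_0) (fun h => s2 k (r h)) L2_0 (Y'2 k)) => //.
    - by move=> u u2; exact: cvg_cst.
    - exact: Y'c.
  have h2 : {ae mu, forall x, A x -> Y' k x <= k%:R * \1_A x}.
    apply: (weak_le_ae mA Aoo (fun h => s2 k (r h)) (fun=> k12 k) (Y'2 k) (k12 k)).
    - move=> h x; rewrite indicE; have [xA|xA] := boolP (x \in A); first by rewrite mulr1 sk.
      by rewrite sA ?mulr0// => Ax; move/negP : xA; apply; rewrite inE.
    - exact: Y'c.
    - by move=> u u2; exact: cvg_cst.
  have h3 : {ae mu, forall x, A x -> Y' k x <= Y' k.+1 x}.
    apply: (weak_le_ae mA Aoo (fun h => s2 k (r h)) (fun h => s2 k.+1 (r h)) (Y'2 k) (Y'2 k.+1)).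
    - by move=> h x; rewrite /s le_min !ge_min lexx/= ler_nat leqnSn orbT.
    - exact: Y'c.
    - exact: Y'c.
  apply: (ae_imp2 _ h1 (ae_imp2 (fun x a b => conj a b) h2 h3)) => x a [b c].
  have [Ax|Ax] := pselect (A x); last by rewrite !Y'A// ler0n.
  split; [exact: a|split; [|exact: c]].
  by rewrite (le_trans (b Ax))// indicE mem_set// mulr1.
have [N [mN N0 NP]] := ae_good.
have good x : ~ N x -> forall k, 0 <= Y' k x /\ (Y' k x <= k%:R /\ Y' k x <= Y' k.+1 x).
  by move=> Nx; apply: contrapT => h; exact: Nx (NP x h).
have mNc : measurable (~` N) by exact: measurableC.
(* The inequalities between the weak limits hold off the null set [N]; setting the limits to 0 on
   [N] makes them hold everywhere. *)
pose Z k x := Y' k x * \1_(~` N) x.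
have mZ k : measurable_fun setT (Z k).
  by apply: measurable_funM; [have [] := Y'2 k|exact: measurable_indic].
have ZP x : (Z ^~ x = Y' ^~ x /\ ~ N x) \/ Z ^~ x = fun=> 0.
  have [Nx|Nx] := pselect (N x).
    by right; apply/funext => k; rewrite /Z indicE memNset ?mulr0// => /(_ Nx).
  by left; split => //; apply/funext => k; rewrite /Z indicE mem_set// mulr1.
have Z0 k x : 0 <= Z k x.
  have [[E Nx]|E] := ZP x; rewrite -[Z k x]/((Z ^~ x) k) E//.
  by have [] := good x Nx k.
have Zk k x : Z k x <= k%:R.
  have [[E Nx]|E] := ZP x; rewrite -[Z k x]/((Z ^~ x) k) E//.
  by have [_ []] := good x Nx k.
have Znd x : {homo Z ^~ x : k h / (k <= h)%N >-> k <= h}.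
  have [[-> Nx]|->] := ZP x => //; apply: homo_leq => [t|a b c|k] //; first exact: le_trans.
  by have [_ []] := good x Nx k.
have ZA k x : ~ A x -> Z k x = 0 by move=> Ax; rewrite /Z Y'A// mul0r.
have Z2 k : L2 (Z k).
  by apply: (L2_bounded (K := k%:R) mA Aoo) => // [x|x]; [rewrite ger0_norm|exact: ZA].
have aeN : {ae mu, forall x, ~ N x} by exists N; split => // x /= /contrapT.
have Zc k g : L2 g -> ip (s k (r h)) g @[h --> \oo] --> ip (Z k) g.
  move=> g2; have := Y'c k g g2.
  suff -> : ip (Y' k) g = ip (Z k) g by [].
  have [mg _] := g2; have [mY _] := Y'2 k.
  apply: Rintegral_ae; [exact: measurable_funM|exact: measurable_funM|].
  by apply: ae_imp aeN => x Nx; rewrite /Z [in RHS]indicE mem_set// mulr1.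
have iZ k : intg (fun x => Z k x `^ p).
  apply: (intg_powR_bounded (K := k%:R) p0 mA Aoo) => // [x|x]; last exact: ZA.
  by rewrite Z0 Zk.
have ZC k : \int[mu]_x Z k x `^ p <= C.
  (* Young's inequality s^p >= p s Z^(p-1) - (p-1) Z^p bounds the p-th power below by an expression
     affine in [s], which passes to the weak limit and becomes an equality at s = Z. *)
  pose zeta x := Z k x `^ (p - 1).
  have z2 : L2 zeta.
    apply: (L2_bounded (K := k%:R `^ (p - 1)) mA Aoo).
    - by apply: (measurableT_comp (f := fun t : R => t `^ (p - 1))) => //; exact: measurable_powR.
    - move=> x; rewrite ger0_norm ?powR_ge0//.
      by apply: ge0_ler_powR; rewrite ?nnegrE ?(ltW p1').
    - by move=> x Ax; rewrite /zeta ZA// powR0// gt_eqF.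
  have lim : p * ip (s k (r h)) zeta - (p - 1) * \int[mu]_x Z k x `^ p @[h --> \oo] -->
      p * ip (Z k) zeta - (p - 1) * \int[mu]_x Z k x `^ p.
    by apply: cvgB; [apply: cvgM; [exact: cvg_cst|exact: Zc]|exact: cvg_cst].
  have zE : ip (Z k) zeta = \int[mu]_x Z k x `^ p.
    by apply: eq_Rintegral => x _; rewrite /zeta mulr_powRB1.
  have -> : \int[mu]_x Z k x `^ p = p * ip (Z k) zeta - (p - 1) * \int[mu]_x Z k x `^ p.
    by rewrite zE; ring.
  apply: (@cvgr_to_le _ _ _ _ _ _ _ lim); apply: nearW => h.
  apply: le_trans (VC (r h)); rewrite /ip -!RintegralZl//; last exact: L2_mul.
  rewrite -RintegralB//; [|by apply: intgZ; exact: L2_mul|exact: intgZ].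
  apply: le_RintegralT => //; first by apply: intgB; apply: intgZ => //; exact: L2_mul.
  move=> x; have q0 : 0 < p / (p - 1) by rewrite divr_gt0.
  have pq : p^-1 + (p / (p - 1))^-1 = 1.
    by field; rewrite !gt_eqF.
  have := conjugate_powR (s0 k (r h) x) (powR_ge0 (Z k x) (p - 1)) p0 q0 pq.
  rewrite -powRrM (_ : (p - 1) * (p / (p - 1)) = p); last by field; rewrite gt_eqF.
  move=> yg; have : p * (s k (r h) x * zeta x) <= s k (r h) x `^ p + (p - 1) * Z k x `^ p.
    have := ler_wpM2l (ltW p0) yg; rewrite -/(zeta x) => /le_trans; apply.
    rewrite mulrDr mulrCA divff ?gt_eqF// mulr1 lerD2l.
    by rewrite le_eqVlt; apply/orP; left; apply/eqP; field; rewrite !gt_eqF.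
  have : s k (r h) x `^ p <= V (r h) x `^ p by apply: ge0_ler_powR; rewrite ?nnegrE ?(ltW p0).
  lra.
have [W [mW W0 iW WZ]] := Lp_monotone_limit (ltW p1) mZ Z0 Znd iZ ZC.
pose V0 x := \1_A x * W x.
have V00 x : 0 <= V0 x by rewrite mulr_ge0.
have V0A x : ~ A x -> V0 x = 0 by move=> Ax; rewrite /V0 indicE memNset// mul0r.
have mV0 : measurable_fun setT V0 by exact: measurable_funM.
have iV0 : intg (fun x => V0 x `^ p).
  apply: (intg_le _ iW); first by apply: (measurableT_comp (f := fun t : R => t `^ p)) => //; exact: measurable_powR.
  move=> x; rewrite !ger0_norm ?powR_ge0//; apply: ge0_ler_powR; rewrite ?nnegrE ?(ltW p0)//.
  by rewrite /V0 ler_piMl// indicE; case: (_ \in _).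
exists r, V0; split => // g K mg gK.
have nV f : measurable_fun setT f -> (forall x, 0 <= f x) -> (forall x, ~ A x -> f x = 0) ->
    intg (fun x => f x `^ p) -> intg f.
  move=> mf f0 fA fi; apply: (intg_powR (ltW p1) mA Aoo mf _ fA).
  by under eq_fun do rewrite ger0_norm//.
have iVh h : intg (V h) by exact: (nV _ (mV h) (V0' h) (VA h) (iV h)).
have iV1 : intg V0 by exact: (nV _ mV0 V00 V0A iV0).
have is1 k h : intg (s k h) by apply: (@intg_bounded _ _ _ A k%:R) => // [x|x]; [rewrite ger0_norm|exact: sA].
have iZ1 k : intg (Z k) by apply: (@intg_bounded _ _ _ A k%:R) => // [x|x]; [rewrite ger0_norm|exact: ZA].
have K0 : 0 <= K by exact: le_trans (gK 0).
have gA2 : L2 (fun x => g x * \1_A x).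
  apply: (L2_bounded (K := K) mA Aoo); first exact: measurable_funM.
    move=> x; rewrite normrM (le_trans (ler_pM _ _ (gK x) (A1 x)))// mulr1//.
  by move=> x Ax; rewrite indicE memNset// mulr0.
apply: (@iterated_limit _ (fun k h => \int[mu]_x (s k (r h) x * g x)) (fun k => \int[mu]_x (Z k x * g x))).
  move=> k; have := Zc k _ gA2.
  have EA f : (forall x, ~ A x -> f x = 0) -> ip f (fun x => g x * \1_A x) = \int[mu]_x (f x * g x).
    move=> fA; apply: eq_Rintegral => x _; rewrite indicE; have [xA|xA] := boolP (x \in A); first by rewrite mulr1.
    by rewrite fA ?mul0r// => Ax; move/negP : xA; apply; rewrite inE.
  rewrite EA; last exact: ZA.
  have E h : ip (s k (r h)) (fun x => g x * \1_A x) = \int[mu]_x (s k (r h) x * g x).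
    by apply: EA; exact: sA.
  by under eq_fun do rewrite E.
have ZV : \int[mu]_x (Z k x * g x) @[k --> \oo] --> \int[mu]_x (V0 x * g x).
  have WN : {ae mu, forall x, Z ^~ x @ \oo --> V0 x}.
    apply: ae_imp WZ => x Zx; have [Ax|Ax] := pselect (A x).
      by rewrite /V0 indicE mem_set// mul1r.
    rewrite V0A//; rewrite (_ : Z ^~ x = cst 0); first exact: cvg_cst.
    by apply/funext => k; exact: ZA.
  have ZleV : {ae mu, forall x, forall k, Z k x <= V0 x}.
    apply: ae_imp WN => x Zx k; apply: (@cvgr_to_ge _ _ _ _ _ _ _ Zx).
    by exists k => // h /= kh; exact: Znd.
  have [N' [mN' N'0 N'P]] := ZleV.
  pose Z' k x := Z k x * \1_(~` N') x.
  have mN'c : measurable (~` N') by exact: measurableC.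
  have E k : \int[mu]_x (Z k x * g x) = \int[mu]_x (Z' k x * g x).
    apply: Rintegral_ae; [exact: measurable_funM| |].
      by apply: measurable_funM => //; apply: measurable_funM => //; exact: measurable_indic.
    have : {ae mu, forall x, ~ N' x} by exists N'; split => // x /= /contrapT.
    by apply: ae_imp => x Nx; rewrite /Z' [in RHS]indicE mem_set// mulr1.
  under eq_fun do rewrite E.
  apply: (@Rintegral_dominated R n _ _ (fun x => K * V0 x)).
  - by move=> k; apply: measurable_funM => //; apply: measurable_funM => //; exact: measurable_indic.
  - exact: measurable_funM.
  - have : {ae mu, forall x, ~ N' x} by exists N'; split => // x /= /contrapT.
    move=> hN; apply: (ae_imp2 _ hN WN) => x Nx Zx.
    have Zx' : Z' ^~ x @ \oo --> V0 x.
      rewrite (_ : Z' ^~ x = Z ^~ x)//; apply/funext => k.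
      by rewrite /Z' indicE mem_set// mulr1.
    exact: (cvgM Zx' (cvg_cst (g x))).
  - exact: intgZ.
  - move=> k x; rewrite normrM mulrC; apply: ler_pM => //; rewrite /Z' indicE.
    have [xN|_] := boolP (x \in ~` N'); last by rewrite mulr0 normr0.
    rewrite mulr1 ger0_norm//; move: k; apply: contrapT => h.
    by move: xN; rewrite inE; apply; exact: N'P.
move=> e e0.
have C0 : 0 <= C by apply: le_trans (VC 0%N); apply: Rintegral_ge0 => x _; exact: powR_ge0.
(* The truncation error tested against [g] is at most K C k^(1-p); requiring D <= k^(p-1) makes it
   at most [e]. *)
pose D := (K * C + 1) / e; have D0 : 0 < D by rewrite divr_gt0// ltr_wpDl// mulr_ge0.
have /cvgrPdist_le/(_ _ e0)[k1 _ Hk1] := ZV.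
pose k := (maxn k1 (Num.truncn (D `^ (p - 1)^-1))).+1.
exists k; split => [h|]; last first.
  by rewrite distrC; apply: Hk1 => /=; rewrite /k ltnW// ltnS leq_maxl.
have kD : D <= k%:R `^ (p - 1).
  have -> : D = (D `^ (p - 1)^-1) `^ (p - 1) by rewrite -powRrM mulVf ?gt_eqF// powRr1// ltW.
  apply: ge0_ler_powR; rewrite ?nnegrE ?(ltW p1') ?powR_ge0//.
  rewrite ltW// (lt_le_trans (truncnS_gt _))// ler_nat ltnS leq_maxr//.
have k0 : (0 : R) < k%:R by rewrite ltr0n.
have iVg : intg (fun x => V (r h) x * g x) by exact: intgM_bounded gK.
have isg : intg (fun x => s k (r h) x * g x) by exact: intgM_bounded gK.
rewrite -RintegralB//.
have iB : intg (fun x => V (r h) x * g x - s k (r h) x * g x) by exact: intgB.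
apply: le_trans (le_normr_Rintegral _ iB) _ => //.
apply: (@le_trans _ _ (\int[mu]_x (K * k%:R `^ (1 - p) * V (r h) x `^ p))).
  apply: le_RintegralT; [exact: (integrable_norm iB)|exact: intgZ|].
  move=> x; rewrite -mulrBl normrM mulrC -mulrA; apply: ler_pM => //.
  rewrite ger0_norm ?subr_ge0// mulrC; exact: powR_tail.
rewrite RintegralZl// (@le_trans _ _ (K * k%:R `^ (1 - p) * C))//.
  by rewrite ler_wpM2l// mulr_ge0 ?powR_ge0.
rewrite -opprB powRN mulrAC ler_pdivrMr ?powR_gt0//.
apply: (@le_trans _ _ (e * D)); last by rewrite ler_wpM2l// ltW.
by rewrite /D mulrCA divff ?gt_eqF// mulr1 lerDl.
Qed.

End Lp_weak_compact.

(** * Weak limits of gradients *)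

Section weak_gradients.
Context {R : realType} {n : nat}.
Local Notation mu := (lebesgue_rV R n).
Local Notation intg f := (mu.-integrable setT (EFin \o f)).
Implicit Types (f g : 'rV[R]_n -> R) (A : set 'rV[R]_n) (p : R).

(** Bounded measurable functions replace the dual of L^p: they include the test functions, which
    identify weak gradients, and the selected slopes of the lower bound for autonomous
    integrands. *)
Definition weak_to (V : nat -> 'rV[R]_n -> R) (V0 : 'rV[R]_n -> R) :=
  forall g K, measurable_fun setT g -> (forall x, `|g x| <= K) ->
    \int[mu]_x (V h x * g x) @[h --> \oo] --> \int[mu]_x (V0 x * g x).

(** The positive parts are extracted first, the negative parts along the subsequence so obtained;
    the boolean [sg] in the proof chooses the sign. *)
Lemma Lp_weak_compact p A (V : nat -> 'rV[R]_n -> R) (C : R) : 1 < p ->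
  measurable A -> (mu A < +oo)%E ->
  (forall h, measurable_fun setT (V h)) ->
  (forall h x, ~ A x -> V h x = 0) -> (forall h, intg (fun x => `|V h x| `^ p)) ->
  (forall h, \int[mu]_x `|V h x| `^ p <= C) ->
  exists r (V0 : 'rV[R]_n -> R), [/\ increasing_nat r, measurable_fun setT V0,
    (forall x, ~ A x -> V0 x = 0), intg (fun x => `|V0 x| `^ p) & weak_to (V \o r) V0].
Proof.
move=> p1 mA Aoo mV VA iV VC; have p0 : 0 < p by exact: lt_trans p1.
have part (sg : bool) r0 : increasing_nat r0 -> let W h x := Num.max ((-1) ^+ sg * V h x) 0 in
  exists r (V0 : 'rV[R]_n -> R), [/\ increasing_nat r, measurable_fun setT V0,
    (forall x, 0 <= V0 x) /\ (forall x, ~ A x -> V0 x = 0), intg (fun x => V0 x `^ p) &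
    weak_to (W \o r0 \o r) V0].
  move=> incr0 W.
  have mW h : measurable_fun setT (W h).
    by apply: measurable_maxr => //; exact: measurable_funM.
  have W0 h x : 0 <= W h x by rewrite le_max lexx orbT.
  have WV h x : W h x `^ p <= `|V h x| `^ p.
    apply: ge0_ler_powR; rewrite ?nnegrE ?(ltW p0)// ge_max normr_ge0 andbT.
    by rewrite (le_trans (ler_norm _))// normrM normrX normrN1 expr1n mul1r.
  have iW h : intg (fun x => W h x `^ p).
    apply: (intg_le _ (iV h)).
      by apply: (measurableT_comp (f := fun t : R => t `^ p)) => //; exact: measurable_powR.
    by move=> x; rewrite (ger0_norm (powR_ge0 _ _)) (ger0_norm (powR_ge0 _ _)).
  apply: (Lp_weak_compact_ge0 p1 mA Aoo (fun h => mW (r0 h)) (fun h => W0 (r0 h))) => //.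
  - by move=> h x Ax; rewrite /W VA// mulr0 maxxx.
  - by move=> h; apply: le_trans (VC (r0 h)); apply: le_RintegralT.
have [r1 [P [i1 mP [P0 PA] iP Pc]]] := part false id (fun _ _ => id).
have [r2 [Q [i2 mQ [Q0 QA] iQ Qc]]] := part true r1 i1.
exists (r1 \o r2), (fun x => P x - Q x); split.
- exact: increasing_nat_comp.
- exact: measurable_funB.
- by move=> x Ax; rewrite PA// QA// subrr.
- apply: (intg_le _ (intgD iP iQ)).
    by apply: measurable_normpowR; exact: measurable_funB.
  move=> x; rewrite (ger0_norm (powR_ge0 _ _)) [leRHS]ger0_norm ?addr_ge0 ?powR_ge0//.
  have [PQ|QP] := leP (P x) (Q x).
    rewrite ler0_norm ?subr_le0// opprB (@le_trans _ _ (Q x `^ p))// ?lerDr ?powR_ge0//.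
    by apply: ge0_ler_powR; rewrite ?nnegrE ?(ltW p0) ?subr_ge0// gerBl.
  rewrite gtr0_norm ?subr_gt0// (@le_trans _ _ (P x `^ p))// ?lerDl ?powR_ge0//.
  by apply: ge0_ler_powR; rewrite ?nnegrE ?(ltW p0) ?subr_ge0 ?(ltW QP)// gerBl.
move=> g K mg gK.
have nV f : measurable_fun setT f -> (forall x, ~ A x -> f x = 0) ->
    intg (fun x => `|f x| `^ p) -> intg f.
  by move=> mf fA fi; apply: (intg_powR (ltW p1) mA Aoo mf fi fA).
have nV0 f : measurable_fun setT f -> (forall x, 0 <= f x) -> (forall x, ~ A x -> f x = 0) ->
    intg (fun x => f x `^ p) -> intg f.
  by move=> mf f0 fA fi; apply: nV => //; under eq_fun do rewrite ger0_norm//.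
pose Vp h x := Num.max ((-1) ^+ false * V h x) 0.
pose Vn h x := Num.max ((-1) ^+ true * V h x) 0.
have VE h x : V h x = Vp h x - Vn h x.
  rewrite /Vp /Vn expr0 expr1 mul1r mulN1r.
  by have [v0|v0] := leP (V h x) 0; [rewrite max_l ?oppr_ge0// sub0r opprK|rewrite max_r ?subr0// oppr_le0 ltW].
have iVn h : intg (V h) by exact: (nV _ (mV h) (VA h) (iV h)).
have iVp h : intg (Vp h).
  apply: (intg_le _ (iVn h)); first by apply: measurable_maxr => //; exact: measurable_funM.
  move=> x; rewrite /Vp expr0 mul1r.
  by have [v0|v0] := leP (V h x) 0; rewrite ?normr0.
have iVq h : intg (Vn h).
  apply: (intg_le _ (iVn h)); first by apply: measurable_maxr => //; exact: measurable_funM.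
  move=> x; rewrite /Vn expr1 mulN1r.
  by have [v0|v0] := leP (- V h x) 0; rewrite ?normr0// normrN.
rewrite (_ : \int[mu]_x ((P x - Q x) * g x) = \int[mu]_x (P x * g x) - \int[mu]_x (Q x * g x)); last first.
  rewrite -RintegralB//; try (by apply: (intgM_bounded _ mg gK); exact: (nV0 _ mP P0 PA iP)); try (by apply: (intgM_bounded _ mg gK); exact: (nV0 _ mQ Q0 QA iQ)).
  by apply: eq_Rintegral => x _; rewrite mulrBl.
have E h : \int[mu]_x ((V \o (r1 \o r2)) h x * g x) =
    \int[mu]_x (Vp (r1 (r2 h)) x * g x) - \int[mu]_x (Vn (r1 (r2 h)) x * g x).
  rewrite -RintegralB//; try by apply: (intgM_bounded _ mg gK).
  by apply: eq_Rintegral => x _; rewrite -mulrBl -VE.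
under eq_fun do rewrite E; apply: cvgB; last exact: (Qc g K mg gK).
exact: (cvg_comp _ _ (increasing_nat_cvg i2) (Pc g K mg gK)).
Qed.

Lemma weak_to_subseq V V0 (r s s' : nat -> nat) N : weak_to (V \o s) V0 -> increasing_nat r ->
  (forall h, s' (h + N)%N = s (r h)) -> weak_to (V \o s') V0.
Proof.
move=> H incr E g K mg gK.
exact: (@cvg_subseq R (fun h => \int[mu]_x (V h x * g x)) _ r N s' s (H g K mg gK) incr E).
Qed.

Context {m : nat}.
Variables (Omega : set 'rV[R]_n) (X : 'I_m -> 'rV[R]_n -> 'rV[R]_n).
Hypotheses (oO : open Omega) (bO : bounded_set Omega) (vX : forall j, vfield Omega (X j)).

(** On the set [A] of finite measure |d| <= k + |d|^p k^(1-p), so convergence of the p-th powers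
    gives convergence in L^1 after [k] has been chosen small. *)
Lemma dist_lt_norm p A (d : nat -> 'rV[R]_n -> R) : 1 < p -> measurable A -> (mu A < +oo)%E ->
  (forall h, measurable_fun setT (d h)) -> (forall h x, ~ A x -> d h x = 0) ->
  (forall h, intg (fun x => `|d h x| `^ p)) ->
  (forall e, 0 < e -> \forall h \near \oo, (\int[mu]_x (`|d h x| `^ p)%:E < e%:E)%E) ->
  \int[mu]_x `|d h x| @[h --> \oo] --> (0 : R).
Proof.
move=> p1 mA Aoo md dA id dc.
pose iA := \int[mu]_x (\1_A x : R); have intA := intg_indic mA Aoo.
have iA0 : 0 <= iA by apply: Rintegral_ge0 => x _; rewrite indicE.
apply/cvgrPdist_le => e e0.
pose k := e / (2 * (iA + 1)).
have k0 : 0 < k by rewrite divr_gt0// mulr_gt0// ltr_wpDl.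
have kp : 0 < k `^ (1 - p) by rewrite powR_gt0.
have e2 : 0 < e / 2 / k `^ (1 - p) by rewrite !divr_gt0.
apply: filterS (dc _ e2) => h; rewrite Rintegral_EFin// lte_fin ltr_pdivlMr// => H.
have i1 : intg (fun x => `|d h x|).
  have := integrable_norm (intg_powR (ltW p1) mA Aoo (md h) (id h) (dA h)); exact.
rewrite sub0r normrN ger0_norm; last exact: Rintegral_ge0.
apply: (@le_trans _ _ (\int[mu]_x (k * \1_A x + k `^ (1 - p) * `|d h x| `^ p))).
  apply: le_RintegralT => //; first by apply: intgD; exact: intgZ.
  move=> x; have [Ax|Ax] := pselect (A x); last first.
    by rewrite dA// normr0 addr_ge0// mulr_ge0 ?(ltW k0) ?(ltW kp) ?powR_ge0// indicE.
  rewrite indicE mem_set// mulr1; have := powR_tail p1 k0 (normr_ge0 (d h x)).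
  have : Num.min `|d h x| k <= k by rewrite ge_min lexx orbT.
  by rewrite (mulrC (k `^ _)); lra.
rewrite RintegralD//; [|exact: intgZ|exact: intgZ].
rewrite !RintegralZl// -/iA.
have kA : k * iA <= e / 2.
  rewrite /k invfM mulrA -mulrA ler_piMr ?divr_ge0 ?(ltW e0)//.
  by rewrite mulrC ler_pdivrMr ?mul1r ?ltr_wpDl// lerDl.
by move: H; rewrite mulrC => H; lra.
Qed.

(** In the identity defining the weak derivative of [u_h], strong convergence handles the side of
    [u_h] and weak convergence the side of the gradient, so the weak limit is the gradient of
    [u]. *)
Lemma weak_gradient_compact p A (u_ : nat -> 'rV[R]_n -> R) (U_ : nat -> 'I_m -> 'rV[R]_n -> R) u (C : R) :
  1 < p -> open_in Omega A -> (forall h, isgrad X p A (u_ h) (U_ h)) -> inLp p A u ->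
  cvgLp p A u_ u -> (forall h j, \int[mu]_x `|(U_ h j \_ A) x| `^ p <= C) ->
  exists r U, [/\ increasing_nat r, isgrad X p A u U &
    forall j, weak_to (fun h => U_ (r h) j \_ A) (U j \_ A)].
Proof.
move=> p1 oA HU_ uA uc UC; have mA := open_in_measurable oA; have Aoo := open_in_lty bO oA.
have p1' := ltW p1.
have uA_ h : inLp p A (u_ h) by have [] := HU_ h.
have UA_ h j : inLp p A (U_ h j) by have [_ /(_ j)[]] := HU_ h.
pose P k t := forall j : 'I_m, j = k :> nat -> exists V0 : 'rV[R]_n -> R,
  [/\ measurable_fun setT V0, (forall x, ~ A x -> V0 x = 0), intg (fun x => `|V0 x| `^ p) &
    weak_to ((fun h => U_ h j \_ A) \o t) V0].
have [||r incr rP] := @diagonal_subsequence P.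
- move=> k t incr; have [[j jk]|nj] := pselect (exists j : 'I_m, j = k :> nat).
    have [||||r [V0 [incr' h1 h2 h3 h4]]] := @Lp_weak_compact p A (fun h => U_ (t h) j \_ A) C p1 mA Aoo.
    + by move=> h; have /(inLpP _ _ p1')[] := UA_ (t h) j.
    + by move=> h x; exact: patch_out.
    + by move=> h; have /(inLpP _ _ p1')[] := UA_ (t h) j.
    + by move=> h; exact: UC.
    exists r => // j' j'k; have -> : j' = j by apply/val_inj; rewrite /= j'k jk.
    by exists V0.
  by exists id => // j jk; exfalso; apply: nj; exists j.
- move=> k t t' r N Pt incr E j jk; have [V0 [h1 h2 h3 h4]] := Pt j jk.
  exists V0; split => //; exact: (weak_to_subseq h4 incr E).
have /choice[U UP] j : exists V0 : 'rV[R]_n -> R,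
  [/\ measurable_fun setT V0, (forall x, ~ A x -> V0 x = 0), intg (fun x => `|V0 x| `^ p) &
    weak_to ((fun h => U_ h j \_ A) \o r) V0] by exact: (rP j j erefl).
have UE j : U j \_ A = U j by have [_ h _ _] := UP j; exact: patch_id.
exists r, U; split => //; last by move=> j; rewrite UE; have [] := UP j.
split => // j; have [mU U0 iU Uc] := UP j; split.
  by apply/inLpP => //; rewrite UE.
move=> phi tphi; have [K pK] := test_bounded tphi; have mp := test_measurable tphi.
have [K' aK] := adj_bounded (vX j) oA.2 tphi.
have ma := adj_measurable oO (vX j) oA.2 tphi.
have l1 := Uc phi K mp pK.
pose d h x := ((fun y => u_ (r h) y - u y) \_ A) x.
have dE h x : d h x = (u_ (r h) \_ A) x - (u \_ A) x.
  by rewrite /d !patchE; case: ifP; rewrite ?subrr.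
have iu h : intg (u_ (r h) \_ A) by exact: (inLp_intg_in bO p1' oA (uA_ _)).
have iu0 : intg (u \_ A) by exact: (inLp_intg_in bO p1' oA uA).
have mu_ h : measurable_fun setT (u_ (r h) \_ A) by have /(inLpP _ _ p1')[] := uA_ (r h).
have mu0 : measurable_fun setT (u \_ A) by have /(inLpP _ _ p1')[] := uA.
have md h : measurable_fun setT (d h).
  by rewrite (_ : d h = (fun x => (u_ (r h) \_ A) x - (u \_ A) x)); [exact: measurable_funB|exact/funext].
have ipd h : intg (fun x => `|d h x| `^ p).
  have h1 : u_ (r h) \_ A \in Lfun mu p%:E by exact: uA_.
  have h2 : u \_ A \in Lfun mu p%:E by exact: uA.
  have : (u_ (r h) \_ A - u \_ A) \in Lfun mu p%:E by apply: rpredB.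
  have -> : u_ (r h) \_ A - u \_ A = d h by apply/funext => x; rewrite dE.
  by move=> /(mem_LfunP _ p1')[].
have dc : forall e, 0 < e -> \forall h \near \oo, (\int[mu]_x (`|d h x| `^ p)%:E < e%:E)%E.
  move=> e e0; have := iffLR (cvgLpP _ _ _ p1') uc e e0 => -[N _ HN].
  exists N; first exact: Logic.I.
  by move=> h Nh; exact: (HN (r h) (leq_trans Nh (increasing_nat_ge incr h))).
have l2 := dist_lt_norm p1 mA Aoo md (fun h => @patch_out _ _ A _) ipd dc.
have id1 h : intg (d h) by exact: (intg_powR p1' mA Aoo (md h) (ipd h) (@patch_out _ _ A _)).
have l3 : \int[mu]_x (d h x * adj (X j) phi x) @[h --> \oo] --> (0 : R).
  have K'0 : 0 <= K' by exact: le_trans (aK 0).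
  have lim : K' * \int[mu]_x `|d h x| @[h --> \oo] --> (0 : R).
    by rewrite -[0](mulr0 K'); apply: cvgM => //; exact: cvg_cst.
  apply/norm_cvg0P; apply: (squeeze_cvgr _ (cvg_cst 0) lim); apply: nearW => h.
  have i1 : intg (fun x => d h x * adj (X j) phi x) by exact: intgM_bounded aK.
  rewrite normr_ge0/= (le_trans (le_normr_Rintegral _ i1))// -RintegralZl//; last exact: (integrable_norm (id1 h)).
  apply: le_RintegralT; [exact: (integrable_norm i1)|exact/intgZ/(integrable_norm (id1 h))|].
  by move=> x; rewrite normrM mulrC ler_wpM2r.
have E h : \int[mu]_x ((U_ (r h) j \_ A) x * phi x) =
    - (\int[mu]_x (d h x * adj (X j) phi x) + \int[mu]_x (u x * adj (X j) phi x)).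
  have -> : \int[mu]_x ((U_ (r h) j \_ A) x * phi x) = \int[mu]_x (U_ (r h) j x * phi x).
    by apply: eq_Rintegral => x _; rewrite patchM0// => Ax; exact: test_out tphi Ax.
  have [_ /(_ j)[_ /(_ phi tphi) ->]] := HU_ (r h).
  congr -%R.
  have i0 : intg (fun x => u x * adj (X j) phi x) by exact: (intg_adj oO (vX j) oA.2 tphi iu0).
  rewrite -RintegralD//; last exact: intgM_bounded aK.
  apply: eq_Rintegral => x _; have [Ax|Ax] := pselect (A x).
    by rewrite /d patchE mem_set// mulrBl subrK.
  by rewrite (adj_out _ tphi Ax) !mulr0 addr0.
have l4 : \int[mu]_x ((U_ (r h) j \_ A) x * phi x) @[h --> \oo] --> - \int[mu]_x (u x * adj (X j) phi x).
  under eq_fun do rewrite E.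
  apply: cvgN; rewrite -[X in _ --> X]add0r; apply: cvgD => //; exact: cvg_cst.
exact: (cvg_unique _ l1 l4).
Qed.

Lemma cvgLp_sub p A (u_ : nat -> 'rV[R]_n -> R) u : 1 <= p -> open_in Omega A ->
  (forall h, inLp p Omega (u_ h)) -> inLp p Omega u -> cvgLp p Omega u_ u -> cvgLp p A u_ u.
Proof.
move=> p1 oA uO_ uO /(cvgLpP _ _ _ p1) uc; apply/(cvgLpP _ _ _ p1) => e e0.
have mA := open_in_measurable oA.
have p0 : 0 < p by exact: lt_le_trans p1.
have mpow f : measurable_fun setT f -> measurable_fun setT (fun x => (`|f x| `^ p)%:E).
  by move=> mf; apply/measurable_EFinP; exact: measurable_normpowR.
apply: filterS (uc e e0) => h; apply: le_lt_trans.
have E : (fun y => u_ h y - u y) \_ Omega = (fun x => (u_ h \_ Omega) x - (u \_ Omega) x).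
  by apply/funext => x; rewrite !patchE; case: ifP; rewrite ?subr0.
have md : measurable_fun setT ((fun y => u_ h y - u y) \_ Omega).
  rewrite E; apply: measurable_funB.
    by have /(inLpP _ _ p1)[] := uO_ h.
  by have /(inLpP _ _ p1)[] := uO.
have EA : (fun y => u_ h y - u y) \_ A = (fun x => ((fun y => u_ h y - u y) \_ Omega) x * \1_A x).
  by rewrite -(patch_patch (fun y => u_ h y - u y) oA.2) patch_indic.
apply: ge0_le_integral => //.
- by apply: mpow; rewrite EA; apply: measurable_funM => //; exact: measurable_indic.
- exact: mpow.
- move=> x _; rewrite lee_fin EA; apply: ge0_ler_powR; rewrite ?nnegrE ?(ltW p0)//.
  by rewrite normrM ler_piMr// indicE normr_nat; case: (_ \in _).
Qed.

End weak_gradients.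

(** * Gamma-convergence for quadratic integrands *)

Section quadratic_Gamma.
Context {R : realType} {n m : nat}.
Local Notation mu := (lebesgue_rV R n).
Local Notation intg f := (mu.-integrable setT (EFin \o f)).
Variables (Omega : set 'rV[R]_n) (X : 'I_m -> 'rV[R]_n -> 'rV[R]_n) (c0 c1 : R).
Hypotheses (oO : open Omega) (bO : bounded_set Omega) (vX : forall j, vfield Omega (X j))
  (LX : LIC X Omega) (c00 : 0 < c0) (c01 : c0 <= c1).
Local Notation T := (('rV[R]_n -> R) * ('I_m -> 'rV[R]_n -> R))%type.

Let c10 : 0 < c1. Proof. exact: lt_le_trans c01. Qed.
Let oOO : open_in Omega Omega. Proof. by split. Qed.

Lemma ip_lin2 (a : R) (u v : 'rV[R]_n -> R) : L2 u -> L2 v ->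
  ip (a *: u + v) (a *: u + v) = a ^+ 2 * ip u u + 2 * a * ip u v + ip v v.
Proof.
move=> u2 v2; have uv2 := L2_lin a u2 v2.
rewrite ip_lin// (ipC u) (ipC v) !ip_lin// (ipC v u); ring.
Qed.

Lemma sqrt_ip_triangle (a : R) (u v : 'rV[R]_n -> R) : L2 u -> L2 v ->
  Num.sqrt (ip (a *: u + v) (a *: u + v)) <= `|a| * Num.sqrt (ip u u) + Num.sqrt (ip v v).
Proof.
move=> u2 v2; have u0 := ip_ge0 u; have v0 := ip_ge0 v.
rewrite -[leRHS]ger0_norm ?addr_ge0 ?mulr_ge0 ?sqrtr_ge0// -sqrtr_sqr ler_sqrt ?sqr_ge0//.
rewrite ip_lin2// sqrrD exprMn !sqr_sqrtr// real_normK ?num_real//.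
rewrite lerD2r lerD2l -mulr_natl.
have : a * ip u v <= `|a| * (Num.sqrt (ip u u) * Num.sqrt (ip v v)).
  rewrite (le_trans (ler_norm _))// normrM ler_wpM2l//.
  rewrite -sqrtrM// -sqrtr_sqr ler_sqrt ?mulr_ge0//.
  exact: L2_cauchy_schwarz.
by rewrite -mulr_natl; lra.
Qed.

Section extraction.
Variable b : nat -> 'rV[R]_n -> 'M[R]_m.
Hypothesis cb : forall k, coefficients c0 c1 (b k).
Local Notation L := (coordX Omega X).

Let Mb := c1 * \sum_i vip (L i) (L i).

(** The abstract construction is applied to pairs of a function and its gradient: the size of a pair
    is the L^2 norm of the function alone, its energy that of the gradient. [Mb] bounds the energies
    of all coordinate functions for every [h]. *)
Lemma correctors_grad2 : exists s (w : 'I_n -> nat -> T), [/\ increasing_nat s,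
  forall i k, grad2 X Omega (w i k).1 (w i k).2,
  forall i k, ip ((w i k).1 - coordf Omega i) ((w i k).1 - coordf Omega i) <= (k.+1%:R^-1) ^+ 2,
  forall i k, vip (flux (b (s k)) (w i k).2) (w i k).2 <= Mb + 1 &
  forall i (C e : R), 0 < e -> exists2 d, 0 < d & exists K, forall k z Z, (K <= k)%N ->
    grad2 X Omega z Z -> ip z z <= d -> vip (flux (b (s k)) Z) Z <= C ->
    `|vip (flux (b (s k)) (w i k).2) Z| <= e].
Proof.
pose D : set T := [set z | grad2 X Omega z.1 z.2].
pose nrm (z : T) := Num.sqrt (ip z.1 z.1).
pose B k (z z' : T) := vip (flux (b k) z.2) z'.2.
have D2 z : D z -> vL2 z.2 by case=> _ _ [].
have D1 z : D z -> L2 z.1 by case.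
have BE h (a : R) U V : vL2 U -> vL2 V -> vip (flux (b h) (a *: V + U)) (a *: V + U) =
    vip (flux (b h) U) U + 2 * a * vip (flux (b h) U) V + a ^+ 2 * vip (flux (b h) V) V.
  move=> u2 v2; have fv := vL2_flux c00 (cb h) v2; have fu := vL2_flux c00 (cb h) u2.
  have vu := vL2_lin a v2 u2.
  rewrite flux_lin vip_lin// !vip_linr//.
  by rewrite (vip_flux_sym c00 (cb h) v2 u2); ring.
have [|||||||s [w [incr Dw nw Mw Pw]]] := @correctors R T D nrm B _ _ _ _ _ 'I_n
    (fun i => (coordf Omega i, L i) : T) Mb _ _.
- by move=> a u v Du Dv; exact: (grad2_lin oO bO vX a oOO Du Dv).
- by move=> a u v Du Dv; apply: sqrt_ip_triangle; exact: D1.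
- rewrite /nrm /ip (_ : \int[mu]_x _ = 0) ?sqrtr0//.
  by under eq_Rintegral do rewrite mul0r; rewrite Rintegral_cst// mul0r.
- by move=> h u /D2; exact: vip_flux_ge0 c00 (cb h) _.
- move=> h a [u U] [v V] /D2 u2 /D2 v2.
  change (vip (flux (b h) (a *: V + U)) (a *: V + U) =
    vip (flux (b h) U) U + 2 * a * vip (flux (b h) U) V + a ^+ 2 * vip (flux (b h) V) V).
  exact: (BE h a U V u2 v2).
- by move=> i; exact: grad2_coord.
- move=> h i; have L2i := vL2_L oO bO vX i.
  rewrite /B (le_trans (vip_flux_le c00 (cb h) L2i))// /Mb ler_wpM2l ?(ltW c10)//.
  by rewrite (bigD1 i)//= lerDl; apply: sumr_ge0 => k _; exact: vip_ge0.
exists s, w; split => //.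
- move=> i k; have := nw i k; rewrite /nrm -[(w i k - _).1]/((w i k).1 - coordf Omega i) => h.
  rewrite -[leLHS]sqr_sqrtr ?ip_ge0//; apply: lerXn2r => //; rewrite nnegrE ?sqrtr_ge0//.
- move=> i C e e0; have [d d0 [K HK]] := Pw i C e e0.
  exists (d ^+ 2); first by rewrite exprn_gt0.
  exists K => k z Z Kk HZ zd ZC; apply: (HK k (z, Z) Kk HZ) => //.
  rewrite /nrm/= -(ger0_norm (ltW d0)) -sqrtr_sqr ler_sqrt ?sqr_ge0//.
Qed.

(** The components of gradients and fluxes form one countable bounded family in L^2, so one
    subsequence makes all of them converge weakly. The limit of the gradients is [L i] because the
    correctors tend to x_i strongly. *)
Lemma corrector_family_exists : exists s M w W sigma, increasing_nat s /\
  corrector_family Omega X c0 c1 (b \o s) M w W sigma.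
Proof.
have [s [w [incr Dw nw Mw Pw]]] := correctors_grad2.
pose W i k := (w i k).2.
have W2 i k : vL2 (W i k) by have [_ _ []] := Dw i k.
have S2 i k : vL2 (flux (b (s k)) (W i k)) by exact: vL2_flux c00 (cb _) _ _.
(* The flag [t.1] selects fluxes when true and gradients when false. *)
pose F (t : bool * ('I_n * 'I_m)) k : 'rV[R]_n -> R :=
  if t.1 then flux (b (s k)) (W t.2.1 k) t.2.2 else W t.2.1 k t.2.2.
have M1 (i : 'I_n) : 0 <= Mb + 1.
  by apply: le_trans (Mw i 0%N); exact: (vip_flux_ge0 c00 (cb (s 0%N)) (W2 i 0%N)).
have comp V (j : 'I_m) : ip (V j) (V j : 'rV[R]_n -> R) <= vip V V.
  by rewrite /vip (bigD1 j)//= lerDl; apply: sumr_ge0 => k _; exact: ip_ge0.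
have WC i k : vip (W i k) (W i k) <= (Mb + 1) / c0.
  rewrite ler_pdivlMr// mulrC (le_trans (vip_flux_ge c00 (cb (s k)) (W2 i k)))//; exact: Mw.
have F2 t k : L2 (F t k) by rewrite /F; case: t.1; [exact: S2|exact: W2].
have FC t k : ip (F t k) (F t k) <= (Mb + 1) / c0 + c1 * (Mb + 1).
  have Mt := M1 t.2.1.
  rewrite /F; case: t.1.
    rewrite (le_trans (comp _ _))// (le_trans (vip_flux_flux c00 (cb (s k)) (W2 _ k)))//.
    rewrite (@le_trans _ _ (c1 * (Mb + 1)))// ?lerDr ?divr_ge0 ?(ltW c00)//.
    by rewrite ler_wpM2l ?(ltW c10)//; exact: Mw.
  rewrite (le_trans (comp _ _))// (le_trans (WC _ k))// lerDl mulr_ge0// ltW//.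
have [r [tau [incr' tau2 tauc]]] := weak_compact_family F2 FC.
have wr0 i : ip ((w i (r k)).1 - coordf Omega i) ((w i (r k)).1 - coordf Omega i) @[k --> \oo] --> (0 : R).
  have inv0 : k.+1%:R^-1 @[k --> \oo] --> (0 : R) by exact: cvg_harmonic.
  have inv2 : (k.+1%:R^-1 : R) ^+ 2 @[k --> \oo] --> (0 : R).
    by rewrite -[0](expr0n R 2); exact: (cvgM inv0 inv0).
  apply: (squeeze_cvgr _ (cvg_cst 0) inv2); apply: nearW => k; rewrite ip_ge0/=.
  apply: (le_trans (nw i (r k))); apply: lerXn2r; rewrite ?nnegrE ?invr_ge0//.
  by rewrite lef_pV2 ?posrE// ler_nat ltnS increasing_nat_ge.
have Wlim i j : {ae mu, forall x, Omega x -> tau (false, (i, j)) x = L i j x}.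
  have [l2 l0 [L2i L0i] HL] := grad2_coord oO bO vX i.
  have bo f : L2 f -> intg (f \_ Omega).
    move=> f2; have : intg (fun x => f x * \1_Omega x).
      apply: L2_mul => //; apply: L2_indic; first exact: open_measurable_rV.
      exact: open_in_lty oOO.
    by rewrite patch_indic.
  apply: (wderiv_uniq oO _ _ _ (HL j)); [exact/bo/tau2|exact/bo/L2i|].
  move=> phi tphi; have [K' aK] := adj_bounded (vX j) (@subset_refl _ Omega) tphi.
  have ma := adj_measurable oO (vX j) (@subset_refl _ Omega) tphi.
  have [K pK] := test_bounded tphi; have mp := test_measurable tphi.
  have mO := open_measurable_rV oO; have Ooo := open_in_lty bO oOO.
  have phi2 : L2 phi by apply: (L2_bounded mO Ooo mp pK) => x; exact: test_out tphi.
  have adj2 : L2 (adj (X j) phi) by apply: (L2_bounded mO Ooo ma aK) => x; exact: adj_out tphi.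
  have e1 := tauc (false, (i, j)) phi phi2.
  have e2 : ip (F (false, (i, j)) (r k)) phi @[k --> \oo] --> - ip (coordf Omega i) (adj (X j) phi).
    have E k : ip (F (false, (i, j)) (r k)) phi =
        - (ip ((w i (r k)).1 - coordf Omega i) (adj (X j) phi) + ip (coordf Omega i) (adj (X j) phi)).
      have [w2 _ _ Hw] := Dw i (r k).
      rewrite /F/=; rewrite [LHS](Hw j phi tphi); congr -%R.
      have := ip_lin (-1) l2 w2 adj2; rewrite scaleN1r mulN1r addrC => ->.
      by rewrite addrAC addNr add0r.
    under eq_fun do rewrite E; apply: cvgN; rewrite -[X in _ --> X]add0r.
    apply: cvgD; last exact: cvg_cst.
    apply: (@cvg0_sqr _ _ _ (ip (adj (X j) phi) (adj (X j) phi)) _ (wr0 i)) => k.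
    have [w2 _ _ _] := Dw i (r k).
    rewrite mulrC; apply: L2_cauchy_schwarz => //.
    by have := L2_lin (-1) l2 w2; rewrite scaleN1r addrC.
  exact: (cvg_unique _ e1 e2).
exists (s \o r), (Mb + 1), (fun i k => (w i (r k)).1), (fun i k => W i (r k)),
  (fun i j => tau (true, (i, j))).
split; first exact: increasing_nat_comp.
split.
- by move=> k; exact: cb.
- by move=> i k; exact: Dw.
- exact: wr0.
- by move=> i k; exact: Mw.
- move=> i C e e0; have [d d0 [K HK]] := Pw i C e e0; exists d => //; exists K => k z Z Kk.
  by apply: HK; exact: leq_trans Kk (increasing_nat_ge incr' k).
- by move=> i j; exact: tau2.
- by move=> i g g2; apply: cvg_sumr => j; exact: (tauc (true, (i, j))).
- move=> i g g2; apply: cvg_sumr => j; have [_ _ [_ L0i] _] := grad2_coord oO bO vX i.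
  have mO := open_measurable_rV oO; have Ooo := open_in_lty bO oOO.
  have gO2 : L2 (fun x => \1_Omega x * g j x).
    by apply: (L2_bounded_mul (M := 1)) => //; move=> x; rewrite indicE normr_nat; case: (_ \in _).
  have := tauc (false, (i, j)) _ gO2; rewrite /F/=.
  have -> : ip (tau (false, (i, j))) (fun x => \1_Omega x * g j x) = ip (L i j) (g j).
    have [mt _] := tau2 (false, (i, j)); have [mgj _] := g2 j; have [mL _] := vL2_L oO bO vX i j.
    apply: Rintegral_ae; [apply: measurable_funM => //; exact: measurable_funM|exact: measurable_funM|].
    apply: ae_imp (Wlim i j) => x H; rewrite indicE; have [xO|xO] := boolP (x \in Omega).
      by rewrite mul1r H//; rewrite inE in xO.
    by rewrite L0i ?mul0r ?mulr0// => Ox; move/negP : xO; apply; rewrite inE.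
  suff E k : ip (W i (r k) j) (fun x => \1_Omega x * g j x) = ip (W i (r k) j) (g j).
    by under eq_fun do rewrite E.
  apply: eq_Rintegral => x _; rewrite indicE; have [xO|xO] := boolP (x \in Omega).
    by rewrite mul1r.
  have [_ _ [_ W0] _] := Dw i (r k); rewrite /W W0 ?mul0r//.
  by move=> Ox; move/negP : xO; apply; rewrite inE.
Qed.

End extraction.

Implicit Types (f : 'rV[R]_n -> 'rV[R]_m -> \bar R) (A : set 'rV[R]_n).

Lemma functional_form f (b : 'rV[R]_n -> 'M[R]_m) A v G :
  {ae mu, forall x, Omega x -> forall eta, f x eta = (qform b x eta)%:E} ->
  measurable_fun (Omega `*` setT) (fun z : 'rV[R]_n * 'rV[R]_m => f z.1 z.2) ->
  coefficients c0 c1 b -> open_in Omega A -> isgrad X 2 A v G ->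
  functional 2 X f v A = (vip (flux b (fun j => G j \_ A)) (fun j => G j \_ A))%:E.
Proof.
move=> fb' mf cb oA vG; have mA := open_in_measurable oA.
rewrite (functionalE oO bO _ vX oA mf vG) ?ler1n//.
have [_ _ [G2 GA] _] := isgrad_grad2 oA vG.
set U := fun j => G j \_ A in G2 GA *.
have F2 := vL2_flux c00 cb G2.
have mgr : measurable_fun A (fun x => (x, \row_j G j x)).
  apply: measurable_grad => // j; apply: (inLp_measurable (p := 2) _ oA); first by rewrite ler1n.
  by have [_ /(_ j)[]] := vG.
have -> : (\int[mu]_(x in A) f x (\row_j G j x) = \int[mu]_(x in A) (dot (flux b U ^~ x) (U ^~ x))%:E)%E.
  apply: ae_eq_integral => //.
  - apply: (@measurable_comp _ _ _ _ _ _ (Omega `*` [set: 'rV[R]_m])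
      (fun z : 'rV[R]_n * 'rV[R]_m => f z.1 z.2) A (fun x => (x, \row_j G j x))) => //.
    + by apply: measurableX => //; exact: open_measurable_rV.
    + by move=> _ [x Ax <-]; split => //=; exact: oA.2.
  - by apply/measurable_EFinP/measurable_funTS; exact: intg_measurable (intg_dot F2 G2).
  - apply: ae_imp fb' => x h Ax; rewrite (h (oA.2 _ Ax)) /qform fluxE.
    suff -> : (\row_j G j x) ord0 = U ^~ x by [].
    by apply/funext => j; rewrite mxE /U patchE mem_set.
rewrite vip_dot// -Rintegral_EFin; last exact: intg_dot.
rewrite integral_mkcond; apply: eq_integral => x _; rewrite patchE; case: ifPn => // /negP xA.
have Ax : ~ A x by move=> Ax; apply: xA; rewrite inE.
congr EFin; rewrite /dot big1// => j _.
have -> : U j x = 0 by exact: GA.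
by rewrite mulr0.
Qed.

Lemma isgrad_eq_on p A u u' G : open_in Omega A -> (forall x, A x -> u x = u' x) ->
  isgrad X p A u G -> isgrad X p A u' G.
Proof.
move=> oA uu' [uA HG]; have E : u \_ A = u' \_ A.
  by apply/funext => x; rewrite !patchE; case: ifPn => //; rewrite inE => /uu'.
split; first by rewrite /inLp -E.
move=> j; have [GA wG] := HG j; split => // phi tphi; rewrite (wG phi tphi); congr -%R.
apply: eq_Rintegral => x _; have [Ax|Ax] := pselect (A x); first by rewrite uu'.
by rewrite (adj_out _ tphi Ax) !mulr0.
Qed.

Lemma functional_lt_isgrad p f v A (c : \bar R) : 1 <= p -> open_in Omega A -> (c < +oo)%E ->
  (functional p X f v A <= c)%E -> exists G, isgrad X p A v G.
Proof.
move=> p1 oA coo; rewrite /functional; case: asboolP => [vW _|_].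
  by exists (fun j x => Xgrad p X A v x ord0 j); exact: (W1X_isgrad oO bO p1 vX oA).
by rewrite leNgt coo.
Qed.

Lemma functional_ge0 p f v A : (forall x eta, Omega x -> (0 <= f x eta)%E) -> A `<=` Omega ->
  (0 <= functional p X f v A)%E.
Proof.
move=> f0 AO; rewrite /functional; case: asboolP => // _; apply: integral_ge0 => x Ax.
exact/f0/AO.
Qed.

Lemma L2_dist (d : 'rV[R]_n -> R) : L2 d -> (\int[mu]_x (`|d x| `^ 2)%:E = (ip d d)%:E)%E.
Proof.
move=> [_ d2]; rewrite ip_sqr -Rintegral_EFin//; apply: eq_integral => x _.
by rewrite powR_mulrn// real_normK// num_real.
Qed.

Lemma cvgLp2_ip A (u_ : nat -> 'rV[R]_n -> R) u : (forall h, L2 (u_ h \_ A)) -> L2 (u \_ A) ->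
  cvgLp 2 A u_ u -> ip (u_ h \_ A - u \_ A) (u_ h \_ A - u \_ A) @[h --> \oo] --> (0 : R).
Proof.
move=> u2_ u2 uc; have H := iffLR (cvgLpP A u_ u (ler1n R 2)) uc.
apply/cvgrPdist_lt => e e0; apply: filterS (H e e0) => h.
have -> : (fun y => u_ h y - u y) \_ A = u_ h \_ A - u \_ A.
  apply/funext => x; rewrite -[RHS]/((u_ h \_ A) x - (u \_ A) x) !patchE.
  by case: ifP; rewrite ?subr0.
have d2 : L2 (u_ h \_ A - u \_ A) by have := L2_lin (-1) u2 (u2_ h); rewrite scaleN1r addrC.
by rewrite L2_dist// lte_fin sub0r normrN ger0_norm// ip_ge0.
Qed.

Lemma quadratic_compactness (f_ : nat -> 'rV[R]_n -> 'rV[R]_m -> \bar R) :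
  (forall h, J1class Omega c0 c1 (f_ h)) ->
  exists s f, [/\ increasing_nat s, J1class Omega c0 c1 f &
    forall A, open_in Omega A -> Gamma_cvg 2 Omega (fun h u => functional 2 X (f_ (s h)) u A)
      (fun u => functional 2 X f u A)].
Proof.
move=> Jf; have /choice[b bP] h : exists b, coefficients c0 c1 b /\
    {ae mu, forall x, Omega x -> forall eta, f_ h x eta = (qform b x eta)%:E}.
  by have [b b1 b2] := J1class_coefficients oO c01 (Jf h); exists b.
have cb h : coefficients c0 c1 (b h) by have [] := bP h.
have [s [M [w [W [sigma [incr cf]]]]]] := corrector_family_exists cb.
have [a ca aL] := limit_coefficients oO bO vX LX c00 c01 cf.
pose f x eta := (qform a x eta)%:E.
have Jlim : J1class Omega c0 c1 f by exact: form_J1class.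
exists s, f; split => // A oA.
have p2 : (1 : R) <= 2 by rewrite ler1n.
have p2' : (1 : R) < 2 by rewrite ltr1n.
have mA := open_in_measurable oA.
have E_ h v G : isgrad X 2 A v G -> functional 2 X (f_ h) v A =
    (vip (flux (b h) (fun j => G j \_ A)) (fun j => G j \_ A))%:E.
  move=> vG; apply: (functional_form _ _ (cb h) oA vG); first by have [] := bP h.
  by have [[]] := Jf h.
have E0 v G : isgrad X 2 A v G -> functional 2 X f v A =
    (vip (flux a (fun j => G j \_ A)) (fun j => G j \_ A))%:E.
  move=> vG; apply: (functional_form _ _ ca oA vG); first by apply: aeW => x _ eta.
  by have [[]] := Jlim.
have LO u : inLp 2 Omega u -> L2 (u \_ A).
  by move=> uO; apply/inLp2P; exact: inLp_sub p2 mA oA.2 uO.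
apply: Gamma_criterion => //.
- by move=> u; apply: functional_ge0 oA.2 => x eta _; rewrite lee_fin; exact: (form_ge0 c00 x eta ca).
- move=> u u_ r c uO uO_ incr' uc H.
  have /choice[G GP] h : exists G, isgrad X 2 A (u_ h) G.
    exact: (functional_lt_isgrad p2 oA (ltry c) (H h)).
  have ucA := cvgLp_sub p2 oA uO_ uO uc.
  have Ec h : vip (flux (b (s (r h))) (fun j => G h j \_ A)) (fun j => G h j \_ A) <= c.
    by rewrite -lee_fin -(E_ _ _ _ (GP h)); exact: H.
  have HG h := isgrad_grad2 oA (GP h).
  have GC h j : \int[mu]_x `|(G h j \_ A) x| `^ 2 <= c / c0.
    have [_ _ [G2 _] _] := HG h; rewrite ler_pdivlMr// mulrC.
    apply: le_trans (Ec h); apply: le_trans (vip_flux_ge c00 (cb _) G2).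
    rewrite ler_wpM2l ?(ltW c00)// /vip (bigD1 j)//= ip_sqr.
    rewrite (_ : \int[mu]_x `|(G h j \_ A) x| `^ 2 = \int[mu]_x (G h j \_ A) x ^+ 2).
      by rewrite lerDl; apply: sumr_ge0 => k _; exact: ip_ge0.
    by apply: eq_Rintegral => x _; rewrite powR_mulrn// real_normK// num_real.
  have uA : inLp 2 A u by exact: inLp_sub p2 mA oA.2 uO.
  have [r' [U [incr'' HU _]]] := weak_gradient_compact oO bO vX p2' oA GP uA ucA GC.
  rewrite (E0 _ _ HU) lee_fin.
  apply: (quadratic_liminf oO bO vX LX c00 c01 cf ca aL oA incr' HG (isgrad_grad2 oA HU)) => //.
  by apply: cvgLp2_ip => // [h|]; exact: LO.
- move=> u e uO Goo e0.
  have [U HU] : exists U, isgrad X 2 A u U.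
    exact: (functional_lt_isgrad p2 oA Goo (lexx _)).
  have e20 : 0 < e / 2 by rewrite divr_gt0.
  have HUg := isgrad_grad2 oA HU.
  have [K HK] := quadratic_recovery oO bO vX LX c00 c01 cf ca aL oA HUg e20.
  exists K => k Kk; have [v [V [Hv vd Ev]]] := HK k Kk.
  have [v2 v0 [V2 V0] _] := Hv.
  (* The competitor [v] is meaningful on [A] and zero elsewhere; [vt] equals it on [A] and [u]
     outside, so that [vt - u] vanishes off [A]. *)
  pose vt : 'rV[R]_n -> R := fun x => u x + (v x - (u \_ A) x).
  have vtA x : A x -> v x = vt x by move=> Ax; rewrite /vt patchE mem_set// addrC subrK.
  have d2 : L2 (v - u \_ A) by have := L2_lin (-1) (LO u uO) v2; rewrite scaleN1r addrC.
  have Hvt : isgrad X 2 A vt V.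
    by apply: (isgrad_eq_on oA vtA); exact: grad2_isgrad.
  exists vt; split.
  + apply/inLp2P; have -> : vt \_ Omega = 1 *: (u \_ Omega) + (v - u \_ A).
      apply/funext => x; rewrite scale1r -[RHS]/((u \_ Omega) x + (v x - (u \_ A) x)).
      rewrite [LHS]patchE [in RHS]patchE; case: ifPn => // /negP xO.
      have Ax : ~ A x by move=> /oA.2 Ox; apply: xO; rewrite inE.
      by rewrite v0// patch_out// subrr addr0.
    by apply: L2_lin => //; apply/inLp2P.
  + rewrite /dist_lt; have -> : (fun y => vt y - u y) \_ Omega = v - u \_ A.
      apply/funext => x; rewrite -[RHS]/(v x - (u \_ A) x) [LHS]patchE; case: ifPn => [_|/negP xO].
        by rewrite /vt addrC addKr.
      have Ax : ~ A x by move=> /oA.2 Ox; apply: xO; rewrite inE.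
      by rewrite v0// patch_out// subrr.
    by rewrite L2_dist// lte_fin (le_lt_trans vd)// ltr_pdivrMr// ltr_pMr// ltr1n.
  + rewrite (E_ _ _ _ Hvt) (E0 _ _ HU) -EFinD lee_fin.
    have -> : (fun j => V j \_ A) = V by apply/funext => j; rewrite patch_id// => x; exact: V0.
    by rewrite (le_trans Ev)// lerD2l ler_pdivrMr// ler_peMr ?(ltW e0)// ler1n.
Qed.

End quadratic_Gamma.

(** * Sequences of convex functions *)

Section convex_sequences.
Context {R : realType} {m : nat}.
Variables (c0 c1 p : R).
Hypotheses (c00 : 0 < c0) (c10 : 0 < c1) (p1 : 1 < p).
Implicit Types (g : 'rV[R]_m -> R) (x y z eta : 'rV[R]_m).

Let p0 : 0 < p. Proof. exact: lt_trans p1. Qed.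

Definition convex_growth g := [/\ forall (t : R) x y, 0 <= t <= 1 ->
    g (t *: x + (1 - t) *: y) <= t * g x + (1 - t) * g y,
  forall eta, c0 * enorm eta `^ p <= g eta & forall eta, g eta <= c1 * (enorm eta `^ p + 1)].

Lemma enorm_le eta : enorm eta <= m%:R * `|eta|.
Proof.
have m0 : 0 <= m%:R * `|eta| by rewrite mulr_ge0.
rewrite -(ger0_norm m0) -sqrtr_sqr; apply: ler_wsqrtr.
apply: (@le_trans _ _ (\sum_(i < m) `|eta| ^+ 2)).
  apply: ler_sum => i _; rewrite -real_normK ?num_real//; apply: lerXn2r; rewrite ?nnegrE//.
  exact: coord_le_norm.
rewrite sumr_const card_ord exprMn -[leLHS]mulr_natl ler_wpM2r ?sqr_ge0//.
by rewrite -natrX ler_nat; case: (m) => // k; rewrite expnS leq_pmulr// expn_gt0.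
Qed.

Lemma norm_le_enorm eta j : `|eta ord0 j| <= enorm eta.
Proof.
rewrite -sqrtr_sqr; apply: ler_wsqrtr; rewrite (bigD1 j)//= lerDl.
by apply: sumr_ge0 => i _; exact: sqr_ge0.
Qed.

Lemma rV_norm_le eta (k : R) : 0 <= k -> (forall j, `|eta ord0 j| <= k) -> `|eta| <= k.
Proof.
move=> k0 H; rewrite /Num.norm/= mx_normrE; apply: bigmax_le => // -[i j] _ /=.
by rewrite (ord1 i).
Qed.

Lemma norm_le_enorm' eta : `|eta| <= enorm eta.
Proof. by apply: rV_norm_le => [|j]; [exact: sqrtr_ge0|exact: norm_le_enorm]. Qed.

Lemma convex_growth_ge0 g eta : convex_growth g -> 0 <= g eta.
Proof. by case=> _ h _; apply: le_trans (h eta); rewrite mulr_ge0 ?powR_ge0// ltW. Qed.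

(** An upper bound for the integrand on the ball of radius [r] in the sup norm, [m r] being a crude
    bound for the Euclidean norm there. At [r + 1] it is also a Lipschitz constant on the ball of
    radius [r]. *)
Definition growth_bound (r : R) := c1 * ((m%:R * r) `^ p + 1).

Lemma growth_boundP g r eta : convex_growth g -> `|eta| <= r -> g eta <= growth_bound r.
Proof.
move=> [_ _ h] er; rewrite (le_trans (h eta))// ler_wpM2l ?(ltW c10)// lerD2r.
have r0 : 0 <= r by exact: le_trans er.
apply: ge0_ler_powR; rewrite ?nnegrE ?(ltW p0) ?sqrtr_ge0 ?mulr_ge0//.
by rewrite (le_trans (enorm_le eta))// ler_wpM2l.
Qed.

(* [y] lies between [x] and the point at unit distance beyond [y]. *)
Lemma growth_lipschitz g r x y : convex_growth g -> `|x| <= r -> `|y| <= r ->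
  `|g x - g y| <= growth_bound (r + 1) * `|x - y|.
Proof.
move=> gg; wlog xy : x y / g x <= g y.
  move=> H xr yr; have [/H|/ltW /H] := leP (g x) (g y); first exact.
  by rewrite distrC (distrC x); exact.
move=> xr yr; rewrite distrC ger0_norm ?subr_ge0// distrC.
have [->|nxy] := eqVneq y x; first by rewrite !subrr normr0 mulr0.
pose d := `|y - x|; have d0 : 0 < d by rewrite normr_gt0 subr_eq0.
pose z := y + d^-1 *: (y - x).
have zr : `|z| <= r + 1.
  rewrite (le_trans (ler_normD _ _))// lerD// normrZ gtr0_norm ?invr_gt0//.
  by rewrite mulVf// gt_eqF.
pose t := d / (1 + d); have d1 : 0 < 1 + d by rewrite addr_gt0.
have t01 : 0 <= t <= 1.
  apply/andP; split; first by rewrite divr_ge0 ?(ltW d0) ?(ltW d1).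
  by rewrite ler_pdivrMr// mul1r lerDr.
have E : t *: z + (1 - t) *: x = y.
  apply/rowP => j; rewrite !mxE /t; field.
  by rewrite !gt_eqF.
have [cv _ _] := gg; have := cv t z x t01; rewrite E => h.
have gz := growth_boundP gg zr; have gx := convex_growth_ge0 x gg.
have B0 : 0 <= growth_bound (r + 1) by exact: le_trans (convex_growth_ge0 z gg) gz.
have td : t <= d by rewrite ler_pdivrMr// ler_peMr ?(ltW d0)// lerDl ltW.
have /andP[t0 _] := t01.
rewrite mulrC -/d.
apply: (@le_trans _ _ (t * growth_bound (r + 1))); first by nra.
by rewrite ler_wpM2r.
Qed.

Lemma growth_continuous g : convex_growth g -> continuous g.
Proof.
move=> gg x; apply/(@cvgrPdist_le _ _ _ (nbhs x) (nbhs_filter x)) => e e0.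
pose B := growth_bound (`|x| + 1 + 1).
have B0 : 0 <= B.
  apply: le_trans (convex_growth_ge0 x gg) (growth_boundP gg _).
  by rewrite -addrA lerDl addr_ge0.
have d0 : 0 < Num.min 1 (e / (B + 1)) by rewrite lt_min ltr01 divr_gt0// ltr_wpDl.
have := @nbhsx_ballx _ _ x _ d0; apply: filterS => y xy.
have {}xy : `|x - y| < Num.min 1 (e / (B + 1)) by have := xy; rewrite -ball_normE.
move: xy; rewrite lt_min => /andP[xy1 xy2].
have yr : `|y| <= `|x| + 1.
  rewrite (_ : y = x - (x - y)); last by rewrite opprB addrC subrK.
  by rewrite (le_trans (ler_normB _ _))// lerD2l ltW.
rewrite (le_trans (growth_lipschitz (r := `|x| + 1) gg _ yr)) ?lerDl//.
apply: (@le_trans _ _ (B * (e / (B + 1)))); first by rewrite ler_wpM2l// ltW.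
by rewrite mulrCA ler_piMr ?(ltW e0)// ler_pdivrMr ?ltr_wpDl// mul1r lerDl.
Qed.

Lemma rat_approx x (e : R) : 0 < e -> exists q : 'rV[rat]_m, `|x - map_mx ratr q| <= e.
Proof.
move=> e0; have /choice[q qP] j : exists q : rat, `|x ord0 j - ratr q| <= e.
  have /rat_in_itvoo[q] : x ord0 j - e < x ord0 j + e by rewrite ltrBlDr -addrA ltrDl addr_gt0.
  rewrite in_itv/= => /andP[h1 h2]; exists q; rewrite ler_norml.
  by apply/andP; split; lra.
exists (\row_j q j); apply: rV_norm_le => [|j]; first exact: ltW.
by rewrite !mxE.
Qed.

Lemma convex_subsequence (g_ : nat -> 'rV[R]_m -> R) : (forall k, convex_growth (g_ k)) ->
  exists s g, [/\ increasing_nat s, convex_growth g &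
    forall eta, g_ (s k) eta @[k --> \oo] --> g eta].
Proof.
move=> gg; pose q i : 'rV[R]_m := if unpickle i is Some v then map_mx ratr (v : 'rV[rat]_m) else 0.
have [s [incr sc]] : exists s, increasing_nat s /\ forall i, cvgn (fun k => g_ (s k) (q i)).
  have [|s incr sc] := @bounded_diagonal R (fun i k => g_ k (q i)) (fun i => growth_bound `|q i|).
    by move=> i k; rewrite ger0_norm ?convex_growth_ge0// growth_boundP.
  by exists s; split.
have gc eta : cvgn (fun k => g_ (s k) eta).
  apply: cauchy_cvg; apply/cauchy_ballP => e e0.
  pose B := growth_bound (`|eta| + 1 + 1).
  have B0 : 0 <= B.
    apply: le_trans (convex_growth_ge0 eta (gg 0%N)) (growth_boundP (gg 0%N) _).
    by rewrite -addrA lerDl addr_ge0.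
  have d0 : 0 < Num.min 1 (e / 4 / (B + 1)) by rewrite lt_min ltr01 !divr_gt0// ltr_wpDl.
  have [v vP] := rat_approx eta d0.
  pose i := pickle v; have qi : q i = map_mx ratr v by rewrite /q /i pickleK.
  have := vP; rewrite -qi le_min => /andP[v1 v2].
  have qr : `|q i| <= `|eta| + 1.
    rewrite (_ : q i = eta - (eta - q i)); last by rewrite opprB addrC subrK.
    by rewrite (le_trans (ler_normB _ _))// lerD2l.
  have close k : `|g_ (s k) eta - g_ (s k) (q i)| <= e / 4.
    rewrite (le_trans (growth_lipschitz (r := `|eta| + 1) (gg _) _ qr)) ?lerDl// -/B.
    apply: (@le_trans _ _ (B * (e / 4 / (B + 1)))); first by rewrite ler_wpM2l.
    rewrite mulrCA ler_piMr ?divr_ge0 ?(ltW e0)// ler_pdivrMr ?ltr_wpDl// mul1r lerDl//.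
  have e4 : 0 < e / 4 by rewrite divr_gt0.
  have /cvgrPdist_lt/(_ _ e4)[N _ HN] := sc i.
  exists (fun x : R => exists2 k, (N <= k)%N & x = g_ (s k) eta, fun x : R => exists2 k, (N <= k)%N & x = g_ (s k) eta).
    by split; exists N => // k Nk; exists k.
  move=> [_ _] [/= [k Nk ->] [l Nl ->]]; rewrite /ball/=.
  have := HN k Nk; have := HN l Nl; have := close k; have := close l.
  move: (g_ (s k) eta) (g_ (s l) eta) (g_ (s k) (q i)) (g_ (s l) (q i)) (lim _) => a b c d f.
  rewrite !ler_norml !ltr_norml => /andP[? ?] /andP[? ?] /andP[? ?] /andP[? ?].
  by apply/andP; split; lra.
exists s, (fun eta => limn (fun k => g_ (s k) eta)); split => //; split.
- move=> t x y t01; have l1 := gc (t *: x + (1 - t) *: y).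
  have l2 : t * g_ (s k) x + (1 - t) * g_ (s k) y @[k --> \oo] -->
      t * limn (fun k => g_ (s k) x) + (1 - t) * limn (fun k => g_ (s k) y).
    by apply: cvgD; apply: cvgM; first [exact: cvg_cst|exact: gc].
  rewrite -subr_ge0; apply: (@cvgr_to_ge _ _ _ _ _ _ _ (cvgB l2 l1)); apply: nearW => k.
  by rewrite subr_ge0; have [+ _ _] := gg (s k); exact.
- by move=> eta; apply: limr_ge; [exact: gc|apply: nearW => k; have [_ h _] := gg (s k)].
- by move=> eta; apply: limr_le; [exact: gc|apply: nearW => k; have [_ _ h] := gg (s k)].
Qed.

Definition aff (a : R) (v : 'I_m -> R) eta := a + dot v (eta ord0).

(* The proximal point [z] of [q]: [l (q - z)] is a subgradient of [g] at [z]. *)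
Lemma proximal_subgradient g q (l : R) : convex_growth g -> 0 < l -> exists z,
  l * dot ((q - z) ord0) ((q - z) ord0) <= 2 * g q /\
  forall eta, g z + l * dot ((q - z) ord0) ((eta - z) ord0) <= g eta.
Proof.
move=> gg l0; have gc := growth_continuous gg.
(* The factor 2 balances the one from differentiating the squared distance, so that [l (q - z)]
   itself is the subgradient. *)
pose F z := 2 * g z + l * dot ((q - z) ord0) ((q - z) ord0).
have Fc : continuous F.
  have dc : continuous (fun z => dot ((q - z) ord0) ((q - z) ord0)).
    apply: continuous_dot_rV => j.
      have -> : (fun x : 'rV[R]_m => (q - x) ord0 j) = (fun x => q ord0 j + (-1) * x ord0 j).
        by apply/funext => x; rewrite !mxE mulN1r.
      apply: continuousD_rV; first by move=> ?; exact: cst_continuous.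
      apply: continuousM_rV; last exact: coord_continuous.
      by move=> ?; exact: cst_continuous.
    have -> : (fun x : 'rV[R]_m => (q - x) ord0 j) = (fun x => q ord0 j + (-1) * x ord0 j).
      by apply/funext => x; rewrite !mxE mulN1r.
    apply: continuousD_rV; first by move=> ?; exact: cst_continuous.
    apply: continuousM_rV; last exact: coord_continuous.
    by move=> ?; exact: cst_continuous.
  by move=> x; exact: (cvgD (cvgM (cvg_cst (2 : R)) (gc x)) (cvgM (cvg_cst l) (dc x))).
(* Outside the cube of this half-side the penalty alone exceeds [2 g q = F q], because rad >= 1 and
   l rad > 2 g q; a minimum over the compact cube is therefore global. *)
pose rad := 2 * g q / l + 1.
have gq0 := convex_growth_ge0 q gg.
have rad0 : 0 <= rad by rewrite addr_ge0// divr_ge0 ?(ltW l0)// mulr_ge0.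
have cK : compact [set z : 'rV[R]_m | forall j, q ord0 j - rad <= z ord0 j <= q ord0 j + rad].
  have -> : [set z : 'rV[R]_m | forall j, q ord0 j - rad <= z ord0 j <= q ord0 j + rad] =
      cbox (\row_j (q ord0 j - rad)) (\row_j (q ord0 j + rad)).
    by apply/seteqP; split => z /= H j; have := H j; rewrite !mxE.
  exact: compact_cbox.
have qK : [set z : 'rV[R]_m | forall j, q ord0 j - rad <= z ord0 j <= q ord0 j + rad] q.
  by move=> j; rewrite lerBlDr !lerDl rad0.
have [z /set_mem zK zmin] := EVT_min_rV (ex_intro _ q qK) cK (continuous_subspaceT Fc).
have Fq : F q = 2 * g q.
  rewrite /F subrr (_ : dot _ _ = 0) ?mulr0 ?addr0//.
  by rewrite /dot big1// => j _; rewrite mxE mul0r.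
have zq : F z <= 2 * g q by rewrite -Fq; apply: zmin; rewrite inE.
have glob eta : F z <= F eta.
  have [inK|nK] := pselect ([set z : 'rV[R]_m | forall j, q ord0 j - rad <= z ord0 j <= q ord0 j + rad] eta).
    by apply: zmin; rewrite inE.
  apply: (le_trans zq); rewrite /F -[leLHS]add0r lerD ?mulr_ge0 ?convex_growth_ge0//.
  have [j jP] : exists j, ~ (q ord0 j - rad <= eta ord0 j <= q ord0 j + rad).
    by apply: contrapT => h; apply: nK => j; apply: contrapT => h'; apply: h; exists j.
  have dj : rad < `|q ord0 j - eta ord0 j|.
    rewrite ltNge; apply/negP; rewrite ler_norml => /andP[h1 h2]; apply: jP.
    by apply/andP; split; lra.
  have : rad ^+ 2 <= dot ((q - eta) ord0) ((q - eta) ord0).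
    rewrite /dot (bigD1 j)//= !mxE -expr2 -[X in _ <= X + _]real_normK ?num_real//.
    rewrite ler_wpDr ?sumr_ge0// => [i _|]; first by rewrite -expr2 sqr_ge0.
    by apply: lerXn2r; rewrite ?nnegrE// ltW.
  move=> h; apply: (@le_trans _ _ (l * rad)).
    by rewrite /rad mulrDr mulrCA divff ?gt_eqF// mulr1 mulr1 lerDl ltW.
  rewrite ler_wpM2l ?(ltW l0)// (le_trans _ h)// expr2 ler_peMr// /rad lerDr.
  by rewrite divr_ge0 ?(ltW l0)// mulr_ge0.
exists z; split.
  by apply: le_trans zq; rewrite /F lerDr mulr_ge0 ?convex_growth_ge0.
move=> eta; set D := dot ((q - z) ord0) ((eta - z) ord0); set E := dot ((eta - z) ord0) ((eta - z) ord0).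
(* Compare [z] with the point at fraction [t] of the way to [eta], use convexity and divide by [t];
   the remainder [t l E] disappears as [t] tends to 0. *)
have key (t : R) : 0 < t <= 1 -> 2 * (g z + l * D) <= 2 * g eta + t * (l * E).
  move=> /andP[t0 t1]; have t01 : 0 <= t <= 1 by rewrite ltW.
  have := glob (t *: eta + (1 - t) *: z); have [cv _ _] := gg.
  have := cv t eta z t01; rewrite /F.
  have -> : (q - (t *: eta + (1 - t) *: z)) ord0 = 1 *: ((q - z) ord0) + (- t) *: ((eta - z) ord0) :> ('I_m -> R).
    apply/funext => j; rewrite !mxE.
    rewrite -[RHS]/(1 * (q - z) ord0 j + - t * (eta - z) ord0 j) !mxE; ring.
  set P := (q - z) ord0; set Q := (eta - z) ord0.
  have -> : dot (1 *: P + - t *: Q) (1 *: P + - t *: Q) = dot P P - 2 * t * D + t ^+ 2 * E.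
    rewrite dot_lin dotZ !(dotC _ (1 *: P + _)) !dot_lin !dotZ (dotC Q P) -/D -/E; ring.
  move: (g _) (g z) (g eta) (dot P P) => a b c d h1 h2.
  rewrite -(ler_pM2l t0); nra.
rewrite -(ler_pM2l (ltr0Sn R 1)) -[leRHS]addr0.
have E0 : 0 <= l * E by rewrite mulr_ge0 ?dot_ge0// ltW.
apply/ler_addgt0Pr => e e0; rewrite addr0.
have tt : 0 < Num.min 1 (e / (l * E + 1)) <= 1.
  by rewrite lt_min ltr01 ge_min lexx/= andbT divr_gt0// ltr_wpDl.
apply: (le_trans (key _ tt)); rewrite lerD2l.
apply: (@le_trans _ _ (e / (l * E + 1) * (l * E))).
  by rewrite ler_wpM2r// ge_min lexx orbT.
by rewrite mulrAC -mulrA ler_piMr ?(ltW e0)// ler_pdivrMr ?ltr_wpDl// mul1r lerDl.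
Qed.

End convex_sequences.

(** * Affine minorants of convex functions with p-growth *)

Section affine_minorants.
Context {R : realType} {m : nat}.
Variables (c0 c1 p : R).
Hypotheses (c00 : 0 < c0) (c10 : 0 < c1) (p1 : 1 < p).
Implicit Types (g : 'rV[R]_m -> R) (x y z eta : 'rV[R]_m).
Local Notation cgrowth := (convex_growth c0 c1 p).
Local Notation gbound := (growth_bound (m := m) c1 p).

Lemma le_dot_sum (v w : 'I_m -> R) (k : R) : (forall j, `|w j| <= k) -> `|dot v w| <= k * \sum_j `|v j|.
Proof.
move=> wk; rewrite (le_trans (ler_norm_sum _ _ _))// mulr_sumr; apply: ler_sum => j _.
by rewrite normrM mulrC ler_wpM2r.
Qed.

(** The minorants support [g] at the proximal points of rational [q] with integer parameters. For
    [q] near [eta] and a large parameter the proximal point is near [q] and the slope stays bounded,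
    so the supporting function is nearly exact at [eta]. *)
Lemma affine_minorants g : cgrowth g -> exists (a : nat -> R) (v : nat -> 'I_m -> R),
  (forall i eta, aff (a i) (v i) eta <= g eta) /\
  forall eta e, 0 < e -> exists i, g eta - e <= aff (a i) (v i) eta.
Proof.
move=> gg; pose qR (q : 'rV[rat]_m) : 'rV[R]_m := map_mx ratr q.
have l0 (l : nat) : 0 < l.+1%:R :> R by rewrite ltr0n.
have /choice[z zP] : forall ql : 'rV[rat]_m * nat, exists z,
  ql.2.+1%:R * dot ((qR ql.1 - z) ord0) ((qR ql.1 - z) ord0) <= 2 * g (qR ql.1) /\
  forall eta, g z + ql.2.+1%:R * dot ((qR ql.1 - z) ord0) ((eta - z) ord0) <= g eta.
  by move=> ql; exact: (proximal_subgradient c00 c10 p1 (qR ql.1) gg (l0 ql.2)).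
pose vv ql : 'I_m -> R := ql.2.+1%:R *: ((qR ql.1 - z ql) ord0).
pose aa ql := g (z ql) - dot (vv ql) (z ql ord0).
have affE ql eta : aff (aa ql) (vv ql) eta = g (z ql) + dot (vv ql) ((eta - z ql) ord0).
  rewrite /aff /aa -addrA; congr (_ + _); rewrite addrC /dot -sumrB; apply: eq_bigr => j _.
  by rewrite !mxE mulrBr.
have affle ql eta : aff (aa ql) (vv ql) eta <= g eta.
  by rewrite affE /vv dotZ; have [_] := zP ql; exact.
(* Indices that code no pair give the zero function, a minorant since [g] is nonnegative. *)
pose a i := if unpickle i is Some ql then aa ql else 0.
pose v i := if unpickle i is Some ql then vv ql else 0.
exists a, v; split.
  move=> i eta; rewrite /a /v; case: (unpickle i) => [ql|]; first exact: affle.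
  rewrite /aff add0r (_ : dot _ _ = 0); first exact: (convex_growth_ge0 c00 eta gg).
  by rewrite /dot big1// => j _; rewrite mul0r.
move=> eta e e0; pose M := gbound (`|eta| + 2 + 1).
have M0 : 0 <= M.
  apply: le_trans (convex_growth_ge0 c00 eta gg) (growth_boundP c10 p1 gg _).
  by rewrite -addrA lerDl addr_ge0.
(* Three errors of size [M rho] add up: two from [g] between [eta] and the proximal point, one from
   the slope between [eta] and [q]. *)
pose rho := Num.min 1 (e / (4 * (M + 1))).
have M1 : 0 < 4 * (M + 1) by rewrite mulr_gt0// ltr_wpDl.
have rho0 : 0 < rho by rewrite lt_min ltr01 divr_gt0.
have rho1 : rho <= 1 by rewrite ge_min lexx.
have rhoM : 3 * (M * rho) <= e.
  have : rho <= e / (4 * (M + 1)) by rewrite ge_min lexx orbT.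
  by rewrite ler_pdivlMr//; nra.
have [q qP] := rat_approx eta rho0.
have gq0 := convex_growth_ge0 c00 (qR q) gg.
have [l lP] : exists l : nat, 2 * g (qR q) <= l.+1%:R * rho ^+ 2.
  exists (Num.truncn (2 * g (qR q) / rho ^+ 2)).
  by rewrite -ler_pdivrMr ?exprn_gt0// ltW// truncnS_gt.
exists (pickle (q, l)); rewrite /a /v pickleK affE.
have [z1 z2] := zP (q, l); rewrite /= in z1 z2; set Z := z (q, l) in z1 z2 *.
have qz : `|qR q - Z| <= rho.
  apply: rV_norm_le => [|j]; first exact: ltW.
  have : (qR q - Z) ord0 j ^+ 2 <= rho ^+ 2.
    have h1 : (qR q - Z) ord0 j ^+ 2 <= dot ((qR q - Z) ord0) ((qR q - Z) ord0).
      rewrite /dot (bigD1 j)//= -expr2 lerDl; apply: sumr_ge0 => i _.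
      by rewrite -expr2 sqr_ge0.
    apply: (le_trans h1); rewrite -(ler_pM2l (l0 l)).
    exact: le_trans z1 lP.
  by rewrite -real_normK ?num_real// ler_pXn2r// nnegrE ltW.
have Zr : `|Z - eta| <= rho + rho.
  rewrite (_ : Z - eta = - (qR q - Z) - (eta - qR q)); last by apply/rowP => j; rewrite !mxE; ring.
  by rewrite (le_trans (ler_normB _ _))// normrN lerD.
have Zb : `|Z| <= `|eta| + 2.
  rewrite (_ : Z = eta + (Z - eta)); last by rewrite addrC subrK.
  by rewrite (le_trans (ler_normD _ _))// lerD2l; lra.
(* At [Z] plus the sign vector of the slope, the minorant equals [g Z >= 0] plus the sum of absolute
   values of the slope, and that point stays in the ball where [g] is at most [M]. *)
have slope : \sum_j `|vv (q, l) j| <= M.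
  pose eta' := Z + \row_j Num.sg (vv (q, l) j).
  have nr : `|eta'| <= `|eta| + 2 + 1.
    rewrite (le_trans (ler_normD _ _))// lerD//; apply: rV_norm_le => // j.
    by rewrite mxE; case: sgrP; rewrite ?normr0 ?normr1 ?normrN1.
  have := affle (q, l) eta'; rewrite affE -/Z.
  have -> : dot (vv (q, l)) ((eta' - Z) ord0) = \sum_j `|vv (q, l) j|.
    apply: eq_bigr => j _; rewrite !mxE [_ + Num.sg _]addrC addrK.
    by rewrite mulrC -normrEsg.
  have := growth_boundP c10 p1 gg nr; rewrite -/M.
  have := convex_growth_ge0 c00 Z gg; lra.
have gZ : g eta - g Z <= M * (rho + rho).
  rewrite (le_trans (ler_norm _))//.
  have er : `|eta| <= `|eta| + 2 by rewrite lerDl.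
  rewrite (le_trans (growth_lipschitz c00 c10 p1 gg er Zb))// -/M ler_wpM2l//.
  by rewrite distrC.
have d1 : dot (vv (q, l)) ((eta - Z) ord0) =
    dot (vv (q, l)) ((qR q - Z) ord0) + dot (vv (q, l)) ((eta - qR q) ord0).
  by rewrite /dot -big_split; apply: eq_bigr => j _; rewrite /= !mxE; ring.
have d2 : 0 <= dot (vv (q, l)) ((qR q - Z) ord0).
  by rewrite /vv dotZ mulr_ge0 ?dot_ge0.
have d3 : `|dot (vv (q, l)) ((eta - qR q) ord0)| <= rho * M.
  apply: le_trans (le_dot_sum (k := rho) _ _) _ => [j|].
    exact: le_trans (coord_le_norm _ _) qP.
  by rewrite ler_wpM2l// ltW.
by move: d3; rewrite ler_norml d1 => /andP[d3 _]; nra.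
Qed.

(** Otherwise violating points exist along a subsequence. Since c0 |eta|^p with p > 1 outgrows
    affine functions, these points stay bounded; at a limit point [eta], pointwise convergence and
    the common Lipschitz constant yield [g eta <= aff a v eta - e], against the minorant
    property. *)
Lemma minorant_eventually (g_ : nat -> 'rV[R]_m -> R) g (a : R) v (e : R) :
  (forall k, cgrowth (g_ k)) -> (forall eta, g_ k eta @[k --> \oo] --> g eta) ->
  (forall eta, aff a v eta <= g eta) -> 0 < e ->
  \forall k \near \oo, forall eta, aff a v eta - e <= g_ k eta.
Proof.
move=> gg gc ag e0; apply: contrapT => nev.
have [|r incr H] := @frequently_subsequence (fun k => exists eta, g_ k eta < aff a v eta - e).
  move=> H; apply: nev; apply: filterS H => k nk eta; rewrite leNgt; apply/negP => h.
  by apply: nk; exists eta.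
have /choice[y yP] := H; pose S := \sum_j `|v j|.
have S0 : 0 <= S by apply: sumr_ge0.
(* For t beyond this radius c0 t^(p-1) >= |a| + S, hence c0 t^p >= t (|a| + S), which dominates the
   affine function at points of Euclidean norm t >= 1. *)
pose T := Num.max 1 (((`|a| + S) / c0) `^ (p - 1)^-1).
have p1' : 0 < p - 1 by rewrite subr_gt0.
have p0 : 0 < p by exact: lt_trans p1.
have T1 : 1 <= T by rewrite le_max lexx.
have yT h : enorm (y h) <= T.
  rewrite leNgt; apply/negP => Ty; set t := enorm (y h) in Ty.
  have t1 : 1 <= t by rewrite ltW// (le_lt_trans T1).
  have t0 : 0 <= t by exact: le_trans t1.
  have aS0 : 0 <= (`|a| + S) / c0 by rewrite divr_ge0 ?addr_ge0 ?(ltW c00).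
  have pw : (`|a| + S) / c0 <= t `^ (p - 1).
    have -> : (`|a| + S) / c0 = (((`|a| + S) / c0) `^ (p - 1)^-1) `^ (p - 1).
      by rewrite -powRrM mulVf ?gt_eqF// powRr1.
    apply: ge0_ler_powR; rewrite ?nnegrE ?(ltW p1') ?powR_ge0//.
    by rewrite ltW// (le_lt_trans _ Ty)// le_max lexx orbT.
  have [_ lo _] := gg (r h); have := lo (y h); rewrite -/t -(mulr_powRB1 t0 p0).
  have := yP h; rewrite /aff.
  have dS : dot v (y h ord0) <= t * S.
    by rewrite (le_trans (ler_norm _))// le_dot_sum// => j; exact: norm_le_enorm.
  move: pw; rewrite ler_pdivrMr// => pw h1 h2.
  have h3 : t * (`|a| + S) <= t * (t `^ (p - 1) * c0) by rewrite ler_wpM2l.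
  have := ler_norm a; have : `|a| <= t * `|a| by rewrite ler_peMl.
  move: h3 h2 h1; rewrite mulrDr [t * (_ * c0)]mulrA [_ * c0]mulrC; lra.
(* Coordinates are indexed by all natural numbers, with value 0 from [m] on, to fit the diagonal
   extraction. *)
pose u j h := if insub j is Some j' then y h ord0 (j' : 'I_m) else 0.
have [|s incr' sc] := @bounded_diagonal R u (fun=> T).
  move=> j h; rewrite /u; case: insub => [j'|]; last by rewrite normr0 (le_trans _ T1).
  exact: le_trans (norm_le_enorm _ _) (yT h).
pose eta := \row_j limn (u j \o s) : 'rV[R]_m.
have yc j : y (s h) ord0 j @[h --> \oo] --> eta ord0 j.
  have := sc j; rewrite /eta mxE; have -> // : (u j \o s) = (fun h => y (s h) ord0 j).
  by apply/funext => h; rewrite /u /= insubT// => ij; congr (y _ _ _); apply/val_inj.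
have affc : aff a v (y (s h)) @[h --> \oo] --> aff a v eta.
  apply: cvgD; first exact: cvg_cst.
  by apply: cvg_sumr => j; apply: cvgM; [exact: cvg_cst|exact: yc].
have dc : \sum_j `|y (s h) ord0 j - eta ord0 j| @[h --> \oo] --> (0 : R).
  have yc0 j : `|y (s h) ord0 j - eta ord0 j| @[h --> \oo] --> (0 : R).
    apply/norm_cvg0P; rewrite -(subrr (eta ord0 j)).
    by apply: cvgB; [exact: yc|exact: cvg_cst].
  have H0 : (fun h => \sum_j `|y (s h) ord0 j - eta ord0 j|) @ \oo --> \sum_(j < m) (0 : R).
    by apply: cvg_sumr => j; exact: yc0.
  by move: H0; rewrite big1.
pose rr := T + `|eta|; pose B := gbound (rr + 1).
have close h : g_ (r (s h)) eta - B * \sum_j `|y (s h) ord0 j - eta ord0 j| <= aff a v (y (s h)) - e.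
  apply: le_trans (ltW (yP (s h))); rewrite lerBlDr addrC -lerBlDr.
  rewrite (le_trans (ler_norm _))//.
  have yr : `|y (s h)| <= rr by rewrite (le_trans (norm_le_enorm' _))// (le_trans (yT _))// lerDl.
  have er : `|eta| <= rr by rewrite lerDr (le_trans _ T1).
  rewrite (le_trans (growth_lipschitz c00 c10 p1 (gg _) er yr))// -/B ler_wpM2l//.
    apply: le_trans (convex_growth_ge0 c00 eta (gg 0%N)) (growth_boundP c10 p1 (gg 0%N) _).
    by rewrite (le_trans er)// lerDl.
  apply: rV_norm_le => [|j]; first by apply: sumr_ge0.
  by rewrite (bigD1 j)//= !mxE distrC lerDl; apply: sumr_ge0.
have gcs : g_ (r (s h)) eta @[h --> \oo] --> g eta.
  exact: (cvg_comp _ _ (increasing_nat_cvg (increasing_nat_comp incr incr')) (gc eta)).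
have l1 : aff a v (y (s h)) - e - (g_ (r (s h)) eta - B * \sum_j `|y (s h) ord0 j - eta ord0 j|)
    @[h --> \oo] --> aff a v eta - e - (g eta - B * 0).
  apply: cvgB; first by apply: cvgB => //; exact: cvg_cst.
  by apply: cvgB => //; apply: cvgM => //; exact: cvg_cst.
have : 0 <= aff a v eta - e - (g eta - B * 0).
  apply: (@cvgr_to_ge _ _ _ _ _ _ _ l1); apply: nearW => h.
  by rewrite subr_ge0.
have := ag eta; rewrite mulr0; lra.
Qed.

End affine_minorants.

(** * Autonomous integrands *)

Section autonomous.
Context {R : realType} {n m : nat}.
Local Notation mu := (lebesgue_rV R n).
Local Notation intg f := (mu.-integrable setT (EFin \o f)).
Variables (Omega : set 'rV[R]_n) (X : 'I_m -> 'rV[R]_n -> 'rV[R]_n) (c0 c1 p : R).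
Hypotheses (oO : open Omega) (bO : bounded_set Omega) (vX : forall j, vfield Omega (X j))
  (c00 : 0 < c0) (c01 : c0 <= c1) (p1 : 1 < p).
Implicit Types (g : 'rV[R]_m -> R) (A : set 'rV[R]_n) (f : 'rV[R]_n -> 'rV[R]_m -> \bar R)
  (V : 'I_m -> 'rV[R]_n -> R).
Local Notation cgrowth := (convex_growth c0 c1 p).

Let c10 : 0 < c1. Proof. exact: lt_le_trans c01. Qed.
Let p0 : 0 < p. Proof. exact: lt_trans p1. Qed.
Let p1' : 1 <= p. Proof. exact: ltW. Qed.

Definition vrow V x : 'rV[R]_m := \row_j V j x.

Lemma measurable_vrow V : (forall j, measurable_fun setT (V j)) -> measurable_fun setT (vrow V).
Proof. by move=> mV; apply: measurable_fun_rV => j; under eq_fun do rewrite mxE; exact: mV. Qed.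

Lemma measurable_growth g V : cgrowth g -> (forall j, measurable_fun setT (V j)) ->
  measurable_fun setT (fun x => g (vrow V x)).
Proof.
move=> gg mV; apply: (measurableT_comp (f := g)); last exact: measurable_vrow.
exact: continuous_measurable_rV (growth_continuous c00 c10 p1 gg).
Qed.

Definition energy A g V x := g (vrow V x) * \1_A x.

Lemma measurable_energy A g V : measurable A -> cgrowth g -> (forall j, measurable_fun setT (V j)) ->
  measurable_fun setT (energy A g V).
Proof.
move=> mA gg mV; apply: measurable_funM; last exact: measurable_indic.
exact: measurable_growth.
Qed.

Lemma energy_ge0 A g V x : cgrowth g -> 0 <= energy A g V x.
Proof. by move=> gg; rewrite mulr_ge0// ?indicE// (convex_growth_ge0 c00 _ gg). Qed.

Lemma energy_powR A g V j x : cgrowth g -> (forall x, ~ A x -> V j x = 0) ->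
  `|V j x| `^ p <= c0^-1 * energy A g V x.
Proof.
move=> gg V0; have [Ax|Ax] := pselect (A x); last first.
  by rewrite V0// normr0 powR0 ?gt_eqF// mulr_ge0 ?invr_ge0 ?(ltW c00)// energy_ge0.
rewrite /energy indicE mem_set// mulr1 mulrC ler_pdivlMr// mulrC.
have [_ lo _] := gg; apply: le_trans (lo _); rewrite ler_wpM2l ?(ltW c00)//.
apply: ge0_ler_powR; rewrite ?nnegrE ?(ltW p0) ?sqrtr_ge0//.
by have := norm_le_enorm (vrow V x) j; rewrite mxE.
Qed.

Lemma dot_vrow (v : 'I_m -> R) V x : dot v (vrow V x ord0) = \sum_j v j * V j x.
Proof. by apply: eq_bigr => j _; rewrite mxE. Qed.

Section selection.
Variables (a : nat -> R) (v : nat -> 'I_m -> R) (V : 'I_m -> 'rV[R]_n -> R).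
Hypothesis mV : forall j, measurable_fun setT (V j).

(* A measurable choice of a maximal one among the zero function and the first
   [N] affine functions, at the point [vrow V x]. *)
Fixpoint select (N : nat) (x : 'rV[R]_n) : R * ('I_m -> R) :=
  if N is N'.+1 then
    let s := select N' x in
    if aff s.1 s.2 (vrow V x) < aff (a N') (v N') (vrow V x) then (a N', v N') else s
  else (0, fun=> 0).

Definition selval N x := aff (select N x).1 (select N x).2 (vrow V x).

Lemma selval_ge0 N x : 0 <= selval N x.
Proof.
elim: N => [|N IH]; first by rewrite /selval /aff/= add0r /dot big1// => j _; rewrite mul0r.
by rewrite /selval /=; case: ifP => [/ltW/(le_trans IH)|].
Qed.

Lemma selval_ge i N x : (i < N)%N -> aff (a i) (v i) (vrow V x) <= selval N x.
Proof.
elim: N => // N IH; rewrite ltnS leq_eqVlt => /predU1P[->|/IH iN]; rewrite /selval /=.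
  by case: ifP => // /negbT; rewrite -leNgt.
by case: ifP => // /ltW; exact: le_trans.
Qed.

Lemma select_bounded N : exists K : R, forall x, `|(select N x).1| <= K /\ forall j, `|(select N x).2 j| <= K.
Proof.
elim: N => [|N [K IH]]; first by exists 0 => x /=; rewrite normr0; split => // j; rewrite normr0.
exists (Num.max K (`|a N| + \sum_j `|v N j|)) => x /=.
have S0 : 0 <= \sum_j `|v N j| by apply: sumr_ge0.
case: ifP => _ /=; split => [|j].
- by rewrite le_max lerDl S0 orbT.
- by rewrite le_max (bigD1 j)//= addrCA lerDl addr_ge0 ?orbT// sumr_ge0.
- by rewrite le_max (IH x).1.
- by rewrite le_max (IH x).2.
Qed.

Lemma measurable_select N : measurable_fun setT (fun x => (select N x).1) /\
  forall j, measurable_fun setT (fun x => (select N x).2 j).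
Proof.
elim: N => [|N [IH1 IH2]]; first by split => [|j]; exact: measurable_cst.
have msel (al : 'rV[R]_n -> R) (be : 'rV[R]_n -> 'I_m -> R) : measurable_fun setT al ->
    (forall j, measurable_fun setT (be^~ j)) -> measurable_fun setT (fun x => aff (al x) (be x) (vrow V x)).
  move=> ma mb; apply: measurable_funD => //.
  under eq_fun do rewrite dot_vrow; apply: measurable_sum_rV => j.
  by apply: measurable_funM; [exact: mb|exact: mV].
pose D := [set x | selval N x < aff (a N) (v N) (vrow V x)].
have mD : measurable D.
  have md : measurable_fun setT (fun x => aff (a N) (v N) (vrow V x) - selval N x).
    by apply: measurable_funB; apply: msel.
  rewrite (_ : D = (fun x => aff (a N) (v N) (vrow V x) - selval N x) @^-1` `]0, +oo[%classic).
    by rewrite -[X in measurable X]setTI; exact: md.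
  by apply/seteqP; split => x /=; rewrite in_itv/= andbT subr_gt0.
have mi (h : 'rV[R]_n -> R) (c : R) : measurable_fun setT h -> measurable_fun setT (fun x => h x + (c - h x) * \1_D x).
  move=> mh; apply: measurable_funD => //; apply: measurable_funM; last exact: measurable_indic.
  exact: measurable_funB.
have Dind x : (\1_D x : R) = (aff (select N x).1 (select N x).2 (vrow V x) < aff (a N) (v N) (vrow V x))%R%:R.
  rewrite indicE; congr (_%:R); apply: congr1; apply/idP/idP; first by rewrite inE.
  by move=> h; rewrite inE.
split => [|j].
  rewrite (_ : (fun x => _) = (fun x => (select N x).1 + (a N - (select N x).1) * \1_D x)); first exact: mi.
  by apply/funext => x; rewrite Dind /=; case: ifP => _; rewrite ?mulr1 ?mulr0 ?addr0// addrC subrK.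
rewrite (_ : (fun x => _) = (fun x => (select N x).2 j + (v N j - (select N x).2 j) * \1_D x)); first exact: mi.
by apply/funext => x; rewrite Dind /=; case: ifP => _; rewrite ?mulr1 ?mulr0 ?addr0// addrC subrK.
Qed.

Lemma select_minorant (P : R -> ('I_m -> R) -> nat -> Prop) N :
  (\forall k \near \oo, P 0 (fun=> 0) k) -> (forall i, \forall k \near \oo, P (a i) (v i) k) ->
  \forall k \near \oo, forall x, P (select N x).1 (select N x).2 k.
Proof.
move=> h0 hi; elim: N => [|N IH] /=; first by apply: filterS h0.
by apply: filterS2 IH (hi N) => k h1 h2 x; case: ifP.
Qed.

Lemma selval_le g N x : (forall eta, 0 <= g eta) -> (forall i eta, aff (a i) (v i) eta <= g eta) ->
  selval N x <= g (vrow V x).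
Proof.
move=> g0 H; elim: N => [|N IH].
  by rewrite /selval /aff/= add0r /dot big1// => j _; rewrite mul0r.
by rewrite /selval /=; case: ifP => _; [exact: H|exact: IH].
Qed.

End selection.

(** The selection is made at the limit [V] and then frozen: its coefficients [al] and [be] are
    bounded measurable functions of [x], so the integral of the selected affine function at [V_h] is
    affine in [V_h] and converges. As [N] grows the selected values at [V] tend to [g], and Fatou's
    lemma concludes. *)
Lemma autonomous_liminf (g_ : nat -> 'rV[R]_m -> R) g A (V_ : nat -> 'I_m -> 'rV[R]_n -> R) V (c : R) :
  (forall k, cgrowth (g_ k)) -> cgrowth g -> (forall eta, g_ k eta @[k --> \oo] --> g eta) ->
  measurable A -> (mu A < +oo)%E ->
  (forall h j, measurable_fun setT (V_ h j)) -> (forall j, measurable_fun setT (V j)) ->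
  (forall h j x, ~ A x -> V_ h j x = 0) -> (forall h j, intg (V_ h j)) -> (forall j, intg (V j)) ->
  (forall j, weak_to (fun h => V_ h j) (V j)) ->
  (forall h, intg (energy A (g_ h) (V_ h)) /\ \int[mu]_x energy A (g_ h) (V_ h) x <= c) ->
  intg (energy A g V) /\ \int[mu]_x energy A g V x <= c.
Proof.
move=> gg_ gg gc mA Aoo mV_ mV V0 iV_ iV Vc H.
have [a [v [avg avd]]] := affine_minorants c00 c10 p1 gg.
pose M N x := selval a v V N x * \1_A x.
have g0 eta : 0 <= g eta by exact: (convex_growth_ge0 c00 eta gg).
have mA1 : measurable_fun setT (\1_A : 'rV[R]_n -> R) by exact: measurable_indic.
have iA := intg_indic mA Aoo.
have A1 x : `|\1_A x : R| <= 1 by rewrite indicE normr_nat; case: (_ \in _).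
have Mint N : intg (M N) /\ \int[mu]_x M N x <= c.
  have [ms1 ms2] := measurable_select a v mV N.
  have [K KP] := select_bounded a v V N.
  pose al x := (select a v V N x).1 * \1_A x.
  pose be j x := (select a v V N x).2 j * \1_A x.
  have mal : measurable_fun setT al by exact: measurable_funM.
  have mbe j : measurable_fun setT (be j) by exact: measurable_funM.
  have K0 : 0 <= K by have [h _] := KP 0; exact: le_trans h.
  have alK x : `|al x| <= K by rewrite normrM (le_trans (ler_pM _ _ (KP x).1 (A1 x)))// mulr1.
  have beK j x : `|be j x| <= K by rewrite normrM (le_trans (ler_pM _ _ ((KP x).2 j) (A1 x)))// mulr1.
  have ial : intg al.
    by apply: (@intg_bounded _ _ _ A K) => // x Ax; rewrite /al indicE memNset// mulr0.
  have ibe (W : 'I_m -> 'rV[R]_n -> R) j : intg (W j) -> intg (fun x => W j x * be j x).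
    by move=> iW; exact: intgM_bounded (beK j).
  have val (W : 'I_m -> 'rV[R]_n -> R) x :
      aff (select a v V N x).1 (select a v V N x).2 (vrow W x) * \1_A x = al x + \sum_j W j x * be j x.
    rewrite /aff dot_vrow mulrDl mulr_suml; congr (_ + _); apply: eq_bigr => j _.
    by rewrite /be; ring.
  have ME : M N = (fun x => al x + \sum_j V j x * be j x) by apply/funext => x; exact: val.
  have iS (W : 'I_m -> 'rV[R]_n -> R) : (forall j, intg (W j)) -> intg (fun x => \sum_j W j x * be j x).
    by move=> iW; apply: intg_sum => j; exact: ibe.
  split; first by rewrite ME; apply: intgD => //; exact: iS.
  have lim : \int[mu]_x (al x + \sum_j V_ h j x * be j x) @[h --> \oo] --> \int[mu]_x M N x.
    rewrite ME RintegralD//; last exact: iS.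
    rewrite Rintegral_sum; last by move=> j; exact: ibe.
    have E h : \int[mu]_x (al x + \sum_j V_ h j x * be j x) =
        \int[mu]_x al x + \sum_j \int[mu]_x (V_ h j x * be j x).
      rewrite RintegralD//; last exact: iS.
      by rewrite Rintegral_sum// => j; exact: ibe.
    under eq_fun do rewrite E; apply: cvgD; first exact: cvg_cst.
    by apply: cvg_sumr => j; exact: (Vc j _ K).
  apply/ler_addgt0Pr => e e0.
  pose iA1 := \int[mu]_x (\1_A x : R).
  have iA0 : 0 <= iA1 by apply: Rintegral_ge0 => x _; rewrite indicE.
  (* An error [d] in each of the finitely many minorants costs [d] times the measure of [A], at most
     [e]. *)
  pose d := e / (iA1 + 1); have d0 : 0 < d by rewrite divr_gt0// ltr_wpDl.
  have ev : \forall k \near \oo, forall x eta,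
      aff (select a v V N x).1 (select a v V N x).2 eta - d <= g_ k eta.
    apply: (@select_minorant a v V (fun a' v' k => forall eta, aff a' v' eta - d <= g_ k eta) N).
      apply: nearW => k eta; rewrite /aff add0r (_ : dot _ _ = 0); last first.
        by rewrite /dot big1// => j _; rewrite mul0r.
      by rewrite sub0r (le_trans _ (convex_growth_ge0 c00 eta (gg_ k)))// oppr_le0 ltW.
    by move=> i; exact: (minorant_eventually c00 c10 p1 gg_ gc (avg i) d0).
  rewrite -lerBlDr; apply: (@cvgr_to_le _ _ _ _ _ _ _ (cvgB lim (cvg_cst e))).
  apply: filterS ev => h Hh; have [iF Fc] := H h; apply: le_trans Fc.
  have iL : intg (fun x => al x + \sum_j V_ h j x * be j x) by apply: intgD => //; exact: iS.
  have dA : d * iA1 <= e.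
    by rewrite /d mulrAC -mulrA ler_piMr ?(ltW e0)// ler_pdivrMr ?ltr_wpDl// mul1r lerDl.
  apply: (@le_trans _ _ (\int[mu]_x (al x + \sum_j V_ h j x * be j x - d * \1_A x))).
    rewrite RintegralB//; last exact: intgZ.
    by rewrite RintegralZl// lerB.
  apply: le_RintegralT => //; first by apply: intgB => //; exact: intgZ.
  move=> x; rewrite -(val (V_ h)) -mulrBl /energy ler_wpM2r// indicE//.
apply: (@Rintegral_fatou R n M (energy A g V) c).
- by move=> N; have [h _] := Mint N; exact: intg_measurable.
- exact: measurable_energy.
- by move=> N x; rewrite mulr_ge0 ?selval_ge0// indicE.
- by move=> x; exact: energy_ge0.
- apply: aeW => x; apply: cvgM; last exact: cvg_cst.
  apply/cvgrPdist_le => e e0; have [i iP] := avd (vrow V x) e e0.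
  exists i.+1 => // N /= iN; have h1 := selval_ge a v V x iN.
  have h2 := selval_le V N x g0 avg.
  by rewrite ger0_norm ?subr_ge0//; lra.
- by move=> N; exists N.
Qed.

End autonomous.

(** * Gamma-convergence for autonomous integrands *)

Section autonomous_Gamma.
Context {R : realType} {n m : nat}.
Local Notation mu := (lebesgue_rV R n).
Local Notation intg f := (mu.-integrable setT (EFin \o f)).
Variables (Omega : set 'rV[R]_n) (X : 'I_m -> 'rV[R]_n -> 'rV[R]_n) (c0 c1 p : R).
Hypotheses (oO : open Omega) (bO : bounded_set Omega) (vX : forall j, vfield Omega (X j))
  (c00 : 0 < c0) (c01 : c0 <= c1) (p1 : 1 < p).
Implicit Types (g : 'rV[R]_m -> R) (A : set 'rV[R]_n) (f : 'rV[R]_n -> 'rV[R]_m -> \bar R)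
  (V : 'I_m -> 'rV[R]_n -> R).
Local Notation cgrowth := (convex_growth c0 c1 p).

Let c10 : 0 < c1. Proof. exact: lt_le_trans c01. Qed.
Let p0 : 0 < p. Proof. exact: lt_trans p1. Qed.
Let p1' : 1 <= p. Proof. exact: ltW. Qed.

(** Being independent of [x], [f] is determined by its values at one point of [Omega] where the
    almost everywhere conditions hold; such a point exists since [Omega] has positive measure. *)
Lemma J2class_growth f : Omega !=set0 -> J2class p Omega c0 c1 f ->
  exists2 g, cgrowth g & forall x eta, Omega x -> f x eta = (g eta)%:E.
Proof.
move=> O0 [[_ f0 _ fconv fgrow] [g fg]].
have [x [Ox [[xfin xconv] xgrow]]] : exists x, Omega x /\
    ((forall eta, f x eta \is a fin_num) /\ convex_function setT (fun eta => fine (f x eta))) /\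
    (forall eta, ((c0 * enorm eta `^ p)%:E <= f x eta <= (c1 * (enorm eta `^ p + 1))%:E)%E).
  apply: contrapT => nx.
  have [N [mN N0 NP]] := ae_imp2 (fun x a b => conj a b) fconv fgrow.
  have ON : Omega `<=` N.
    move=> x Ox; apply: NP => /= -[h1 h2]; apply: nx; exists x; split => //; split; [exact: h1|exact: h2].
  have := open_lebesgue_rV_gt0 oO O0.
  have : (mu Omega <= mu N)%E by apply: le_measure; rewrite ?inE//; exact: open_measurable_rV.
  by rewrite N0 => h1 /(lt_le_trans)/(_ h1); rewrite ltxx.
exists (fun eta => fine (f x eta)).
  split.
  - by move=> t y z; exact: (iffLR (convex_functionP _) xconv t y z).
  - by move=> eta; rewrite -lee_fin fineK//; have /andP[] := xgrow eta.
  - by move=> eta; rewrite -lee_fin fineK//; have /andP[] := xgrow eta.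
by move=> y eta Oy; rewrite fineK// !fg.
Qed.

Lemma growth_J2class g : cgrowth g -> J2class p Omega c0 c1 (fun _ eta => (g eta)%:E).
Proof.
move=> gg; have mO := open_measurable_rV oO; have [cv lo up] := gg.
split; last by exists (fun eta => (g eta)%:E).
split.
- apply/measurable_EFinP/measurable_funTS.
  apply: (measurableT_comp (f := g)); last exact: measurable_snd.
  exact: continuous_measurable_rV (growth_continuous c00 c10 p1 gg).
- by move=> x eta _; rewrite lee_fin (convex_growth_ge0 c00 eta gg).
- by move=> eta; exact: measurable_cst.
- apply: aeW => x _; split => //; apply/convex_functionP => t y z.
  exact: cv.
- by apply: aeW => x _ eta; rewrite !lee_fin lo up.
Qed.

Lemma functional_growth f g A v G : cgrowth g -> (forall x eta, Omega x -> f x eta = (g eta)%:E) ->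
  measurable_fun (Omega `*` setT) (fun z : 'rV[R]_n * 'rV[R]_m => f z.1 z.2) ->
  open_in Omega A -> isgrad X p A v G ->
  functional p X f v A = (\int[mu]_x (energy A g (fun j => G j \_ A) x)%:E)%E.
Proof.
move=> gg fg mf oA vG; rewrite (functionalE oO bO p1' vX oA mf vG) integral_mkcond.
apply: eq_integral => x _; rewrite patchE /energy indicE; case: ifPn => xA; last by rewrite mulr0.
rewrite mulr1 fg; last by apply: oA.2; rewrite inE in xA.
by congr (g _)%:E; apply/rowP => j; rewrite !mxE patchE xA.
Qed.

Lemma autonomous_compactness (f_ : nat -> 'rV[R]_n -> 'rV[R]_m -> \bar R) : Omega !=set0 ->
  (forall h, J2class p Omega c0 c1 (f_ h)) ->
  exists s f, [/\ increasing_nat s, J2class p Omega c0 c1 f &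
    forall A, open_in Omega A -> Gamma_cvg p Omega (fun h u => functional p X (f_ (s h)) u A)
      (fun u => functional p X f u A)].
Proof.
move=> O0 Jf; have /choice[g_ gP] h : exists g, cgrowth g /\ forall x eta, Omega x -> f_ h x eta = (g eta)%:E.
  by have [g g1 g2] := J2class_growth O0 (Jf h); exists g.
have gg_ h : cgrowth (g_ h) by have [] := gP h.
have [s [g [incr gg gc]]] := convex_subsequence c00 c10 p1 gg_.
pose f (x : 'rV[R]_n) eta := (g eta)%:E.
have Jlim : J2class p Omega c0 c1 f by exact: growth_J2class.
exists s, f; split => // A oA.
have mA := open_in_measurable oA; have Aoo := open_in_lty bO oA.
have mf_ h : measurable_fun (Omega `*` setT) (fun z : 'rV[R]_n * 'rV[R]_m => f_ h z.1 z.2) by have [[]] := Jf h.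
have mf : measurable_fun (Omega `*` setT) (fun z : 'rV[R]_n * 'rV[R]_m => f z.1 z.2) by have [[]] := Jlim.
have E_ h v G : isgrad X p A v G -> functional p X (f_ h) v A =
    (\int[mu]_x (energy A (g_ h) (fun j => G j \_ A) x)%:E)%E.
  by move=> vG; apply: functional_growth => //; have [] := gP h.
have E0 v G : isgrad X p A v G -> functional p X f v A =
    (\int[mu]_x (energy A g (fun j => G j \_ A) x)%:E)%E.
  by move=> vG; apply: functional_growth.
have mG v G j : isgrad X p A v G -> measurable_fun setT (G j \_ A) /\ intg (fun x => `|(G j \_ A) x| `^ p).
  by move=> [_ /(_ j)[/(inLpP _ _ p1')]].
have iG v G j : isgrad X p A v G -> intg (G j \_ A).
  by move=> [_ /(_ j)[/(inLp_intg_in bO p1' oA)]].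
have en g' v G (c : R) : cgrowth g' -> isgrad X p A v G ->
    (\int[mu]_x (energy A g' (fun j => G j \_ A) x)%:E <= c%:E)%E ->
    intg (energy A g' (fun j => G j \_ A)) /\ \int[mu]_x energy A g' (fun j => G j \_ A) x <= c.
  move=> gg' vG h; have me := measurable_energy c00 c01 p1 mA gg' (fun j => (mG v G j vG).1).
  have ie : intg (energy A g' (fun j => G j \_ A)).
    apply/ge0_intgP => //; first by move=> x; apply: energy_ge0 gg'.
    exact: le_lt_trans h (ltry _).
  by split => //; rewrite -lee_fin -Rintegral_EFin.
apply: Gamma_criterion => //.
- by move=> u; apply: functional_ge0 oA.2 => x eta _; rewrite lee_fin (convex_growth_ge0 c00 eta gg).
- move=> u u_ r c uO uO_ incr' uc H.
  have /choice[G GP] h : exists G, isgrad X p A (u_ h) G.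
    exact: (functional_lt_isgrad oO bO vX p1' oA (ltry c) (H h)).
  have ucA := cvgLp_sub p1' oA uO_ uO uc.
  have eG h : intg (energy A (g_ (s (r h))) (fun j => G h j \_ A)) /\
      \int[mu]_x energy A (g_ (s (r h))) (fun j => G h j \_ A) x <= c.
    by apply: (en _ _ _ _ (gg_ _) (GP h)); rewrite -(E_ _ _ _ (GP h)); exact: H.
  have GC h j : \int[mu]_x `|(G h j \_ A) x| `^ p <= c0^-1 * c.
    have [ie le] := eG h.
    apply: (@le_trans _ _ (\int[mu]_x (c0^-1 * energy A (g_ (s (r h))) (fun j => G h j \_ A) x))).
      apply: le_RintegralT; [exact: (mG _ _ j (GP h)).2|exact: intgZ|].
      move=> x; apply: (energy_powR c00 p1 x (gg_ (s (r h)))).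
      exact: patch_out.
    by rewrite RintegralZl// ler_wpM2l// invr_ge0 ltW.
  have uA : inLp p A u by exact: inLp_sub p1' mA oA.2 uO.
  have [r' [U [incr'' HU Uc]]] := weak_gradient_compact oO bO vX p1 oA GP uA ucA GC.
  rewrite (E0 _ _ HU).
  have gc' eta : g_ (s (r (r' k))) eta @[k --> \oo] --> g eta.
    exact: (cvg_comp _ _ (increasing_nat_cvg (increasing_nat_comp incr' incr'')) (gc eta)).
  have [] := @autonomous_liminf R n m c0 c1 p c00 c01 p1 (fun k => g_ (s (r (r' k)))) g A
    (fun h j => G (r' h) j \_ A) (fun j => U j \_ A) c (fun k => gg_ _) gg gc' mA Aoo.
  + by move=> h j; have [] := mG _ _ j (GP (r' h)).
  + by move=> j; have [] := mG _ _ j HU.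
  + by move=> h j x; exact: patch_out.
  + by move=> h j; exact: (iG _ _ _ (GP (r' h))).
  + by move=> j; exact: (iG _ _ _ HU).
  + exact: Uc.
  + by move=> h; exact: eG.
  + by move=> ie le; rewrite Rintegral_EFin// lee_fin.
- move=> u e uO Goo e0.
  have [U HU] : exists U, isgrad X p A u U.
    exact: (functional_lt_isgrad oO bO vX p1' oA Goo (lexx _)).
  set V := fun j => U j \_ A.
  have mV j : measurable_fun setT (V j) by have [] := mG _ _ j HU.
  have ieg : intg (energy A g V).
    have me := measurable_energy c00 c01 p1 mA gg mV.
    apply/ge0_intgP => //; first by move=> x; apply: energy_ge0 gg.
    by rewrite -(E0 _ _ HU).
  have iA := intg_indic mA Aoo.
  (* The common growth conditions bound every [g_ k] by c1 (g / c0 + 1), so one integrable function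
     dominates the energies of [V] under all [g_ (s k)]. *)
  pose dom x := c1 * (c0^-1 * energy A g V x + \1_A x).
  have idom : intg dom by apply: intgZ; apply: intgD => //; exact: intgZ.
  have ledom k x : energy A (g_ (s k)) V x <= dom x.
    rewrite /dom /energy indicE; have [xA|_] := boolP (x \in A); last by rewrite !mulr0 addr0 mulr0.
    rewrite !mulr1; have [_ _ up] := gg_ (s k); apply: le_trans (up _) _.
    rewrite ler_wpM2l ?(ltW c10)// lerD2r ler_pdivlMl//.
    by have [_ lo _] := gg.
  have mk k : measurable_fun setT (energy A (g_ (s k)) V) by exact: (measurable_energy c00 c01 p1 mA (gg_ _) mV).
  have ek0 k x : 0 <= energy A (g_ (s k)) V x by apply: energy_ge0 (gg_ _).
  have iek k : intg (energy A (g_ (s k)) V).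
    apply: (intg_le (mk k) idom) => x; rewrite ger0_norm//.
    by rewrite (le_trans (ledom k x))// ler_norm.
  have lim : \int[mu]_x energy A (g_ (s k)) V x @[k --> \oo] --> \int[mu]_x energy A g V x.
    apply: (Rintegral_dominated mk _ _ idom).
    - exact: intg_measurable.
    - by apply: aeW => x; apply: cvgM; [exact: gc|exact: cvg_cst].
    - by move=> k x; rewrite ger0_norm.
  have [K _ HK] : \forall k \near \oo, \int[mu]_x energy A (g_ (s k)) V x < \int[mu]_x energy A g V x + e.
    by apply: (cvgr_lt _ lim); rewrite ltrDl.
  exists K => k Kk; exists u; split => //.
    rewrite /dist_lt (_ : (fun y => u y - u y) \_ Omega = cst 0).
      rewrite (eq_integral (cst 0%E)) ?integral0 ?lte_fin// => x _.
      by rewrite /= normr0 powR0// gt_eqF.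
    by apply/funext => x; rewrite patchE subrr; case: ifP.
  rewrite (E_ _ _ _ HU) (E0 _ _ HU) !Rintegral_EFin// -EFinD lee_fin.
  exact: ltW (HK k Kk).
Qed.

End autonomous_Gamma.

(** * The empty domain and the conclusion *)

Section empty_domain.
Context {R : realType} {n m : nat}.

(** Serves the empty domain, where an autonomous integrand has no point at which to be read off; all
    functionals coincide there and constant recovery sequences do. *)
Lemma Gamma_cvg_cst p (Omega : set 'rV[R]_n) (G : ('rV[R]_n -> R) -> \bar R) : 1 <= p ->
  (forall u, (0 <= G u)%E) -> (forall u v, inLp p Omega u -> inLp p Omega v -> G u = G v) ->
  Gamma_cvg p Omega (fun=> G) G.
Proof.
move=> p1 G0 GE; apply: Gamma_criterion => //.
- by move=> u u_ r c uO uO_ _ _ H; rewrite (GE _ _ uO (uO_ 0%N)); exact: H 0%N.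
- move=> u e uO _ e0; exists 0%N => k _; exists u; split => //.
    rewrite /dist_lt (_ : (fun y => u y - u y) \_ Omega = cst 0).
      rewrite (eq_integral (cst 0%E)) ?integral0 ?lte_fin// => x _.
      by rewrite /= normr0 powR0// gt_eqF// (lt_le_trans _ p1).
    by apply/funext => x; rewrite patchE subrr; case: ifP.
  by rewrite leeDl// lee_fin ltW.
Qed.

End empty_domain.

Theorem theorem4p20 (R : realType) (n m : nat) (Omega : set 'rV[R]_n)
    (c0 c1 p : R) (X : 'I_m -> 'rV[R]_n -> 'rV[R]_n) (k : integrand_kind)
    (f_ : nat -> 'rV[R]_n -> 'rV[R]_m -> \bar R) :
  open Omega -> bounded_set Omega ->
  0 < c0 -> c0 <= c1 ->
  (forall (j : 'I_m) (i : 'I_n), [lipschitz X j x ord0 i | x in Omega]) ->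
  LIC X Omega ->
  admissible_exponent k p ->
  (forall h, Jclass k p Omega c0 c1 (f_ h)) ->
  exists s : nat -> nat, {homo s : h l / (h < l)%N} /\
  exists (F : ('rV[R]_n -> R) -> set 'rV[R]_n -> \bar R)
         (f : 'rV[R]_n -> 'rV[R]_m -> \bar R),
    [/\ (forall u A, inLp p Omega u -> open_in Omega A -> (0 <= F u A)%E),
        local_functional p Omega F,
        Jclass k p Omega c0 c1 f,
        (forall A, open_in Omega A ->
           Gamma_cvg p Omega (fun h u => functional p X (f_ (s h)) u A)
             (fun u => F u A)) &
        (forall u A, inLp p Omega u -> open_in Omega A ->
           F u A = functional p X f u A)].
Proof.
move=> oO bO c00 c01 lX LX pk Jf.
have vX j : vfield Omega (X j) by move=> i; exact: lipschitz_lip_bounded.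
have p1 : 1 <= p by case: k pk {Jf} => /= [->|/ltW//]; rewrite ler1n.
have Jge0 (f : 'rV[R]_n -> 'rV[R]_m -> \bar R) : Jclass k p Omega c0 c1 f -> forall x eta, Omega x -> (0 <= f x eta)%E.
  by case: k {pk Jf} => /= -[[]].
have conclude s f : increasing_nat s -> Jclass k p Omega c0 c1 f ->
    (forall A, open_in Omega A -> Gamma_cvg p Omega (fun h u => functional p X (f_ (s h)) u A)
      (fun u => functional p X f u A)) ->
    exists s : nat -> nat, {homo s : h l / (h < l)%N} /\
    exists (F : ('rV[R]_n -> R) -> set 'rV[R]_n -> \bar R) f,
    [/\ (forall u A, inLp p Omega u -> open_in Omega A -> (0 <= F u A)%E),
        local_functional p Omega F, Jclass k p Omega c0 c1 f,
        (forall A, open_in Omega A ->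
           Gamma_cvg p Omega (fun h u => functional p X (f_ (s h)) u A) (fun u => F u A)) &
        (forall u A, inLp p Omega u -> open_in Omega A -> F u A = functional p X f u A)].
  move=> incr Jlim GG; exists s; split; first exact: incr.
  exists (functional p X f), f; split.
  - move=> u A _ oA; apply: functional_ge0; last exact: oA.2.
    exact: (Jge0 f Jlim).
  - exact: (functional_local oO bO p1 vX).
  - exact: Jlim.
  - exact: GG.
  - by move=> u A _ _.
have [ne|ne] := pselect (Omega !=set0).
  case: k pk Jf {Jge0} conclude => /= pk Jf conclude.
    rewrite {}pk in conclude *.
    by have [s [f [h1 h2 h3]]] := quadratic_compactness oO bO vX LX c00 c01 Jf; exact: (conclude s f).
  by have [s [f [h1 h2 h3]]] := autonomous_compactness oO bO vX c00 c01 pk ne Jf; exact: (conclude s f).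
(* Open subsets of the empty set are empty, so the value depends only on membership in [W1X], which
   does not involve [h]. *)
have E h u A : open_in Omega A -> functional p X (f_ h) u A = functional p X (f_ 0%N) u A.
  move=> oA; have A0 x : ~ A x by move=> /oA.2 Ox; apply: ne; exists x.
  by rewrite /functional; case: ifP => // _; apply: eq_integral => x; rewrite inE => /A0.
apply: (conclude id (f_ 0%N)); [by []|exact: Jf|move=> A oA].
have -> : (fun h u => functional p X (f_ (id h)) u A) = fun=> (fun u => functional p X (f_ 0%N) u A).
  by apply/funext => h; apply/funext => u; exact: E.
apply: (Gamma_cvg_cst p1) => [u|u v uO vO].
  by apply: functional_ge0; [exact: (Jge0 _ (Jf 0%N))|exact: oA.2].
apply: (functional_local oO bO p1 vX _ uO vO oA).
by apply: aeW => x /oA.2 Ox; exfalso; apply: ne; exists x.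
Qed.
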